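(* Let $n\ge2$, $x_0\in\mathbb{R}^n$, $D\subset\mathbb{R}^n$ a domain, $n-1<p\le n$, $\alpha:=\frac{p}{p-n+1}$. Let $Q:\mathbb{R}^n\to(0,\infty)$ be Lebesgue measurable with $Q\in L^{\frac{n-1}{p-n+1}}_{\rm loc}(\mathbb{R}^n)$, and let $f:D\to\mathbb{R}^n$ be a homeomorphism with bounded image $f(D)$ which is a lower $Q$-mapping with respect to $p$-modulus at $x_0$. Then for every $0<\varepsilon<\varepsilon_0<\infty$ and any compact sets $C_2\subset D\setminus B(x_0,\varepsilon_0)$ and $C_1\subset\overline{B(x_0,\varepsilon)}\cap D$, $$M_\alpha\big(f(\Gamma(C_1,C_2,D))\big)\le\int_{A(x_0,\varepsilon,\varepsilon_0)}Q^{\frac{n-1}{p-n+1}}(x)\,\eta^\alpha(|x-x_0|)\,dm(x)$$ for every Lebesgue measurable $\eta:(\varepsilon,\varepsilon_0)\to[0,\infty]$ with $\int_\varepsilon^{\varepsilon_0}\eta(r)\,dr=1$.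
   Context: $A(x_0,r_1,r_2)=\{x\in\mathbb{R}^n:r_1<|x-x_0|<r_2\}$; $B,S$ are Euclidean balls and spheres. For a path family $\Gamma$, $M_q(\Gamma)=\inf\int\rho^q\,dm$ over Borel $\rho\ge0$ with $\int_\gamma\rho|dx|\ge1$ for all locally rectifiable $\gamma\in\Gamma$; $\Gamma(E,F,G)$ is the family of paths joining $E$ to $F$ whose interior points lie in $G$; $f(\Gamma)=\{f\circ\gamma:\gamma\in\Gamma\}$. $\mathcal{H}^{n-1}$ is normalized $(n-1)$-dimensional Hausdorff measure. Modulus of surface families: for a family $\Sigma$ of $(n-1)$-dimensional surfaces $S$ (continuous images $S:D_S\to\mathbb{R}^n$ of open sets $D_S\subset\mathbb{R}^{n-1}$, with multiplicity $N(S,y)=\#S^{-1}(y)$), set $\int_S\rho^{n-1}d\mathcal{A}=\int_{\mathbb{R}^n}\rho^{n-1}(y)N(S,y)\,d\mathcal{H}^{n-1}y$; $\rho$ (Borel, $\ge0$) is admissible for $\Sigma$ if $\int_S\rho^{n-1}d\mathcal{A}\ge1$ for all $S\in\Sigma$, and $M_p(\Sigma)=\inf\int\rho^p\,dm$ over admissible $\rho$. $\rho$ is extensively $p$-admissible for $\Sigma$ ($\rho\in\mathrm{ext}_p\,\mathrm{adm}\,\Sigma$) if $\int_S\rho^{n-1}d\mathcal{A}\ge1$ for all $S\in\Sigma$ except a subfamily of $p$-modulus zero. Lower $Q$-mapping: $f:D\to\mathbb{R}^n$ is a lower $Q$-mapping with respect to $p$-modulus at $x_0$ if, with $d_0=\sup_{x\in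 D}|x-x_0|$, for every $r_0\in(0,d_0)$ and $\varepsilon\in(0,r_0)$, $$M_p(f(\Sigma_\varepsilon))\ge\inf_{\rho\in\mathrm{ext}_p\mathrm{adm}\,\Sigma_\varepsilon}\int_{D\cap A(x_0,\varepsilon,r_0)}\frac{\rho^p(x)}{Q(x)}\,dm(x),$$ where $\Sigma_\varepsilon$ is the family of sets $S(x_0,r)\cap D$, $r\in(\varepsilon,r_0)$, and $f(\Sigma_\varepsilon)$ the family of their images. *)

(* Defs.v *)
From HB Require Import structures.
From mathcomp Require Import all_boot all_order all_algebra.
From mathcomp Require Import all_classical all_reals all_analysis.
Set Implicit Arguments. Unset Strict Implicit. Unset Printing Implicit Defensive.
Import Order.TTheory GRing.Theory Num.Theory.
Import numFieldNormedType.Exports.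
Local Open Scope classical_set_scope.
Local Open Scope ring_scope.

Section QmapDefs.
Context {R : realType} {n : nat}.
Notation V := 'rV[R]_n.

Definition enorm (x : V) : R := Num.sqrt (\sum_(i < n) (x ord0 i) ^+ 2).

Definition eball (x0 : V) (r : R) : set V := [set x | enorm (x - x0) < r].
Definition ecball (x0 : V) (r : R) : set V := [set x | enorm (x - x0) <= r].
Definition esphere (x0 : V) (r : R) : set V := [set x | enorm (x - x0) = r].
Definition annulus (x0 : V) (r1 r2 : R) : set V :=
  [set x | r1 < enorm (x - x0) < r2].

(** Euclidean diameter (diam of the empty set is 0). *)
Definition ediam (E : set V) : \bar R :=
  ereal_sup ([set 0%E] `|` [set (enorm (x - y))%:E | x in E & y in E]).

(** Volume of the unit ball of R^k. *)
Fixpoint omega (k : nat) : R :=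
  match k with
  | 0%N => 1
  | 1%N => 2
  | k'.+2 => (2 * pi / k'.+2%:R) * omega k'
  end.

Definition hausdorff_delta (k : nat) (d : R) (E : set V) : \bar R :=
  ereal_inf [set (\sum_(0 <= i <oo) (omega k * (fine (ediam (F i)) / 2) ^+ k)%:E)%E
            | F in [set F : nat -> set V |
                    E `<=` \bigcup_i F i /\ forall i, (ediam (F i) < d%:E)%E]].
Definition hausdorff (k : nat) (E : set V) : \bar R :=
  ereal_sup [set hausdorff_delta k d E | d in [set d : R | 0 < d]].

Definition box (a b : V) : set V := [set x | forall i, a ord0 i <= x ord0 i <= b ord0 i].
Definition leb_outer (E : set V) : \bar R :=
  ereal_inf [set (\sum_(0 <= k <oo) (\prod_(i < n) (ab.2 k ord0 i - ab.1 k ord0 i))%:E)%E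
            | ab in [set ab : (nat -> V) * (nat -> V) |
                     (forall k i, ab.1 k ord0 i <= ab.2 k ord0 i) /\
                     E `<=` \bigcup_k box (ab.1 k) (ab.2 k)]].

Definition leb_measurable (E : set V) : Prop :=
  forall A, leb_outer A = (leb_outer (A `&` E) + leb_outer (A `&` ~` E))%E.
Definition leb_measurable_fun (Q : V -> R) : Prop :=
  forall t : R, leb_measurable [set x | Q x < t].

Definition borel_set (E : set V) : Prop := <<s [set U : set V | open U] >> E.
Definition borel_fun (rho : V -> \bar R) : Prop :=
  forall t : R, borel_set [set x | (t%:E < rho x)%E].

(** Integral over A of a nonnegative function w.r.t. the outer measure mu,
    via the layer-cake formula  int_A h dmu = int_0^oo mu({x in A | h x > t}) dt. *)
Definition lcint (mu : set V -> \bar R) (A : set V) (h : V -> \bar R) : \bar R :=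
  (\int[lebesgue_measure]_(t in `]0%R, +oo[) mu [set x | A x /\ (t%:E < h x)%E])%E.

Definition vint (A : set V) (h : V -> \bar R) : \bar R := lcint leb_outer A h.

Definition Lloc (s : R) (Q : V -> R) : Prop :=
  forall K : set V, compact K -> (vint K (fun x => (Q x `^ s)%:E) < +oo)%E.

Record cpath := CPath { pa : R; pb : R; pmap : R -> V }.

Definition is_cpath (g : cpath) : Prop :=
  pa g < pb g /\ {within `[pa g, pb g], continuous (pmap g)}.

Definition plength (g : R -> V) (c d : R) : \bar R :=
  ereal_sup [set l | exists (k : nat) (s : nat -> R),
    [/\ s 0%N = c, s k = d, (forall i, (i < k)%N -> s i <= s i.+1) &
        l = (\sum_(i < k) enorm (g (s i.+1) - g (s i)))%:E]].

Definition rectifiable (g : cpath) : Prop := (plength (pmap g) (pa g) (pb g) < +oo)%E.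

Definition arclen (g : cpath) (t : R) : R := fine (plength (pmap g) (pa g) t).
Definition normal_rep (g : cpath) (s : R) : V :=
  pmap g (inf [set t | pa g <= t <= pb g /\ s <= arclen g t]).

Definition lineint (rho : V -> \bar R) (g : cpath) : \bar R :=
  (\int[lebesgue_measure]_(s in `[0%R, arclen g (pb g)]) rho (normal_rep g s))%E.

Definition path_adm (G : set cpath) (rho : V -> \bar R) : Prop :=
  [/\ borel_fun rho, (forall x, 0 <= rho x)%E &
      forall g, G g -> rectifiable g -> (1 <= lineint rho g)%E].
Definition path_modulus (q : R) (G : set cpath) : \bar R :=
  ereal_inf [set vint setT (fun x => poweR (rho x) q) | rho in path_adm G].

Definition joining_paths (E F G : set V) : set cpath :=
  [set g | [/\ is_cpath g, E (pmap g (pa g)), F (pmap g (pb g)) &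
              forall t, pa g < t < pb g -> G (pmap g t)]].

Definition image_paths (f : V -> V) (G : set cpath) : set cpath :=
  (fun g => CPath (pa g) (pb g) (f \o pmap g)) @` G.

(** Surfaces (here: embedded, multiplicity one) and their p-modulus. *)
Definition surf_int (rho : V -> \bar R) (S : set V) : \bar R :=
  lcint (hausdorff n.-1) S (fun y => (rho y ^+ n.-1)%E).
Definition surf_adm (Sg : set (set V)) (rho : V -> \bar R) : Prop :=
  [/\ borel_fun rho, (forall x, 0 <= rho x)%E &
      forall S, Sg S -> (1 <= surf_int rho S)%E].
Definition surf_modulus (p : R) (Sg : set (set V)) : \bar R :=
  ereal_inf [set vint setT (fun x => poweR (rho x) p) | rho in surf_adm Sg].
Definition ext_adm (p : R) (Sg : set (set V)) (rho : V -> \bar R) : Prop :=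
  [/\ borel_fun rho, (forall x, 0 <= rho x)%E &
      exists2 Sg0, Sg0 `<=` Sg /\ surf_modulus p Sg0 = 0%E &
        forall S, Sg S -> ~ Sg0 S -> (1 <= surf_int rho S)%E].

Definition sphere_family (D : set V) (x0 : V) (e r0 : R) : set (set V) :=
  [set S | exists2 r, e < r < r0 & S = esphere x0 r `&` D].

Definition lower_Q_mapping (p : R) (Q : V -> R) (D : set V) (f : V -> V) (x0 : V) : Prop :=
  let d0 := ereal_sup [set (enorm (x - x0))%:E | x in D] in
  forall r0 e : R, 0 < r0 -> (r0%:E < d0)%E -> 0 < e < r0 ->
  (ereal_inf [set vint (D `&` annulus x0 e r0)
                     (fun x => poweR (rho x) p * (Q x)^-1%:E)%E
             | rho in ext_adm p (sphere_family D x0 e r0)]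
     <= surf_modulus p ((fun S => f @` S) @` sphere_family D x0 e r0))%E.

Definition homeo_onto_image (D : set V) (f : V -> V) : Prop :=
  [/\ {within D, continuous f}, set_inj D f &
      exists g : V -> V, (forall x, D x -> g (f x) = x) /\ {within f @` D, continuous g}].

Definition domain (D : set V) : Prop := open D /\ connected D /\ D !=set0.

End QmapDefs.

Definition lebR_measurable (R : realType) (E : set R) : Prop :=
  (@wlength R idfun)^*%mu.-cara.-measurable E.
Definition lebR_measurable_fun (R : realType) (A : set R) (h : R -> \bar R) : Prop :=
  lebR_measurable A /\ forall t : R, lebR_measurable [set r | A r /\ (t%:E < h r)%E].
Definition lebR_integral (R : realType) (A : set R) (h : R -> \bar R) : \bar R :=
  (\int[@completed_lebesgue_measure R]_(r in A) h r)%E.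

(* Main.v *)
Require Import Defs.
From HB Require Import structures.
From mathcomp Require Import all_boot all_order all_algebra.
From mathcomp Require Import perm.
From mathcomp Require Import all_classical all_reals all_analysis.
From mathcomp Require Import measurable_realfun.
From mathcomp Require Import ring lra zify.
Set Implicit Arguments.
Unset Strict Implicit.
Unset Printing Implicit Defensive.
Import Order.TTheory GRing.Theory Num.Theory.
Import numFieldNormedType.Exports.
Local Open Scope classical_set_scope.
Local Open Scope ring_scope.

(** Put W = f(D) and v(y) = |f^-1(y) - x0|, so that f maps the part in D of the
    sphere of radius r onto the level {v = r} of the open set W.  Write k = n - 1,
    P = p / k, so that P and alpha are conjugate, and let J be the right-hand side.

    Lower bound.  Let w <= eta be bounded and Borel with integral m over (a, b),
    where e < a < b < e0.  Integrating w(r) <= w(r) int_{S_r} rho^k over r and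
    slicing space by spheres (up to the constant kappa relating Hausdorff and
    Lebesgue measures on hyperplanes), Young's inequality with the weight Q gives
    int rho^p / Q >= (m / kappa)^P J^(1 - P) for every extensively admissible rho.
    By hypothesis the same number M bounds the p-modulus of the levels of v.

    Upper bound.  Let h = rho^k be nearly optimal for the levels of v.  A uniform
    density on a thin tube around a curve crossing from {v <= a} to {v >= b} is
    admissible for the levels, so the first variation of int h^P in its direction
    shows that averages of h^(P - 1), divided by kappa M, are admissible for the
    curves having a tube of given width in W.  Hence these curves have
    alpha-modulus at most kappa^(-alpha) M^(1 - alpha); by uniform convexity of
    L^alpha (Ziemer) this passes to the union over all widths.  The two constants
    kappa cancel, leaving m^(-alpha) J, and m tends to 1. *)

(** * Kuhn's lemma and the Poincare-Miranda theorem *)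

(** Since [f] is merely a homeomorphism, [v] is merely continuous: no gradient and no coarea formula
    exist on the image side. What replaces them is a covering fact: each small translate of a
    polygon running from {v < r} to {v > r} meets {v = r}, so the cube of translations is covered by
    pieces of the level swept along the edges. This needs full-dimensional room around the curve,
    hence the tubes, and hence openness of f(D), which is invariance of domain, proved from
    Poincare-Miranda. The hypotheses 2 <= n and n - 1 < p <= n enter as 1 < P <= 2 <= alpha: P <= 2
    gives the first-order expansion of (h + z)^P with error z^P, and alpha >= 2 gives Clarkson's
    inequality. Boundedness of [w] lets a function of small L^P norm absorb the exceptional spheres;
    (a, b) is strictly inside (e, e0) so that the ends of a curve have neighbourhoods in {v <= a}
    and {v >= b}. On the sphere side a measurable majorant [psi] takes the place of the slice
    measure as a function of r. *)

Section kuhn_labels.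
Variable n : nat.

Definition rainbow (L : seq nat) := perm_eq L (iota 0 n.+1).
Definition almost_rainbow (L : seq nat) a := perm_eq L (a :: iota 0 n).

(** Deleting an entry leaves the labels 0, ..., n-1 for exactly one position if the list is rainbow
    (the entry is then n), for the two positions of a repeated label a < n, and for no position
    otherwise. *)
Lemma rainbow_parity (L : seq nat) : all (fun a => a <= n)%N L ->
  \big[addb/false]_(a <- L) almost_rainbow L a = rainbow L.
Proof.
move=> leL.
have -> : \big[addb/false]_(a <- L) almost_rainbow L a =
    odd (count (almost_rainbow L) L).
  move: (almost_rainbow L) => P; elim: L {leL} => [|a s IH]; first by rewrite big_nil.
  by rewrite big_cons /= IH oddD; case: (P a).
have iotaS : perm_eq (iota 0 n.+1) (n :: iota 0 n).
  by rewrite -addn1 iotaD add0n perm_catC.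
have [/hasP[a aL La]|/hasPn noL] := boolP (has (almost_rainbow L) L); last first.
  rewrite (_ : count _ _ = 0)%N; last first.
    by apply/eqP; rewrite -leqn0 leqNgt -has_count; apply/hasPn.
  apply/esym/negP => RL.
  have : n \in L by rewrite (perm_mem RL) mem_iota /= add0n ltnS.
  by move/noL => /negP; apply; apply: perm_trans RL iotaS.
have an : (a <= n)%N by move/allP: leL; apply.
rewrite (_ : count _ _ = (a < n)%N + 1)%N; last first.
  transitivity (count_mem a L).
    apply: eq_in_count => b bL /=; rewrite /almost_rainbow.
    apply/idP/eqP => [Lb|-> //].
    have := seq.permP Lb (pred1 b); rewrite (seq.permP La) /= eqxx.
    by move/eqP; rewrite eqn_add2r; case: (a =P b).
  rewrite (seq.permP La) /= eqxx addnC; congr (_ + _)%N.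
  by rewrite count_uniq_mem ?iota_uniq // mem_iota /= add0n.
rewrite oddD /= addbT oddb -leqNgt; apply/idP/idP.
  move=> na; have an' : a = n by apply/eqP; rewrite eqn_leq na an.
  by rewrite an' in La; apply: perm_trans La _; rewrite perm_sym.
move=> RL; have := seq.permP (perm_trans RL iotaS) (pred1 n).
rewrite (seq.permP La) /= eqxx.
by move/eqP; rewrite eqn_add2r; case: (a =P n) => // ->.
Qed.

End kuhn_labels.

(** A simplex of Kuhn's triangulation of the grid {0, ..., N+1}^n: a corner of a unit cell and a
    ranking of the axes. Vertex [k] is reached from the corner by unit steps along the axes of rank
    0, ..., k-1. *)
Definition simplex n N := ({ffun 'I_n -> 'I_N.+1} * 'S_n)%type.

Definition kvertex n N (s : simplex n N) (k : nat) : 'I_n -> nat :=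
  fun i => (s.1 i + (s.2 i < k))%N.

Definition klabels n N (lab : ('I_n -> nat) -> nat) (s : simplex n N) :=
  [seq lab (kvertex s k) | k <- iota 0 n.+1].

Definition kfacet n N (lab : ('I_n -> nat) -> nat) (s : simplex n N) k :=
  perm_eq [seq lab (kvertex s j) | j <- iota 0 k ++ iota k.+1 (n - k)] (iota 0 n).

(** Kuhn's boundary condition, the cubical analogue of Sperner's: it forces a boundary facet with
    labels 0, ..., n-1 to lie in the face where the last coordinate vanishes. *)
Definition klabelling n N (lab : ('I_n -> nat) -> nat) :=
  forall x : 'I_n -> nat, (forall i, x i <= N.+1)%N ->
  [/\ (lab x <= n)%N, (forall i, x i = 0%N -> (lab x <= i)%N) &
      (forall i, x i = N.+1 -> lab x != i)].

Lemma kvertex_le n N (s : simplex n N) k i : (kvertex s k i <= N.+1)%N.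
Proof. by rewrite /kvertex; case: (_ < k)%N; rewrite ?addn1 ?addn0 // ltnW. Qed.

Lemma almost_rainbow_kfacet n N lab (s : simplex n N) k : (k <= n)%N ->
  almost_rainbow n (klabels lab s) (lab (kvertex s k)) = kfacet lab s k.
Proof.
move=> kn; rewrite /almost_rainbow /kfacet /klabels.
have -> : iota 0 n.+1 = iota 0 k ++ k :: iota k.+1 (n - k).
  by rewrite -[in LHS](subnKC (leqW kn)) iotaD add0n subSn.
rewrite map_cat /= -cat1s perm_catCA /= perm_cons map_cat.
by [].
Qed.

Lemma rainbow_kfacets n N lab (s : simplex n N) : klabelling N lab ->
  rainbow n (klabels lab s) = \big[addb/false]_(k < n.+1) kfacet lab s k.
Proof.
move=> Hl; rewrite -rainbow_parity; last first.
  apply/allP => a /mapP[k _ ->].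
  by have [] := Hl (kvertex s k) (kvertex_le s k).
rewrite [in LHS]/klabels big_map -{1}[n.+1]subn0 -/(index_iota 0 n.+1) big_mkord.
by apply: eq_bigr => k _; rewrite almost_rainbow_kfacet // -ltnS.
Qed.

(** Exchanging the two consecutive ranks [k] and [k+1] replaces vertex [k+1] and keeps all others,
    so the simplices sharing such a facet come in pairs. *)
Lemma sum_kfacet_inner m N lab (k : 'I_m) :
  \big[addb/false]_(s : simplex m.+1 N) kfacet lab s k.+1 = false.
Proof.
pose a : 'I_m.+1 := inord k; pose b : 'I_m.+1 := inord k.+1.
have va : a = k :> nat by rewrite inordK // ltnS ltnW.
have vb : b = k.+1 :> nat by rewrite inordK // ltnS.
have ab : a != b by rewrite -val_eqE /= va vb neq_ltn leqnn.
pose sw (s : simplex m.+1 N) : simplex m.+1 N := (s.1, (s.2 * tperm a b)%g).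
have swK : involutive sw.
  by case=> x t; rewrite /sw /= -mulgA tperm2 mulg1.
have swF s : kfacet lab (sw s) k.+1 = kfacet lab s k.+1.
  congr (perm_eq _ _); apply/eq_in_map => j jk.
  have {}jk : j != k.+1.
    move: jk; rewrite mem_cat !mem_iota; case: (j =P k.+1) => // ->.
    by rewrite !ltnn !andbF.
  congr (lab _); apply: funext => i; rewrite /kvertex /= permM; congr (_ + _)%N.
  case: tpermP => [->|->|//]; rewrite va vb.
    by rewrite [in RHS]leq_eqVlt eq_sym (negbTE jk).
  by rewrite [in LHS]leq_eqVlt eq_sym (negbTE jk).
(* The exchange reverses the parity of the ranking, so it maps the odd half of the sum bijectively
   onto the even half. *)
rewrite (bigID (fun s : simplex m.+1 N => odd_perm s.2)) /=.
rewrite (reindex_inj (inv_inj swK)) /=.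
rewrite [X in addb X _](eq_bigl (fun s : simplex m.+1 N => ~~ odd_perm s.2)); last first.
  by case=> x t; rewrite /= odd_permM odd_tperm ab addbT.
by rewrite [X in addb X _](eq_bigr (fun s => kfacet lab s k.+1)) ?addbb // => s _; rewrite swF.
Qed.

Section kuhn_boundary.
Variables (m N : nat) (lab : ('I_m.+1 -> nat) -> nat).
Hypothesis lablab : klabelling N lab.
Let S := simplex m.+1 N.

(** [A] says that the grid continues beyond the facet opposite vertex 0, [B] the same for the facet
    opposite the last vertex: the former lies at height s.1 i + 1 along the axis of rank 0, the
    latter at height s.1 i along the axis of last rank. *)
Let A (s : S) := [forall i, (s.2 i == ord0) ==> (s.1 i < N)%N].
Let B (s : S) := [forall i, (s.2 i == ord_max) ==> (0 < s.1 i)%N].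

Let inj_shift (t : 'S_m.+1) (c : 'I_m.+1) : injective (fun i => t i + c).
Proof. by move=> i j /addIr/perm_inj. Qed.

(** The neighbour across the facet opposite vertex 0: the corner advances along the axis of rank 0,
    which then gets the last rank. Adding [ord_max] modulo m+1 lowers every other rank by one. *)
Let rot (s : S) : S :=
  ([ffun i => inord (s.1 i + (s.2 i == ord0))%N], perm (@inj_shift s.2 ord_max)).
Let rotV (s : S) : S :=
  ([ffun i => inord (s.1 i - (s.2 i == ord_max))%N], perm (@inj_shift s.2 (- ord_max))).

Let addmax0 (i : 'I_m.+1) : (i + ord_max == ord_max) = (i == ord0).
Proof. by rewrite -{2}[ord_max]add0r (inj_eq (addIr _)). Qed.

Let submax0 (i : 'I_m.+1) : (i - ord_max == ord0) = (i == ord_max).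
Proof. by rewrite subr_eq add0r. Qed.

Let val_addmax (i : 'I_m.+1) : i != ord0 -> (i + ord_max : 'I_m.+1) = i.-1 :> nat.
Proof.
rewrite -val_eqE /= -lt0n => i0; rewrite -[in LHS](prednK i0) addSnnS modnDr.
by rewrite modn_small // (leq_ltn_trans (leq_pred _)).
Qed.

Let rotK s : A s -> rotV (rot s) = s.
Proof.
move=> /forallP As; case: s As => x t /= As; rewrite /rotV /rot /=; congr pair.
  apply/ffunP => i; rewrite !ffunE permE addmax0; apply: val_inj.
  have := As i; case: (t i == ord0) => /= xi.
    have x1 : (x i + 1 < N.+1)%N by rewrite addn1 ltnS.
    by rewrite inordK inordK // addnK.
  by rewrite addn0 subn0 !inord_val.
by apply/permP => i; rewrite !permE /= addrK.
Qed.

Let rotVK s : B s -> rot (rotV s) = s.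
Proof.
move=> /forallP Bs; case: s Bs => x t /= Bs; rewrite /rotV /rot /=; congr pair.
  apply/ffunP => i; rewrite !ffunE permE submax0; apply: val_inj.
  have := Bs i; case: (t i == ord_max) => /= xi.
    have x1 : (x i - 1 < N.+1)%N by rewrite (leq_ltn_trans (leq_subr _ _)).
    by rewrite inordK inordK // subnK.
  by rewrite addn0 subn0 !inord_val.
by apply/permP => i; rewrite !permE /= subrK.
Qed.

Let B_rot s : B (rot s) = A s.
Proof.
apply/forallP/forallP => /= H i; have := H i; rewrite ffunE permE addmax0;
  case: (s.2 i == ord0) => //=; rewrite addn1.
  move=> xi; rewrite ltnNge; apply/negP => Ni; move: xi.
  by rewrite /inord /insubd insubN //= -leqNgt ltnS.
by move=> xi; rewrite inordK // ltnS.
Qed.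

Let kvertex_rot s k : A s -> (k <= m)%N -> kvertex (rot s) k = kvertex s k.+1.
Proof.
move=> /forallP As km; apply: funext => i; rewrite /kvertex /= ffunE permE.
have := As i; have [ti|ti] := eqVneq (s.2 i) ord0 => /= xi.
  rewrite inordK; last by rewrite addn1 ltnS.
  by rewrite ti add0n modn_small // ltnNge km addn0.
rewrite addn0 inord_val; have /= -> := val_addmax ti; congr (_ + nat_of_bool _)%N.
by rewrite -[in RHS](prednK (_ : 0 < s.2 i)%N) // lt0n.
Qed.

Let kfacet_rot s : A s -> kfacet lab (rot s) m.+1 = kfacet lab s 0.
Proof.
move=> As; rewrite /kfacet subnn subn0 cats0 cat0s -[1%N]addn0 iotaDl -map_comp.
congr (perm_eq _ _); apply/eq_in_map => j; rewrite mem_iota add0n => /andP[_ jm] /=.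
by rewrite kvertex_rot // add1n.
Qed.

(** Such a facet lies where the coordinate of rank 0 equals N+1, and there the label of that
    coordinate is excluded. *)
Let kfacet0F s : ~~ A s -> kfacet lab s 0 = false.
Proof.
rewrite negb_forall => /existsP[i]; rewrite negb_imply -leqNgt => /andP[/eqP ti xi].
rewrite /kfacet subn0 cat0s; apply/negP => pm.
have : val i \in [seq lab (kvertex s j) | j <- iota 1 m.+1].
  by rewrite (perm_mem pm) mem_iota add0n ltn_ord.
move=> /mapP[j]; rewrite mem_iota => /andP[j1 _] labi.
have [_ _ /(_ i)] := lablab (kvertex_le s j); rewrite -labi eqxx => H.
suff : kvertex s j i = N.+1 by move/H.
rewrite /kvertex ti j1 addn1; congr _.+1.
by apply/eqP; rewrite eqn_leq xi -ltnS ltn_ord.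
Qed.

(** The facet lies in a face x_i = 0, where labels are at most i; it carries the label m, which
    leaves only i = m. *)
Let kfacet_max s : ~~ B s -> kfacet lab s m.+1 ->
  (s.2 ord_max == ord_max) && (s.1 ord_max == ord0).
Proof.
rewrite negb_forall => /existsP[i]; rewrite negb_imply -leqNgt leqn0.
move=> /andP[/eqP ti xi].
rewrite /kfacet subnn cats0 => pm.
have : m \in [seq lab (kvertex s j) | j <- iota 0 m.+1].
  by rewrite (perm_mem pm) mem_iota add0n ltnSn.
move=> /mapP[j]; rewrite mem_iota add0n => /andP[_ j1] labi.
have [_ /(_ i) + _] := lablab (kvertex_le s j); rewrite /= -labi.
rewrite /kvertex ti (eqP xi) add0n /= ltnNge -ltnS j1 /= => /(_ erefl) mi.
have im : ord_max = i by apply/val_inj/eqP; rewrite eqn_leq mi -ltnS ltn_ord.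
by rewrite im ti -im eqxx im -val_eqE.
Qed.

Definition kextend (x : 'I_m -> nat) : 'I_m.+1 -> nat :=
  fun i => if unlift ord_max i is Some j then x j else 0%N.

Lemma klabelling_extend : klabelling N (lab \o kextend).
Proof.
move=> x xN; have [|l1 l2 l3] := lablab (x := kextend x).
  by move=> i; rewrite /kextend; case: unlift.
split=> /=.
- by apply: (l2 ord_max); rewrite /kextend unlift_none.
- move=> i xi; rewrite -[X in (_ <= X)%N](lift_max i); apply: l2.
  by rewrite /kextend liftK.
- move=> i xi; rewrite -[X in _ != X](lift_max i); apply: l3.
  by rewrite /kextend liftK.
Qed.

(** Modulo 2, rainbow simplices are counted by their facets. Interior facets cancel in pairs,
    through [sum_kfacet_inner] and [rot], and what survives on the boundary is the triangulation of
    one face, one dimension lower. *)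
Lemma kuhn_step :
  \big[addb/false]_(s : simplex m.+1 N) rainbow m.+1 (klabels lab s) =
  \big[addb/false]_(s : simplex m N) rainbow m (klabels (lab \o kextend) s).
Proof.
under eq_bigr do rewrite rainbow_kfacets //.
rewrite exchange_big /= big_ord_recl big_ord_recr /=.
rewrite [X in addb _ (addb X _)]big1 ?addFb; last first.
  by move=> k _; exact: (sum_kfacet_inner N lab k).
rewrite (_ : bump 0 m = m.+1) //.
rewrite [X in addb X _](bigID A) /= [X in addb (addb _ X) _]big1 ?addbF; last first.
  by move=> s /kfacet0F ->.
rewrite [X in addb _ X](bigID B) /=.
rewrite [X in addb _ (addb X _)](reindex_onto rot rotV) => [|s /rotVK //].
rewrite [X in addb _ (addb X _)](eq_bigl A); last first.
  move=> s; rewrite B_rot; case As: (A s) => //=.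
  by rewrite rotK ?eqxx.
rewrite [X in addb _ (addb X _)](eq_bigr (fun s => kfacet lab s 0)); last first.
  by move=> s /kfacet_rot ->.
rewrite addbA addbb addFb.
pose lift_simplex (s : simplex m N) : S :=
  ([ffun i => if unlift ord_max i is Some j then s.1 j else ord0],
   lift_perm ord_max ord_max s.2).
pose P (s : S) := (s.2 ord_max == ord_max) && (s.1 ord_max == ord0).
transitivity (\big[addb/false]_(s | P s) kfacet lab s m.+1).
  rewrite big_mkcond [RHS]big_mkcond /=; apply: eq_bigr => s _.
  case Bs: (B s) => /=.
    case: ifPn => // /andP[/eqP s2 /eqP s1].
    by move/forallP: Bs => /(_ ord_max); rewrite s2 eqxx s1.
  have := @kfacet_max s (negbT Bs); rewrite /P.
  by case: (kfacet _ _ _) => [->//|_]; rewrite if_same.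
(* The ranking that remains when the axis [ord_max] is deleted; it inverts [lift_perm] on the
   rankings that fix this axis. *)
pose ulsf (t : 'S_m.+1) k := odflt k (unlift (t ord_max) (t (lift ord_max k))).
have ulsfK (t : 'S_m.+1) k : lift (t ord_max) (ulsf t k) = t (lift ord_max k).
  rewrite /ulsf; have := neq_lift ord_max k.
  by rewrite -(can_eq (permK t)) => /unlift_some[] ? ? ->.
have inj_ulsf t : injective (ulsf t).
  by move=> j k jk; apply/(@lift_inj _ ord_max)/(@perm_inj _ t); rewrite -!ulsfK jk.
rewrite (reindex lift_simplex) /=; last first.
  exists (fun s : S => ([ffun j => s.1 (lift ord_max j)], perm (inj_ulsf s.2))).
    move=> [x t] _ /=; congr pair; first by apply/ffunP => j; rewrite !ffunE liftK.
    by apply/permP => k; rewrite permE /ulsf lift_perm_lift lift_perm_id liftK.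
  move=> [x t] /andP[/= /eqP t0 /eqP x0]; rewrite /lift_simplex /=; congr pair.
    apply/ffunP => i; rewrite !ffunE.
    by case: (unliftP ord_max i) => [j|] ->; rewrite ?ffunE ?x0.
  apply/permP => k; case: (unliftP ord_max k) => [j|] ->; rewrite ?lift_perm_id //.
  by rewrite lift_perm_lift permE -ulsfK t0.
apply: eq_big => [s|s _].
  by rewrite /P /lift_simplex /= lift_perm_id ffunE unlift_none !eqxx.
rewrite /kfacet subnn cats0 /rainbow /klabels; congr (perm_eq _ _).
apply/eq_in_map => j; rewrite mem_iota add0n => /andP[_ jm] /=; congr (lab _).
apply: funext => i; rewrite /kvertex /kextend /= ffunE.
case: (unliftP ord_max i) => [k|] ->; rewrite ?lift_perm_lift ?lift_perm_id /=.
  by rewrite /bump [(m <= _)%N]leqNgt ltn_ord.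
by rewrite ltnNge -ltnS jm.
Qed.

End kuhn_boundary.

Lemma kuhn n N (lab : ('I_n -> nat) -> nat) : klabelling N lab ->
  exists s : simplex n N, rainbow n (klabels lab s).
Proof.
move=> Hl; apply/existsP; apply: contraT; rewrite negb_exists => /forallP no.
suff : \big[addb/false]_(s : simplex n N) rainbow n (klabels lab s) = true.
  by rewrite big1 // => s _; apply/negbTE/no.
elim: n lab Hl {no} => [|m IH] lab Hl; last by rewrite kuhn_step // IH //; exact: klabelling_extend.
have s0 : simplex 0 N by split; [exact: [ffun=> ord0]|exact: 1%g].
rewrite (bigD1 s0) //= big1 ?addbF.
  rewrite /rainbow /klabels /=; have [+ _ _] := Hl _ (kvertex_le s0 0).
  by rewrite leqn0 => /eqP ->.
move=> [x t] /eqP[]; case: s0 => y u; congr pair; last by apply/permP; case.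
by apply/ffunP; case.
Qed.

Lemma box_compact (R : realType) n (a b : 'rV[R]_n) : compact (box a b).
Proof.
have -> : box a b = [set v | forall i, `[a ord0 i, b ord0 i]%classic (v ord0 i)].
  by apply/seteqP; split=> x /= H i; have := H i; rewrite in_itv.
by apply: (@rV_compact R n (fun i => `[a ord0 i, b ord0 i]%classic)) => i; exact: segment_compact.
Qed.

Lemma ler_rV_norm (R : realType) n (x : 'rV[R]_n) (M : R) : 0 <= M ->
  (forall i, `|x ord0 i| <= M) -> `|x| <= M.
Proof.
move=> M0 xM; rewrite [leLHS]/Num.norm /= mx_normrE; apply/bigmax_leP; split=> //= -[i j] _.
by rewrite ord1; exact: xM.
Qed.

Lemma rV_coord_le_norm (R : realType) n (x : 'rV[R]_n) i : `|x ord0 i| <= `|x|.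
Proof.
rewrite [leRHS]/Num.norm /= mx_normrE; apply/bigmax_geP; right.
by exists (ord0, i).
Qed.

Lemma discrete_poincare_miranda (R : realType) n (a b : 'rV[R]_n)
    (F : 'rV[R]_n -> 'rV[R]_n) (N : nat) :
  (forall i, a ord0 i < b ord0 i) ->
  (forall x i, box a b x -> x ord0 i = a ord0 i -> F x ord0 i <= 0) ->
  (forall x i, box a b x -> x ord0 i = b ord0 i -> 0 <= F x ord0 i) ->
  exists2 y, box a b y & forall i, exists p q,
    [/\ box a b p, box a b q, `|p - y| <= `|b - a| / N.+1%:R,
        `|q - y| <= `|b - a| / N.+1%:R & F p ord0 i <= 0 <= F q ord0 i].
Proof.
move=> ab Fa Fb.
pose pt (x : 'I_n -> nat) : 'rV[R]_n :=
  \row_i (a ord0 i + (b ord0 i - a ord0 i) * ((x i)%:R / N.+1%:R)).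
have ba i : 0 <= b ord0 i - a ord0 i by rewrite subr_ge0 ltW.
have ptbox x : (forall i, x i <= N.+1)%N -> box a b (pt x).
  move=> xN i; rewrite mxE lerDl mulr_ge0 ?divr_ge0 //=.
  rewrite -lerBrDl ler_piMr // ler_pdivrMr ?ltr0n // mul1r ler_nat.
  exact: xN.
(* The label is the first coordinate that is not [up], and n if there is none. A label i thus gives
   F_i <= 0, and the label n gives F_i >= 0 for all i, the upper faces being covered by the
   hypothesis on [F]. *)
pose up (x : 'I_n -> nat) i := (0 < F (pt x) ord0 i) || (x i == N.+1).
pose lab x := find (fun i => ~~ up x i) (enum 'I_n).
have nthi (i : 'I_n) : nth i (enum 'I_n) i = i by exact: nth_ord_enum.
have labi x (i : 'I_n) : lab x = i -> ~~ up x i.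
  move=> li; have := @nth_find _ i (fun i => ~~ up x i) (enum 'I_n).
  by rewrite has_find -/(lab x) li size_enum_ord ltn_ord nthi => /(_ isT).
have labn x (i : 'I_n) : (i < lab x)%N -> up x i.
  by move=> il; have := before_find i il; rewrite nthi => /negbFE.
have Hl : klabelling N lab.
  move=> x xN; split.
  - by have := find_size (fun i => ~~ up x i) (enum 'I_n); rewrite size_enum_ord.
  - move=> i xi; rewrite leqNgt; apply/negP => /labn; rewrite /up xi orbF.
    rewrite ltNge Fa //; first exact: ptbox.
    by rewrite mxE xi mul0r mulr0 addr0.
  - move=> i xi; apply/negP => /eqP/labi; rewrite /up xi eqxx orbT.
    by [].
have [s Rs] := kuhn Hl.
have vbox k : box a b (pt (kvertex s k)) by apply: ptbox => i; exact: kvertex_le.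
have vnear k : `|pt (kvertex s k) - pt (kvertex s 0)| <= `|b - a| / N.+1%:R.
  apply: ler_rV_norm; first by rewrite divr_ge0.
  move=> i; rewrite !mxE /kvertex ltn0 addn0.
  rewrite (_ : _ - _ = (b ord0 i - a ord0 i) * ((s.2 i < k)%N%:R / N.+1%:R)); last first.
    by rewrite natrD; ring.
  rewrite normrM ger0_norm // ler_pM //.
    by have := rV_coord_le_norm (b - a) i; rewrite !mxE ger0_norm.
  rewrite ger0_norm ?divr_ge0 //; case: (_ < _)%N => /=; first by rewrite mul1r.
  by rewrite mul0r invr_ge0.
exists (pt (kvertex s 0)) => // i.
have lab_in j : (j <= n)%N -> exists k, lab (kvertex s k) = j.
  move=> jn; have : j \in klabels lab s by rewrite (perm_mem Rs) mem_iota add0n ltnS.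
  by move=> /mapP[k _ ->]; exists k.
have [k ki] := lab_in i (ltnW (ltn_ord i)).
have [l ln] := lab_in n (leqnn n).
exists (pt (kvertex s k)), (pt (kvertex s l)); split=> //.
have := labi _ _ ki; rewrite /up negb_or -leNgt => /andP[-> _] /=.
have : up (kvertex s l) i by apply: labn; rewrite ln.
move=> /orP[/ltW //|/eqP li]; apply: Fb => //.
by rewrite mxE li divff ?pnatr_eq0 // mulr1 addrC subrK.
Qed.

Theorem poincare_miranda (R : realType) n (a b : 'rV[R]_n)
    (F : 'rV[R]_n -> 'rV[R]_n) :
  (forall i, a ord0 i < b ord0 i) ->
  {within box a b, continuous F} ->
  (forall x i, box a b x -> x ord0 i = a ord0 i -> F x ord0 i <= 0) ->
  (forall x i, box a b x -> x ord0 i = b ord0 i -> 0 <= F x ord0 i) ->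
  exists2 x, box a b x & F x = 0.
Proof.
move=> ab Fc Fa Fb.
have /choice[y yP] N : exists y, box a b y /\ forall i, exists p q,
    [/\ box a b p, box a b q, `|p - y| <= `|b - a| / N.+1%:R,
        `|q - y| <= `|b - a| / N.+1%:R & F p ord0 i <= 0 <= F q ord0 i].
  by have [y yb H] := discrete_poincare_miranda N ab Fa Fb; exists y.
have [|x [xb clx]] := @box_compact R n a b (y @ \oo) _.
  by exists 0%N => // N _; have [] := yP N.
exists x => //; apply/rowP => i; rewrite mxE.
have Fxi : (fun z => F z ord0 i) @ within (box a b) (nbhs x) --> F x ord0 i.
  have /subspace_continuousP/(_ x xb) Fx := Fc.
  exact: (cvg_comp _ _ Fx (@coord_continuous R 1 n ord0 i (F x))).
(* Arbitrarily near the cluster point the [i]-th component takes both a nonpositive and a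
   nonnegative value, so its value at the point can have no strict sign. *)
have key (P : set R) : nbhs (F x ord0 i) P ->
    exists p q, [/\ P (F p ord0 i), P (F q ord0 i) & F p ord0 i <= 0 <= F q ord0 i].
  move=> /Fxi; rewrite /= nbhs_simpl /= => /nbhs_ballP[e /= e0 He].
  pose M := `|b - a| * 2 / e.
  have [N MN] : exists N : nat, M < N.+1%:R.
    exists (Num.truncn M); exact: truncnS_gt.
  have [||_ [[k /= Nk <-] yk]] := clx [set y k | k in [set k | (N <= k)%N]] (ball x (e / 2)).
  - by exists N => // k /= Nk; exists k.
  - by apply: nbhsx_ballx; rewrite divr_gt0.
  have small z : `|z - y k| <= `|b - a| / k.+1%:R -> ball x e z.
    move=> zy; rewrite (splitr e); apply: ball_triangle yk _.
    rewrite -ball_normE /= distrC (le_lt_trans zy) //.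
    rewrite ltr_pdivrMr ?ltr0n // -ltr_pdivrMl ?divr_gt0 // invf_div mulrC mulrA.
    by rewrite (lt_le_trans MN) // ler_nat ltnS.
  have [_ /(_ i)[p [q [pb qb /small pe /small qe pq]]]] := yP k.
  by exists p, q; split=> //; apply: He.
have [F0|F0|//] := ltgtP (F x ord0 i) 0.
  have [p [q [_ /= + /andP[_ +]]]] := key [set z | z < 0] (lt_nbhsl F0).
  by move=> /lt_le_trans H /H; rewrite ltxx.
have [p [q [/= + _ /andP[+ _]]]] := key [set z | 0 < z] (lt_nbhsr F0).
by move=> /lt_le_trans H /H; rewrite ltxx.
Qed.

(** * Lebesgue and Hausdorff outer measures *)

Section cover_inf.
Local Open Scope ereal_scope.
Context (R : realType) (T I : Type) (C : I -> set T) (w : I -> \bar R) (P : set I).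
Hypothesis w_ge0 : forall i, 0 <= w i.

(** The common form of [leb_outer] and [hausdorff_delta]: covers by sets [C i] of weight [w i] with
    indices in [P]. Countable subadditivity is proved once for both. *)
Definition cover_inf (E : set T) : \bar R :=
  ereal_inf [set \sum_(0 <= k <oo) w (F k) | F in
    [set F : nat -> I | (forall k, P (F k)) /\ E `<=` \bigcup_k C (F k)]].

Lemma cover_inf_ge0 E : 0 <= cover_inf E.
Proof. by apply: le_ereal_inf_tmp => _ [F _ <-]; exact: nneseries_ge0. Qed.

Lemma le_cover_inf : {homo cover_inf : A B / A `<=` B >-> A <= B}.
Proof.
move=> A B AB; apply: ereal_inf_le_tmp => _ [F [PF BF] <-].
by exists F => //; split=> //; exact: subset_trans BF.
Qed.

Lemma cover_inf_le E F : (forall k, P (F k)) -> E `<=` \bigcup_k C (F k) ->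
  cover_inf E <= \sum_(0 <= k <oo) w (F k).
Proof. by move=> PF EF; apply: ereal_inf_lbound; exists F. Qed.

Lemma cover_inf_adherent E (e : R) : (0 < e)%R -> cover_inf E < +oo ->
  exists F : nat -> I, [/\ forall k, P (F k), E `<=` \bigcup_k C (F k) &
    \sum_(0 <= k <oo) w (F k) <= cover_inf E + e%:E].
Proof.
move=> e0 Eoo; have fE : cover_inf E \is a fin_num.
  by rewrite ge0_fin_numE // cover_inf_ge0.
have [_ [F [PF EF] <-] lF] := lb_ereal_inf_adherent e0 fE.
by exists F; split=> //; exact: ltW.
Qed.

Lemma nneseries_pair (a : nat -> nat -> \bar R) : (forall i j, 0 <= a i j) ->
  exists f : nat -> nat * nat, (forall p, exists k, f k = p) /\
    \sum_(0 <= k <oo) a (f k).1 (f k).2 =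
    \sum_(0 <= i <oo) \sum_(0 <= j <oo) a i j.
Proof.
move=> a0; have /card_esym/ppcard_eqP[f] := card_nat2.
exists f; split=> [p|].
  by exists (f^-1%FUN p); rewrite invK // inE.
rewrite !nneseries_esumT //; last by move=> i; exact: nneseries_ge0.
under [RHS]eq_esum do rewrite nneseries_esumT //.
rewrite esum_esum //= (_ : _ `*`` _ = [set: nat * nat]); last by apply/seteqP; split.
by rewrite (reindex_esum setT _ f) //=; exact: 'bij_f.
Qed.

Lemma cover_inf_sigma_subadditive : sigma_subadditive cover_inf.
Proof.
move=> A; have [[i ioo]|] := pselect (exists i, cover_inf (A i) = +oo).
  rewrite (eseries_pinfty _ _ ioo) ?leey // => k _.
  by rewrite -ltNye (lt_le_trans _ (cover_inf_ge0 _)).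
rewrite -forallNE => Aoo; apply/lee_addgt0Pr => e e0.
rewrite (le_trans _ (epsilon_trick _ _ (ltW e0))) //; last first.
  by move=> k; exact: cover_inf_ge0.
have /choice[G GP] k : exists F : nat -> I, [/\ forall j, P (F j),
    A k `<=` \bigcup_j C (F j) &
    \sum_(0 <= j <oo) w (F j) <= cover_inf (A k) + (e / (2 ^ k.+1)%:R)%:E].
  apply: cover_inf_adherent; first by rewrite divr_gt0 // ltr0n expn_gt0.
  by rewrite ltey; exact/eqP.
have [f [fsurj fsum]] := nneseries_pair (fun i j => w_ge0 (G i j)).
apply: (@le_trans _ _ (\sum_(0 <= k <oo) w (G (f k).1 (f k).2))).
  apply: (cover_inf_le (F := fun k => G (f k).1 (f k).2)).
    by move=> k; have [] := GP (f k).1.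
  move=> x [i _ Ax]; have [_ /(_ _ Ax)[j _ Cx] _] := GP i.
  by have [k fk] := fsurj (i, j); exists k; rewrite // fk.
rewrite fsum; apply: lee_nneseries => [i _ _|i _]; first exact: nneseries_ge0.
by have [] := GP i.
Qed.

Lemma cover_inf0 i0 : P i0 -> w i0 = 0 -> cover_inf set0 = 0.
Proof.
move=> Pi0 w0; apply/eqP; rewrite eq_le cover_inf_ge0 andbT.
apply: (le_trans (cover_inf_le (F := fun=> i0) _ _)) => //.
by rewrite eseries0.
Qed.

Lemma cover_inf_le1 i0 i E : P i0 -> w i0 = 0 -> P i -> E `<=` C i ->
  cover_inf E <= w i.
Proof.
move=> Pi0 w0 Pi EC.
have := @cover_inf_le E (fun k => if k is 0%N then i else i0).
rewrite nneseries_recl // eseries0 ?adde0 => [|[|k] //]; apply; first by case.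
by move=> x /EC Cx; exists 0%N.
Qed.

End cover_inf.

Section leb_outer_measure.
Local Open Scope ereal_scope.
Context {R : realType} {n : nat}.
Notation V := 'rV[R]_n.+1.

(** The dimension is a successor so that flat boxes of volume 0 exist, with which finite covers are
    padded to sequences; in dimension 0 the empty product gives every box volume 1. *)
Definition boxvol (ab : V * V) : \bar R :=
  (\prod_(i < n.+1) (ab.2 ord0 i - ab.1 ord0 i))%:E.

Definition box_ok (ab : V * V) := forall i, (ab.1 ord0 i <= ab.2 ord0 i)%R.

Lemma boxvol_ge0 ab : box_ok ab -> 0 <= boxvol ab.
Proof. by move=> H; rewrite lee_fin prodr_ge0 // => i _; rewrite subr_ge0. Qed.

(** The absolute value makes the weight nonnegative for all pairs, as [cover_inf] requires, and
    changes nothing on [box_ok] pairs. *)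
Lemma leb_outerE (E : set V) :
  leb_outer E = cover_inf (fun ab : V * V => box ab.1 ab.2) (fun ab => `|boxvol ab|) box_ok E.
Proof.
rewrite /leb_outer /cover_inf; congr ereal_inf; apply/seteqP; split=> x.
  move=> [[a b] /= [ab Eab] <-]; exists (fun k => (a k, b k)); first by split=> // k i; exact: ab.
  apply: eq_eseriesr => k _; congr EFin; rewrite ger0_norm //.
  by apply: prodr_ge0 => i _; rewrite subr_ge0; exact: ab.
move=> [F [okF EF] <-]; exists (fun k => (F k).1, fun k => (F k).2) => /=.
  by split=> // k i; exact: okF.
apply: eq_eseriesr => k _; congr EFin; rewrite ger0_norm //.
by apply: prodr_ge0 => i _; rewrite subr_ge0; exact: okF.
Qed.

Let w0 (ab : V * V) : 0 <= `|boxvol ab|. Proof. exact: abse_ge0. Qed.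

Lemma leb_outer0 : leb_outer (set0 : set V) = 0.
Proof.
rewrite leb_outerE (@cover_inf0 _ _ _ _ _ _ w0 (0, 0)%R) //.
by rewrite /boxvol /= big_ord_recl !mxE subrr mul0r normr0.
Qed.

Lemma leb_outer_ge0 (E : set V) : 0 <= leb_outer E.
Proof. by rewrite leb_outerE; exact: cover_inf_ge0. Qed.

Lemma le_leb_outer : {homo @leb_outer R n.+1 : A B / A `<=` B >-> A <= B}.
Proof. by move=> A B AB; rewrite !leb_outerE; exact: le_cover_inf. Qed.

Lemma leb_outer_sigma_subadditive : sigma_subadditive (@leb_outer R n.+1).
Proof.
move=> F; rewrite leb_outerE; under eq_eseriesr do rewrite leb_outerE.
exact: cover_inf_sigma_subadditive.
Qed.

HB.instance Definition _ := isOuterMeasure.Build R V (@leb_outer R n.+1)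
  leb_outer0 leb_outer_ge0 le_leb_outer leb_outer_sigma_subadditive.

Lemma leb_outer_adherent (E : set V) (e : R) : (0 < e)%R -> leb_outer E < +oo ->
  exists F : nat -> V * V, [/\ forall k, box_ok (F k),
    E `<=` \bigcup_k box (F k).1 (F k).2 &
    \sum_(0 <= k <oo) boxvol (F k) <= leb_outer E + e%:E].
Proof.
move=> e0; rewrite leb_outerE => /(cover_inf_adherent w0 e0)[F [okF EF sF]].
exists F; split=> //; apply: le_trans sF.
by apply: lee_nneseries => [k _ _|k _]; [exact: boxvol_ge0|exact: lee_abs].
Qed.

Lemma leb_outer_box_le (a b : V) : box_ok (a, b) -> leb_outer (box a b) <= boxvol (a, b).
Proof.
move=> ab; have ok0 : box_ok (a, a) by move=> i; exact: lexx.
rewrite leb_outerE.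
rewrite -[leRHS]gee0_abs ?boxvol_ge0 //.
apply: (@cover_inf_le1 _ _ _ _ (fun ab => `|boxvol ab|) _ w0 (a, a)) => //.
by rewrite /boxvol /= big_ord_recl /= subrr mul0r normr0.
Qed.

End leb_outer_measure.

Section hausdorff_outer_measure.
Local Open Scope ereal_scope.
Context {R : realType} {n : nat} (k : nat).
Notation V := 'rV[R]_n.

(** The exponent is a successor so that the empty set has weight 0; with exponent 0 its weight would
    be 1. *)
Definition hweight (F : set V) : \bar R :=
  (omega k.+1 * (fine (ediam F) / 2) ^+ k.+1)%:E.

Lemma omega_gt0 j : (0 < omega j :> R)%R.
Proof.
elim/ltn_ind: j => -[|[|j]] IH //=.
by rewrite mulr_gt0 ?IH // divr_gt0 // mulr_gt0 // pi_gt0.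
Qed.

Lemma ediam_ge0 (F : set V) : 0 <= ediam F.
Proof. by apply: ereal_sup_ubound; left. Qed.

Lemma ediam_set0 : ediam (set0 : set V) = 0.
Proof.
apply/eqP; rewrite eq_le ediam_ge0 andbT; apply: ge_ereal_sup => x [-> //|].
by move=> [y []].
Qed.

Lemma hweight_ge0 F : 0 <= hweight F.
Proof.
rewrite lee_fin mulr_ge0 ?(ltW (omega_gt0 _)) // exprn_ge0 // divr_ge0 //.
exact/fine_ge0/ediam_ge0.
Qed.

Lemma hausdorff_deltaE (d : R) (E : set V) : hausdorff_delta k.+1 d E =
  cover_inf (@id (set V)) hweight [set F | ediam F < d%:E] E.
Proof.
by congr ereal_inf; apply/seteqP; split=> x [F [H1 H2] <-]; exists F.
Qed.

Lemma le_hausdorff_delta (d d' : R) (E : set V) : (d <= d')%R ->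
  hausdorff_delta k.+1 d' E <= hausdorff_delta k.+1 d E.
Proof.
move=> dd'; apply: ereal_inf_le_tmp => _ [F [EF Fd] <-]; exists F => //; split=> // i.
by rewrite (lt_le_trans (Fd i)) // lee_fin.
Qed.

Lemma hausdorff_delta_le (d : R) (E : set V) : (0 < d)%R ->
  hausdorff_delta k.+1 d E <= hausdorff k.+1 E.
Proof. by move=> d0; apply: ereal_sup_ubound; exists d. Qed.

Lemma hausdorff_delta_ge0 (d : R) (E : set V) : 0 <= hausdorff_delta k.+1 d E.
Proof. by rewrite hausdorff_deltaE; apply: cover_inf_ge0; exact: hweight_ge0. Qed.

Lemma hausdorff_ge0 (E : set V) : 0 <= hausdorff k.+1 E.
Proof. exact: le_trans (hausdorff_delta_ge0 1 E) (hausdorff_delta_le E ltr01). Qed.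

Lemma hausdorff0 : hausdorff k.+1 (set0 : set V) = 0.
Proof.
apply/eqP; rewrite eq_le hausdorff_ge0 andbT; apply: ge_ereal_sup => _ [d d0 <-].
rewrite hausdorff_deltaE (@cover_inf0 _ _ _ _ _ _ hweight_ge0 set0) //=.
  by rewrite ediam_set0 lte_fin.
by rewrite /hweight ediam_set0 /= mul0r expr0n mulr0.
Qed.

Lemma le_hausdorff : {homo @hausdorff R n k.+1 : A B / A `<=` B >-> A <= B}.
Proof.
move=> A B AB; apply: ge_ereal_sup => _ [d d0 <-].
apply: le_trans (hausdorff_delta_le _ d0); rewrite !hausdorff_deltaE.
exact: le_cover_inf.
Qed.

Lemma hausdorff_sigma_subadditive : sigma_subadditive (@hausdorff R n k.+1).
Proof.
move=> F; apply: ge_ereal_sup => _ [d d0 <-]; rewrite hausdorff_deltaE.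
apply: le_trans.
  by apply: (@cover_inf_sigma_subadditive _ _ _ _ _ _ hweight_ge0).
apply: lee_nneseries => [i _ _|i _]; rewrite -hausdorff_deltaE.
  exact: hausdorff_delta_ge0.
exact: hausdorff_delta_le.
Qed.

HB.instance Definition _ := isOuterMeasure.Build R V (@hausdorff R n k.+1)
  hausdorff0 hausdorff_ge0 le_hausdorff hausdorff_sigma_subadditive.

End hausdorff_outer_measure.

Section outer_restriction.
Local Open Scope ereal_scope.
Context (R : realType) (T : Type) (mu : {outer_measure set T -> \bar R}) (A : set T).

Definition orestr (E : set T) := mu (E `&` A).

Let orestr0 : orestr set0 = 0. Proof. by rewrite /orestr set0I outer_measure0. Qed.
Let orestr_ge0 E : 0 <= orestr E. Proof. exact: outer_measure_ge0. Qed.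
Let le_orestr : {homo orestr : E F / E `<=` F >-> E <= F}.
Proof. by move=> E F EF; apply: le_outer_measure; exact: setSI. Qed.
Let orestr_sub : sigma_subadditive orestr.
Proof.
by move=> F; rewrite /orestr setI_bigcupl; exact: outer_measure_sigma_subadditive.
Qed.

HB.instance Definition _ := isOuterMeasure.Build R T orestr
  orestr0 orestr_ge0 le_orestr orestr_sub.

End outer_restriction.

(** * Euclidean norm *)

Section euclid.
Context {R : realType} {n : nat}.
Notation V := 'rV[R]_n.
Implicit Types x y z : V.

Definition dotv x y : R := \sum_(i < n) x ord0 i * y ord0 i.

Lemma dotvC x y : dotv x y = dotv y x.
Proof. by apply: eq_bigr => i _; rewrite mulrC. Qed.

Lemma dotvDl x y z : dotv (x + y) z = dotv x z + dotv y z.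
Proof. by rewrite -big_split; apply: eq_bigr => i _; rewrite mxE mulrDl. Qed.

Lemma dotvZl c x y : dotv (c *: x) y = c * dotv x y.
Proof. by rewrite mulr_sumr; apply: eq_bigr => i _; rewrite mxE mulrA. Qed.

Lemma dotvNl x y : dotv (- x) y = - dotv x y.
Proof. by rewrite -scaleN1r dotvZl mulN1r. Qed.

Lemma dotvBl x y z : dotv (x - y) z = dotv x z - dotv y z.
Proof. by rewrite dotvDl dotvNl. Qed.

Lemma dotvDr x y z : dotv x (y + z) = dotv x y + dotv x z.
Proof. by rewrite dotvC dotvDl !(dotvC x). Qed.

Lemma dotvBr x y z : dotv x (y - z) = dotv x y - dotv x z.
Proof. by rewrite dotvC dotvBl !(dotvC x). Qed.

Lemma dotvZr c x y : dotv x (c *: y) = c * dotv x y.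
Proof. by rewrite dotvC dotvZl dotvC. Qed.

Lemma dotvv_ge0 x : 0 <= dotv x x.
Proof. by apply: sumr_ge0 => i _; rewrite -expr2 sqr_ge0. Qed.

Lemma enormE x : enorm x = Num.sqrt (dotv x x).
Proof. by congr Num.sqrt; apply: eq_bigr => i _; rewrite expr2. Qed.

Lemma enorm_ge0 x : 0 <= enorm x. Proof. exact: sqrtr_ge0. Qed.

Lemma sqr_enorm x : enorm x ^+ 2 = dotv x x.
Proof. by rewrite enormE sqr_sqrtr // dotvv_ge0. Qed.

Lemma enorm0 : enorm (0 : V) = 0.
Proof.
by rewrite enormE (_ : dotv _ _ = 0) ?sqrtr0 // /dotv big1 // => i _; rewrite mxE mul0r.
Qed.

Lemma enormZ c x : enorm (c *: x) = `|c| * enorm x.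
Proof. by rewrite !enormE dotvZl dotvZr mulrA -expr2 sqrtrM ?sqr_ge0 // sqrtr_sqr. Qed.

Lemma enormN x : enorm (- x) = enorm x.
Proof. by rewrite -scaleN1r enormZ normrN1 mul1r. Qed.

Lemma enormB x y : enorm (x - y) = enorm (y - x).
Proof. by rewrite -enormN opprB. Qed.

Lemma dotv_eq0 x : dotv x x = 0 -> x = 0.
Proof.
move=> /eqP; rewrite psumr_eq0 => [/allP H|i _]; last by rewrite -expr2 sqr_ge0.
apply/rowP => i; rewrite mxE; apply/eqP.
by have := H i (mem_index_enum i); rewrite mulf_eq0 orbb.
Qed.

Lemma enorm_eq0 x : enorm x = 0 -> x = 0.
Proof. by move=> x0; apply: dotv_eq0; rewrite -sqr_enorm x0 expr0n. Qed.

Lemma cauchy_schwarz x y : `|dotv x y| <= enorm x * enorm y.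
Proof.
have [/enorm_eq0 ->|y0] := eqVneq (enorm y) 0.
  rewrite enorm0 mulr0 (_ : dotv _ _ = 0) ?normr0 // /dotv big1 // => i _.
  by rewrite mxE mulr0.
have [/enorm_eq0 ->|x0] := eqVneq (enorm x) 0.
  rewrite enorm0 mul0r (_ : dotv _ _ = 0) ?normr0 // /dotv big1 // => i _.
  by rewrite mxE mul0r.
set a := enorm x; set b := enorm y.
have a0 : 0 < a by rewrite lt_def x0 enorm_ge0.
have b0 : 0 < b by rewrite lt_def y0 enorm_ge0.
have ab : 0 < 2 * (a * b) by rewrite !mulr_gt0.
have H1 := dotvv_ge0 (b *: x - a *: y).
have H2 := dotvv_ge0 (b *: x + a *: y).
move: H1 H2; rewrite !(dotvBl, dotvBr, dotvDl, dotvDr, dotvZl, dotvZr).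
rewrite -!sqr_enorm -/a -/b (dotvC y x); set d := dotv x y => H1 H2.
rewrite ler_norml; apply/andP; split; rewrite -(ler_pM2l ab); nra.
Qed.

Lemma enormD x y : enorm (x + y) <= enorm x + enorm y.
Proof.
rewrite -(@ler_pXn2r _ 2) // ?nnegrE ?addr_ge0 ?enorm_ge0 //.
rewrite sqr_enorm dotvDl !dotvDr -!sqr_enorm (dotvC y x).
have := cauchy_schwarz x y; rewrite ler_norml => /andP[_]; nra.
Qed.

Lemma enorm_tri x y z : enorm (x - z) <= enorm (x - y) + enorm (y - z).
Proof. by rewrite -[x - z](_ : (x - y) + (y - z) = _) ?enormD // addrA subrK. Qed.

Lemma enormB_ge x y : `|enorm x - enorm y| <= enorm (x - y).
Proof.
have := enormD (x - y) y; have := enormD (y - x) x; rewrite !subrK (enormB y x).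
by rewrite ler_norml => H1 H2; apply/andP; split; lra.
Qed.

Lemma coord_le_enorm x i : `|x ord0 i| <= enorm x.
Proof.
rewrite -sqrtr_sqr enormE ler_wsqrtr // /dotv (bigD1 i) //= -expr2 lerDl.
by apply: sumr_ge0 => j _; rewrite -expr2 sqr_ge0.
Qed.

Lemma norm_le_enorm x : `|x| <= enorm x.
Proof. by apply: ler_rV_norm => [|i]; [exact: enorm_ge0|exact: coord_le_enorm]. Qed.

Lemma enorm_le_sum x : enorm x <= \sum_(i < n) `|x ord0 i|.
Proof.
rewrite -(@ler_pXn2r _ 2) // ?nnegrE ?enorm_ge0 ?sumr_ge0 //.
rewrite sqr_enorm expr2 mulr_sumr; apply: ler_sum => i _.
rewrite (le_trans (ler_norm _)) // normrM ler_wpM2r //.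
by rewrite (bigD1 i) //= lerDl sumr_ge0.
Qed.

Lemma enorm_le_norm x : enorm x <= n%:R * `|x|.
Proof.
apply: (le_trans (enorm_le_sum x)).
rewrite -[X in X%:R]card_ord mulr_natl -sumr_const.
by apply: ler_sum => i _; exact: rV_coord_le_norm.
Qed.

Lemma enorm_le_cst x (M : R) : (forall i, `|x ord0 i| <= M) -> enorm x <= n%:R * M.
Proof.
move=> xM; apply: (le_trans (enorm_le_sum x)).
by rewrite -[X in X%:R]card_ord mulr_natl -sumr_const; apply: ler_sum => i _.
Qed.

Lemma enorm_continuous : continuous (@enorm R n).
Proof.
move=> x A /= /nbhs_ballP[e /= e0 eA]; apply/nbhs_ballP.
exists (e / n.+1%:R) => /=; first by rewrite divr_gt0.
move=> y; rewrite -ball_normE /= ltr_pdivlMr ?ltr0n // => xy; apply: eA.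
rewrite -ball_normE /=; apply: le_lt_trans (enormB_ge _ _) _.
apply: le_lt_trans (enorm_le_norm _) _; apply: le_lt_trans xy.
by rewrite mulrC ler_wpM2l // ler_nat.
Qed.

End euclid.

Section lipschitz_hausdorff.
Local Open Scope ereal_scope.
Context {R : realType}.

Lemma ediam_le n (F : set 'rV[R]_n) (c : R) : (0 <= c)%R ->
  (forall x y, F x -> F y -> (enorm (x - y) <= c)%R) -> ediam F <= c%:E.
Proof.
move=> c0 Fc; apply: ge_ereal_sup => z [->|[x Fx [y Fy <-]]]; rewrite lee_fin //.
exact: Fc.
Qed.

Lemma ediam_ge n (F : set 'rV[R]_n) x y : F x -> F y -> (enorm (x - y))%:E <= ediam F.
Proof. by move=> Fx Fy; apply: ereal_sup_ubound; right; exists x => //; exists y. Qed.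

Lemma ediam_fin n (F : set 'rV[R]_n) (d : R) : ediam F < d%:E -> ediam F \is a fin_num.
Proof. by move=> Fd; rewrite ge0_fin_numE ?ediam_ge0 // (lt_trans Fd) ?ltry. Qed.

Lemma hausdorff_lipschitz n m k (T : 'rV[R]_n -> 'rV[R]_m) (E : set 'rV[R]_n) (K : R) :
  (0 < K)%R ->
  (forall x y, E x -> E y -> (enorm (T x - T y) <= K * enorm (x - y))%R) ->
  hausdorff k.+1 (T @` E) <= (K ^+ k.+1)%:E * hausdorff k.+1 E.
Proof.
move=> K0 TK; have KX0 : (0 <= K ^+ k.+1)%R by rewrite exprn_ge0 // ltW.
apply: ge_ereal_sup => _ [d d0 <-] /=.
have dK0 : (0 < d / K)%R by rewrite divr_gt0.
apply: (@le_trans _ _ ((K ^+ k.+1)%:E * hausdorff_delta k.+1 (d / K) E)); last first.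
  by rewrite lee_wpmul2l ?lee_fin // hausdorff_delta_le.
rewrite -lee_pdivrMl ?exprn_gt0 //; apply: le_ereal_inf_tmp => _ [F [EF Fd] <-].
rewrite lee_pdivrMl ?exprn_gt0 // -nneseriesZl; last first.
  by move=> i _; exact: (hweight_ge0 k (F i)).
have fd i : (0 <= fine (ediam (F i)))%R by apply: fine_ge0; exact: ediam_ge0.
have dT i : ediam (T @` (F i `&` E)) <= (K * fine (ediam (F i)))%:E.
  apply: ediam_le; first by rewrite mulr_ge0 ?(ltW K0).
  move=> _ _ [x [Fx Ex] <-] [y [Fy Ey] <-]; rewrite (le_trans (TK _ _ Ex Ey)) //.
  by rewrite ler_pM2l // -lee_fin fineK ?(ediam_fin (Fd i)) //; exact: ediam_ge.
apply: (@le_trans _ _ (\sum_(0 <= i <oo) hweight k (T @` (F i `&` E)))).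
  rewrite hausdorff_deltaE; apply: cover_inf_le => [i|_ [x Ex <-]] /=.
    apply: (le_lt_trans (dT i)); rewrite lte_fin mulrC -ltr_pdivlMr //.
    by rewrite -lte_fin fineK ?(ediam_fin (Fd i)).
  by have [i _ Fx] := EF _ Ex; exists i => //; exists x.
apply: lee_nneseries => [i _ _|i _]; first exact: hweight_ge0.
rewrite -EFinM lee_fin mulrCA ler_pM2l ?omega_gt0 // -exprMn lerXn2r ?nnegrE //.
- by rewrite divr_ge0 //; apply: fine_ge0; exact: ediam_ge0.
- by rewrite mulr_ge0 ?(ltW K0) // divr_ge0.
rewrite mulrA ler_pM2r ?invr_gt0 // -lee_fin fineK //.
by rewrite ge0_fin_numE ?ediam_ge0 // (le_lt_trans (dT i)) ?ltry.
Qed.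

End lipschitz_hausdorff.

(** * Caratheodory's criterion for Hausdorff measure *)

Section metric_hausdorff.
Local Open Scope ereal_scope.
Context {R : realType} {n : nat} (k : nat).
Notation V := 'rV[R]_n.
Notation H := (@hausdorff R n k.+1).

Lemma ereal_supD_le (S S' : set (\bar R)) (X : \bar R) :
  S !=set0 -> S' !=set0 -> (forall a, S a -> 0 <= a) -> (forall b, S' b -> 0 <= b) ->
  (forall a b, S a -> S' b -> a + b <= X) -> ereal_sup S + ereal_sup S' <= X.
Proof.
move=> [a0 Sa0] [b0 Sb0] S0 S'0 SS'; have [->|XX] := eqVneq X +oo; first exact: leey.
have X0 : 0 <= X by apply: le_trans (SS' _ _ Sa0 Sb0); apply: adde_ge0; [exact: S0|exact: S'0].
have Xfin : X \is a fin_num by rewrite ge0_fin_numE // ltey.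
have fb b : S' b -> b \is a fin_num.
  move=> S'b; rewrite ge0_fin_numE; last exact: S'0.
  apply: (@le_lt_trans _ _ X); last by rewrite ltey.
  by apply: le_trans (SS' _ _ Sa0 S'b); rewrite leeDr //; exact: S0.
have sSb b : S' b -> ereal_sup S + b <= X.
  move=> S'b; rewrite -leeBrDr; last exact: fb.
  by apply: ge_ereal_sup => a Sa; rewrite leeBrDr; [exact: SS'|exact: fb].
have fS : ereal_sup S \is a fin_num.
  rewrite ge0_fin_numE; last by rewrite (le_trans (S0 _ Sa0)) // ereal_sup_ubound.
  apply: (@le_lt_trans _ _ X); last by rewrite ltey.
  by apply: le_trans (sSb _ Sb0); rewrite leeDl //; exact: S'0.
by rewrite addeC -leeBrDr //; apply: ge_ereal_sup => b S'b; rewrite leeBrDr // addeC; exact: sSb.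
Qed.

(** A covering set of diameter less than [e] cannot meet both [A] and [B], so a fine cover of the
    union splits into covers of the two parts. *)
Lemma hausdorff_metric (A B : set V) (e : R) : (0 < e)%R ->
  (forall x y, A x -> B y -> (e <= enorm (x - y))%R) -> H A + H B <= H (A `|` B).
Proof.
move=> e0 AB.
have key d : (0 < d <= e)%R ->
    hausdorff_delta k.+1 d A + hausdorff_delta k.+1 d B <= H (A `|` B).
  move=> /andP[d0 de]; apply: le_trans (hausdorff_delta_le _ _ d0).
  apply: le_ereal_inf_tmp => _ [F [EF Fd] <-].
  pose G (C : set V) i := if pselect (F i `&` C !=set0) then F i else set0.
  have cov C : C `<=` A `|` B ->
      hausdorff_delta k.+1 d C <= \sum_(0 <= i <oo) hweight k (G C i).
    move=> CAB; rewrite hausdorff_deltaE; apply: cover_inf_le => [i|x Cx].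
      by rewrite /G /=; case: pselect => FC /=; rewrite ?ediam_set0 ?lte_fin.
    have [i _ Fx] := EF _ (CAB _ Cx); exists i => //.
    by rewrite /G; case: pselect => //= -[]; exists x.
  apply: (le_trans (leeD (cov A (@subsetUl _ _ _)) (cov B (@subsetUr _ _ _)))).
  rewrite -nneseriesD => [|i _ _|i _ _]; try exact: hweight_ge0.
  have w0 : hweight k (set0 : set V) = 0.
    by rewrite /hweight ediam_set0 /= mul0r expr0n mulr0.
  apply: lee_nneseries => [i _ _|i _]; first by rewrite adde_ge0 ?hweight_ge0.
  rewrite /G; case: pselect => [[x [Fx Ax]]|nA]; case: pselect => [[y [Fy By]]|nB] /=;
    rewrite ?w0 ?adde0 ?add0e //; last exact: hweight_ge0.
  have := ediam_ge Fx Fy; have := Fd i => dF /le_lt_trans/(_ dF).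
  by rewrite lte_fin => /lt_le_trans/(_ de); rewrite ltNge AB.
apply: ereal_supD_le.
- by exists (hausdorff_delta k.+1 1 A); exists 1%R => //=; rewrite ltr01.
- by exists (hausdorff_delta k.+1 1 B); exists 1%R => //=; rewrite ltr01.
- by move=> _ [d d0 <-]; exact: hausdorff_delta_ge0.
- by move=> _ [d d0 <-]; exact: hausdorff_delta_ge0.
move=> _ _ [d1 /= d10 <-] [d2 /= d20 <-].
pose d := Num.min e (Num.min d1 d2).
have d0 : (0 < d <= e)%R by rewrite !lt_min e0 d10 d20 /= ge_min lexx.
apply: le_trans (key _ d0); apply: leeD; apply: le_hausdorff_delta.
  by rewrite !ge_min lexx orbT.
by rewrite !ge_min lexx !orbT.
Qed.

(** Caratheodory's argument. The strips [W j] accumulate at the hyperplane; strips of equal parity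
    are separated, so each parity sums to at most H A and the series of all strips converges. Its
    tail bounds what [U m] misses of the part of [A] above the hyperplane. *)
Lemma hausdorff_halfspace (i : 'I_n) (t : R) : H.-caratheodory [set x : V | (x ord0 i <= t)%R].
Proof.
set C := [set x : V | _].
suff key A : H (A `&` C) + H (A `&` ~` C) <= H A by exact: le_caratheodory_measurable.
have [->|AX] := eqVneq (H A) +oo; first exact: leey.
pose r j : R := (t + j.+1%:R^-1)%R.
have r_lt j l : (j < l)%N -> (r l < r j)%R.
  by move=> jl; rewrite ltrD2l ltf_pV2 ?posrE // ltr_nat.
pose U j := A `&` [set x | (r j <= x ord0 i)%R].
pose W j := A `&` [set x | (r j.+1 <= x ord0 i < r j)%R].
have sep (P Q : set V) a b : (a < b)%R -> (forall x, P x -> x ord0 i <= a)%R ->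
    (forall x, Q x -> b <= x ord0 i)%R -> H P + H Q <= H (P `|` Q).
  move=> ab Pa Qb; apply: (@hausdorff_metric _ _ (b - a)); first by rewrite subr_gt0.
  move=> x y /Pa xa /Qb yb; apply: le_trans (coord_le_enorm _ i).
  by rewrite !mxE distrC (le_trans _ (ler_norm _)) // lerB.
have AU j : H (A `&` C) + H (U j) <= H A.
  apply: (@le_trans _ _ (H ((A `&` C) `|` U j))).
    apply: (@sep _ _ t (r j)) => [|x []//|x []//].
    by rewrite ltrDl invr_gt0.
  by apply: le_outer_measure => x [[]|[]].
have parity b m : \sum_(0 <= j < m) H (W (2 * j + b)%N) <=
    H (\bigcup_(j in `I_m) W (2 * j + b)%N).
  elim: m => [|m IH]; first by rewrite !big_geq // outer_measure_ge0.
  rewrite big_nat_recr //= IIS bigcup_setU bigcup_set1; apply: (le_trans (leeD2r _ IH)).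
  rewrite addeC setUC.
  pose c := (if m is 0 then r b + 1 else r (2 * m + b).-1)%R.
  apply: (@sep _ _ (r (2 * m + b)%N) c).
  - rewrite /c; case: m {IH} @c => [|m]; first by rewrite ltrDl.
    by apply: r_lt; rewrite mulnS.
  - by move=> x [_ /= /andP[_ /ltW]].
  - move=> x [j /= jm [_ /= /andP[rx _]]]; rewrite /c.
    case: m jm {IH c} => // m jm; apply: le_trans rx.
    have [<-//|jm'] := eqVneq (2 * j + b).+1 (2 * m.+1 + b).-1.
    by apply/ltW/r_lt; move: jm jm'; rewrite !mulnS /=; lia.
have WA b m : \sum_(0 <= j < m) H (W (2 * j + b)%N) <= H A.
  by apply: (le_trans (parity b m)); apply: le_outer_measure => x [j _ []].
have sumW : \sum_(0 <= j <oo) H (W j) <= H A + H A.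
  apply: lime_le; first by apply: is_cvg_nneseries => j _ _; exact: outer_measure_ge0.
  apply: nearW => m.
  apply: (@le_trans _ _ (\sum_(0 <= j < 2 * m) H (W j))).
    rewrite [leRHS](big_cat_nat (n := m)) //=; last by rewrite mul2n -addnn leq_addr.
    by rewrite leeDl // sume_ge0 // => j _; exact: outer_measure_ge0.
  apply: le_trans (leeD (WA 0%N m) (WA 1%N m)).
  elim: m => [|m IH]; first by rewrite muln0 !big_geq // adde0.
  rewrite mulnS addnC addn2 !big_nat_recr //= addn0 addn1.
  by rewrite [leRHS]addeACA [leRHS]addeA; apply: leeD2r; apply: leeD2r.
have A0 B : 0 <= H B by exact: outer_measure_ge0.
have AC m : H (A `&` C) + H (A `&` ~` C) <= H A + \sum_(m <= j <oo) H (W j).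
  apply: le_trans (leeD2r _ (AU m)); rewrite -addeA leeD2l //.
  apply: (@le_trans _ _ (H (U m `|` \bigcup_(j in ~` `I_m) W j))); last first.
    apply: (le_trans (outer_measureU2 _ _ _)); rewrite leeD2l //.
    exact: outer_measure_sigma_subadditive_tail.
  apply: le_outer_measure => x [Ax /= /negP]; rewrite -ltNge => tx.
  have [xm|xm] := leP (r m) (x ord0 i); [by left|right].
  have ex : exists j, (r j <= x ord0 i)%R.
    exists (Num.truncn (x ord0 i - t)^-1); rewrite /r -lerBrDl -[leRHS]invrK.
    rewrite lef_pV2 ?posrE ?invr_gt0 ?subr_gt0 //; apply: ltW.
    exact: truncnS_gt.
  case: (ex_minnP ex) => -[|j] jx jmin.
    by move: xm; rewrite ltNge (le_trans _ jx) // /r; case: m => // m; apply/ltW/r_lt.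
  exists j; first by apply/negP; rewrite -leqNgt leqNgt; apply/negP => jm;
     move: xm; rewrite ltNge (le_trans _ jx) //; have [->//|?] := eqVneq m j.+1; apply/ltW/r_lt; lia.
  split=> //=; rewrite jx ltNge; apply/negP => /jmin; rewrite ltnn.
  by [].
have fA : H A \is a fin_num by rewrite ge0_fin_numE // ltey.
have tail0 : (fun m => \sum_(m <= j <oo) H (W j)) @ \oo --> 0.
  apply: nneseries_tail_cvg => //.
  by rewrite (le_lt_trans sumW) // lte_add_pinfty // ltey.
have cA : (fun m => H A + \sum_(m <= j <oo) H (W j)) @ \oo --> H A + 0.
  by apply: cvgeD => //; [exact: fin_num_adde_defr|exact: cvg_cst].
by rewrite adde0 in cA; apply: (cvge_ge _ cA); apply: nearW => m; exact: AC.
Qed.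

End metric_hausdorff.

Section borel_outer.
Local Open Scope ereal_scope.
Context {R : realType} {n : nat}.
Notation V := 'rV[R]_n.

Definition halfspaces : set (set V) :=
  [set A | exists i t, A = [set x : V | (x ord0 i <= t)%R]].

Lemma halfspaces_ball (x : V) (r : R) : (0 < r)%R -> <<s halfspaces >> (ball x r).
Proof.
move=> r0; rewrite -[<<s _ >> _]/(@measurable _ (g_sigma_algebraType halfspaces) (ball x r)).
have -> : ball x r = \bigcap_(i in [set: 'I_n])
    [set y : V | (x ord0 i - r < y ord0 i < x ord0 i + r)%R].
  apply/seteqP; split=> [y [_ xy] i _|y xy]; last split=> // j i; rewrite ?ord1.
    by have := xy ord0 i; rewrite -ball_normE /= ltr_distlC.
  by have := xy i I; rewrite -ball_normE /= ltr_distlC.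
have mle i t : @measurable _ (g_sigma_algebraType halfspaces) [set y : V | (y ord0 i <= t)%R].
  by apply: sub_sigma_algebra; exists i, t.
have mlt i t : @measurable _ (g_sigma_algebraType halfspaces) [set y : V | (y ord0 i < t)%R].
  have -> : [set y : V | (y ord0 i < t)%R] =
      \bigcup_k [set y : V | (y ord0 i <= t - k.+1%:R^-1)%R].
    apply/seteqP; split=> [y /= yt|y [k _ /= yk]]; last first.
      by apply: (le_lt_trans yk); rewrite ltrBlDr ltrDl invr_gt0.
    exists (Num.truncn (t - y ord0 i)^-1) => //=; rewrite lerBrDr -lerBrDl.
    rewrite -[leRHS]invrK lef_pV2 ?posrE ?invr_gt0 ?subr_gt0 //.
    by apply: ltW; exact: truncnS_gt.
  exact: bigcupT_measurable.
apply: fin_bigcap_measurable; first exact: finite_finset.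
move=> i _.
have -> : [set y : V | (x ord0 i - r < y ord0 i < x ord0 i + r)%R] =
   [set y : V | (y ord0 i < x ord0 i + r)%R] `\` [set y : V | (y ord0 i <= x ord0 i - r)%R].
  apply/seteqP; split=> y /=.
    by move=> /andP[ry yr]; split=> //; apply/negP; rewrite -ltNge.
  by move=> [yr /negP]; rewrite -ltNge => ->.
exact: measurableD.
Qed.

Definition ratball (k : nat) (q : 'rV[rat]_n) : set V :=
  ball (map_mx ratr q : V) k.+1%:R^-1.

Lemma open_ratballs (U : set V) x : open U -> U x ->
  exists k q, ratball k q x /\ ratball k q `<=` U.
Proof.
move=> oU Ux; have /nbhs_ballP[e /= e0 eU] := open_nbhs_nbhs (conj oU Ux).
pose k := Num.truncn (2 / e)%R; pose r : R := (k.+1%:R^-1)%R.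
have r0 : (0 < r)%R by rewrite invr_gt0.
have re : (r + r <= e)%R.
  have : (2 / e < k.+1%:R)%R by exact: truncnS_gt.
  rewrite ltr_pdivrMr // -ltr_pdivrMl // mulrC => /ltW; apply: le_trans.
  by rewrite -/r; lra.
have /choice[q qx] (i : 'I_n) : exists q : rat, (x ord0 i - r < ratr q < x ord0 i + r)%R.
  have /rat_in_itvoo[q] : (x ord0 i - r < x ord0 i + r)%R by lra.
  by rewrite in_itv /=; exists q.
exists k, (\row_i q i); split.
  split=> // j i; rewrite ord1 !mxE -ball_normE /= distrC ltr_distlC.
  exact: qx.
move=> y [_ qy]; apply: eU; split=> // j i; rewrite ord1 -ball_normE /=.
have := qy ord0 i; rewrite -ball_normE /= !mxE => H.
have H2 : (`|x ord0 i - ratr (q i)| < r)%R by rewrite distrC ltr_distl; exact: qx.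
apply: (lt_le_trans _ re); rewrite -(subrKA (ratr (q i))).
by apply: (le_lt_trans (ler_normD _ _)); rewrite ltrD.
Qed.

Lemma open_halfspaces (U : set V) : open U -> <<s halfspaces >> U.
Proof.
move=> oU; rewrite -[<<s _ >> _]/(@measurable _ (g_sigma_algebraType halfspaces) U).
pose B j := if unpickle j is Some (k, q) then
  (if pselect (ratball k q `<=` U) then ratball k q else set0) else set0.
have -> : U = \bigcup_j B j.
  apply/seteqP; split=> [x Ux|x [j _]].
    have [k [q [qx qU]]] := open_ratballs oU Ux.
    by exists (pickle (k, q)) => //; rewrite /B pickleK; case: pselect.
  rewrite /B; case: unpickle => [[k q]|//]; case: pselect => //= qU.
  exact: qU.
apply: bigcupT_measurable => j; rewrite /B; case: unpickle => [[k q]|//].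
case: pselect => //= _; apply: halfspaces_ball; rewrite invr_gt0.
by [].
Qed.

(** Half-spaces generate the Borel sets ([open_halfspaces]), so this condition already makes every
    Borel set measurable for [mu]; see [borel_caratheodory]. *)
Definition borel_outer (mu : set V -> \bar R) :=
  forall i t, mu.-caratheodory [set x : V | (x ord0 i <= t)%R].

Lemma borel_caratheodory (mu : {outer_measure set V -> \bar R}) (A : set V) :
  borel_outer mu -> borel_set A -> mu.-caratheodory A.
Proof.
move=> bmu; apply: (@smallest_sub _ (sigma_algebra setT)).
  exact: (sigma_algebra_measurable (caratheodory_type mu)).
move=> U /open_halfspaces; apply: (@smallest_sub _ (sigma_algebra setT)).
  exact: (sigma_algebra_measurable (caratheodory_type mu)).
by move=> _ [i [t ->]]; exact: bmu.
Qed.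

End borel_outer.

Section leb_borel.
Local Open Scope ereal_scope.
Context {R : realType} {n : nat}.
Notation V := 'rV[R]_n.+1.

Definition set_coord (x : V) (i : 'I_n.+1) (t : R) : V :=
  \row_j (if j == i then t else x ord0 j).

Lemma leb_outer_cover_le (G : nat -> V * V) (B : set V) : (forall k, box_ok (G k)) ->
  B `<=` \bigcup_k box (G k).1 (G k).2 ->
  leb_outer B <= \sum_(0 <= k <oo) boxvol (G k).
Proof.
move=> okG BG; apply: ereal_inf_lbound; by exists (fun k => (G k).1, fun k => (G k).2).
Qed.

Lemma leb_outer_halfspace : borel_outer (@leb_outer R n.+1).
Proof.
move=> i t; set C := [set x : V | _].
suff key A : leb_outer (A `&` C) + leb_outer (A `&` ~` C) <= leb_outer A.
  exact: le_caratheodory_measurable.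
have [->|AX] := eqVneq (leb_outer A) +oo; first exact: leey.
apply/lee_addgt0Pr => e e0.
have [|F [okF AF sF]] := leb_outer_adherent e0 (_ : leb_outer A < +oo); first by rewrite ltey.
apply: le_trans sF.
(* The cut height [t] clamped to the extent of the box, so that both halves are boxes, one of them
   possibly flat. *)
pose s k : R := Num.max ((F k).1 ord0 i) (Num.min t ((F k).2 ord0 i)).
have s1 k : ((F k).1 ord0 i <= s k)%R by rewrite le_max lexx.
have s2 k : (s k <= (F k).2 ord0 i)%R by rewrite ge_max okF ge_min lexx orbT.
pose F1 k := ((F k).1, set_coord (F k).2 i (s k)).
pose F2 k := (set_coord (F k).1 i (s k), (F k).2).
have ok1 k : box_ok (F1 k).
  by move=> j; rewrite /= mxE; case: eqP => [->|_] //; exact: okF.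
have ok2 k : box_ok (F2 k).
  by move=> j; rewrite /= mxE; case: eqP => [->|_] //; exact: okF.
have vol k : boxvol (F k) = boxvol (F1 k) + boxvol (F2 k).
  rewrite /boxvol -EFinD; congr EFin; rewrite !(bigD1 i (P := xpredT)) //=.
  rewrite !mxE eqxx.
  set p := (\prod_(j < n.+1 | j != i) ((F k).2 ord0 j - (F k).1 ord0 j))%R.
  rewrite (_ : \prod_(j < n.+1 | _) (set_coord _ _ _ _ _ - _) = p)%R; last first.
    by apply: eq_bigr => j ji; rewrite mxE (negbTE ji).
  rewrite (_ : \prod_(j < n.+1 | _) (_ - set_coord _ _ _ _ _) = p)%R; last first.
    by apply: eq_bigr => j ji; rewrite mxE (negbTE ji).
  by ring.
under eq_eseriesr do rewrite vol.
rewrite nneseriesD => [|k _ _|k _ _]; try exact: boxvol_ge0.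
apply: leeD; apply: leb_outer_cover_le => // x [Ax].
  move=> Cx; have [k _ xk] := AF _ Ax; exists k => // j /=; rewrite mxE.
  have /andP[x1 x2] := xk j; rewrite x1 /=; case: eqP => // ji.
  by rewrite ji /s le_max le_min; rewrite -ji x2 [in X in (X && _)]ji Cx orbT.
move=> /negP; rewrite /C /= -ltNge => Cx.
have [k _ xk] := AF _ Ax; exists k => // j /=; rewrite mxE.
have /andP[x1 x2] := xk j; rewrite x2 andbT; case: eqP => // ji.
by rewrite ji /s ge_max ge_min -ji x1 [in X in (X || _)]ji (ltW Cx).
Qed.

End leb_borel.

(** * Comparison of Hausdorff and Lebesgue measure *)

Section additive_ereal_linear.
Local Open Scope ereal_scope.
Context {R : realType}.

(** Cauchy's functional equation: additivity and nonnegativity give monotonicity, and comparison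
    with rational arguments gives linearity. It serves to find the measure of a box one side at a
    time. *)
Lemma additive_ereal_linear (phi : R -> \bar R) :
  (forall u, (0 <= u)%R -> 0 <= phi u) ->
  (forall u v, (0 <= u)%R -> (0 <= v)%R -> phi (u + v)%R = phi u + phi v) ->
  phi 1%R \is a fin_num -> forall u, (0 <= u)%R -> phi u = u%:E * phi 1%R.
Proof.
move=> phi0 phiD phi1.
have mono u v : (0 <= u <= v)%R -> phi u <= phi v.
  move=> /andP[u0 uv]; rewrite -[v](subrKC u) phiD ?subr_ge0 //.
  by rewrite leeDl // phi0 // subr_ge0.
have phiZ (x : R) k : (0 <= x)%R -> phi (k.+1%:R * x)%R = k.+1%:R%:E * phi x.
  move=> x0; elim: k => [|k IH]; first by rewrite mul1r mul1e.
  rewrite -[k.+2%:R]natr1 mulrDl mul1r phiD ?mulr_ge0 // IH EFinD.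
  by rewrite ge0_muleDl ?lee_fin // mul1e.
have phi00 : phi 0%R = 0.
  have f0 : phi 0%R \is a fin_num.
    by rewrite ge0_fin_numE ?phi0 // (le_lt_trans (mono 0%R 1%R _)) ?lexx ?ler01 // ltey_eq phi1.
  have := phiD 0%R 0%R (lexx _) (lexx _); rewrite addr0.
  by rewrite -(fineK f0) -EFinD => -[] H; congr EFin; lra.
set r := fine (phi 1%R); have phi1E : phi 1%R = r%:E by rewrite fineK.
have r0 : (0 <= r)%R by apply: fine_ge0; exact: phi0.
have phiV N : phi (N.+1%:R^-1)%R = (r / N.+1%:R)%:E.
  have := phiZ (N.+1%:R^-1)%R N; rewrite mulfV ?pnatr_eq0 // => /(_ _).
  rewrite invr_ge0 ler0n => /(_ isT); rewrite phi1E => /esym H.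
  rewrite mulrC EFinM -H muleA -EFinM mulVf ?pnatr_eq0 // mul1e.
  by [].
have phiQ k N : phi (k%:R / N.+1%:R)%R = (k%:R / N.+1%:R * r)%:E.
  case: k => [|k]; first by rewrite !mul0r phi00.
  rewrite phiZ ?invr_ge0 // phiV -EFinM; congr EFin; ring.
move=> u u0; rewrite phi1E -EFinM.
have bounds N : ((u - N.+1%:R^-1) * r)%:E <= phi u <= ((u + N.+1%:R^-1) * r)%:E.
  pose k := Num.truncn (u * N.+1%:R).
  have /andP[k1 k2] : (k%:R <= u * N.+1%:R < k.+1%:R)%R.
    by apply: truncn_itv; rewrite mulr_ge0.
  have uk : (k%:R / N.+1%:R <= u)%R by rewrite ler_pdivrMr ?ltr0n.
  have ku : (u <= k.+1%:R / N.+1%:R)%R by rewrite ler_pdivlMr ?ltr0n // ltW.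
  have kS : (k.+1%:R / N.+1%:R = k%:R / N.+1%:R + N.+1%:R^-1 :> R)%R.
    by rewrite -natr1 mulrDl mul1r.
  apply/andP; split.
    apply: (@le_trans _ _ (phi (k%:R / N.+1%:R)%R)); last first.
      by apply: mono; rewrite uk divr_ge0.
    by rewrite phiQ lee_fin ler_wpM2r // lerBlDr -kS.
  apply: (@le_trans _ _ (phi (k.+1%:R / N.+1%:R)%R)).
    by apply: mono; rewrite u0 ku.
  by rewrite phiQ lee_fin ler_wpM2r // kS lerD2r.
have fu : phi u \is a fin_num.
  rewrite ge0_fin_numE ?phi0 //; have /andP[_ /le_lt_trans] := bounds 0%N; apply.
  exact: ltry.
rewrite -(fineK fu); congr EFin; apply/eqP; rewrite -subr_eq0 -normr_le0.
apply/ler_addgt0Pr => e e0; rewrite add0r.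
pose N := Num.truncn (r / e); have Ne : (r / N.+1%:R <= e)%R.
  by rewrite ler_pdivrMr ?ltr0n // mulrC -ler_pdivrMr // ltW // truncnS_gt.
have := bounds N; rewrite -(fineK fu) !lee_fin => /andP[b1 b2].
rewrite (le_trans _ Ne) // ler_norml /= [(r / _)%R]mulrC.
move: b1 b2; move: (N.+1%:R^-1)%R => q; rewrite mulrBl mulrDl => b1 b2.
by apply/andP; split; lra.
Qed.

Lemma prod_shift_cvg (I : Type) (r : seq I) (P : pred I) (s : I -> R) :
  (fun e : R => \prod_(i <- r | P i) (s i + e))%R @ (0 : R)^'+ --> (\prod_(i <- r | P i) s i)%R.
Proof.
elim: r => [|i r IH]; first by rewrite big_nil; under eq_fun do rewrite big_nil; exact: cvg_cst.
rewrite big_cons; under eq_fun do rewrite big_cons.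
case: (P i) => //; apply: cvgM => //.
rewrite -[X in _ --> X]addr0; apply: cvgD; first exact: cvg_cst.
exact: cvg_at_right_filter.
Qed.

Lemma prod_shift_le (I : Type) (r : seq I) (P : pred I) (s : I -> R) (k X : \bar R) :
  k \is a fin_num ->
  (forall e, (0 < e)%R -> X <= k * (\prod_(i <- r | P i) (s i + e))%:E) ->
  X <= k * (\prod_(i <- r | P i) s i)%:E.
Proof.
move=> kfin H.
have c : (fun e : R => k * (\prod_(i <- r | P i) (s i + e))%:E) @ (0 : R)^'+ -->
    k * (\prod_(i <- r | P i) s i)%:E.
  apply: cvgeZl => //; apply: cvg_EFin; first exact: nearW.
  exact: prod_shift_cvg.
apply: (cvge_ge _ c); near=> e; apply: H; near: e; exact: nbhs_right_gt.
Unshelve. all: by end_near. Qed.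

End additive_ereal_linear.

Section integrate_out.
Local Open Scope ereal_scope.
Context {R : realType} {n : nat}.
Notation V := 'rV[R]_n.+1.
Variables (G : nat -> V * V) (okG : forall k, box_ok (G k)).

Let side k (J : pred 'I_n.+1) (u : V) i : R :=
  if J i then ((G k).2 ord0 i - (G k).1 ord0 i)%R
  else ((G k).1 ord0 i <= u ord0 i <= (G k).2 ord0 i)%R%:R.

Let side_ge0 k J u i : (0 <= side k J u i)%R.
Proof. by rewrite /side; case: ifP => // _; rewrite subr_ge0; exact: okG. Qed.

(** Tonelli for a cover by boxes. In a coordinate outside [J] the hypothesis sees only whether u_i
    lies within the side of the box; integrating over u_i in [0, 1] replaces this indicator by at
    most the side length. Each step of the induction integrates one coordinate. *)
Lemma integrate_out (J : pred 'I_n.+1) (X : \bar R) (c : R) : (0 <= c)%R -> 0 <= X ->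
  (forall u : V, (forall i, 0 <= u ord0 i <= 1)%R ->
    X <= \sum_(0 <= k <oo) (c * \prod_(i < n.+1) side k J u i)%:E) ->
  X <= c%:E * \sum_(0 <= k <oo) boxvol (G k).
Proof.
move=> c0 X0 H.
have K j : (j <= n.+1)%N -> forall u : V, (forall i, 0 <= u ord0 i <= 1)%R ->
    X <= \sum_(0 <= k <oo)
      (c * \prod_(i < n.+1) side k (fun i => J i || (i < j)%N) u i)%:E.
  elim: j => [_ u uI|j IH jn u uI].
    apply: (le_trans (H u uI)); apply: lee_nneseries => [k _ _|k _].
      by rewrite lee_fin mulr_ge0 // prodr_ge0.
    rewrite lee_fin ler_wpM2l // le_eqVlt; apply/orP; left; apply/eqP.
    by apply: eq_bigr => i _; rewrite /side ltn0 orbF.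
  pose i0 := Ordinal jn.
  have [Jj|Jj] := boolP (J i0).
    apply: (le_trans (IH (ltnW jn) u uI)); apply: lee_nneseries => [k _ _|k _].
      by rewrite lee_fin mulr_ge0 // prodr_ge0.
    rewrite lee_fin ler_wpM2l // le_eqVlt; apply/orP; left; apply/eqP.
    apply: eq_bigr => i _; rewrite /side [in RHS]ltnS [in RHS]leq_eqVlt.
    by rewrite -[i == j :> nat]/(i == i0) ; case: eqP => [->|]; rewrite ?Jj.
  pose ck k : R := (c * \prod_(i < n.+1 | i != i0) side k (fun i => J i || (i < j)%N) u i)%R.
  have ck0 k : (0 <= ck k)%R by rewrite mulr_ge0 // prodr_ge0.
  pose I k : set R := `[(G k).1 ord0 i0, (G k).2 ord0 i0]%classic.
  have slice t : (0 <= t <= 1)%R -> X <= \sum_(0 <= k <oo) (ck k)%:E * (\1_(I k) t)%:E.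
    move=> t01; have /(IH (ltnW jn)) : forall i, (0 <= set_coord u i0 t ord0 i <= 1)%R.
      by move=> i; rewrite mxE; case: ifP.
    move=> /le_trans; apply; apply: lee_nneseries => [k _ _|k _].
      by rewrite lee_fin mulr_ge0 // prodr_ge0.
    rewrite -EFinM lee_fin le_eqVlt; apply/orP; left; apply/eqP.
    rewrite (bigD1 i0) //= /ck -mulrA; congr (_ * _)%R; rewrite mulrC; congr (_ * _)%R.
      by apply: eq_bigr => i ii0; rewrite /side mxE (negbTE ii0).
    rewrite /side ltnn (negbTE Jj) /= mxE eqxx indicE /I.
    by rewrite mem_setE in_itv.
  have mI k : measurable (I k) by exact: measurable_itv.
  pose h k : R -> \bar R := fun t => (ck k)%:E * (\1_(I k) t)%:E.
  have mck k : measurable_fun [set: R] (h k).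
    apply: emeasurable_funM; first exact: measurable_cst.
    by apply/measurable_EFinP; exact: measurable_indic.
  have -> : X = \int[lebesgue_measure]_(t in `[0%R, 1%R]) X.
    rewrite integral_cst //= lebesgue_measure_itv /= lte_fin ltr01 oppr0 adde0.
    by rewrite mule1.
  apply: (@le_trans _ _ (\int[lebesgue_measure]_(t in `[0%R, 1%R])
      (\sum_(0 <= k <oo) (ck k)%:E * (\1_(I k) t)%:E))).
    apply: ge0_le_integral => //.
    apply: (@ge0_emeasurable_sum _ _ _ _ h xpredT) => k.
      by move=> t _ _; rewrite mule_ge0 // lee_fin.
    by move=> _; exact: measurable_funTS.
  rewrite integral_nneseries //; last 2 first.
  - by move=> k; exact: (measurable_funTS (mck k)).
  - by move=> k t _; rewrite mule_ge0 // lee_fin.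
  apply: lee_nneseries => [k _ _|k _].
    by apply: integral_ge0 => t _; rewrite mule_ge0 // lee_fin.
  pose g : R -> \bar R := fun t => (\1_(I k) t)%:E.
  have mg : measurable_fun [set: R] g by apply/measurable_EFinP; exact: measurable_indic.
  rewrite ge0_integralZl ?lee_fin //; last exact: (measurable_funTS mg).
  rewrite integral_indic //; last exact: mI.
  apply: (@le_trans _ _ ((ck k)%:E * lebesgue_measure (I k))).
    apply: lee_wpmul2l; first by rewrite lee_fin.
    apply: le_measure; rewrite ?inE; [|exact: mI|exact: subIsetl].
    by apply: measurableI; [exact: mI|exact: measurable_itv].
  rewrite /I lebesgue_measure_itv /= lte_fin.
  have [ab|ab] := ltP; last first.
    by rewrite mule0 lee_fin mulr_ge0 // prodr_ge0.
  rewrite -EFinB -EFinM lee_fin (bigD1 i0) //= /ck -mulrA ler_wpM2l // mulrC.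
  rewrite le_eqVlt; apply/orP; left; apply/eqP; congr (_ * _)%R.
    by rewrite /side ltnSn orbT.
  apply: eq_bigr => i ii0; rewrite /side [in RHS]ltnS [in RHS]leq_eqVlt.
  by rewrite -[i == j :> nat]/(i == i0) (negbTE ii0).
rewrite -nneseriesZl; last by move=> k _; exact: boxvol_ge0.
have u0 i : (0 <= (0 : V) ord0 i <= 1)%R by rewrite mxE lexx ler01.
apply: (le_trans (K n.+1 (leqnn _) 0%R u0)); apply: lee_nneseries => [k _ _|k _].
  by rewrite lee_fin mulr_ge0 // prodr_ge0.
rewrite -EFinM lee_fin ler_wpM2l // le_eqVlt; apply/orP; left; apply/eqP.
by apply: eq_bigr => i _; rewrite /side ltn_ord orbT.
Qed.

End integrate_out.

Section unit_cube.
Local Open Scope ereal_scope.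
Context {R : realType} {n : nat}.
Notation V := 'rV[R]_n.+1.

(** The case of [integrate_out] in which all coordinates are integrated: at every point of the cube
    at least one product of indicators equals 1. *)
Lemma unit_cube_cover (G : nat -> V * V) : (forall k, box_ok (G k)) ->
  box 0 (const_mx 1%R) `<=` \bigcup_k box (G k).1 (G k).2 ->
  1 <= \sum_(0 <= k <oo) boxvol (G k).
Proof.
move=> okG cov; rewrite -[leRHS]mul1e.
apply: (integrate_out okG (J := xpred0)) => // u uI.
have [|k _ uk] := cov u; first by move=> i; rewrite !mxE; exact: uI.
rewrite (nneseriesD1 (n := k)) //; last by move=> l _; rewrite lee_fin mulr_ge0 // prodr_ge0.
rewrite (_ : \prod_(i < n.+1) _ = 1)%R; last by rewrite big1 // => i _; rewrite uk.
rewrite mulr1 leeDl //; apply: nneseries_ge0 => l _ _.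
by rewrite lee_fin mulr_ge0 // prodr_ge0.
Qed.

Lemma leb_outer_unit_cube : leb_outer (box 0 (const_mx 1%R) : set V) = 1.
Proof.
have ok : box_ok (0, const_mx 1%R : V)%R by move=> i; rewrite /= !mxE ler01.
apply/eqP; rewrite eq_le; apply/andP; split.
  apply: (le_trans (leb_outer_box_le ok)); rewrite /boxvol /= big1 // => i _.
  by rewrite !mxE subr0.
apply: le_ereal_inf_tmp => _ [[a b] [/= ab cov] <-].
exact: (@unit_cube_cover (fun k => (a k, b k))).
Qed.

End unit_cube.

Section cover_inf_fin.
Local Open Scope ereal_scope.
Context (R : realType) (T I : Type) (C : I -> set T) (w : I -> \bar R) (P : set I).
Hypothesis w_ge0 : forall i, 0 <= w i.

Lemma cover_inf_fin (K : finType) (F : K -> I) i0 E : P i0 -> w i0 = 0 ->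
  (forall j, P (F j)) -> E `<=` \bigcup_j C (F j) ->
  cover_inf C w P E <= \sum_(j : K) w (F j).
Proof.
move=> Pi0 w0 PF EF; pose s := map F (enum K).
apply: (@le_trans _ _ (\sum_(0 <= k <oo) w (nth i0 s k))).
  apply: cover_inf_le => [k|x /EF[j _ Cx]].
    have [ks|sk] := ltnP k (size s); last by rewrite nth_default.
    case: (ltngtP 0%N #|K|) => // [K0|K0]; last first.
      by move: ks; rewrite size_map -cardE -K0.
    have [j0 _] : exists j0 : K, true by move/card_gt0P: K0 => [j0 _]; exists j0.
    rewrite (nth_map j0) ?PF //; by move: ks; rewrite size_map.
  exists (index j (enum K)) => //.
  by rewrite (nth_map j) ?index_mem ?mem_enum // nth_index ?mem_enum.
rewrite (nneseries_split 0 (size s)) // add0n [X in _ + X]eseries0 ?adde0; last first.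
  by move=> k sk _; rewrite nth_default.
by rewrite -(big_nth i0 xpredT w) big_map big_enum.
Qed.

End cover_inf_fin.

Lemma hausdorff_isometry (R : realType) n m k (T : 'rV[R]_n -> 'rV[R]_m)
    (S : 'rV[R]_m -> 'rV[R]_n) (E : set 'rV[R]_n) :
  (forall x y, enorm (T x - T y) = enorm (x - y)) -> cancel T S ->
  hausdorff k.+1 (T @` E) = hausdorff k.+1 E.
Proof.
move=> isoT TS; apply/eqP; rewrite eq_le; apply/andP; split.
  have := @hausdorff_lipschitz R n m k T E 1 ltr01.
  by rewrite expr1n mul1e; apply => x y _ _; rewrite isoT mul1r.
have := @hausdorff_lipschitz R m n k S (T @` E) 1 ltr01.
rewrite expr1n mul1e image_comp (_ : (S \o T) @` E = E); last first.
  by rewrite (eq_imagel (f' := id)) ?image_id // => x _ /=; rewrite TS.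
by apply=> _ _ [x Ex <-] [y Ey <-]; rewrite !TS isoT mul1r.
Qed.

Section open_borel.
Context {R : realType} {n : nat}.
Notation V := 'rV[R]_n.

Lemma open_coord_lt (i : 'I_n) (t : R) : open [set x : V | x ord0 i < t].
Proof.
by apply: (open_comp _ (@open_lt R t)) => x _; exact: coord_continuous.
Qed.

Lemma open_borel (U : set V) : open U -> borel_set U.
Proof. exact: sub_gen_smallest. Qed.

Lemma borel_sigma_algebra : sigma_algebra setT (@borel_set R n).
Proof. exact: smallest_sigma_algebra. Qed.

Lemma borelC (A : set V) : borel_set A -> borel_set (~` A).
Proof. by rewrite -setTD; have [_ + _] := borel_sigma_algebra; apply. Qed.

Lemma borel_bigcup (F : nat -> set V) : (forall k, borel_set (F k)) ->
  borel_set (\bigcup_k F k).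
Proof. by have [_ _ +] := borel_sigma_algebra; apply. Qed.

Lemma borelI (A B : set V) : borel_set A -> borel_set B -> borel_set (A `&` B).
Proof.
move=> bA bB; rewrite -[borel_set _]/(@measurable _ (g_sigma_algebraType [set U : set V | open U]) _).
exact: measurableI.
Qed.

Lemma borel_bigcap (F : nat -> set V) : (forall k, borel_set (F k)) ->
  borel_set (\bigcap_k F k).
Proof.
move=> bF; rewrite -[X in borel_set X]setCK setC_bigcap; apply: borelC.
by apply: borel_bigcup => k; exact: borelC.
Qed.

Lemma borelD (A B : set V) : borel_set A -> borel_set B -> borel_set (A `\` B).
Proof. by move=> bA bB; apply: borelI => //; exact: borelC. Qed.

Lemma closed_borel (A : set V) : closed A -> borel_set A.
Proof. by move=> cA; rewrite -[A]setCK; apply: borelC; apply: open_borel; exact: closed_openC. Qed.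

Lemma borel_preimage (g : V -> V) (A : set V) : continuous g ->
  borel_set A -> borel_set (g @^-1` A).
Proof.
move=> gc; pose S := [set B : set V | borel_set (g @^-1` B)].
suff : @borel_set R n `<=` S by apply.
apply: (@smallest_sub _ (sigma_algebra setT)) => [|U oU]; last first.
  by apply: open_borel; apply: open_comp => // x _; exact: gc.
split.
- by rewrite /S /= preimage_set0; have [] := borel_sigma_algebra.
- by move=> B SB; rewrite /S /= setTD preimage_setC; exact: borelC.
- by move=> F SF; rewrite /S /= preimage_bigcup; exact: borel_bigcup.
Qed.

Lemma borel_coord_lt (i : 'I_n) (t : R) : borel_set [set x : V | x ord0 i < t].
Proof. by apply: open_borel; exact: open_coord_lt. Qed.

Lemma borel_coord_ge (i : 'I_n) (t : R) : borel_set [set x : V | t <= x ord0 i].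
Proof.
rewrite (_ : [set x : V | _] = ~` [set x : V | x ord0 i < t]).
  by apply: borelC; exact: borel_coord_lt.
by apply/seteqP; split=> x /=; rewrite leNgt => /negP.
Qed.

Lemma borel_coord_le (i : 'I_n) (t : R) : borel_set [set x : V | x ord0 i <= t].
Proof.
apply: closed_borel; apply: (closed_comp _ (@closed_le R t)) => x _.
exact: coord_continuous.
Qed.

Lemma borel_forall (I : finType) (F : I -> set V) :
  (forall i, borel_set (F i)) -> borel_set [set x | forall i, F i x].
Proof.
move=> bF; rewrite (_ : [set x | _] = \bigcap_(i in [set: I]) F i); last first.
  by apply/seteqP; split=> x /= H i => [_|]; apply: H.
apply: (@fin_bigcap_measurable _ (g_sigma_algebraType [set U : set V | open U])).
  exact: finite_finset.
by move=> i _; exact: bF.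
Qed.

End open_borel.

Lemma hausdorff_borel_outer (R : realType) n k : borel_outer (@hausdorff R n k.+1).
Proof. by move=> i t; exact: hausdorff_halfspace. Qed.

Lemma outer_additiveI (R : realType) n (mu : {outer_measure set 'rV[R]_n -> \bar R})
    (X A : set 'rV[R]_n) : borel_outer mu -> borel_set A ->
  mu X = (mu (X `&` A) + mu (X `\` A))%E.
Proof. by move=> bmu bA; rewrite (borel_caratheodory bmu bA X) setDE. Qed.

(** * Hausdorff measure on coordinate planes *)

Section coordinate_plane.
Local Open Scope ereal_scope.
Context {R : realType} {n : nat}.
Notation V := 'rV[R]_n.+1.
Variables (J : pred 'I_n.+1) (k : nat) (cardJ : #|J| = k.+1).
Notation H := (@hausdorff R n.+1 k.+1).

Definition cplane : set V := [set x | forall i, ~~ J i -> x ord0 i = 0%R].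
(** Half-open sides, so that a cut orthogonal to an axis of [J] splits a box into two disjoint boxes
    of the same kind. *)
Definition hbox (a b : V) : set V := [set x | forall i, J i -> (a ord0 i <= x ord0 i < b ord0 i)%R].
Definition hunit : \bar R := H (hbox 0%R (const_mx 1%R) `&` cplane).

Lemma borel_cplane : borel_set cplane.
Proof.
apply: (@borel_forall R n.+1 _ (fun i => [set x | ~~ J i -> x ord0 i = 0%R])) => i.
have [Ji|Ji] := boolP (J i).
  rewrite [X in borel_set X](_ : _ = setT); first by apply: open_borel; exact: openT.
  by apply/seteqP; split.
rewrite [X in borel_set X](_ : _ = [set x : V | (x ord0 i <= 0)%R] `&` [set x : V | (0 <= x ord0 i)%R]).
  by apply: borelI; [exact: borel_coord_le|exact: borel_coord_ge].
apply/seteqP; split=> x /=; first by move=> /(_ isT) ->.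
by move=> [x1 x2] _; apply/eqP; rewrite eq_le x1.
Qed.

Lemma borel_hbox a b : borel_set (hbox a b).
Proof.
apply: (@borel_forall R n.+1 _ (fun i => [set x | J i -> (a ord0 i <= x ord0 i < b ord0 i)%R])) => i.
case: (J i); last first.
  rewrite [X in borel_set X](_ : _ = setT); first by apply: open_borel; exact: openT.
  by apply/seteqP; split.
rewrite [X in borel_set X](_ : _ = [set x : V | (a ord0 i <= x ord0 i)%R] `&` [set x : V | (x ord0 i < b ord0 i)%R]).
  by apply: borelI; [exact: borel_coord_ge|exact: borel_coord_lt].
apply/seteqP; split=> x /=; first by move=> /(_ isT) /andP[].
by move=> [-> ->].
Qed.

Lemma hbox_shift (a b z : V) : cplane z ->
  H (hbox (a + z)%R (b + z)%R `&` cplane) = H (hbox a b `&` cplane).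
Proof.
move=> zP; rewrite -(@hausdorff_isometry R n.+1 n.+1 k (fun x => x + z)%R (fun x => x - z)%R (hbox a b `&` cplane)).
- congr hausdorff; apply/seteqP; split=> [x [xb xP]|_ [x [xb xP] <-]].
    exists (x - z)%R; last by rewrite subrK.
    split=> i Ji.
      by have := xb i Ji; rewrite !mxE lerBrDr ltrBlDr.
    by rewrite !mxE xP // zP // subr0.
  split=> i Ji; first by have := xb i Ji; rewrite !mxE lerD2r ltrD2r.
  by rewrite mxE xP // zP // addr0.
- by move=> x y; rewrite opprD addrACA subrr addr0.
- by move=> x; rewrite addrK.
Qed.

Lemma hbox_additive (t : V) i (u v : R) : J i -> (0 <= u)%R -> (0 <= v)%R ->
  H (hbox 0%R (set_coord t i (u + v)) `&` cplane) =
  H (hbox 0%R (set_coord t i u) `&` cplane) + H (hbox 0%R (set_coord t i v) `&` cplane).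
Proof.
move=> Ji u0 v0.
rewrite (outer_additiveI _ (@hausdorff_borel_outer R n.+1 k) (borel_coord_lt i u)).
congr (_ + _).
  congr hausdorff; apply/seteqP; split=> x.
    move=> [[xb xP] /= xu]; split=> // j Jj; have := xb j Jj; rewrite !mxE.
    by case: eqP => // -> /andP[-> _].
  move=> [xb xP]; split; last by have := xb i Ji; rewrite /= !mxE eqxx => /andP[].
  split=> // j Jj; have := xb j Jj; rewrite !mxE; case: eqP => // _ /andP[-> xu] /=.
  by rewrite (lt_le_trans xu) // lerDl.
pose z : V := set_coord 0%R i u.
have zP : cplane z by move=> j Jj; rewrite !mxE; case: eqP => // ji; rewrite ji Ji in Jj.
rewrite -(hbox_shift _ _ zP); congr hausdorff; apply/seteqP; split=> x.
  move=> [[xb xP] /= /negP]; rewrite -leNgt => ux; split=> // j Jj.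
  have := xb j Jj; rewrite !mxE; case: eqP => [-> /andP[_ xuv]|_]; last by rewrite !addr0.
  by rewrite add0r ux addrC.
move=> [xb xP]; split; last first.
  by have := xb i Ji; rewrite !mxE !eqxx add0r /= => /andP[ux _]; apply/negP; rewrite -leNgt.
split=> // j Jj; have := xb j Jj; rewrite !mxE; case: eqP => [->|_]; last by rewrite !addr0.
by rewrite add0r addrC => /andP[ux ->]; rewrite (le_trans u0 ux).
Qed.

Let diamP (N : nat) (F : set V) : F `<=` cplane ->
  (forall x y i, F x -> F y -> J i -> (`|x ord0 i - y ord0 i| <= N.+1%:R^-1)%R) ->
  ediam F <= (n.+1%:R / N.+1%:R)%:E.
Proof.
move=> FP FN; apply: ediam_le; first by rewrite divr_ge0.
move=> x y Fx Fy; apply: enorm_le_cst => i; rewrite !mxE.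
have [Ji|Ji] := boolP (J i); first exact: FN.
by rewrite !(FP _ _ _ Ji) // subrr normr0 invr_ge0.
Qed.

(** The unit box splits into (N+1)^(k+1) cubes of diameter at most (n+1)/(N+1), and their weights
    add up to a bound independent of N. *)
Lemma hunit_fin : hunit \is a fin_num.
Proof.
rewrite ge0_fin_numE ?outer_measure_ge0 //.
apply: (@le_lt_trans _ _ (omega k.+1 * (n.+1%:R / 2) ^+ k.+1)%:E); last exact: ltry.
apply: ge_ereal_sup => _ [d d0 <-]; rewrite /= in d0.
pose N := Num.truncn (n.+1%:R / d)%R.
have Nd : (n.+1%:R / N.+1%:R < d)%R.
  by rewrite ltr_pdivrMr ?ltr0n // mulrC -ltr_pdivrMr //; exact: truncnS_gt.
pose K := {ffun {i | J i} -> 'I_N.+1}.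
pose Q (f : K) : set V := [set x | cplane x /\
  forall i : {i | J i}, ((f i)%:R / N.+1%:R <= x ord0 (val i) <= (f i).+1%:R / N.+1%:R)%R].
have dQ f : ediam (Q f) <= (n.+1%:R / N.+1%:R)%:E.
  apply: diamP => [x []//|x y i [_ xf] [_ yf] Ji].
  have := xf (exist _ i Ji); have := yf (exist _ i Ji) => /= /andP[y1 y2] /andP[x1 x2].
  rewrite ler_norml; move: x1 x2 y1 y2.
  move: (x ord0 i) (y ord0 i) (nat_of_ord (f _)) => a b c.
  rewrite -[c.+1%:R]natr1 mulrDl mul1r.
  move: (c%:R / N.+1%:R : R)%R (N.+1%:R^-1 : R)%R => p q x1 x2 y1 y2.
  by apply/andP; split; lra.
rewrite hausdorff_deltaE.
apply: (le_trans (@cover_inf_fin _ _ _ id (hweight k) _ (@hweight_ge0 R n.+1 k) K Q set0 _ _ _ _ _)).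
- by rewrite /= ediam_set0 lte_fin.
- by rewrite /hweight ediam_set0 /= mul0r expr0n mulr0.
- by move=> f; rewrite /= (le_lt_trans (dQ f)) // lte_fin.
- move=> x [xb xP]; exists [ffun i => inord (Num.truncn (x ord0 (val i) * N.+1%:R))%R] => //.
  split=> // -[i Ji] /=; rewrite ffunE /=.
  have := xb i Ji; rewrite !mxE => /andP[x0 x1].
  have /andP[t1 t2] : ((Num.truncn (x ord0 i * N.+1%:R))%:R <= x ord0 i * N.+1%:R
      < (Num.truncn (x ord0 i * N.+1%:R)).+1%:R)%R.
    by apply: truncn_itv; rewrite mulr_ge0.
  rewrite inordK; first by rewrite ler_pdivrMr ?ltr0n // t1 /= ler_pdivlMr ?ltr0n // ltW.
  rewrite -(ltr_nat R) (le_lt_trans t1) // -[ltRHS]mul1r ltr_pM2r ?ltr0n //.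
apply: (@le_trans _ _ (\sum_(f : K) (omega k.+1 * (n.+1%:R / N.+1%:R / 2) ^+ k.+1)%:E)).
  apply: lee_sum => f _; rewrite lee_fin ler_pM2l ?omega_gt0 //.
  rewrite lerXn2r ?nnegrE ?divr_ge0 ?fine_ge0 ?ediam_ge0 //.
  rewrite ler_pM2r ?invr_gt0 // -lee_fin fineK // ge0_fin_numE ?ediam_ge0 //.
  by rewrite (le_lt_trans (dQ f)) ?ltry.
rewrite sumEFin sumr_const lee_fin -[leLHS]mulr_natr -[leLHS]mulrA ler_pM2l ?omega_gt0 //.
rewrite card_ffun card_ord card_sig cardJ natrX -exprMn.
by rewrite mulrAC divfK ?pnatr_eq0.
Qed.

(** The sides are changed from 1 to t_i one coordinate after another; in each of them the measure is
    additive by [hbox_additive], hence linear. *)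
Lemma hbox_measure0 (t : V) : (forall i, 0 <= t ord0 i)%R ->
  H (hbox 0%R t `&` cplane) = hunit * (\prod_(i < n.+1 | J i) t ord0 i)%:E.
Proof.
move=> t0.
pose tj j : V := \row_i (if (i < j)%N then t ord0 i else 1%R).
have key j : (j <= n.+1)%N -> H (hbox 0%R (tj j) `&` cplane) =
    hunit * (\prod_(i < n.+1 | J i && (i < j)%N) t ord0 i)%:E.
  elim: j => [_|j IH jn].
    rewrite big_pred0 => [|i]; last by rewrite ltn0 andbF.
    rewrite mule1; congr hausdorff; congr setI; apply/seteqP; split=> x xb i Ji;
    by have := xb i Ji; rewrite !mxE ltn0.
  pose i0 := Ordinal jn; have [Ji0|Ji0] := boolP (J i0); last first.
    rewrite (eq_bigl (fun i => J i && (i < j)%N)); last first.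
      move=> i; rewrite ltnS leq_eqVlt -[i == j :> nat]/(i == i0).
      by case: eqP => [->|//]; rewrite (negbTE Ji0).
    rewrite -IH ?(ltnW jn) //; congr hausdorff; congr setI.
    apply/seteqP; split=> x xb i Ji; have := xb i Ji; rewrite !mxE.
      rewrite ltnS leq_eqVlt -[i == j :> nat]/(i == i0).
      by case: eqP => [ii0|//]; rewrite ii0 (negbTE Ji0) in Ji.
    rewrite [in X in _ -> X]ltnS [in X in _ -> X]leq_eqVlt -[i == j :> nat]/(i == i0).
    by case: eqP => [ii0|//]; rewrite ii0 (negbTE Ji0) in Ji.
  have tS : tj j.+1 = set_coord (tj j) i0 (t ord0 i0) /\ tj j = set_coord (tj j) i0 1%R.
    split; apply/rowP => i; rewrite !mxE.
      rewrite ltnS leq_eqVlt -[i == j :> nat]/(i == i0).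
      by case: eqP => [->|//].
    by case: eqP => [->|//]; rewrite ltnn.
  have [-> t1] := tS.
  pose phi u := H (hbox 0%R (set_coord (tj j) i0 u) `&` cplane).
  have IHj := IH (ltnW jn).
  have := @additive_ereal_linear R phi (fun _ _ => outer_measure_ge0 _ _).
  have phi1 : phi 1%R = hunit * (\prod_(i < n.+1 | J i && (i < j)%N) t ord0 i)%:E.
    by rewrite -IHj /phi -t1.
  rewrite -[H _]/(phi (t ord0 i0)) => -> //.
  - rewrite phi1 muleCA -EFinM; congr (_ * _%:E).
    rewrite [RHS](bigD1 i0) /=; last by rewrite Ji0 /= ltnSn.
    congr (_ * _)%R; apply: eq_bigl => i; rewrite [in RHS]ltnS [in RHS]leq_eqVlt -[i == j :> nat]/(i == i0).
    case: eqP => [->|_]; last by rewrite andbT.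
    by rewrite ltnn andbF andbF.
  - by move=> u v u0 v0; exact: hbox_additive.
  - by rewrite phi1 fin_numM // hunit_fin.
have := key n.+1 (leqnn _); rewrite (eq_bigl J) => [<-|i]; last by rewrite ltn_ord andbT.
congr hausdorff; congr setI; apply/seteqP; split=> x xb i Ji;
by have := xb i Ji; rewrite !mxE ltn_ord.
Qed.

Lemma hbox_measure (a b : V) : (forall i, a ord0 i <= b ord0 i)%R ->
  H (hbox a b `&` cplane) = hunit * (\prod_(i < n.+1 | J i) (b ord0 i - a ord0 i))%:E.
Proof.
move=> ab; pose z : V := \row_i (if J i then a ord0 i else 0%R).
have zP : cplane z by move=> i Ji; rewrite mxE (negbTE Ji).
pose t : V := (b - a)%R.
transitivity (H (hbox (0 + z)%R (t + z)%R `&` cplane)).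
  congr hausdorff; congr setI; apply/seteqP; split=> x xb i Ji;
  by have := xb i Ji; rewrite !mxE Ji add0r subrK.
rewrite hbox_shift // hbox_measure0; last by move=> i; rewrite !mxE subr_ge0.
by congr (_ * _%:E); apply: eq_bigr => i _; rewrite !mxE.
Qed.

(** A closed box lies in the half-open boxes that exceed it by [e] at the upper ends;
    [prod_shift_le] lets [e] tend to 0. *)
Lemma cbox_measure_le (a b : V) : (forall i, a ord0 i <= b ord0 i)%R ->
  H ([set x : V | forall i, J i -> (a ord0 i <= x ord0 i <= b ord0 i)%R] `&` cplane) <=
  hunit * (\prod_(i < n.+1 | J i) (b ord0 i - a ord0 i))%:E.
Proof.
move=> ab; apply: prod_shift_le; first exact: hunit_fin.
move=> e e0; pose b' : V := (b + const_mx e)%R.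
apply: (@le_trans _ _ (H (hbox a b' `&` cplane))).
  apply: le_outer_measure => x [xb xP]; split=> // i Ji.
  by have /andP[-> xbi] := xb i Ji; rewrite !mxE (le_lt_trans xbi) // ltrDl.
rewrite hbox_measure; last by move=> i; rewrite !mxE (le_trans (ab i)) // lerDl ltW.
apply: lee_wpmul2l; first exact: outer_measure_ge0.
by rewrite le_eqVlt; apply/orP; left; apply/eqP; congr EFin; apply: eq_bigr => i _; rewrite !mxE addrAC.
Qed.

Lemma hunit_gt0 : 0 < hunit.
Proof.
(* The half-open box of side 2 contains the closed unit box, to which [unit_cube_cover] applies. *)
have two0 : (forall i : 'I_n.+1, 0 <= (const_mx 2 : V) ord0 i)%R by move=> i; rewrite mxE.
suff : 0 < H (hbox 0%R (const_mx 2%R) `&` cplane).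
  rewrite hbox_measure0 // lt_neqAle => /andP[+ _].
  rewrite lt_neqAle outer_measure_ge0 andbT; apply: contra => /eqP <-.
  by rewrite mul0e.
(* A set of diameter s lies, within the plane, in a box of side 2s around any of its points, and its
   weight omega (s/2)^(k+1) is [c] times the volume (2s)^(k+1) of that box. In the other coordinates
   the boxes [G j] span [0, 1]. *)
pose c : R := (omega k.+1 / 4 ^+ k.+1)%R.
have c0 : (0 < c)%R by rewrite divr_gt0 ?omega_gt0 ?exprn_gt0.
apply: (@lt_le_trans _ _ c%:E); first by rewrite lte_fin.
apply: le_trans (hausdorff_delta_le k _ ltr01).
apply: le_ereal_inf_tmp => _ [F [EF Fd] <-].
have fd j : (0 <= fine (ediam (F j)))%R by apply: fine_ge0; exact: ediam_ge0.
have /choice[x xF] j : exists x, F j !=set0 -> F j x.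
  by have [[x Fx]|nF] := pselect (F j !=set0); [exists x|exists 0%R].
pose G j : V * V := (\row_i (if J i then x j ord0 i - fine (ediam (F j)) else 0)%R,
                     \row_i (if J i then x j ord0 i + fine (ediam (F j)) else 1)%R).
have okG j : box_ok (G j).
  move=> i; rewrite /= !mxE; case: (J i) => //.
  by rewrite lerBlDr -addrA lerDl addr_ge0.
have volG j : c%:E * boxvol (G j) = hweight k (F j).
  rewrite /boxvol /hweight -EFinM; congr EFin.
  rewrite (bigID J) /= [X in (_ * (_ * X))%R]big1 => [|i Ji]; last first.
    by rewrite !mxE (negbTE Ji) subr0.
  rewrite mulr1 (eq_bigr (fun=> 2 * fine (ediam (F j)))%R) => [|i Ji]; last first.
    by rewrite !mxE Ji; ring.
  rewrite prodr_const cardJ /c -mulrA -exprVn -exprMn; congr (_ * _ ^+ _)%R.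
  by field.
rewrite -[leRHS](_ : c%:E * \sum_(0 <= j <oo) boxvol (G j) = _); last first.
  rewrite -nneseriesZl => [|j _]; last exact: boxvol_ge0.
  by apply: eq_eseriesr => j _; rewrite volG.
rewrite -[leLHS]mule1 lee_wpmul2l ?lee_fin ?(ltW c0) //; apply: unit_cube_cover => // y y01.
pose y' : V := \row_i (if J i then y ord0 i else 0%R).
have [|j _ Fy] := EF y'.
  split=> i Ji; last by rewrite mxE (negbTE Ji).
  have := y01 i; rewrite !mxE Ji => /andP[-> y1] /=.
  by rewrite (le_lt_trans y1) // ltr1n.
exists j => // i; rewrite /= !mxE; have [Ji|Ji] := boolP (J i); last by have := y01 i; rewrite !mxE.
have Fx : F j (x j) by apply: xF; exists y'.
have := ediam_ge Fy Fx; rewrite -(fineK (ediam_fin (Fd j))) lee_fin => /(le_trans (coord_le_enorm _ i)).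
by rewrite !mxE Ji ler_distl.
Qed.

(** [E] times the unit cube in the coordinates outside [J]: a set in the plane becomes one of full
    dimension, which [leb_outer] can measure. *)
Definition cylinder (E : set V) : set V := [set x | exists y, [/\ E y,
  forall i, J i -> x ord0 i = y ord0 i & forall i, ~~ J i -> (0 <= x ord0 i <= 1)%R]].

(** For each [u] in the unit cube, the sections at [u] of boxes covering the cylinder cover [E], and
    [cbox_measure_le] bounds their measures; [integrate_out] then integrates over [u]. *)
Lemma hausdorff_le_cylinder (E : set V) : E `<=` cplane ->
  H E <= hunit * leb_outer (cylinder E).
Proof.
move=> EP; set c := fine hunit.
have hc : hunit = c%:E by rewrite fineK // hunit_fin.
have c0 : (0 < c)%R by rewrite -lte_fin -hc hunit_gt0.
rewrite hc -lee_pdivrMl //; apply: le_ereal_inf_tmp => _ [[a b] [/= ab cov] <-].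
rewrite lee_pdivrMl //; pose G j := (a j, b j).
have okG j : box_ok (G j) by exact: ab.
apply: (@integrate_out R n G okG J (H E) c (ltW c0)); first exact: outer_measure_ge0.
move=> u uI.
pose pass j := [forall i, ~~ J i ==> (a j ord0 i <= u ord0 i <= b j ord0 i)%R].
pose B j : set V := if pass j then
  [set x : V | forall i, J i -> (a j ord0 i <= x ord0 i <= b j ord0 i)%R] `&` cplane else set0.
apply: (@le_trans _ _ (H (\bigcup_j B j))).
  apply: le_outer_measure => y Ey.
  pose x : V := \row_i (if J i then y ord0 i else u ord0 i).
  have [|j _ xj] := cov x.
    exists y; split=> // i Ji; rewrite mxE ?Ji // (negbTE Ji).
    exact: uI.
  exists j => //; rewrite /B (_ : pass j); last first.
    apply/forallP => i; apply/implyP => Ji; have := xj i.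
    by rewrite !mxE (negbTE Ji).
  split; last exact: EP.
  by move=> i Ji; have := xj i; rewrite !mxE Ji.
apply: (le_trans (outer_measure_sigma_subadditive _ _)).
apply: lee_nneseries => [j _ _|j _]; first exact: outer_measure_ge0.
rewrite /B; case: ifPn => [/forallP pj|_]; last first.
  rewrite outer_measure0 lee_fin mulr_ge0 ?(ltW c0) // prodr_ge0 // => i _.
  by case: ifP => // _; rewrite subr_ge0; exact: ab.
apply: (le_trans (cbox_measure_le (ab j))); rewrite hc -EFinM lee_fin ler_pM2l //.
rewrite [leRHS](bigID J) /= [X in (_ * X)%R]big1 => [|i Ji]; last first.
  by rewrite (negbTE Ji); have := pj i; rewrite Ji /= => ->.
rewrite mulr1 le_eqVlt; apply/orP; left; apply/eqP; apply: eq_bigr => i Ji.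
by rewrite Ji.
Qed.

End coordinate_plane.

Section hausdorff_hull.
Local Open Scope ereal_scope.
Context {R : realType} {n : nat} (k : nat).
Notation V := 'rV[R]_n.
Notation H := (@hausdorff R n k.+1).

Lemma closure_enorm (F : set V) x (e : R) : (0 < e)%R -> closure F x ->
  exists2 y, F y & (enorm (x - y) < e)%R.
Proof.
move=> e0 Fx; have [|y [Fy xy]] := Fx (ball x (e / n.+1%:R)%R).
  by apply: nbhsx_ballx; rewrite divr_gt0.
exists y => //; apply: (le_lt_trans (enorm_le_norm _)).
move: xy; rewrite -ball_normE /= ltr_pdivlMr ?ltr0n //; apply: le_lt_trans.
by rewrite mulrC ler_wpM2l // ler_nat.
Qed.

Lemma ediam_closure (F : set V) : ediam (closure F) <= ediam F.
Proof.
have [->|fF] := eqVneq (ediam F) +oo; first exact: leey.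
have Ffin : ediam F \is a fin_num by rewrite ge0_fin_numE ?ediam_ge0 // ltey.
rewrite -(fineK Ffin); apply: ediam_le; first by apply: fine_ge0; exact: ediam_ge0.
move=> x y Fx Fy; apply/ler_addgt0Pr => e e0.
have e2 : (0 < e / 2)%R by rewrite divr_gt0.
have [x' Fx' xx'] := closure_enorm e2 Fx; have [y' Fy' yy'] := closure_enorm e2 Fy.
apply: (le_trans (enorm_tri x x' y)); have := enorm_tri x' y' y.
have : (enorm (x' - y') <= fine (ediam F))%R by rewrite -lee_fin fineK //; exact: ediam_ge.
by rewrite (enormB y' y); lra.
Qed.

(** Closures do not increase diameters, so near-optimal covers may be taken closed; the hull is the
    intersection, over all scales, of the unions of these covers. *)
Lemma hausdorff_hull (E : set V) : H E < +oo ->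
  exists B, [/\ borel_set B, E `<=` B & H B <= H E].
Proof.
move=> HE; have j0 j : (0 < j.+1%:R^-1 :> R)%R by rewrite invr_gt0.
have /choice[F FP] j : exists F : nat -> set V, [/\ forall i, ediam (F i) < (j.+1%:R^-1)%:E,
    E `<=` \bigcup_i F i &
    \sum_(0 <= i <oo) hweight k (F i) <= H E + (j.+1%:R^-1)%:E].
  have Hj := hausdorff_delta_le k E (j0 j).
  have := @cover_inf_adherent R _ _ (@id (set V)) (hweight k) [set F | ediam F < (j.+1%:R^-1)%:E]
    (@hweight_ge0 R n k) E _ (j0 j).
  rewrite -hausdorff_deltaE => /(_ (le_lt_trans Hj HE))[F [Fd EF sF]].
  by exists F; split=> //; apply: (le_trans sF); rewrite leeD2r.
exists (\bigcap_j \bigcup_i closure (F j i)); split.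
- apply: borel_bigcap => j; apply: borel_bigcup => i; apply: closed_borel.
  exact: closed_closure.
- move=> x Ex j _; have [_ /(_ _ Ex)[i _ Fx] _] := FP j.
  by exists i => //; exact: subset_closure.
apply: ge_ereal_sup => _ [d /= d0 <-]; apply/lee_addgt0Pr => e e0.
pose j := Num.truncn (Num.max d^-1 e^-1)%R.
have jd : (j.+1%:R^-1 <= Num.min d e)%R.
  have jm : (Num.max d^-1 e^-1 <= j.+1%:R)%R by apply: ltW; exact: truncnS_gt.
  move: jm; rewrite ge_max le_min => /andP[jd je].
  by rewrite -[X in (_ <= X)%R && _]invrK -[X in _ && (_ <= X)%R]invrK !lef_pV2 ?posrE ?invr_gt0 // jd.
move: jd; rewrite le_min => /andP[jd je].
apply: (le_trans (le_hausdorff_delta k _ jd)).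
have [Fd EF sF] := FP j.
apply: (@le_trans _ _ (\sum_(0 <= i <oo) hweight k (closure (F j i)))).
  rewrite hausdorff_deltaE; apply: cover_inf_le => [i|x /(_ j I)] //=.
  exact: le_lt_trans (ediam_closure _) (Fd i).
apply: (@le_trans _ _ (\sum_(0 <= i <oo) hweight k (F j i))).
  apply: lee_nneseries => [i _ _|i _]; first exact: hweight_ge0.
  rewrite lee_fin ler_pM2l ?omega_gt0 // lerXn2r ?nnegrE ?divr_ge0 ?fine_ge0 ?ediam_ge0 //.
  rewrite ler_pM2r ?invr_gt0 // fine_le ?ediam_closure //.
    exact: ediam_fin (le_lt_trans (ediam_closure _) (Fd i)).
  exact: ediam_fin (Fd i).
by apply: (le_trans sF); rewrite leeD2l // lee_fin.
Qed.

End hausdorff_hull.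

Section cylinder_measure.
Local Open Scope ereal_scope.
Context {R : realType} {n : nat}.
Notation V := 'rV[R]_n.+1.
Variables (J : pred 'I_n.+1) (k : nat) (cardJ : #|J| = k.+1).
Notation H := (@hausdorff R n.+1 k.+1).

Definition cproj (x : V) : V := \row_i (if J i then x ord0 i else 0%R).

Lemma cproj_continuous : continuous cproj.
Proof.
move=> x A /nbhs_ballP[e /= e0 eA]; apply/nbhs_ballP; exists e => // y [_ xy].
apply: eA; split=> // i j; rewrite !mxE ord1; case: (J j); first by have := xy ord0 j.
exact: ballxx.
Qed.

Lemma cproj_cplane x : cplane J (cproj x).
Proof. by move=> i Ji; rewrite mxE (negbTE Ji). Qed.

Lemma cylinderE (B : set V) : B `<=` cplane J ->
  cylinder J B = cproj @^-1` B `&` [set x | forall i, ~~ J i -> (0 <= x ord0 i <= 1)%R].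
Proof.
move=> BP; apply/seteqP; split=> [x [y [By xy xI]]|x [Bx xI]].
  split=> //=; rewrite (_ : cproj x = y) //; apply/rowP => i; rewrite mxE.
  by have [/xy //|Ji] := boolP (J i); rewrite BP.
by exists (cproj x); split=> // i Ji; rewrite mxE Ji.
Qed.

Lemma borel_cylinder (B : set V) : B `<=` cplane J -> borel_set B ->
  borel_set (cylinder J B).
Proof.
move=> BP bB; rewrite cylinderE //; apply: borelI.
  exact: (borel_preimage cproj_continuous).
apply: (@borel_forall R n.+1 _ (fun i => [set x | ~~ J i -> (0 <= x ord0 i <= 1)%R])) => i.
case: (J i) => /=.
  rewrite [X in borel_set X](_ : _ = setT); first by apply: open_borel; exact: openT.
  by apply/seteqP; split.
rewrite [X in borel_set X](_ : _ = [set x : V | (0 <= x ord0 i)%R] `&` [set x : V | (x ord0 i <= 1)%R]).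
  by apply: borelI; [exact: borel_coord_ge|exact: borel_coord_le].
apply/seteqP; split=> x /=; first by move=> /(_ isT) /andP[].
by move=> [-> ->].
Qed.

(** The reverse of [hausdorff_le_cylinder], by taking complements: it holds on the whole box [Q] by
    explicit volumes, and the inequality already proved, applied to the complement of a Borel set
    [B] in [Q], forces the reverse on [B]. A general [E] is enclosed in a Borel hull. *)
Lemma cylinder_le_hausdorff (E : set V) (N : R) : (0 <= N)%R -> E `<=` cplane J ->
  E `<=` hbox J (const_mx (- N)%R) (const_mx N) ->
  hunit J k * leb_outer (cylinder J E) <= H E.
Proof.
move=> N0 EP EQ; set Q := hbox J (const_mx (- N)%R) (const_mx N) `&` cplane J.
have NN : forall i : 'I_n.+1, ((const_mx (- N) : V) ord0 i <= (const_mx N : V) ord0 i)%R.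
  by move=> i; rewrite !mxE; lra.
have hfin : (hunit J k : \bar R) \is a fin_num := hunit_fin cardJ.
have HQ := hbox_measure cardJ NN; rewrite -/Q in HQ.
have Qfin : H Q \is a fin_num by rewrite HQ fin_numM.
have lQ : hunit J k * leb_outer (cylinder J Q) <= H Q.
  rewrite HQ lee_wpmul2l ?outer_measure_ge0 //.
  pose a : V := \row_i (if J i then - N else 0)%R; pose b : V := \row_i (if J i then N else 1)%R.
  have ab : box_ok (a, b) by move=> i; rewrite /= !mxE; case: (J i); lra.
  apply: (@le_trans _ _ (leb_outer (box a b))).
    apply: le_outer_measure => x [y [[yb _] xy xI]] i; rewrite !mxE.
    have [Ji|Ji] := boolP (J i); last exact: xI.
    by have := yb i Ji; rewrite !mxE xy // => /andP[-> /ltW].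
  apply: (le_trans (leb_outer_box_le ab)); rewrite /boxvol /= (bigID J) /=.
  rewrite [X in (_ * X)%R]big1 ?mulr1 => [|i Ji]; last by rewrite !mxE (negbTE Ji) subr0.
  by rewrite lee_fin ler_prod // => i Ji; rewrite !mxE Ji lexx andbT; lra.
have key B : borel_set B -> B `<=` Q -> hunit J k * leb_outer (cylinder J B) <= H B.
  move=> bB BQ; have BP : B `<=` cplane J by move=> x /BQ[].
  have HQB := outer_additiveI Q (@hausdorff_borel_outer R n.+1 k) bB.
  have QB : Q `&` B = B by apply/setIidPr.
  rewrite QB in HQB.
  have DBfin : H (Q `\` B) \is a fin_num.
    rewrite ge0_fin_numE ?outer_measure_ge0 // (@le_lt_trans _ _ (H Q)) //.
      by apply: le_outer_measure; exact: subDsetl.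
    by rewrite -ge0_fin_numE // outer_measure_ge0.
  have LQB := outer_additiveI (cylinder J Q) (@leb_outer_halfspace R n) (borel_cylinder BP bB).
  rewrite -(@leeD2rE _ (H (Q `\` B))) // -HQB; apply: le_trans lQ.
  rewrite LQB ge0_muleDr ?outer_measure_ge0 //; apply: leeD.
    rewrite lee_wpmul2l ?outer_measure_ge0 //; apply: le_outer_measure.
    move=> x [y [By xy xI]]; split; exists y; split=> //.
    exact: BQ.
  apply: (le_trans (hausdorff_le_cylinder cardJ _)) => [x [[]]//|].
  rewrite lee_wpmul2l ?outer_measure_ge0 //; apply: le_outer_measure.
  move=> x [y [[Qy nBy] xy xI]]; split; first by exists y.
  move=> [y' [By' xy' _]]; apply: nBy; rewrite (_ : y = y') //.
  apply/rowP => i; have [Ji|Ji] := boolP (J i); first by rewrite -xy // -xy'.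
  by rewrite (BP _ By' i Ji); have [_ ->] := Qy.
have EQ' : E `<=` Q by move=> x Ex; split; [exact: EQ|exact: EP].
have [|B [bB EB HB]] := @hausdorff_hull R n.+1 k E.
  apply: (@le_lt_trans _ _ (H Q)); first exact: le_outer_measure.
  by rewrite -ge0_fin_numE // outer_measure_ge0.
have bBQ : borel_set (B `&` Q).
  by apply: borelI => //; apply: borelI; [exact: borel_hbox|exact: borel_cplane].
apply: le_trans HB; apply: (@le_trans _ _ (H (B `&` Q))); last first.
  by apply: le_outer_measure; exact: subIsetl.
apply: le_trans (key _ bBQ (@subIsetr _ _ _)).
rewrite lee_wpmul2l ?outer_measure_ge0 //; apply: le_outer_measure.
move=> x [y [Ey xy xI]]; exists y; split=> //; split; [exact: EB|exact: EQ'].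
Qed.

End cylinder_measure.

(** * Lebesgue measure under Lipschitz maps *)

Section lebesgue_lipschitz.
Local Open Scope ereal_scope.
Context {R : realType} {n : nat}.
Notation V := 'rV[R]_n.+1.

Definition ebounded (E : set V) := exists M : R, forall x, E x -> (enorm x <= M)%R.

Lemma ebounded_lipschitz (T : V -> V) (E : set V) (K : R) : (0 <= K)%R -> ebounded E ->
  (forall x y, E x -> E y -> (enorm (T x - T y) <= K * enorm (x - y))%R) ->
  ebounded (T @` E).
Proof.
move=> K0 [M EM] TK; have [[x0 Ex0]|/set0P/negP/negPn/eqP E0] := pselect (E !=set0); last first.
  by exists 0%R => x [y]; rewrite E0.
exists (K * (M + M) + enorm (T x0))%R => _ [x Ex <-].
rewrite -[T x](subrK (T x0)); apply: (le_trans (enormD _ _)); rewrite lerD2r.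
apply: (le_trans (TK _ _ Ex Ex0)); rewrite ler_wpM2l //.
by apply: (le_trans (enormD _ _)); rewrite enormN lerD ?EM.
Qed.

Lemma hbox_ebounded (J : pred 'I_n.+1) (E : set V) : ebounded E ->
  exists2 N : R, (0 <= N)%R & E `<=` hbox J (const_mx (- N)%R) (const_mx N).
Proof.
move=> [M EM]; exists (`|M| + 1)%R => [|x /EM xM i _]; first by rewrite addr_ge0.
rewrite !mxE; have := le_trans (coord_le_enorm x i) (le_trans xM (ler_norm M)).
by rewrite ler_norml; lra.
Qed.

Let cplaneT : cplane predT = [set: V].
Proof. by apply/seteqP; split. Qed.

Let cylinderT (E : set V) : cylinder predT E = E.
Proof.
apply/seteqP; split=> [x [y [Ey xy _]]|x Ex]; last by exists x.
by rewrite (_ : x = y) //; apply/rowP => i; exact: xy.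
Qed.

Let cardT : #|(predT : pred 'I_n.+1)| = n.+1.
Proof. exact: card_ord. Qed.

Lemma leb_hausdorff (E : set V) : ebounded E ->
  hunit (predT : pred 'I_n.+1) n * leb_outer E = hausdorff n.+1 E.
Proof.
move=> bE; have [N N0 EN] := hbox_ebounded predT bE.
apply/eqP; rewrite eq_le; apply/andP; split.
  by rewrite -[E in leb_outer E]cylinderT; apply: (cylinder_le_hausdorff cardT N0) => //; rewrite cplaneT.
by rewrite -[E in leb_outer E]cylinderT; apply: (hausdorff_le_cylinder cardT); rewrite cplaneT.
Qed.

(** A Lipschitz map controls diameters but does not send boxes to boxes; the estimate is therefore
    carried over from Hausdorff measure, which is proportional to [leb_outer] by [leb_hausdorff]. *)
Lemma leb_lipschitz (T : V -> V) (E : set V) (K : R) : (0 < K)%R -> ebounded E ->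
  (forall x y, E x -> E y -> (enorm (T x - T y) <= K * enorm (x - y))%R) ->
  leb_outer (T @` E) <= (K ^+ n.+1)%:E * leb_outer E.
Proof.
move=> K0 bE TK; have bT := ebounded_lipschitz (ltW K0) bE TK.
have hf : (hunit (predT : pred 'I_n.+1) n : \bar R) \is a fin_num := hunit_fin cardT.
have h0 : 0 < (hunit (predT : pred 'I_n.+1) n : \bar R) := hunit_gt0 cardT.
rewrite -(@lee_pmul2l _ (hunit (predT : pred 'I_n.+1) n)) // muleCA !leb_hausdorff //.
exact: hausdorff_lipschitz.
Qed.

Lemma leb_isometry_le (T : V -> V) (E : set V) : ebounded E ->
  (forall x y, enorm (T x - T y) = enorm (x - y)) -> leb_outer (T @` E) <= leb_outer E.
Proof.
move=> bE Ti; have := @leb_lipschitz T E 1 ltr01 bE; rewrite expr1n mul1e; apply.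
by move=> x y _ _; rewrite Ti mul1r.
Qed.

(** Stated for a relation between points, so that [A] only has to lie in the stretched copy of
    [B]. *)
Lemma leb_stretch (A B : set V) (c l : R) : (0 < l)%R ->
  (forall x, A x -> exists2 y, B y & x ord0 ord0 = (c + l * y ord0 ord0)%R /\
     forall i, i != ord0 -> x ord0 i = y ord0 i) ->
  leb_outer A <= l%:E * leb_outer B.
Proof.
move=> l0 AB; have [->|Bfin] := eqVneq (leb_outer B) +oo.
  by rewrite gt0_muley ?lte_fin // leey.
have Bf : leb_outer B \is a fin_num by rewrite ge0_fin_numE ?outer_measure_ge0 // ltey.
suff H (e : R) : (0 < e)%R -> leb_outer A <= l%:E * (leb_outer B + e%:E).
  apply/lee_addgt0Pr => e e0; have := H (e / l)%R (divr_gt0 e0 l0).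
  by rewrite muleDr // -?EFinM 1?mulrC ?divfK ?gt_eqF // fin_num_adde_defl.
move=> e0; have [G [okG BG sG]] := leb_outer_adherent e0 (ltac:(by rewrite ltey) : leb_outer B < +oo).
pose st (x : V) : V := set_coord x ord0 (c + l * x ord0 ord0)%R.
apply: (@le_trans _ _ (\sum_(0 <= k <oo) boxvol (st (G k).1, st (G k).2))).
  apply: leb_outer_cover_le.
    move=> k i; rewrite /= !mxE; case: eqP => [_|_]; last exact: okG.
    by rewrite lerD2l ler_pM2l // okG.
  move=> x /AB[y By [x0 xi]]; have [k _ yk] := BG _ By; exists k => //= i; rewrite !mxE.
  case: eqP => [->|/eqP i0]; last by rewrite xi.
  by have := yk ord0; rewrite x0 !lerD2l !ler_pM2l.
apply: (@le_trans _ _ (\sum_(0 <= k <oo) (l%:E * boxvol (G k)))).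
  apply: lee_nneseries => [k _ _|k _].
    apply: boxvol_ge0 => i; rewrite /= !mxE; case: eqP => [_|_]; last exact: okG.
    by rewrite lerD2l ler_pM2l // okG.
  rewrite /boxvol -EFinM lee_fin (bigD1 ord0) // [X in (_ <= l * X)%R](bigD1 ord0) //= !mxE eqxx mulrA.
  rewrite (_ : (c + l * (G k).2 ord0 ord0 - (c + l * (G k).1 ord0 ord0))%R =
    (l * ((G k).2 ord0 ord0 - (G k).1 ord0 ord0))%R); last by ring.
  rewrite le_eqVlt; apply/orP; left; apply/eqP; congr (_ * _)%R; apply: eq_bigr => i i0.
  by rewrite !mxE (negbTE i0).
rewrite nneseriesZl; last by move=> k _; exact: boxvol_ge0.
by rewrite lee_wpmul2l // lee_fin ltW.
Qed.

End lebesgue_lipschitz.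

(** The Householder reflection in the hyperplane orthogonal to w = e - e0; for w = 0 it is the
    identity. *)
Lemma reflection_to_e0 (R : realType) n (e : 'rV[R]_n.+1) : enorm e = 1 ->
  exists S : 'rV[R]_n.+1 -> 'rV[R]_n.+1,
  [/\ forall x y, S (x + y) = S x + S y, forall c x, S (c *: x) = c *: S x,
      forall x, enorm (S x) = enorm x, forall x, S (S x) = x &
      S e = delta_mx ord0 ord0].
Proof.
move=> e1; set e0 : 'rV[R]_n.+1 := delta_mx ord0 ord0.
have e00 : dotv e0 e0 = 1.
  rewrite /dotv (bigD1 ord0) //= big1 ?addr0 => [|i i0]; first by rewrite !mxE eqxx mulr1.
  by rewrite !mxE (negbTE i0) mulr0.
have ee : dotv e e = 1 by rewrite -sqr_enorm e1 expr1n.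
pose w : 'rV[R]_n.+1 := e - e0; pose c x := 2 * dotv x w / dotv w w.
pose S (x : 'rV[R]_n.+1) : 'rV[R]_n.+1 := x - c x *: w.
have cD x y : c (x + y) = c x + c y by rewrite /c dotvDl; ring.
have cZ a x : c (a *: x) = a * c x by rewrite /c dotvZl; ring.
have cw x : c x * dotv w w = 2 * dotv x w.
  have [w0|w0] := eqVneq (dotv w w) 0; last by rewrite /c divfK.
  by rewrite (dotv_eq0 w0) /dotv !big1 ?mulr0 // => i _; rewrite mxE mulr0.
have SD x y : S (x + y) = S x + S y.
  by rewrite /S cD scalerDl opprD addrACA.
have SZ a x : S (a *: x) = a *: S x by apply/rowP => i; rewrite /S cZ !mxE; ring.
exists S; split=> //.
- move=> x; rewrite !enormE; congr Num.sqrt.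
  rewrite /S; clearbody w; rewrite !(dotvBl, dotvBr, dotvZl, dotvZr) (dotvC w x).
  have -> : dotv x x - c x * dotv x w - c x * (dotv x w - c x * dotv w w) =
    dotv x x - c x * (2 * dotv x w - c x * dotv w w) by ring.
  by rewrite cw subrr mulr0 subr0.
- move=> x; have [w0|w0] := eqVneq (dotv w w) 0.
    by rewrite /S (dotv_eq0 w0) !scaler0 !subr0.
  have cSx : c (S x) = - c x.
    apply: (mulIf w0); rewrite mulNr !cw /S dotvBl dotvZl cw; ring.
  by rewrite {1}/S cSx scaleNr opprK /S subrK.
- have [w0|w0] := eqVneq (dotv w w) 0.
    by rewrite /S (dotv_eq0 w0) scaler0 subr0; apply/eqP; rewrite -subr_eq0 -/w (dotv_eq0 w0).
  suff -> : S e = e - w by rewrite /w opprB addrC subrK.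
  rewrite /S (_ : c e = 1) ?scale1r //; apply: (mulIf w0); rewrite cw mul1r.
  by rewrite /w !(dotvBl, dotvBr) (dotvC e0 e) ee e00; ring.
Qed.

Lemma small_partition (R : realType) n (t : R) : 0 < t ->
  exists P : nat -> set 'rV[R]_n, [/\ forall j, borel_set (P j), trivIset setT P,
    \bigcup_j P j = setT & forall j x y, P j x -> P j y -> enorm (x - y) <= t].
Proof.
move=> t0; pose k := Num.truncn (n.+1%:R * 2 / t)%R.
pose F j : set 'rV[R]_n := if unpickle j is Some q then ratball k q else set0.
have bF j : borel_set (F j).
  rewrite /F; case: (unpickle j) => [q|]; apply: open_borel; last exact: open0.
  exact: ball_open.
exists (seqDU F); split.
- move=> j; apply: borelD => //; apply: (big_ind (@borel_set R n)) => //.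
    by apply: open_borel; exact: open0.
  move=> A B bA bB; rewrite -(setCK (A `|` B)) setCU; apply: borelC.
  by apply: borelI; exact: borelC.
- exact: trivIset_seqDU.
- rewrite -seqDU_bigcup_eq; apply/seteqP; split=> // x _.
  have q0 : (0 : R) < k.+1%:R^-1 by rewrite invr_gt0.
  have /choice[q qP] i : exists q : rat, `|ratr q - x ord0 i| < k.+1%:R^-1.
    have [q] := @rat_in_itvoo R (x ord0 i - k.+1%:R^-1) (x ord0 i + k.+1%:R^-1) (ltac:(by rewrite ltrD2l gtrN)).
    by rewrite in_itv /= => q_; exists q; rewrite ltr_distl.
  exists (pickle (\row_i q i)) => //; rewrite /F pickleK; split=> // i j.
  by rewrite ord1 !mxE; exact: qP.
- move=> j x y [Fx _] [Fy _]; move: Fx Fy; rewrite /F; case: (unpickle j) => // q.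
  rewrite /ratball -ball_normE /= => qx qy; apply: (le_trans (enorm_le_norm _)).
  have kt : n.+1%:R * 2 / t < k.+1%:R :> R by exact: truncnS_gt.
  have xy : `|x - y| <= 2 * k.+1%:R^-1.
    rewrite -[x - y](addrNK (map_mx ratr q)) -!addrA [X in _ + X]addrC addrA.
    rewrite (_ : _ + _ = (x - map_mx ratr q) + (map_mx ratr q - y)).
      by apply: (le_trans (ler_normD _ _)); rewrite distrC mulr2n mulrDl mul1r lerD // ltW.
    by rewrite addNr addr0 subrKA.
  apply: (@le_trans _ _ (n.+1%:R * (2 * k.+1%:R^-1))).
    by apply: ler_pM => //; rewrite ler_nat.
  by rewrite mulrA ler_pdivrMr ?ltr0n // [leRHS]mulrC -ler_pdivrMr // ltW.
Qed.

Lemma outer_partition (R : realType) n (mu : {outer_measure set 'rV[R]_n -> \bar R})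
    (P : nat -> set 'rV[R]_n) (B : set 'rV[R]_n) :
  borel_outer mu -> (forall j, borel_set (P j)) -> trivIset setT P ->
  (\sum_(0 <= j <oo) mu (B `&` P j) <= mu B)%E.
Proof.
move=> mb bP tP; apply: le_trans (caratheodory_lime_le _ tP B).
  by rewrite leeDl // outer_measure_ge0.
by move=> j; exact: borel_caratheodory.
Qed.

(** * Volume swept by a surface in a fixed direction *)

Section shadow.
Local Open Scope ereal_scope.
Context {R : realType} {n : nat}.
Notation V := 'rV[R]_n.+2.
Notation H := (@hausdorff R n.+2 n.+1).

Definition hplane : pred 'I_n.+2 := predC1 ord0.
(* The value of this constant is never computed: it enters the bound for the
   surface modulus and the bound for the path modulus, and cancels between them. *)
Definition kappa : \bar R := hunit hplane n.

Lemma card_hplane : #|hplane| = n.+1.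
Proof. by rewrite cardC1 card_ord. Qed.

Lemma kappa_fin : kappa \is a fin_num. Proof. exact: (hunit_fin card_hplane). Qed.
Lemma kappa_gt0 : 0 < kappa. Proof. exact: (hunit_gt0 card_hplane). Qed.
Lemma kappa_ge0 : 0 <= kappa. Proof. exact/ltW/kappa_gt0. Qed.

(** Translates run backwards along [e]: a point is in the shadow when a segment of length at most
    [l] in direction [e] leads from it to [S]. *)
Definition shadow (S : set V) (e : V) (l : R) : set V :=
  [set x | exists y t, [/\ S y, (0 <= t <= l)%R & x = (y - t *: e)%R]].

(** After a reflection [e] is the first axis. Heights on [S] differ from that of [y0] by at most
    [t], so the shadow lies over the projection of [S], within an interval of heights of length l +
    2t; and projecting does not increase Hausdorff measure. *)
Lemma shadow_small (S : set V) (e : V) (l t : R) : enorm e = 1%R -> (0 < l)%R -> (0 < t)%R ->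
  (forall x y, S x -> S y -> (enorm (x - y) <= t)%R) ->
  kappa * leb_outer (shadow S e l) <= (l + 2 * t)%:E * H S.
Proof.
move=> e1 l0 t0 St; have [[y0 Sy0]|/set0P/negP/negPn/eqP S0] := pselect (S !=set0); last first.
  rewrite (_ : shadow S e l = set0) ?outer_measure0 ?mule0.
    by rewrite mule_ge0 ?outer_measure_ge0 // lee_fin; lra.
  by rewrite S0; apply/seteqP; split=> // x [y [s []]].
have [T [TD TZ Tn TK Te]] := reflection_to_e0 e1.
have TN x : T (- x)%R = (- T x)%R by rewrite -scaleN1r TZ scaleN1r.
have Ti x y : enorm (T x - T y) = enorm (x - y) by rewrite -TN -TD Tn.
have SB : ebounded S.
  exists (t + enorm y0)%R => y Sy; rewrite -[y](subrK y0).
  by apply: (le_trans (enormD _ _)); rewrite lerD2r St.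
pose E : set V := (cproj hplane \o T) @` S.
have El x y : S x -> S y -> (enorm ((cproj hplane \o T) x - (cproj hplane \o T) y) <= 1 * enorm (x - y))%R.
  move=> _ _; rewrite mul1r /= -(Ti x y) !enormE ler_wsqrtr // ler_sum // => i _.
  rewrite !mxE; case: ifP => // _; rewrite subrr mulr0; exact: sqr_ge0.
have EB : ebounded E := ebounded_lipschitz ler01 SB El.
have EP : E `<=` cplane hplane by move=> _ [x _ <-]; exact: cproj_cplane.
have [N N0 EN] := hbox_ebounded hplane EB.
have HE := cylinder_le_hausdorff card_hplane N0 EP EN; rewrite -/kappa in HE.
have HES : H E <= H S.
  by have := @hausdorff_lipschitz R _ _ n _ S 1 ltr01 El; rewrite expr1n mul1e.
have shB : ebounded (T @` shadow S e l).
  apply: (ebounded_lipschitz ler01) => [|x y _ _]; last by rewrite mul1r Ti.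
  have [M SM] := SB; exists (M + l)%R => _ [y [s [Sy sl ->]]].
  apply: (le_trans (enormD _ _)); rewrite enormN enormZ e1 mulr1 lerD ?SM //.
  by rewrite ger0_norm; lra.
apply: (@le_trans _ _ (kappa * leb_outer (T @` shadow S e l))).
  rewrite lee_wpmul2l ?kappa_ge0 //.
  have -> : leb_outer (shadow S e l) = leb_outer (T @` (T @` shadow S e l)).
    congr leb_outer; apply/seteqP; split=> [x xS|_ [_ [x xS <-] <-]]; last by rewrite TK.
    by exists (T x); [exists x|rewrite TK].
  exact: leb_isometry_le.
apply: (@le_trans _ _ (kappa * ((l + 2 * t)%:E * leb_outer (cylinder hplane E)))).
  rewrite lee_wpmul2l ?kappa_ge0 //.
  apply: (@leb_stretch _ _ _ _ (T y0 ord0 ord0 - t - l)%R); first lra.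
  move=> _ [_ [y [s [Sy /andP[s0 sl] ->]]] <-].
  have TyE : T (y - s *: e)%R = (T y - s *: delta_mx ord0 ord0)%R by rewrite TD TN TZ Te.
  have yy0 : (`|T y ord0 ord0 - T y0 ord0 ord0| <= t)%R.
    apply: le_trans (St _ _ Sy Sy0); rewrite -Ti; have := coord_le_enorm (T y - T y0) ord0.
    by rewrite !mxE.
  have lt0 : (0 < l + 2 * t)%R by lra.
  pose r := ((T y ord0 ord0 - s - (T y0 ord0 ord0 - t - l)) / (l + 2 * t))%R.
  exists (set_coord (T y) ord0 r).
    exists (cproj hplane (T y)); split; first by exists y.
      by move=> i i0; rewrite !mxE i0; move: i0; rewrite /hplane /= => /negbTE ->.
    move=> i; rewrite negbK => /eqP ->; rewrite mxE eqxx /r.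
    move: yy0; rewrite ler_norml => /andP[yy1 yy2]; apply/andP; split.
      by apply: divr_ge0; lra.
    by rewrite ler_pdivrMr // mul1r; lra.
  split=> [|i i0]; last by rewrite TyE !mxE (negbTE i0) andbF mulr0 subr0.
  rewrite TyE !mxE !eqxx mulr1 /r [X in _ = (_ + X)%R]mulrC divfK ?gt_eqF //; ring.
rewrite muleCA lee_wpmul2l //; first by rewrite lee_fin; lra.
exact: le_trans HE HES.
Qed.

(** Cutting [S] into pieces of diameter at most [t] by a Borel partition makes the excess height 2t
    of [shadow_small] arbitrarily small, while the measures of the pieces add up to at most that of
    [S]. *)
Lemma shadow_le (S : set V) (e : V) (l : R) : enorm e = 1%R -> (0 < l)%R ->
  kappa * leb_outer (shadow S e l) <= l%:E * H S.
Proof.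
move=> e1 l0; have [->|Sfin] := eqVneq (H S) +oo.
  by rewrite gt0_muley ?lte_fin // leey.
have Sf : H S \is a fin_num by rewrite ge0_fin_numE ?outer_measure_ge0 // ltey.
suff key (t : R) : (0 < t)%R -> kappa * leb_outer (shadow S e l) <= (l + 2 * t)%:E * H S.
  apply/lee_addgt0Pr => d d0; set s := fine (H S).
  have s0 : (0 <= s)%R by rewrite fine_ge0 ?outer_measure_ge0.
  apply: (le_trans (key (d / (2 * (s + 1)))%R _)); first by rewrite divr_gt0 //; lra.
  rewrite -(fineK Sf) -/s -!EFinM -EFinD lee_fin mulrDl lerD2l.
  rewrite (_ : (2 * (d / (2 * (s + 1))) * s = d * (s / (s + 1)))%R); last by field; lra.
  by rewrite -[leRHS]mulr1 ler_wpM2l ?(ltW d0) // ler_pdivrMr; lra.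
move=> t0; have [P [bP tP PT Pt]] := @small_partition R n.+2 t t0.
apply: (@le_trans _ _ (\sum_(0 <= j <oo) (kappa * leb_outer (shadow (S `&` P j) e l)))).
  rewrite -(fineK kappa_fin) nneseriesZl => [|j _]; last exact: outer_measure_ge0.
  rewrite fineK ?kappa_fin // lee_wpmul2l ?kappa_ge0 //; apply: le_trans (outer_measure_sigma_subadditive _ _).
  apply: le_outer_measure => x [y [s [Sy sl ->]]].
  have [j _ Pj] : (\bigcup_j P j) y by rewrite PT.
  by exists j => //; exists y, s.
apply: (@le_trans _ _ (\sum_(0 <= j <oo) ((l + 2 * t)%:E * H (S `&` P j)))).
  apply: lee_nneseries => [j _ _|j _].
    by rewrite mule_ge0 ?outer_measure_ge0 ?kappa_ge0.
  apply: shadow_small => // x y [_ Px] [_ Py]; exact: Pt Px Py.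
rewrite nneseriesZl => [|j _]; last exact: outer_measure_ge0.
rewrite lee_wpmul2l //; first by rewrite lee_fin; lra.
by apply: outer_partition => //; exact: hausdorff_borel_outer.
Qed.

End shadow.

(** * Layer-cake integrals *)

Section measurable_levels.
Local Open Scope ereal_scope.
Context {R : realType}.

Lemma emeasurable_gt d (T : measurableType d) (D : set T) (f : T -> \bar R) :
  (forall t : R, measurable (D `&` [set x | t%:E < f x])) -> measurable_fun D f.
Proof.
move=> mf; apply: (measurability _ (ErealGenOInfty.measurableE R)) => _ [_ [t ->] <-].
rewrite [X in measurable X](_ : _ = D `&` [set x | t%:E < f x]) //.
by apply/seteqP; split=> x /=; rewrite in_itv /= andbT.
Qed.

Lemma nonincreasing_emeasurable (phi : R -> \bar R) (D : set R) : measurable D ->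
  (forall s t, (s <= t)%R -> phi t <= phi s) -> measurable_fun D phi.
Proof.
move=> mD dphi; apply: measurable_funTS; apply: emeasurable_gt => t; rewrite setTI.
apply: is_interval_measurable => x y /= _ ty z /andP[_ zy].
exact: lt_le_trans ty (dphi _ _ zy).
Qed.

Lemma le_expR_lim (x y : \bar R) : 0 <= y ->
  (forall th, (0 < th)%R -> x <= (expR th)%:E * y) -> x <= y.
Proof.
move=> y0 xy; have [->|yfin] := eqVneq y +oo; first exact: leey.
have yf : y \is a fin_num by rewrite ge0_fin_numE // ltey.
apply/lee_addgt0Pr => e e0; set r := fine y.
have r0 : (0 <= r)%R by rewrite fine_ge0.
have q0 : (0 < e / (r + 1))%R by rewrite divr_gt0 // ltr_wpDl.
pose a : R := ln (1 + e / (r + 1)); have a0 : (0 < a)%R by rewrite /a ln_gt0 // ltrDl.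
apply: (le_trans (xy a a0)); rewrite /a lnK ?posrE ?addr_gt0 //.
rewrite -(fineK yf) -/r -EFinM -EFinD lee_fin mulrDl mul1r lerD2l mulrAC ler_pdivrMr ?ltr_wpDl //.
by rewrite ler_pM2l // lerDl.
Qed.

End measurable_levels.

Section geometric_grid.
Local Open Scope ereal_scope.
Context {R : realType} (th : R) (th0 : (0 < th)%R).

Definition zof (j : nat) : int := if odd j then Negz j./2 else Posz j./2.

Lemma zof_inj : injective zof.
Proof.
move=> i j; rewrite /zof; have := odd_double_half i; have := odd_double_half j.
by case: (odd i); case: (odd j) => //= ej ei [e]; rewrite -ei -ej e.
Qed.

Lemma zof_surj z : exists j, zof j = z.
Proof.
case: z => k; [exists k.*2|exists k.*2.+1]; rewrite /zof /= odd_double ?doubleK //=.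
by rewrite uphalf_double.
Qed.

Definition grid (j : nat) : R := expR (th * (zof j)%:~R).

(** For each [c] a partition of (0, oo) into intervals of ratio e^th. With c = 0 the interval lies
    above the grid point [grid j], with c = -1 below it. *)
Definition gridset (c : R) (j : nat) : set R :=
  `]expR (th * ((zof j)%:~R + c)), expR (th * ((zof j)%:~R + c + 1))]%classic.

Let gridsetE c j t : gridset c j t <-> (0 < t)%R /\ Num.ceil (ln t / th - c)%R = (zof j + 1)%R.
Proof.
rewrite /gridset /= in_itv /=; split.
  move=> /andP[t1 t2]; have t0 : (0 < t)%R by apply: lt_trans t1; exact: expR_gt0.
  split=> //; apply: ceil_def; rewrite addrK intrD.
  move: t1 t2; rewrite -{1 2}[t](lnK) ?posrE // ltr_expR ler_expR.
  rewrite -ltr_pdivlMl // -ler_pdivrMl // [(th^-1 * _)%R]mulrC => t1 t2.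
  by rewrite ltrBrDr t1 /= lerBlDr addrAC.
move=> [t0 tE]; have := ceil_itv (ln t / th - c)%R; rewrite tE addrK intrD => /andP[t1 t2].
rewrite -[t in X in X && _](lnK) ?posrE // -[t in X in _ && X](lnK) ?posrE //.
rewrite ltr_expR ler_expR -ltr_pdivlMl // -ler_pdivrMl // [(th^-1 * _)%R]mulrC.
by move: t1 t2; rewrite ltrBrDr lerBlDr addrAC => -> ->.
Qed.

Lemma trivIset_gridset c : trivIset setT (gridset c).
Proof.
apply/trivIsetP => i j _ _ ij; apply/seteqP; split=> // t [/gridsetE[_ ti] /gridsetE[_ tj]].
by move/eqP: ij; apply; apply: zof_inj; apply: (@addIr _ 1%R); rewrite -ti.
Qed.

Lemma bigcup_gridset c : \bigcup_j gridset c j = `]0%R, +oo[%classic.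
Proof.
apply/seteqP; split=> [t [j _ /gridsetE[t0 _]]|t]; rewrite /= in_itv /= andbT // => t0.
have [j jE] := zof_surj (Num.ceil (ln t / th - c) - 1)%R.
by exists j => //; apply/gridsetE; split=> //; rewrite jE subrK.
Qed.

Lemma gridset_measure c j : lebesgue_measure (gridset c j) =
  (expR (th * c) * (expR th - 1) * grid j)%:E.
Proof.
rewrite /gridset lebesgue_measure_itv /= lte_fin ltr_expR ltr_pM2l // ltrDl ltr01.
rewrite -EFinB /grid; congr EFin.
rewrite !mulrDr !expRD mulr1; ring.
Qed.

(** A Riemann sum for nonincreasing [phi]. The weight is the length of the interval above the grid
    point, and e^th times the length of the one below it; this gives the two comparisons with the
    integral. *)
Definition gsum (phi : R -> \bar R) : \bar R :=
  \sum_(0 <= j <oo) (((expR th - 1) * grid j)%:E * phi (grid j)).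

Let q1 : (0 < expR th - 1 :> R)%R.
Proof. by rewrite subr_gt0 expR_gt1. Qed.

Lemma gridw_ge0 j : (0 <= (expR th - 1) * grid j)%R.
Proof. by rewrite mulr_ge0 ?expR_ge0 // ltW. Qed.

Variables (phi : R -> \bar R) (phi0 : forall t, 0 <= phi t)
  (dphi : forall s t, (s <= t)%R -> phi t <= phi s).

Let mphi D : measurable D -> measurable_fun D phi.
Proof. by move=> mD; exact: nonincreasing_emeasurable. Qed.

Let mgrid c j : measurable (gridset c j).
Proof. exact: measurable_itv. Qed.

Lemma integral_le_gsum : \int[lebesgue_measure]_(t in `]0%R, +oo[) phi t <= gsum phi.
Proof.
rewrite -(bigcup_gridset 0) ge0_integral_bigcup //; last 3 first.
- exact: mgrid.
- by apply: mphi; exact: bigcup_measurable.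
- exact: trivIset_gridset.
apply: lee_nneseries => [j _ _|j _]; first exact: integral_ge0.
apply: (@le_trans _ _ (\int[lebesgue_measure]_(t in gridset 0 j) cst (phi (grid j)) t)).
  apply: ge0_le_integral => //; [exact: mgrid|by apply: mphi; exact: mgrid|move=> t].
  rewrite /gridset /= in_itv /= addr0 => /andP[/ltW t1 _]; exact: dphi.
apply: (@le_trans _ _ (phi (grid j) * lebesgue_measure (gridset 0 j))).
  rewrite le_eqVlt; apply/orP; left; apply/eqP.
  exact: (integral_cst (@lebesgue_measure R) (mgrid 0 j)).
by rewrite gridset_measure mulr0 expR0 mul1r muleC.
Qed.

Lemma gsum_le_integral :
  gsum phi <= (expR th)%:E * \int[lebesgue_measure]_(t in `]0%R, +oo[) phi t.
Proof.
rewrite -(bigcup_gridset (-1)%R) ge0_integral_bigcup //; last 3 first.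
- exact: mgrid.
- by apply: mphi; exact: bigcup_measurable.
- exact: trivIset_gridset.
rewrite -nneseriesZl => [|j _]; last exact: integral_ge0.
apply: lee_nneseries => [j _ _|j _]; first by rewrite mule_ge0 // lee_fin gridw_ge0.
rewrite -lee_pdivrMl ?expR_gt0 //.
apply: (@le_trans _ _ (\int[lebesgue_measure]_(t in gridset (-1)%R j) cst (phi (grid j)) t)).
  apply: (@le_trans _ _ (phi (grid j) * lebesgue_measure (gridset (-1)%R j))); last first.
    rewrite le_eqVlt; apply/orP; left; apply/eqP/esym.
    exact: (integral_cst (@lebesgue_measure R) (mgrid (-1)%R j)).
  rewrite gridset_measure [leRHS]muleC muleA -EFinM mulrN1 expRN.
  by rewrite mulrA.
apply: ge0_le_integral.
- exact: mgrid.
- by move=> t _; exact: phi0.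
- exact: measurable_cst.
- by apply: mphi; exact: mgrid.
move=> t; rewrite /gridset /= in_itv /= subrK => /andP[_ t1]; exact: dphi.
Qed.

End geometric_grid.

Section layer_cake.
Local Open Scope ereal_scope.
Context {R : realType} {n : nat}.
Notation V := 'rV[R]_n.

Lemma integral_below (y : \bar R) : 0 <= y ->
  \int[lebesgue_measure]_(t in `]0%R, +oo[) (\1_[set s : R | (s%:E < y)%E] t)%:E = y.
Proof.
have my : measurable [set t : R | t%:E < y].
  by apply: is_interval_measurable => a b /= _ bY c /andP[_ cb]; apply: le_lt_trans bY.
rewrite integral_indic //; case: y my => [r| |] // my r0.
  rewrite (_ : _ `&` _ = `]0%R, r[%classic); last first.
    by apply/seteqP; split=> t /=; rewrite !in_itv /= ?andbT lte_fin; [move=> [-> ->]|move=> /andP[-> ->]].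
  rewrite [LHS](_ : _ = lebesgue_measure (`]0%R, r[%classic : set R)) // lebesgue_measure_itv /= lte_fin; move: r0; rewrite lee_fin le_eqVlt.
  by move=> /orP[/eqP <-|->]; rewrite ?ltxx // -EFinB subr0.
rewrite (_ : _ `&` _ = `]0%R, +oo[%classic).
  rewrite [LHS](_ : _ = lebesgue_measure (`]0%R, +oo[%classic : set R)) // lebesgue_measure_itv /=.
  by rewrite ltry.
by apply/seteqP; split=> t /=; rewrite ltry => // -[].
Qed.

Lemma lcint_ge0 (mu : {outer_measure set V -> \bar R}) A h : 0 <= lcint mu A h.
Proof. by apply: integral_ge0 => t _; exact: outer_measure_ge0. Qed.

Lemma le_lcint (mu : {outer_measure set V -> \bar R}) A B h g : A `<=` B ->
  (forall x, A x -> h x <= g x) -> lcint mu A h <= lcint mu B g.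
Proof.
move=> AB hg.
have m h' A' : measurable_fun (`]0%R, +oo[%classic : set R) (fun t : R => mu [set x | A' x /\ t%:E < h' x]).
  apply: nonincreasing_emeasurable => // s t st; apply: le_outer_measure => x /= [Ax th].
  by split=> //; apply: le_lt_trans th; rewrite lee_fin.
rewrite /lcint; apply: ge0_le_integral => //; [exact: m|exact: m|move=> t _].
apply: le_outer_measure => x /= [Ax th].
by split; [exact: AB|exact: lt_le_trans th (hg _ Ax)].
Qed.

Lemma eq_lcint (mu : {outer_measure set V -> \bar R}) A h g :
  (forall x, A x -> h x = g x) -> lcint mu A h = lcint mu A g.
Proof.
by move=> hg; apply/eqP; rewrite eq_le !le_lcint // => x Ax; rewrite hg.
Qed.

Variable mu : {outer_measure set V -> \bar R}.

Definition cara_fun (f : V -> \bar R) := forall t : R, mu.-caratheodory [set x | t%:E < f x].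

Notation W := (caratheodory_type mu).

Definition cmeas : {measure set W -> \bar R} := (mu : set W -> \bar R).

Lemma cara_fun_measurable (f : V -> \bar R) (D : set W) : cara_fun f -> measurable_fun D (f : W -> \bar R).
Proof.
move=> mf; apply: measurable_funTS; apply: emeasurable_gt => t; rewrite setTI.
exact: mf.
Qed.

(** The layer-cake integral is replaced by [gsum], at the price of a factor e^th in either
    direction, and the sum is exchanged with the integral over [x]. A countable sum may be exchanged
    for every measure, whereas Tonelli in (x, t) asks for a sigma-finite one, and Hausdorff measure
    of lower dimension is not sigma-finite. *)
Lemma lcintE (A : set V) (f : V -> \bar R) : mu.-caratheodory A -> cara_fun f ->
  (forall x, 0 <= f x) ->
  lcint mu A f = \int[cmeas]_(x in A) f x.
Proof.
move=> mA mf f0; pose phi t := mu [set x | A x /\ t%:E < f x].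
have phi0 t : 0 <= phi t by exact: outer_measure_ge0.
have dphi s t : (s <= t)%R -> phi t <= phi s.
  move=> st; apply: le_outer_measure => x /= [Ax tf]; split=> //.
  by apply: le_lt_trans tf; rewrite lee_fin.
pose below x t : \bar R := (\1_[set s : R | (s%:E < f x)%E] t)%:E.
have below0 x t : 0 <= below x t by rewrite lee_fin.
have dbelow x s t : (s <= t)%R -> below x t <= below x s.
  move=> st; rewrite lee_fin /indic; case: (boolP (t \in _)) => //.
  rewrite inE /= => tf; rewrite mem_set //=.
  by apply: le_lt_trans tf; rewrite lee_fin.
have belowE x : \int[lebesgue_measure]_(t in `]0%R, +oo[) below x t = f x by exact: integral_below.
have mset (t : R) : measurable ([set x | t%:E < f x] : set W) by exact: mf.
have mbelow th j : measurable_fun (A : set W)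
    (fun x => ((expR th - 1) * grid th j)%:E * below x (grid th j)).
  apply: measurable_funeM; apply/measurable_EFinP.
  rewrite (_ : (fun x => _) = \1_([set x | ((grid th j)%:E < f x)%E] : set W)); first exact: measurable_indic.
  by apply/funext => x; rewrite /indic; congr (_ _)%:R; apply/idP/idP; rewrite !inE.
have gphi th : (0 < th)%R -> \int[cmeas]_(x in A) gsum th (below x) = gsum th phi.
  move=> th0; rewrite /gsum integral_nneseries //; last first.
    by move=> j x _; rewrite mule_ge0 // lee_fin gridw_ge0.
  apply: eq_eseriesr => j _; rewrite ge0_integralZl //; last 2 first.
    by move: (mbelow th j) => _; apply/measurable_EFinP; rewrite (_ : (fun x => _) = \1_([set x | ((grid th j)%:E < f x)%E] : set W)); [exact: measurable_indic|apply/funext => x; rewrite /indic; congr (_ _)%:R; apply/idP/idP; rewrite !inE].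
    by rewrite lee_fin gridw_ge0.
  congr (_ * _); rewrite /below.
  transitivity (\int[cmeas]_(x in A) (\1_([set x | ((grid th j)%:E < f x)%E] : set W) x)%:E).
    by apply: eq_integral => x _; rewrite /indic; congr (_ _)%:R%:E.
  by rewrite integral_indic // setIC.
have mgs th : (0 < th)%R -> measurable_fun (A : set W) (fun x => gsum th (below x)).
  move=> th0; apply: ge0_emeasurable_sum => // j x _ _.
  by rewrite mule_ge0 // lee_fin gridw_ge0.
apply/eqP; rewrite eq_le; apply/andP; split; apply: le_expR_lim => [|th th0].
- exact: integral_ge0.
- apply: (le_trans (integral_le_gsum th0 phi0 dphi)); rewrite -gphi //.
  have -> : (expR th)%:E * \int[cmeas]_(x in A) f x = \int[cmeas]_(x in A) ((expR th)%:E * f x).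
    by rewrite ge0_integralZl // ?lee_fin ?expR_ge0 //; exact: cara_fun_measurable.
  apply: ge0_le_integral => //.
  + by move=> x _; apply: nneseries_ge0 => j _ _; rewrite mule_ge0 // lee_fin gridw_ge0.
  + exact: mgs.
  + by apply: measurable_funeM; exact: cara_fun_measurable.
  + by move=> x _; have := gsum_le_integral th0 (below0 x) (dbelow x); rewrite belowE.
- exact: lcint_ge0.
- apply: le_trans (gsum_le_integral th0 phi0 dphi); rewrite -gphi //.
  apply: ge0_le_integral => //.
  + exact: cara_fun_measurable.
  + exact: mgs.
  + by move=> x _; have := integral_le_gsum th0 (below0 x) (dbelow x); rewrite belowE.
Qed.

End layer_cake.

(** * Integration over spheres *)

(** [T] is injective on [E], with a [K]-Lipschitz inverse. *)
Lemma hausdorff_expanding (R : realType) n m k (T : 'rV[R]_n -> 'rV[R]_m)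
    (E : set 'rV[R]_n) (K : R) : (0 < K)%R ->
  (forall x y, E x -> E y -> (enorm (x - y) <= K * enorm (T x - T y))%R) ->
  (hausdorff k.+1 E <= (K ^+ k.+1)%:E * hausdorff k.+1 (T @` E))%E.
Proof.
move=> K0 TK; pose g y := xget 0 [set x | E x /\ T x = y].
have gT x : E x -> E (g (T x)) /\ T (g (T x)) = T x.
  by move=> Ex; rewrite /g; case: xgetP => [z -> []//|/(_ x)]; case.
have gK x : E x -> g (T x) = x.
  move=> Ex; have [Eg Tg] := gT _ Ex; apply/eqP; rewrite -subr_eq0; apply/eqP/enorm_eq0.
  by apply/eqP; rewrite eq_le enorm_ge0 andbT (le_trans (TK _ _ Eg Ex)) // Tg subrr enorm0 mulr0.
rewrite -[X in (hausdorff _ X <= _)%E](_ : g @` (T @` E) = E).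
  apply: hausdorff_lipschitz => // _ _ [x Ex <-] [y Ey <-].
  by rewrite !gK //; exact: TK.
apply/seteqP; split=> [_ [_ [x Ex <-] <-]|x Ex]; first by rewrite gK.
by exists (T x); [exists x|exact: gK].
Qed.

Section slices.
Local Open Scope ereal_scope.
Context {R : realType} {n : nat}.
Notation V := 'rV[R]_n.+2.
Notation H := (@hausdorff R n.+2 n.+1).

Notation kap := (@kappa R n).

Definition level0 (r : R) : set V := [set x | x ord0 ord0 = r].

Lemma box_slice (a b : V) (r : R) : (forall i, a ord0 i <= b ord0 i)%R ->
  H (box a b `&` level0 r) <= kap *
    ((\prod_(i < n.+2 | i != ord0) (b ord0 i - a ord0 i)) *
     \1_(`[a ord0 ord0, b ord0 ord0]%classic : set R) r)%:E.
Proof.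
move=> ab; have [rab|rab] := boolP (r \in (`[a ord0 ord0, b ord0 ord0]%classic : set R)); last first.
  rewrite (_ : _ `&` _ = set0) ?outer_measure0.
    by rewrite mule_ge0 ?kappa_ge0 // lee_fin mulr_ge0 // prodr_ge0 // => i _; rewrite subr_ge0.
  apply/seteqP; split=> // x [xb /= xr]; move/negP: rab; apply; rewrite inE /= in_itv /=.
  by have := xb ord0; rewrite xr.
rewrite indicE rab mulr1.
pose z : V := (r *: delta_mx ord0 ord0)%R.
have zE i : z ord0 i = (if i == ord0 then r else 0)%R.
  by rewrite !mxE eqxx /=; case: eqP => _; rewrite ?mulr1 ?mulr0.
have := cbox_measure_le (@card_hplane n) ab; apply: le_trans.
rewrite -[leRHS](@hausdorff_isometry R n.+2 n.+2 n (fun x => x + z)%R (fun x => x - z)%R).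
- apply: le_outer_measure => x [xb xr]; exists (x - z)%R; last by rewrite subrK.
  split=> i; rewrite /hplane /= => i0.
    by rewrite !mxE -/(z ord0 i) ?(negbTE i0) /= ?andbF ?mulr0 subr0; exact: xb.
  move: i0; rewrite negbK => /eqP ->.
  by rewrite mxE [X in (_ + X)%R]mxE zE eqxx xr subrr.
- by move=> x y; rewrite opprD addrACA subrr addr0.
- by move=> x; rewrite addrK.
Qed.

(** [psi] adds up the bounds of [box_slice] over a near-optimal cover by boxes, so it is measurable
    by construction, as a majorant of the slice measure. *)
Lemma flat_slices (B : set V) (d : R) : (0 < d)%R -> leb_outer B < +oo ->
  exists psi : R -> \bar R, [/\ measurable_fun [set: R] psi, (forall r, 0 <= psi r),
    (forall r, H (B `&` level0 r) <= psi r) &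
    \int[lebesgue_measure]_r psi r <= kap * (leb_outer B + d%:E)].
Proof.
move=> d0 Bfin; have [G [okG BG sG]] := leb_outer_adherent d0 Bfin.
pose w k := (\prod_(i < n.+2 | i != ord0) ((G k).2 ord0 i - (G k).1 ord0 i))%R.
have w0 k : (0 <= w k)%R by rewrite prodr_ge0 // => i _; rewrite subr_ge0 okG.
pose I k : set R := `[(G k).1 ord0 ord0, (G k).2 ord0 ord0]%classic.
pose f k (r : R) : \bar R := kap * (w k * \1_(I k) r)%:E.
have f0 k r : 0 <= f k r by rewrite mule_ge0 ?kappa_ge0 // lee_fin mulr_ge0.
have mI k : measurable (I k) by exact: measurable_itv.
have mi k : measurable_fun [set: R] (fun r : R => (\1_(I k) r)%:E).
  by apply/measurable_EFinP; exact: measurable_indic.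
have mw k : measurable_fun [set: R] (fun r : R => (w k * \1_(I k) r)%:E).
  apply/measurable_EFinP.
  apply: measurable_funM; [exact: measurable_cst|exact: measurable_indic].
have mf k : measurable_fun [set: R] (f k) by exact: measurable_funeM.
exists (fun r => \sum_(0 <= k <oo) f k r); split.
- by apply: ge0_emeasurable_sum => // k r _ _; exact: f0.
- by move=> r; apply: nneseries_ge0 => k _ _; exact: f0.
- move=> r; apply: (@le_trans _ _ (\sum_(0 <= k <oo) H (box (G k).1 (G k).2 `&` level0 r))).
    apply: le_trans (outer_measure_sigma_subadditive _ _); apply: le_outer_measure.
    by move=> x [/BG[k _ xk] xr]; exists k.
  apply: lee_nneseries => [k _ _|k _]; first exact: outer_measure_ge0.
  by apply: box_slice; exact: okG.
rewrite integral_nneseries //.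
apply: (@le_trans _ _ (\sum_(0 <= k <oo) (kap * boxvol (G k)))); last first.
  rewrite -(fineK (@kappa_fin R n)) nneseriesZl => [|k _]; last exact: boxvol_ge0.
  by rewrite fineK ?kappa_fin // lee_wpmul2l ?kappa_ge0.
apply: lee_nneseries => [k _ _|k _]; first exact: integral_ge0.
rewrite /f ge0_integralZl //; last 3 first.
- exact: mw.
- by move=> r _; rewrite lee_fin mulr_ge0.
- exact: kappa_ge0.
rewrite lee_wpmul2l ?kappa_ge0 //.
under eq_integral do rewrite EFinM.
rewrite ge0_integralZl //; last 2 first.
- exact: mi.
- by rewrite lee_fin.
rewrite [X in _ * X](_ : _ = ((G k).2 ord0 ord0 - (G k).1 ord0 ord0)%:E); last first.
  etransitivity; first exact: (integral_indic (@lebesgue_measure R) measurableT (mI k)).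
  rewrite setIT [LHS](_ : _ = lebesgue_measure (I k)) // /I lebesgue_measure_itv /= lte_fin.
  have := okG k ord0; rewrite le_eqVlt => /orP[/eqP ->|->]; last by rewrite -EFinB.
  by rewrite ltxx subrr.
by rewrite -EFinM lee_fin (bigD1 ord0) //= mulrC.
Qed.

(** Multiplied by |u| + |v|, the difference on the left is the inner product of u - v with (u - |u|
    e) + (v - |v| e), and Cauchy-Schwarz applies. *)
Lemma flatten_bilipschitz (e u v : V) (th : R) : (0 <= th)%R ->
  (enorm (u - enorm u *: e) <= th * enorm u)%R ->
  (enorm (v - enorm v *: e) <= th * enorm v)%R ->
  (`|(enorm u - dotv u e) - (enorm v - dotv v e)| <= th * enorm (u - v))%R.
Proof.
move=> th0 ue ve; set s := (enorm u + enorm v)%R.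
have s0 : (0 <= s)%R by rewrite addr_ge0 ?enorm_ge0.
have [s00|s00] := eqVneq s 0%R.
  have u0 : enorm u = 0%R by have := enorm_ge0 u; have := enorm_ge0 v; rewrite /s in s00; lra.
  have v0 : enorm v = 0%R by have := enorm_ge0 u; have := enorm_ge0 v; rewrite /s in s00; lra.
  rewrite (enorm_eq0 u0) (enorm_eq0 v0) !subrr normr0 mulr_ge0 // enorm_ge0 //.
have sp : (0 < s)%R by rewrite lt_neqAle eq_sym s00.
rewrite -(ler_pM2r sp) -[s in leLHS]gtr0_norm // -normrM.
have -> : ((enorm u - dotv u e - (enorm v - dotv v e)) * s)%R =
    dotv (u - v) ((u - enorm u *: e) + (v - enorm v *: e)).
  have dN (a b : V) : dotv a (- b)%R = (- dotv a b)%R by rewrite dotvC dotvNl dotvC.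
  rewrite !(dotvBl, dotvDr, dN, dotvZr) -(sqr_enorm u) -(sqr_enorm v) (dotvC v u) /s; ring.
apply: (le_trans (cauchy_schwarz _ _)); rewrite [leRHS]mulrAC mulrC ler_wpM2r ?enorm_ge0 //.
by apply: (le_trans (enormD _ _)); rewrite mulrDr lerD.
Qed.

Lemma curved_slices (x0 e : V) (B : set V) (th d : R) : enorm e = 1%R ->
  (0 < th < 1)%R -> (0 < d)%R -> ebounded B -> leb_outer B < +oo ->
  (forall x, B x -> (enorm (x - x0 - enorm (x - x0) *: e) <= th * enorm (x - x0))%R) ->
  exists psi : R -> \bar R, [/\ measurable_fun [set: R] psi, (forall r, 0 <= psi r),
    (forall r, H (B `&` esphere x0 r) <= psi r) &
    \int[lebesgue_measure]_r psi r <=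
      (((1 + th) / (1 - th)) ^+ n.+2)%:E * (kap * leb_outer B) + d%:E].
Proof.
move=> e1 /andP[th0 th1] d0 bB Bfin Be.
have [S [SD SZ Sn SK Se]] := reflection_to_e0 e1.
have SN x : S (- x)%R = (- S x)%R by rewrite -scaleN1r SZ scaleN1r.
have dot0 (x : V) : dotv x (delta_mx ord0 ord0) = x ord0 ord0.
  rewrite /dotv (bigD1 ord0) //= big1 ?addr0 => [|i i0]; first by rewrite !mxE eqxx mulr1.
  by rewrite !mxE (negbTE i0) mulr0.
have Sdot z : S z ord0 ord0 = dotv z e.
  have hS w : dotv (S w) (S w) = dotv w w by rewrite -!sqr_enorm Sn.
  have := hS (z + e)%R; rewrite SD !(dotvDl, dotvDr) !hS (dotvC (S e) (S z)) (dotvC e z).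
  by rewrite Se dot0; lra.
(* Straightening the spheres: [G u] differs from [u] only along [e] and has height |u| there, so
   spheres about 0 go into hyperplanes. On the cone around [e] the difference of [G] and the
   identity is th-Lipschitz. *)
pose G (u : V) : V := (u + (enorm u - dotv u e) *: e)%R.
pose T x := S (G (x - x0)%R).
have Tl x y : B x -> B y -> (enorm (T x - T y - S (x - y)) <= th * enorm (x - y))%R.
  move=> Bx By; rewrite /T -!SN -!SD Sn /G.
  have -> : (x - x0 + (enorm (x - x0) - dotv (x - x0) e) *: e -
     (y - x0 + (enorm (y - x0) - dotv (y - x0) e) *: e) - (x - y))%R =
     (((enorm (x - x0) - dotv (x - x0) e) - (enorm (y - x0) - dotv (y - x0) e)) *: e)%R :> V.
    by apply/rowP => i; rewrite !mxE; ring.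
  rewrite enormZ e1 mulr1.
  have := flatten_bilipschitz (ltW th0) (Be _ Bx) (Be _ By).
  by rewrite (_ : (x - x0 - (y - x0) = x - y)%R) // opprB addrA subrK.
have T1 x y : B x -> B y -> (enorm (T x - T y) <= (1 + th) * enorm (x - y))%R.
  move=> Bx By; have := Tl _ _ Bx By; have := enormD (T x - T y - S (x - y))%R (S (x - y)%R).
  by rewrite subrK Sn; lra.
have T2 x y : B x -> B y -> (enorm (x - y) <= (1 - th)^-1 * enorm (T x - T y))%R.
  move=> Bx By; have := Tl _ _ Bx By; rewrite ler_pdivlMl ?subr_gt0 //.
  have := enormD (S (x - y) - (T x - T y))%R (T x - T y)%R; rewrite subrK Sn (enormB (S (x - y)%R)); lra.
have T0 x : T x ord0 ord0 = enorm (x - x0).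
  by rewrite /T Sdot /G dotvDl dotvZl -!sqr_enorm e1 expr1n mulr1 addrC subrK.
have th1' : (0 < 1 - th)%R by rewrite subr_gt0.
have K0 : (0 < (1 - th)^-1)%R by rewrite invr_gt0.
pose K := ((1 - th)^-1 ^+ n.+1)%R; have KP : (0 < K)%R by rewrite exprn_gt0.
have LT : leb_outer (T @` B) <= ((1 + th) ^+ n.+2)%:E * leb_outer B.
  by apply: leb_lipschitz => //; lra.
set k := fine kap; have kE : kap = k%:E by rewrite fineK // kappa_fin.
have kp : (0 < k)%R by rewrite -lte_fin -kE kappa_gt0.
have Bf : leb_outer B \is a fin_num by rewrite ge0_fin_numE ?outer_measure_ge0.
have d'0 : (0 < d / (K * k))%R by rewrite divr_gt0 // mulr_gt0.
have [|psi [mpsi psi0 Hpsi ipsi]] := @flat_slices (T @` B) _ d'0.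
  by apply: (le_lt_trans LT); rewrite -(fineK Bf) -EFinM ltry.
exists (fun r => K%:E * psi r); split.
- exact: measurable_funeM.
- by move=> r; rewrite mule_ge0 // lee_fin ltW.
- move=> r; apply: (@le_trans _ _ (K%:E * H (T @` (B `&` esphere x0 r)))).
    by apply: hausdorff_expanding => // x y [Bx _] [By _]; exact: T2.
  rewrite lee_wpmul2l ?lee_fin ?(ltW KP) //; apply: le_trans (Hpsi r).
  apply: le_outer_measure => _ [x [Bx xr] <-]; split; first by exists x.
  by rewrite /level0 /= T0.
rewrite ge0_integralZl //; last by rewrite lee_fin ltW.
apply: (@le_trans _ _ (K%:E * (kap * (((1 + th) ^+ n.+2)%:E * leb_outer B + (d / (K * k))%:E)))).
  rewrite lee_wpmul2l ?lee_fin ?(ltW KP) //; apply: (le_trans ipsi).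
  by rewrite lee_wpmul2l ?kappa_ge0 // leeD2r.
rewrite kE -(fineK Bf) -!(EFinM, EFinD) lee_fin mulrDr mulrDr; apply: lerD; last first.
  by rewrite le_eqVlt; apply/orP; left; apply/eqP; field; rewrite !gt_eqF.
have lB : (0 <= fine (leb_outer B))%R by rewrite fine_ge0 ?outer_measure_ge0.
rewrite [leRHS]mulrA mulrA mulrA ler_wpM2r // mulrAC ler_wpM2r ?(ltW kp) //.
rewrite expr_div_n mulrC ler_wpM2l ?exprn_ge0 //; first lra.
rewrite /K -exprVn ler_weXn2l // invf_ge1 //; lra.
Qed.

Lemma sphere_slices (x0 : V) (a b : R) (B : set V) (th d : R) : (0 < a)%R ->
  (0 < th < 1)%R -> (0 < d)%R -> B `<=` annulus x0 a b ->
  exists psi : R -> \bar R, [/\ measurable_fun [set: R] psi, (forall r, 0 <= psi r),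
    (forall r, H (B `&` esphere x0 r) <= psi r) &
    \int[lebesgue_measure]_r psi r <=
      (((1 + th) / (1 - th)) ^+ n.+2)%:E * (kap * leb_outer B) + d%:E].
Proof.
move=> a0 th01 d0 Bab; have /andP[th0 th1] := th01.
have q0 : (0 < (1 + th) / (1 - th))%R by rewrite divr_gt0 //; lra.
have [Boo|Bfin] := eqVneq (leb_outer B) +oo.
  exists (cst +oo); split=> [|r|r|]; [exact: measurable_cst|exact: leey|exact: leey|].
  rewrite Boo gt0_muley ?kappa_gt0 // gt0_muley ?lte_fin ?exprn_gt0 //.
  exact: leey.
have bB : ebounded B.
  exists (b + enorm x0)%R => x /Bab /andP[_ xb]; rewrite -[x](subrK x0).
  by apply: (le_trans (enormD _ _)); rewrite lerD2r ltW.
(* On a piece of diameter th a / 2 containing [c], let [e] be the direction of c - x0. The deviation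
   of x - x0 from |x - x0| e is then at most 2 |x - c| <= th a <= th |x - x0|, the cone condition of
   [curved_slices]. *)
have t0 : (0 < th * a / 2)%R by rewrite divr_gt0 // mulr_gt0.
have [P [bP tP PT Pt]] := @small_partition R n.+2 _ t0.
have Bf : leb_outer B < +oo by rewrite ltey.
have /choice[psi psiP] j : exists psi : R -> \bar R,
  [/\ measurable_fun [set: R] psi, (forall r, 0 <= psi r),
    (forall r, H (B `&` P j `&` esphere x0 r) <= psi r) &
    \int[lebesgue_measure]_r psi r <=
      (((1 + th) / (1 - th)) ^+ n.+2)%:E * (kap * leb_outer (B `&` P j)) + (d / (2 ^ j.+1)%:R)%:E].
  have [[c [Bc Pc]]|/set0P/negP/negPn/eqP E0] := pselect (B `&` P j !=set0); last first.
    exists (cst 0); split=> [|r|r|]; [exact: measurable_cst|by []|by rewrite E0 set0I outer_measure0|].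
    rewrite integral0 E0 outer_measure0 !mule0 add0e lee_fin divr_ge0 //; exact: ltW.
  have /andP[ac cb] := Bab _ Bc.
  have c0 : (0 < enorm (c - x0))%R by exact: lt_trans ac.
  pose e := ((enorm (c - x0))^-1 *: (c - x0) : V)%R.
  have e1 : enorm e = 1%R.
    by rewrite /e enormZ gtr0_norm ?invr_gt0 // mulVf // gt_eqF.
  apply: (@curved_slices x0 e) => //.
  - by rewrite divr_gt0 // ltr0n expn_gt0.
  - by have [M BM] := bB; exists M => x [/BM].
  - by apply: le_lt_trans Bf; apply: le_outer_measure; exact: subIsetl.
  move=> x [Bx Px]; have /andP[ax xb] := Bab _ Bx.
  have xc := Pt _ _ _ Px Pc.
  have cE : (c - x0 = enorm (c - x0) *: e)%R by rewrite /e scalerA divff ?scale1r ?gt_eqF.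
  have := enorm_tri (x - x0) (c - x0) (enorm (x - x0) *: e)%R.
  rewrite (_ : (x - x0 - (c - x0))%R = (x - c)%R); last by rewrite opprB addrA subrK.
  rewrite {1}cE -scalerBl enormZ e1 mulr1.
  have := enormB_ge (c - x0) (x - x0).
  rewrite (_ : (c - x0 - (x - x0))%R = (c - x)%R); last by rewrite opprB addrA subrK.
  rewrite (enormB c x).
  have : (th * a <= th * enorm (x - x0))%R by rewrite ler_wpM2l ?(ltW th0) // ltW.
  by lra.
have psi0 j r : 0 <= psi j r by case: (psiP j).
have mpsi j : measurable_fun [set: R] (psi j) by case: (psiP j).
exists (fun r => \sum_(0 <= j <oo) psi j r); split.
- by apply: ge0_emeasurable_sum => // k r _ _; exact: psi0.
- by move=> r; apply: nneseries_ge0 => k _ _; exact: psi0.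
- move=> r; apply: (@le_trans _ _ (\sum_(0 <= j <oo) H (B `&` P j `&` esphere x0 r))).
    apply: le_trans (outer_measure_sigma_subadditive _ _); apply: le_outer_measure.
    move=> x [Bx xr]; have [j _ Pj] : (\bigcup_j P j) x by rewrite PT.
    by exists j.
  apply: lee_nneseries => [k _ _|k _]; first exact: outer_measure_ge0.
  by case: (psiP k).
rewrite integral_nneseries //.
set q := (((1 + th) / (1 - th)) ^+ n.+2)%R in psiP *.
have qk0 X : 0 <= leb_outer X -> 0 <= q%:E * (kap * leb_outer (X : set V)).
  by move=> X0; rewrite mule_ge0 ?mule_ge0 ?kappa_ge0 // lee_fin exprn_ge0 // ltW.
apply: (@le_trans _ _ (\sum_(0 <= j <oo) (q%:E * (kap * leb_outer (B `&` P j)) + (d / (2 ^ j.+1)%:R)%:E))).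
  apply: lee_nneseries => [k _ _|k _]; first exact: integral_ge0.
  by case: (psiP k).
apply: (le_trans (epsilon_trick _ _ (ltW d0))).
  by move=> j; apply: qk0; exact: outer_measure_ge0.
rewrite leeD2r // nneseriesZl => [|j _]; last by rewrite mule_ge0 ?kappa_ge0 ?outer_measure_ge0.
rewrite lee_wpmul2l ?lee_fin ?exprn_ge0 ?(ltW q0) //.
rewrite -(fineK (@kappa_fin R n)) nneseriesZl => [|j _]; last exact: outer_measure_ge0.
rewrite fineK ?kappa_fin // lee_wpmul2l ?kappa_ge0 //.
by apply: outer_partition => //; exact: leb_outer_halfspace.
Qed.

(** The integral over a sphere is at most the [gsum] over superlevel sets of [h], and
    [sphere_slices] is applied to each of these. Its error is divided by the weight [w j], so that
    the errors sum to [d]. *)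
Lemma sphere_integrals (x0 : V) (a b : R) (h : V -> \bar R) (th d : R) : (0 < a)%R ->
  (0 < th < 1)%R -> (0 < d)%R ->
  exists psi : R -> \bar R, [/\ measurable_fun [set: R] psi, (forall r, 0 <= psi r),
    (forall r, (a < r < b)%R -> lcint H (esphere x0 r) h <= psi r) &
    \int[lebesgue_measure]_r psi r <=
      (((1 + th) / (1 - th)) ^+ n.+2)%:E * (kap * ((expR th)%:E * lcint leb_outer (annulus x0 a b) h)) + d%:E].
Proof.
move=> a0 th01 d0; have /andP[th0 th1] := th01.
have q0 : (0 < (1 + th) / (1 - th))%R by rewrite divr_gt0 //; lra.
pose w j := ((expR th - 1) * grid th j)%R.
have w0 j : (0 < w j)%R by rewrite mulr_gt0 ?expR_gt0 // subr_gt0 expR_gt1.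
pose B j : set V := [set x | annulus x0 a b x /\ (grid th j)%:E < h x].
have /choice[psi psiP] j : exists psi : R -> \bar R,
  [/\ measurable_fun [set: R] psi, (forall r, 0 <= psi r),
    (forall r, H (B j `&` esphere x0 r) <= psi r) &
    \int[lebesgue_measure]_r psi r <= (((1 + th) / (1 - th)) ^+ n.+2)%:E *
      (kap * leb_outer (B j)) + (d / (2 ^ j.+1)%:R / w j)%:E].
  apply: (@sphere_slices x0 a b) => //; last by move=> x [].
  by rewrite !divr_gt0 // ltr0n expn_gt0.
have psi0 j r : 0 <= (w j)%:E * psi j r by rewrite mule_ge0 ?lee_fin ?(ltW (w0 j)) //; case: (psiP j).
have mpsi j : measurable_fun [set: R] (fun r => (w j)%:E * psi j r).
  by apply: measurable_funeM; case: (psiP j).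
exists (fun r => \sum_(0 <= j <oo) ((w j)%:E * psi j r)); split.
- by apply: ge0_emeasurable_sum => // k r _ _; exact: psi0.
- by move=> r; apply: nneseries_ge0 => k _ _; exact: psi0.
- move=> r /andP[ar rb].
  apply: (le_trans (@integral_le_gsum _ _ th0 (fun t => H [set x | esphere x0 r x /\ t%:E < h x]) _ _)).
  + by move=> t; exact: outer_measure_ge0.
  + move=> s t st; apply: le_outer_measure => x /= [xr xt]; split=> //.
    by apply: le_lt_trans xt; rewrite lee_fin.
  apply: lee_nneseries => [k _ _|k _].
    by rewrite mule_ge0 ?outer_measure_ge0 // lee_fin ltW // w0.
  rewrite lee_wpmul2l // ?lee_fin ?(ltW (w0 k)) //.
  case: (psiP k) => _ _ /(_ r) + _; apply: le_trans; apply: le_outer_measure.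
  move=> x /= [xr xh]; split=> //; split=> //; rewrite /annulus /=.
  by rewrite /esphere /= in xr; rewrite xr ar.
rewrite integral_nneseries //.
set q := (((1 + th) / (1 - th)) ^+ n.+2)%R in psiP *.
have qq0 : (0 <= q)%R by rewrite exprn_ge0 // ltW.
apply: (@le_trans _ _ (\sum_(0 <= j <oo) (q%:E * (kap * ((w j)%:E * leb_outer (B j))) + (d / (2 ^ j.+1)%:R)%:E))).
  apply: lee_nneseries => [k _ _|k _]; first exact: integral_ge0.
  case: (psiP k) => mk k0 _ ik; rewrite ge0_integralZl //; last by rewrite lee_fin ltW.
  apply: (@le_trans _ _ ((w k)%:E * (q%:E * (kap * leb_outer (B k)) + (d / (2 ^ k.+1)%:R / w k)%:E))).
    by rewrite lee_wpmul2l // lee_fin ltW.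
  rewrite muleDr //; last by rewrite fin_num_adde_defl.
  apply: leeD; last by rewrite -EFinM lee_fin mulrC divfK // gt_eqF.
  by rewrite muleCA [X in _ * X <= _]muleCA.
apply: (le_trans (epsilon_trick _ _ (ltW d0))).
  by move=> j; rewrite !mule_ge0 ?kappa_ge0 ?outer_measure_ge0 // lee_fin ltW.
have wB0 j : 0 <= (w j)%:E * leb_outer (B j) by rewrite mule_ge0 ?outer_measure_ge0 // lee_fin ltW.
rewrite leeD2r // nneseriesZl => [|j _]; last by rewrite mule_ge0 ?kappa_ge0.
rewrite lee_wpmul2l ?lee_fin //.
rewrite -(fineK (@kappa_fin R n)) nneseriesZl => [|j _]; last exact: wB0.
rewrite fineK ?kappa_fin // lee_wpmul2l ?kappa_ge0 //.
apply: (@gsum_le_integral _ _ th0 (fun t => leb_outer [set x | annulus x0 a b x /\ t%:E < h x])).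
- by move=> t; exact: outer_measure_ge0.
- move=> s t st; apply: le_outer_measure => x /= [xr xt]; split=> //.
  by apply: le_lt_trans xt; rewrite lee_fin.
Qed.

End slices.

(** * Invariance of domain *)

Section invariance_of_domain.
Context {R : realType} {n : nat}.
Notation V := 'rV[R]_n.+1.

Lemma row_continuous_at (X : topologicalType) (h : 'I_n.+1 -> X -> R) (x : X) :
  (forall i, {for x, continuous (h i)}) -> {for x, continuous (fun y => \row_i h i y : V)}.
Proof.
move=> ch; apply/cvgrPdist_le => e e0.
have : \forall y \near x, forall i, `|h i x - h i y| <= e.
  by apply: filter_forall => i; move/cvgrPdist_le : (ch i) => /(_ e e0).
apply: filterS => y hy; apply: ler_rV_norm => [|i]; first exact: ltW.
by rewrite !mxE; exact: hy.
Qed.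

Lemma lipschitz_continuous_rV (T : V -> V) (K : R) :
  (forall x y, enorm (T x - T y) <= K * enorm (x - y)) -> continuous T.
Proof.
have K0 : 0 < (`|K| + 1) * n.+1%:R by rewrite mulr_gt0 // ltr_wpDl.
move=> TK x A /nbhs_ballP[e /= e0 eA]; apply/nbhs_ballP.
exists (e / ((`|K| + 1) * n.+1%:R)); first by rewrite /= divr_gt0.
move=> y; rewrite -ball_normE /= => xy; apply: eA; rewrite -ball_normE /=.
apply: (le_lt_trans (norm_le_enorm _)); apply: (le_lt_trans (TK _ _)).
apply: (@le_lt_trans _ _ ((`|K| + 1) * enorm (x - y))).
  by rewrite ler_wpM2r ?enorm_ge0 // (le_trans (ler_norm K)) // lerDl.
apply: (@le_lt_trans _ _ ((`|K| + 1) * (n.+1%:R * `|x - y|))).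
  by rewrite ler_wpM2l ?enorm_le_norm // addr_ge0.
by rewrite mulrA mulrC -ltr_pdivlMr.
Qed.

Lemma subr_continuous_rV (c : V) : continuous (fun y : V => y - c).
Proof.
apply: (@lipschitz_continuous_rV _ 1) => x y; rewrite mul1r.
by rewrite (_ : x - c - (y - c) = x - y) // opprB addrA subrK.
Qed.

Lemma norm_sub_continuous (c : V) : continuous (fun y : V => `|y - c|).
Proof.
move=> y; apply: (@continuous_comp _ _ _ (fun y : V => y - c) (fun z => `|z|)).
  exact: subr_continuous_rV.
exact: norm_continuous.
Qed.

(** (d + t + |d - t|) / 2 is the maximum of d and t; this is a coordinate of the radial map [Phi] in
    [invariance_of_domain]. *)
Lemma retraction_continuous (X : topologicalType) (t u : X -> R) (c d : R) (x : X) :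
  t x != 0 -> {for x, continuous t} -> {for x, continuous u} ->
  {for x, continuous (fun z => c + (d + t z + `|d - t z|) / 2 / t z * u z)}.
Proof.
move=> tx ct cu; apply: cvgD; first exact: cvg_cst.
apply: cvgM => //; apply: cvgM; last exact: cvgV.
apply: cvgM; last exact: cvg_cst.
apply: cvgD; first by apply: cvgD => //; exact: cvg_cst.
by apply: cvg_norm; apply: cvgB => //; exact: cvg_cst.
Qed.

Lemma compact_uniform (h : V -> R) (Z : set V) (e : R) : compact Z -> continuous h -> 0 < e ->
  exists2 d, 0 < d & forall y z, Z y -> `|y - z| < d -> `|h y - h z| <= e.
Proof.
move=> /compact_near_coveringP cZ ch e0.
have := cZ nat \oo (fun i y => forall z, `|y - z| < i.+1%:R^-1 -> `|h y - h z| <= e) _.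
case=> [y Zy|N _ NP]; last first.
  exists N.+1%:R^-1; first by rewrite invr_gt0.
  by move=> y z Zy; exact: (NP N (leqnn N) y Zy).
have /cvgrPdist_lt /(_ (e / 2)) := ch y; rewrite divr_gt0 // => /(_ isT).
move=> /nbhs_ballP[d /= d0 dP].
pose N := Num.truncn (2 / d); exists (ball y (d / 2), [set i | (N <= i)%N]) => /=.
  by split; [apply: nbhsx_ballx; rewrite divr_gt0|exists N].
move=> [y' i] [/=]; rewrite -ball_normE /= => yy' Ni z y'z.
have iN : i.+1%:R^-1 < d / 2.
  rewrite -[ltRHS]invrK ltf_pV2 ?posrE ?invr_gt0 ?divr_gt0 // invf_div.
  by rewrite (lt_le_trans (truncnS_gt _)) // ler_nat.
have yz : `|y - z| < d.
  rewrite -[y - z](subrKA y'); apply: (le_lt_trans (ler_normD _ _)).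
  by rewrite (splitr d) ltrD // (lt_trans y'z).
have h1 : `|h y - h z| < e / 2 by apply: dP; rewrite -ball_normE.
have h2 : `|h y - h y'| < e / 2.
  by apply: dP; rewrite -ball_normE /=; apply: (lt_trans yy'); rewrite ltr_pdivrMr //; lra.
rewrite -[h y' - h z](subrKA (h y)); apply: (le_trans (ler_normD _ _)).
by rewrite (splitr e) lerD ?ltW // distrC.
Qed.

(* Inf-convolution of [h] with a steep cone. *)
Lemma lipschitz_approx (h : V -> R) (Z : set V) (e : R) : compact Z -> continuous h -> 0 < e ->
  exists (p : V -> R) (k : R), [/\ 0 < k, forall y z, `|p y - p z| <= k * enorm (y - z) &
    forall y, Z y -> `|p y - h y| <= e].
Proof.
move=> cZ ch e0; have [[z0 Zz0]|/set0P/negP/negPn/eqP Z0] := pselect (Z !=set0); last first.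
  exists (fun=> 0), 1; split=> // [y z|y]; last by rewrite Z0.
  by rewrite subrr normr0 mul1r enorm_ge0.
have ch' : {within Z, continuous h} by exact: continuous_subspaceT.
have [M M0 hM] : exists2 M, 0 < M & forall y, Z y -> `|h y| <= M.
  have /compact_bounded[M [_ MP]] : compact (h @` Z) := continuous_compact ch' cZ.
  exists (`|M| + 1) => [|y Zy]; first by rewrite ltr_wpDl.
  by apply: MP; [rewrite (le_lt_trans (ler_norm M)) // ltrDl|exists y].
have [d d0 dP] := compact_uniform cZ ch e0.
(* Slope of the cone: at distance [d] it has risen by 2M, the largest possible drop of [h] on
   [Z]. *)
pose k := 2 * M / d; have k0 : 0 < k by rewrite divr_gt0 // mulr_gt0.
pose A y := [set h z + k * enorm (y - z) | z in Z].
have Alb y : lbound (A y) (- M).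
  move=> _ [z Zz <-]; have := hM _ Zz; rewrite ler_norml => /andP[h1 _].
  by apply: (le_trans h1); rewrite lerDl mulr_ge0 ?enorm_ge0 // ltW.
have An0 y : A y !=set0 by exists (h z0 + k * enorm (y - z0)); exists z0.
have Ainf y : has_inf (A y) by split=> //; exists (- M).
pose p y := inf (A y).
have pl y z : p y - p z <= k * enorm (y - z).
  rewrite lerBlDr -lerBlDl; apply: lb_le_inf => // _ [w Zw <-].
  rewrite lerBlDl; apply: (@le_trans _ _ (h w + k * enorm (y - w))).
    by apply: ge_inf; [case: (Ainf y)|exists w].
  rewrite addrCA lerD2l -mulrDr ler_pM2l //; exact: enorm_tri.
exists p, k; split=> // [y z|y Zy].
  by rewrite ler_norml pl andbT lerNl opprB enormB pl.
rewrite distrC ger0_norm; last first.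
  rewrite subr_ge0; apply: ge_inf; first by case: (Ainf y).
  by exists y => //; rewrite subrr enorm0 mulr0 addr0.
rewrite lerBlDr -lerBlDl; apply: lb_le_inf => // _ [w Zw <-]; rewrite lerBlDl.
have [yw|yw] := ltP `|y - w| d.
  have := dP _ _ Zy yw; rewrite ler_norml => /andP[_]; rewrite lerBlDr => /le_trans; apply.
  by rewrite lerD2l lerDl mulr_ge0 ?enorm_ge0 // ltW.
have : 2 * M <= k * enorm (y - w).
  rewrite /k mulrAC ler_pdivlMr // ler_pM2l ?mulr_gt0 //.
  exact: le_trans yw (norm_le_enorm _).
have := hM _ Zy; have := hM _ Zw; rewrite !ler_norml; lra.
Qed.

Lemma leb_cube_boundary (c : V) (d : R) : 0 < d ->
  leb_outer [set y : V | `|y - c| = d] = 0%E.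
Proof.
move=> d0; apply/eqP; rewrite eq_le outer_measure_ge0 andbT.
pose face (b : bool) (i : 'I_n.+1) : V * V :=
  (\row_j (if j == i then (if b then c ord0 i + d else c ord0 i - d) else c ord0 j - d),
   \row_j (if j == i then (if b then c ord0 i + d else c ord0 i - d) else c ord0 j + d)).
have ok b i : box_ok (face b i) by move=> j; rewrite /= !mxE; case: eqP => // _; case: b; lra.
have f0 b i : leb_outer (box (face b i).1 (face b i).2) = 0%E.
  apply/eqP; rewrite eq_le outer_measure_ge0 andbT; apply: (le_trans (leb_outer_box_le (ok b i))).
  by rewrite /boxvol (bigD1 i) //= !mxE !eqxx subrr mul0r.
pose F k := if unpickle k is Some (b, i) then box (face b i).1 (face b i).2 else set0.
apply: (@le_trans _ _ (\sum_(0 <= k <oo) leb_outer (F k))%E).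
  apply: le_trans (outer_measure_sigma_subadditive _ _); apply: le_outer_measure => y /= yd.
  have yl j : `|y ord0 j - c ord0 j| <= d by have := rV_coord_le_norm (y - c) j; rewrite yd !mxE.
  have [i yi] : exists i, `|y ord0 i - c ord0 i| = d.
    apply: contrapT => /forallNP ne.
    have lt j : `|y ord0 j - c ord0 j| < d.
      by rewrite lt_neqAle yl andbT; apply/eqP; exact: ne.
    pose m := \big[Num.max/0]_(j < n.+1) `|y ord0 j - c ord0 j|.
    have md : m < d by apply/bigmax_ltP; split.
    have : `|y - c| <= m.
      apply: ler_rV_norm => [|j]; first exact: bigmax_ge_id.
      by rewrite !mxE; exact: le_bigmax.
    by rewrite yd leNgt md.
  pose b := 0 <= y ord0 i - c ord0 i.
  exists (pickle (b, i)) => //; rewrite /F pickleK => j /=; rewrite !mxE.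
  case: eqP => [->|_]; last by have := yl j; rewrite ler_norml; lra.
  move: yi; rewrite /b; case: (leP 0 (y ord0 i - c ord0 i)) => h;
    [rewrite ger0_norm //|rewrite ltr0_norm //]; lra.
rewrite eseries0 // => k _ _; rewrite /F; case: (unpickle k) => [[b i]|]; first exact: f0.
exact: outer_measure0.
Qed.

Lemma leb_box_gt0 (s : R) : 0 < s -> (0 < leb_outer (box 0 (const_mx s) : set V))%E.
Proof.
move=> s0; have bB : ebounded (box 0 (const_mx s) : set V).
  exists (n.+1%:R * s) => x xb; apply: enorm_le_cst => i; have := xb i.
  by rewrite !mxE => /andP[x0 xs]; rewrite ger0_norm.
have si0 : 0 < s^-1 by rewrite invr_gt0.
have := @leb_lipschitz R n (fun x => s^-1 *: x) _ _ si0 bB _.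
have -> : (fun x : V => s^-1 *: x) @` box 0 (const_mx s) = box 0 (const_mx 1).
  apply/seteqP; split=> [_ [x xb <-] i|x xb].
    have := xb i; rewrite !mxE => /andP[x0 xs].
    by rewrite mulr_ge0 ?(ltW si0) //= mulrC ler_pdivrMr // mul1r.
  exists (s *: x); last by rewrite scalerA mulVf ?scale1r // gt_eqF.
  move=> i; have := xb i; rewrite !mxE => /andP[x0 xs].
  by rewrite mulr_ge0 ?(ltW s0) //= -[leRHS]mulr1 ler_pM2l.
rewrite leb_outer_unit_cube => /(_ _) h; rewrite lt_neqAle outer_measure_ge0 andbT.
apply/negP => /eqP b0; move: h; rewrite -b0 mule0 => h.
suff : (1 <= 0 :> \bar R)%E by rewrite lee_fin ler10.
by apply: h => x y _ _; rewrite -scalerBr enormZ gtr0_norm.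
Qed.

(** The Lipschitz image of the boundary of a cube is null, but the box of candidates for [b] is
    not. *)
Lemma avoid_value (P : V -> V) (K : R) (c : V) (d s : R) : 0 < d -> 0 < s ->
  (forall x y, enorm (P x - P y) <= K * enorm (x - y)) ->
  exists2 b : V, `|b| <= s & forall y, `|y - c| = d -> P y != b.
Proof.
move=> d0 s0 PK; apply: contrapT => ne.
have sub : box 0 (const_mx s) `<=` P @` [set y : V | `|y - c| = d].
  move=> b bs; apply: contrapT => nb; apply: ne; exists b.
    apply: ler_rV_norm => [|i]; first exact: ltW.
    by have := bs i; rewrite !mxE => /andP[b0 b1]; rewrite ger0_norm.
  by move=> y yd; apply/eqP => Pb; apply: nb; exists y.
have bd : ebounded [set y : V | `|y - c| = d].
  exists (n.+1%:R * (d + `|c|)) => y /= yd; apply: (le_trans (enorm_le_norm _)).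
  rewrite ler_pM2l // -[y](subrK c); apply: (le_trans (ler_normD _ _)).
  by rewrite yd.
have K0 : 0 < `|K| + 1 by rewrite ltr_wpDl.
have := leb_box_gt0 s0; apply/negP; rewrite -leNgt.
apply: (le_trans (le_outer_measure leb_outer _ _ sub)).
have := leb_lipschitz K0 bd; rewrite leb_cube_boundary // mule0; apply=> x y _ _.
apply: (le_trans (PK x y)); rewrite ler_wpM2r ?enorm_ge0 //.
by rewrite (le_trans (ler_norm K)) // lerDl.
Qed.

Lemma lipschitz_approx_rV (h : V -> V) (Z : set V) (e : R) : compact Z -> continuous h -> 0 < e ->
  exists (p : V -> V) (k : R), (forall y z, enorm (p y - p z) <= k * enorm (y - z)) /\
    forall y, Z y -> `|p y - h y| <= e.
Proof.
move=> cZ ch e0.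
have ci i : continuous (fun y => h y ord0 i).
  by move=> y; apply: (@continuous_comp _ _ _ h (fun z : V => z ord0 i)); [exact: ch|exact: coord_continuous].
have /choice[pk pkP] i := lipschitz_approx cZ (ci i) e0.
have /choice[k kP] := pkP.
exists (fun y => \row_i pk i y), (n.+1%:R * \sum_i k i); split=> [y z|y Zy].
  rewrite -mulrA; apply: enorm_le_cst => i; rewrite !mxE.
  have [k0 kl _] := kP i; apply: (le_trans (kl y z)); rewrite ler_wpM2r ?enorm_ge0 //.
  rewrite (bigD1 i) //= lerDl sumr_ge0 // => j _; by have [/ltW] := kP j.
apply: ler_rV_norm => [|i]; first exact: ltW.
by rewrite !mxE; have [_ _] := kP i; apply.
Qed.

Lemma compact_norm_pos (G : V -> V) (Z : set V) : compact Z -> continuous G ->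
  (forall y, Z y -> G y != 0) -> exists2 m, 0 < m & forall y, Z y -> m <= `|G y|.
Proof.
move=> cZ cG GZ; have [Z0|/set0P/negP/negPn/eqP Z0] := pselect (Z !=set0); last first.
  by exists 1 => // y; rewrite Z0.
have cn : {within Z, continuous (fun y => - `|G y|)}.
  apply: continuous_subspaceT => y; apply: (@continuous_comp _ _ _ (fun y => `|G y|) -%R).
    by apply: (@continuous_comp _ _ _ G (fun z => `|z|)); [exact: cG|exact: norm_continuous].
  exact: opp_continuous.
have [c Zc cP] := compact_EVT_max Z0 cZ cn.
exists `|G c|; first by rewrite normr_gt0 GZ // -inE.
by move=> y Zy; rewrite -lerN2 cP // inE.
Qed.

(* Kulpa's argument: were [f x] on the boundary of the image, [g] could be
   perturbed near it into a map without zeros, against Poincare-Miranda. *)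
Lemma invariance_of_domain (D : set V) (f g : V -> V) : open D ->
  {within D, continuous f} -> (forall x, D x -> g (f x) = x) ->
  {within f @` D, continuous g} -> open (f @` D).
Proof.
move=> oD cf gf cg; rewrite openE => _ [x1 Dx1 <-]; rewrite /interior.
have /nbhs_ballP[r2 /= r20 r2D] : nbhs x1 D by exact: open_nbhs_nbhs.
pose r := r2 / 2; have r0 : 0 < r by rewrite divr_gt0.
pose a : V := x1 - const_mx r; pose b : V := x1 + const_mx r.
pose K := box a b.
have KE x : K x <-> `|x - x1| <= r.
  split=> [xK|xr i].
    by apply: ler_rV_norm => [|i]; [exact: ltW|have := xK i; rewrite !mxE ler_norml; lra].
  by have := le_trans (rV_coord_le_norm (x - x1) i) xr; rewrite !mxE ler_norml; lra.
have KD : K `<=` D.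
  move=> x /KE xr; apply: r2D; rewrite -ball_normE /= distrC; apply: (le_lt_trans xr).
  by rewrite /r ltr_pdivrMr //; lra.
have cK : compact K := box_compact (a := a) (b := b).
have cfK : {within K, continuous f} by exact: continuous_subspaceW cf.
have cF : compact (f @` K) := continuous_compact cfK cK.
have FD : f @` K `<=` f @` D by move=> _ [x /KD Dx <-]; exists x.
have cgF : {within f @` K, continuous g} by exact: continuous_subspaceW cg.
have clF : closed (f @` K) by apply: compact_closed => //; exact: norm_hausdorff.
(* Tietze's extension theorem, coordinate by coordinate: [G] extends g - x1 from the compact set
   f(K) to the whole space. *)
have /choice[G_ GP] i : exists G_ : V -> R, [/\ continuous G_,
    forall x, K x -> G_ (f x) = x ord0 i - x1 ord0 i & forall y, `|G_ y| <= r].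
  have [||G_ [fG cG Gr]] := @continuous_bounded_extension V R pseudometric_normal _ clF
      (fun y => (g y ord0 i - x1 ord0 i : R^o)) r r0.
  - apply/subspace_continuousP => y Fy.
    apply: cvgB; last exact: cvg_cst.
    move/subspace_continuousP : cgF => /(_ y Fy) gy.
    by apply: (cvg_comp _ (fun z : V => z ord0 i) gy); exact: coord_continuous.
  - move=> _ [x Kx <-]; rewrite gf; last exact: KD.
    by have := le_trans (rV_coord_le_norm (x - x1) i) ((KE x).1 Kx); rewrite !mxE.
  exists G_; split=> // x Kx; rewrite -fG; first by rewrite gf //; exact: KD.
  by rewrite inE; exists x.
pose G y : V := \row_i G_ i y.
have cG : continuous G by move=> y; apply: row_continuous_at => i; have [/(_ y)] := GP i.
have GfE x : K x -> G (f x) = x - x1.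
  by move=> Kx; apply/rowP => i; rewrite !mxE; have [_ ->] := GP i.
have Kx1 : K x1 by apply/KE; rewrite subrr normr0 ltW.
have Gx1 : G (f x1) = 0 by rewrite GfE // subrr.
have r4 : 0 < r / 4 by rewrite divr_gt0.
have /cvgrPdist_le /(_ _ r4) /nbhs_ballP[d2 /= d20 Gd] := cG (f x1).
pose d := d2 / 2; have d0 : 0 < d by rewrite divr_gt0.
have Gd' y : `|y - f x1| < d2 -> `|G y| <= r / 4.
  move=> yd; have := Gd y; rewrite -ball_normE /= Gx1 sub0r normrN; apply.
  by rewrite distrC.
apply: contrapT => nF.
(* If f(D) is not a neighbourhood of f x1, points outside f(K) lie arbitrarily near; [d] is so small
   that |G| <= r / 4 on the cube of radius [d] around [c]. *)
have [c [cd ncF]] : exists c, `|c - f x1| < d /\ ~ (f @` K) c.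
  apply: contrapT => /forallNP all; apply: nF; apply/nbhs_ballP; exists d => // y.
  rewrite -ball_normE /= distrC => yd; apply: FD; apply: contrapT => nFy.
  by apply: (all y).
have Qd y : `|y - c| <= d -> `|G y| <= r / 4.
  move=> yc; apply: Gd'; rewrite -[y - f x1](subrKA c); apply: (le_lt_trans (ler_normD _ _)).
  by rewrite (splitr d2) ler_ltD.
pose Z1 := f @` K `&` [set y | d <= `|y - c|].
have cZ1 : compact Z1.
  apply: (subclosed_compact _ cF); last exact: subIsetl.
  apply: closedI => //; apply: (@closed_comp _ _ (fun y : V => `|y - c|) [set t | d <= t]).
    by move=> y _; exact: norm_sub_continuous.
  exact: closed_ge.
have [m m0 mP] : exists2 m, 0 < m & forall y, Z1 y -> m <= `|G y|.
  apply: compact_norm_pos => // _ [[x Kx <-] /= dx]; rewrite GfE // subr_eq0.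
  by apply: contraPneq dx => ->; rewrite distrC; apply/negP; rewrite -ltNge.
pose Z := f @` K `|` box (c - const_mx d) (c + const_mx d).
have cZ : compact Z by apply: compactU => //; exact: box_compact.
(* An error of 2e has to stay below [m], to exclude zeros off the cube around [c], and together with
   two bounds r / 4 it has to stay within [r], to keep the signs on the faces of [K]. *)
pose e := Num.min (r / 4) (m / 4); have e0 : 0 < e by rewrite lt_min r4 divr_gt0.
have [P [k [Pk Pe]]] := lipschitz_approx_rV cZ cG e0.
have [v ve Pv] := avoid_value c d0 e0 Pk.
have er : e <= r / 4 by rewrite ge_min lexx.
have em : e <= m / 4 by rewrite ge_min lexx orbT.
have PG y : Z y -> `|P y - v - G y| <= 2 * e.
  move=> Zy; rewrite addrAC; apply: (le_trans (ler_normD _ _)).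
  by rewrite normrN mulr2n mulrDl mul1r lerD // Pe.
(* [s y] is max(d, |y - c|) / |y - c|: [Phi] pushes the punctured cube around [c] radially onto its
   boundary, where P - v has no zero, and fixes everything else. It is continuous on f(K) because
   [c] lies outside. *)
pose s (y : V) := (d + `|y - c| + `|d - `|y - c| |) / 2 / `|y - c|.
pose Phi (y : V) : V := c + s y *: (y - c).
have Phi1 y : d <= `|y - c| -> Phi y = y.
  move=> dy; rewrite /Phi /s ler0_norm ?subr_le0 // (_ : _ / 2 / _ = 1) ?scale1r ?subrKC //.
  by field; rewrite gt_eqF // (lt_le_trans d0).
have Phi2 y : y != c -> `|y - c| < d -> `|Phi y - c| = d.
  move=> yc yd; have yc0 : 0 < `|y - c| by rewrite normr_gt0 subr_eq0.
  have -> : Phi y - c = (d / `|y - c|) *: (y - c).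
    rewrite /Phi addrAC subrr add0r; congr (_ *: _); rewrite /s gtr0_norm ?subr_gt0 //.
    by field; rewrite gt_eqF.
  by rewrite normrZ normrM normfV normr_id gtr0_norm // divfK // gt_eqF.
pose F x := P (Phi (f x)) - v.
have Kne x : K x -> f x != c by move=> Kx; apply/eqP => fc; apply: ncF; exists x.
have FK x : K x -> `|F x - (x - x1)| <= r /\ F x != 0.
  move=> Kx; rewrite -GfE // /F; have [dx|dx] := leP d `|f x - c|.
    have Zx : Z (f x) by left; exists x.
    rewrite Phi1 //; split; first by apply: (le_trans (PG _ Zx)); lra.
    apply/eqP => F0; have := PG _ Zx; rewrite F0 sub0r normrN.
    have : m <= `|G (f x)| by apply: mP; split=> //; exists x.
    by lra.
  have pd := Phi2 _ (Kne _ Kx) dx.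
  split; last by rewrite subr_eq0; exact: Pv.
  have Zp : Z (Phi (f x)).
    right => i; have := rV_coord_le_norm (Phi (f x) - c) i.
    by rewrite pd !mxE ler_norml; lra.
  have h1 := PG _ Zp.
  have h2 : `|G (Phi (f x))| <= r / 4 by apply: Qd; rewrite pd.
  have h3 : `|G (f x)| <= r / 4 by apply: Qd; exact: ltW.
  have -> : P (Phi (f x)) - v - G (f x) =
    (P (Phi (f x)) - v - G (Phi (f x))) + (G (Phi (f x)) - G (f x)) by rewrite subrKA.
  apply: (le_trans (ler_normD _ _)); have := ler_normB (G (Phi (f x))) (G (f x)).
  by lra.
have cPhi (y : V) : y != c -> {for y, continuous Phi}.
  move=> yc; have yc0 : `|y - c| != 0 by rewrite normr_eq0 subr_eq0.
  have ct : {for y, continuous (fun y : V => `|y - c|)} by exact: norm_sub_continuous.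
  have -> : Phi = fun y => \row_i (c ord0 i + s y * (y - c) ord0 i).
    by apply/funext => z; apply/rowP => i; rewrite !mxE.
  apply: row_continuous_at => i.
  apply: (@retraction_continuous V (fun y => `|y - c|) (fun y => (y - c) ord0 i)) => //.
  apply: (@continuous_comp _ _ _ (fun y : V => y - c) (fun z : V => z ord0 i)).
    exact: subr_continuous_rV.
  exact: coord_continuous.
have cFc : {within K, continuous F}.
  apply/subspace_continuousP => x Kx; move/subspace_continuousP : cfK => /(_ x Kx) fx.
  have h1 := cvg_comp _ _ fx (cPhi _ (Kne _ Kx)).
  have cP : continuous P := lipschitz_continuous_rV Pk.
  have cv := @subr_continuous_rV v.
  have h2 := cvg_comp _ _ h1 (cP (Phi (f x))).
  exact: (cvg_comp _ _ h2 (cv (P (Phi (f x))))).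
have ab i : a ord0 i < b ord0 i by rewrite !mxE; lra.
have [||x Kx F0] := poincare_miranda ab cFc.
- move=> x i Kx xa; have [Fr _] := FK _ Kx.
  by have := le_trans (rV_coord_le_norm _ i) Fr; move: xa; rewrite !mxE ler_norml; lra.
- move=> x i Kx xb; have [Fr _] := FK _ Kx.
  by have := le_trans (rV_coord_le_norm _ i) Fr; move: xb; rewrite !mxE ler_norml; lra.
by have [_ /eqP] := FK _ Kx.
Qed.

End invariance_of_domain.

(** * Arc length *)

Section arc_length.
Context {R : realType} {n : nat}.
Notation V := 'rV[R]_n.

Lemma within_segment_continuous (g : R -> V) (a b : R) u (e : R) :
  {within `[a, b], continuous g} -> a <= u <= b -> 0 < e ->
  exists2 d, 0 < d & forall v, a <= v <= b -> `|v - u| < d -> enorm (g v - g u) < e.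
Proof.
move=> /subspace_continuousP cg uab e0.
have n0 : 0 < e / n.+1%:R by rewrite divr_gt0.
have := cg u _ _ (nbhsx_ballx (g u) (e / n.+1%:R) n0); rewrite /= in_itv /= uab => /(_ isT).
move=> /nbhs_ballP[d /= d0 dP]; exists d => // v vab vu.
have := dP v; rewrite -ball_normE /= distrC in_itv /= vab => /(_ vu isT).
rewrite -ball_normE /= distrC => gvu; apply: (le_lt_trans (enorm_le_norm _)).
move: gvu; rewrite ltr_pdivlMr // mulrC; apply: le_lt_trans.
by rewrite ler_wpM2r // ler_nat.
Qed.

Variable (gm : cpath) (cgm : @is_cpath R n gm) (rgm : rectifiable gm).
Local Notation g := (Defs.pmap gm).
Local Notation a := (pa gm).
Local Notation b := (pb gm).
Local Notation len := (arclen gm).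

Let ab : a < b. Proof. by case: cgm. Qed.
Let cg : {within `[a, b], continuous g}. Proof. by case: cgm. Qed.

Lemma plength_ge0 c d : c <= d -> (0 <= plength g c d)%E.
Proof.
move=> cd; apply: (@le_trans _ _ (enorm (g d - g c))%:E); first by rewrite lee_fin enorm_ge0.
apply: ereal_sup_ubound; exists 1%N, (fun i => if i is 0%N then c else d); split=> //.
  by move=> [|i].
by rewrite big_ord1.
Qed.

Lemma plength_append c t t' : c <= t -> t <= t' ->
  (plength g c t + (enorm (g t' - g t))%:E <= plength g c t')%E.
Proof.
move=> ct tt'; have fin : (enorm (g t' - g t))%:E \is a fin_num by [].
rewrite -leeBrDr //; apply: ge_ereal_sup => _ [k [s [s0 sk sm ->]]].
rewrite leeBrDr // -EFinD; apply: ereal_sup_ubound.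
exists k.+1, (fun i => if (i <= k)%N then s i else t'); split=> //.
- by rewrite ltnn.
- move=> i; rewrite ltnS => ik; rewrite ik; case: ltnP => ik'; first exact: sm.
  by rewrite (_ : i = k) ?sk //; apply/eqP; rewrite eqn_leq ik.
congr EFin; rewrite big_ord_recr /= ltnn leqnn sk; congr (_ + _).
by apply: eq_bigr => i _; rewrite (ltnW (ltn_ord i)) ltn_ord.
Qed.

Let pfin t : a <= t <= b -> plength g a t \is a fin_num.
Proof.
move=> /andP[ta tb]; rewrite ge0_fin_numE ?plength_ge0 //; apply: le_lt_trans rgm.
by apply: le_trans (plength_append ta tb); rewrite leeDl // lee_fin enorm_ge0.
Qed.

Lemma arclen_enorm t t' : a <= t -> t <= t' -> t' <= b ->
  enorm (g t' - g t) <= len t' - len t.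
Proof.
move=> ta tt' tb; rewrite lerBrDl -lee_fin EFinD /arclen.
rewrite !fineK ?pfin ?plength_append ?ta ?tb ?(le_trans tt' tb) ?(le_trans ta tt') //.
Qed.

Lemma arclen_le t t' : a <= t -> t <= t' -> t' <= b -> len t <= len t'.
Proof.
by move=> ta tt' tb; rewrite -subr_ge0 (le_trans _ (arclen_enorm ta tt' tb)) // enorm_ge0.
Qed.

Lemma arclen_ge0 t : a <= t <= b -> 0 <= len t.
Proof. by move=> /andP[ta tb]; rewrite fine_ge0 // plength_ge0. Qed.

Let A s := [set t | a <= t <= b /\ s <= len t].
Let ti s := inf (A s).

Let A_b s : s <= len b -> A s b.
Proof. by move=> sb; split=> //; rewrite lexx ltW. Qed.

Let A_inf s : s <= len b -> has_inf (A s).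
Proof.
by move=> sb; split; [exists b; exact: A_b|exists a => t [/andP[]]].
Qed.

Let ti_ab s : s <= len b -> a <= ti s <= b.
Proof.
move=> sb; apply/andP; split; first by apply: lb_le_inf => [|t [/andP[]]//]; exists b; exact: A_b.
by apply: ge_inf; [case: (A_inf sb)|exact: A_b].
Qed.

Let ti_lt s t : s <= len b -> a <= t -> t < ti s -> len t < s.
Proof.
move=> sb ta tt; rewrite ltNge; apply/negP => st.
have /andP[_ tib] := ti_ab sb.
have : ti s <= t.
  apply: ge_inf; first by case: (A_inf sb).
  by split=> //; rewrite ta (le_trans (ltW tt)).
by rewrite leNgt tt.
Qed.

Let ti_gt s t : s <= len b -> ti s < t -> t <= b -> s <= len t.
Proof.
move=> sb tt tb; have [t' [/andP[t'a t'b] st'] t't] := inf_lt (A_inf sb).1 tt.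
by apply: (le_trans st'); apply: arclen_le => //; exact: ltW.
Qed.

Lemma normal_rep0 : normal_rep gm 0 = g a.
Proof.
rewrite /normal_rep; congr g; apply/eqP; rewrite eq_le; apply/andP; split.
  apply: ge_inf; first by exists a => t [/andP[]].
  by rewrite /= lexx (ltW ab) arclen_ge0 // lexx ltW.
by apply: lb_le_inf => [|t [/andP[]]//]; exists b; apply: A_b; rewrite arclen_ge0 // lexx ltW.
Qed.

(** The infimum of the parameters of full length may precede [b]; beyond it no length is left, so
    the curve is constant there, and continuity reaches the infimum itself. *)
Lemma normal_rep_end : normal_rep gm (len b) = g b.
Proof.
rewrite /normal_rep -/(A (len b)) -/(ti (len b)).
have /andP[ta tb] := ti_ab (lexx (len b)).
have [tE|tltb] := eqVneq (ti (len b)) b; first by rewrite tE.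
have tib : ti (len b) < b by rewrite lt_neqAle tltb.
apply/eqP; rewrite -subr_eq0; apply/eqP/enorm_eq0/eqP; rewrite eq_le enorm_ge0 andbT.
apply/ler_addgt0Pr => e e0; rewrite add0r.
have [d d0 dP] := within_segment_continuous cg (ti_ab (lexx (len b))) e0.
pose t := Num.min b (ti (len b) + d / 2).
have t1 : ti (len b) < t by rewrite lt_min tib ltrDl divr_gt0.
have t2 : t <= b by rewrite ge_min lexx.
have t3 : `|t - ti (len b)| < d.
  rewrite gtr0_norm ?subr_gt0 // ltrBlDl (@le_lt_trans _ _ (ti (len b) + d / 2)) //.
    by rewrite ge_min lexx orbT.
  by rewrite ltrD2l ltr_pdivrMr //; lra.
have ta' : a <= t by apply: ltW; exact: le_lt_trans t1.
have lt := ti_gt (lexx _) t1 t2.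
have gtb : g t = g b.
  apply/eqP; rewrite eq_sym -subr_eq0; apply/eqP/enorm_eq0/eqP; rewrite eq_le enorm_ge0 andbT.
  by apply: (le_trans (arclen_enorm ta' t2 (lexx _))); rewrite subr_le0.
by rewrite enormB -gtb ltW // dP // ta' t2.
Qed.

(** [ti s] is only an infimum, so lengths are compared at parameters slightly inside the interval
    from [ti s] to [ti s']; continuity of the curve accounts for the two ends. *)
Lemma normal_rep_lipschitz s s' : 0 <= s -> s <= s' -> s' <= len b ->
  enorm (normal_rep gm s' - normal_rep gm s) <= s' - s.
Proof.
move=> s0 ss' s'b; have sb := le_trans ss' s'b.
rewrite /normal_rep -/(A s) -/(A s') -/(ti s) -/(ti s').
have /andP[ta tb] := ti_ab sb; have /andP[t'a t'b] := ti_ab s'b.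
have tt' : ti s <= ti s'.
  apply: lb_le_inf; first by exists b; exact: A_b.
  move=> t [tab st]; apply: ge_inf; first by case: (A_inf sb).
  by split=> //; exact: le_trans st.
have [<-|ne] := eqVneq (ti s) (ti s'); first by rewrite subrr enorm0 subr_ge0.
have {ne}tt' : ti s < ti s' by rewrite lt_neqAle ne.
apply/ler_addgt0Pr => e e0; have e2 : 0 < e / 2 by rewrite divr_gt0.
have [d d0 dP] := within_segment_continuous cg (ti_ab sb) e2.
have [d' d'0 d'P] := within_segment_continuous cg (ti_ab s'b) e2.
pose m := Num.min (Num.min d d') (ti s' - ti s).
have m0 : 0 < m by rewrite !lt_min d0 d'0 subr_gt0.
have md : m <= d by rewrite !ge_min lexx.
have md' : m <= d' by rewrite !ge_min lexx orbT.
have mt : m <= ti s' - ti s by rewrite ge_min lexx orbT.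
pose t := ti s + m / 3; pose t' := ti s' - m / 3.
have tab : a <= t <= b by rewrite /t; lra.
have t'ab : a <= t' <= b by rewrite /t'; lra.
have h1 : enorm (g t - g (ti s)) < e / 2.
  by apply: dP => //; rewrite /t addrAC subrr add0r gtr0_norm; lra.
have h2 : enorm (g t' - g (ti s')) < e / 2.
  by apply: d'P => //; rewrite /t' addrAC subrr add0r normrN gtr0_norm; lra.
have l1 : s <= len t by apply: ti_gt; rewrite /t; lra.
have l2 : len t' < s' by apply: ti_lt; rewrite /t'; lra.
have h3 : enorm (g t' - g t) <= len t' - len t by apply: arclen_enorm; rewrite /t /t'; lra.
have := enorm_tri (g (ti s')) (g t') (g (ti s)); have := enorm_tri (g t') (g t) (g (ti s)).
by rewrite (enormB (g (ti s')) (g t')); lra.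
Qed.

Lemma normal_rep_image s : s <= len b -> exists2 t, a <= t <= b & normal_rep gm s = g t.
Proof. by move=> sb; exists (ti s); first exact: ti_ab. Qed.

End arc_length.

(** * Inequalities for powers *)

Section power_inequalities.
Context {R : realType}.
Implicit Types x y z w p q s : R.

(** Young's inequality for x and w^(q-1), with exponents q and q / (q-1). *)
Lemma powR_tangent x w q : 1 <= q -> 0 <= x -> 0 <= w ->
  w `^ q + q * w `^ (q - 1) * (x - w) <= x `^ q.
Proof.
rewrite le_eqVlt => /orP[/eqP <-|q1] x0 w0.
  by rewrite subrr powRr0 !powRr1 // mulr1 mul1r subrKC.
have q0 : 0 < q by lra.
have qm : 0 < q - 1 by lra.
have := @conjugate_powR R x (w `^ (q - 1)) q (q / (q - 1)) x0 (powR_ge0 _ _) q0 (divr_gt0 q0 qm).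
rewrite -powRrM mulrCA divff ?gt_eqF // mulr1 => /(_ _) h.
have {h} : x * w `^ (q - 1) <= x `^ q / q + w `^ q / (q / (q - 1)).
  by apply: h; field; rewrite !gt_eqF.
rewrite -(ler_pM2l q0) mulrDr.
have -> : q * (x `^ q / q) = x `^ q by rewrite mulrC divfK // gt_eqF.
have -> : q * (w `^ q / (q / (q - 1))) = (q - 1) * w `^ q by field; rewrite !gt_eqF.
have := mulr_powRB1 w0 q0 => <-; nra.
Qed.

Lemma powR_subadditive x z s : 0 < s <= 1 -> 0 <= x -> 0 <= z ->
  (x + z) `^ s <= x `^ s + z `^ s.
Proof.
move=> /andP[s0 s1] x0 z0; have [w0|w0] := eqVneq (x + z) 0.
  by rewrite w0 powR0 ?gt_eqF // addr_ge0 ?powR_ge0.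
have wp : 0 < x + z by rewrite lt_neqAle eq_sym w0 addr_ge0.
have key u : 0 <= u -> u <= x + z -> (x + z) `^ s * (u / (x + z)) <= u `^ s.
  move=> u0 uw; rewrite -[leRHS](_ : (x + z) `^ s * (u / (x + z)) `^ s = _).
    rewrite ler_wpM2l ?powR_ge0 //; have [->|un] := eqVneq u 0.
      by rewrite mul0r powR_ge0.
    have up : 0 < u by rewrite lt_neqAle eq_sym un.
    rewrite -[leLHS]powRr1 ?divr_ge0 ?(ltW wp) //; apply: ger_powR => //.
    by rewrite divr_gt0 // ler_pdivrMr // mul1r.
  by rewrite -powRM ?divr_ge0 ?(ltW wp) // mulrC divfK.
have := key x x0; have := key z z0; rewrite lerDl lerDr => /(_ x0) h1 /(_ z0) h2.
apply: le_trans (lerD h2 h1); rewrite -mulrDr -mulrDl divff // mulr1 //.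
Qed.

Lemma powR_superadditive x z s : 1 <= s -> 0 <= x -> 0 <= z ->
  x `^ s + z `^ s <= (x + z) `^ s.
Proof.
move=> s1 x0 z0; have s0 : s != 0 by rewrite gt_eqF //; lra.
have [w0|w0] := eqVneq (x + z) 0.
  have [-> ->] : x = 0 /\ z = 0 by split; lra.
  by rewrite addr0 powR0 // addr0.
have wp : 0 < x + z by rewrite lt_neqAle eq_sym w0 addr_ge0.
have key u : 0 <= u -> u <= x + z -> u `^ s <= (x + z) `^ s * (u / (x + z)).
  move=> u0 uw; rewrite -[leLHS](_ : (x + z) `^ s * (u / (x + z)) `^ s = _).
    rewrite ler_wpM2l ?powR_ge0 //; have [->|un] := eqVneq u 0.
      by rewrite mul0r powR0.
    have up : 0 < u by rewrite lt_neqAle eq_sym un.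
    rewrite -[leRHS]powRr1 ?divr_ge0 ?(ltW wp) //; apply: ger_powR => //.
    by rewrite divr_gt0 // ler_pdivrMr // mul1r.
  by rewrite -powRM ?divr_ge0 ?(ltW wp) // mulrC divfK.
have := key x x0; have := key z z0; rewrite lerDl lerDr => /(_ x0) h1 /(_ z0) h2.
apply: (le_trans (lerD h2 h1)); rewrite -mulrDr -mulrDl divff // mulr1 //.
Qed.

Lemma powR_convex x y s q : 1 <= q -> 0 <= x -> 0 <= y -> 0 <= s <= 1 ->
  ((1 - s) * x + s * y) `^ q <= (1 - s) * x `^ q + s * y `^ q.
Proof.
move=> q1 x0 y0 /andP[s0 s1]; set c := (1 - s) * x + s * y.
have c0 : 0 <= c by rewrite addr_ge0 // mulr_ge0 // subr_ge0.
have hx := powR_tangent q1 x0 c0; have hy := powR_tangent q1 y0 c0.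
have s1' : 0 <= 1 - s by rewrite subr_ge0.
have := lerD (ler_wpM2l s1' hx) (ler_wpM2l s0 hy); apply: le_trans.
rewrite le_eqVlt; apply/orP; left; apply/eqP.
by rewrite /c; ring.
Qed.

(** Convexity at the points x / (1-s) and y / s. For small [s] the first coefficient is close to 1;
    the second is large, but meets a small term in [ziemer]. *)
Lemma powR_split x y s q : 1 <= q -> 0 <= x -> 0 <= y -> 0 < s < 1 ->
  (x + y) `^ q <= (1 - s) `^ (1 - q) * x `^ q + s `^ (1 - q) * y `^ q.
Proof.
move=> q1 x0 y0 /andP[s0 s1]; have s1' : 0 < 1 - s by rewrite subr_gt0.
have := @powR_convex (x / (1 - s)) (y / s) s q q1.
rewrite !divr_ge0 ?(ltW s0) ?(ltW s1') //= => /(_ isT isT); rewrite (ltW s1) => /(_ isT).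
have E (t u : R) : 0 < t -> t * (u / t) = u by move=> t0; rewrite mulrCA divff ?mulr1 // gt_eqF.
have F (t u : R) : 0 < t -> 0 <= u -> t * (u / t) `^ q = t `^ (1 - q) * u `^ q.
  move=> t0 u0; rewrite powRM // ?invr_ge0 ?(ltW t0) // mulrCA mulrC; congr (_ * _).
  rewrite -(powR_inv1 (ltW t0)) -powRrM mulN1r -[X in X * _]powRr1 ?(ltW t0) // -powRD //.
  by apply/implyP => _; rewrite gt_eqF.
by rewrite !E // !F.
Qed.

(** The tangent at x + z, then subadditivity of the power p - 1 <= 1; this is where p <= 2
    enters. *)
Lemma powR_add_le x z p : 1 < p <= 2 -> 0 <= x -> 0 <= z ->
  (x + z) `^ p <= x `^ p + p * (x `^ (p - 1) * z) + p * z `^ p.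
Proof.
move=> /andP[p1 p2] x0 z0; have xz0 : 0 <= x + z by rewrite addr_ge0.
have := powR_tangent (ltW p1) x0 xz0.
have -> : x - (x + z) = - z by rewrite opprD addrA subrr sub0r.
have : (x + z) `^ (p - 1) <= x `^ (p - 1) + z `^ (p - 1) by apply: powR_subadditive => //; lra.
have := @mulr_powRB1 R z p z0 (lt_trans ltr01 p1) => <-.
move: ((x + z) `^ (p - 1)) (x `^ (p - 1)) (z `^ (p - 1)) => A B C h1 h2.
have : p * z * A <= p * z * (B + C) by rewrite ler_wpM2l // mulr_ge0 //; lra.
nra.
Qed.

(** The parallelogram law for squares, between superadditivity and convexity of the power q / 2 >=
    1. *)
Lemma clarkson x y q : 2 <= q -> 0 <= x -> 0 <= y ->
  ((x + y) / 2) `^ q + (`|x - y| / 2) `^ q <= (x `^ q + y `^ q) / 2.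
Proof.
move=> q2 x0 y0; pose s := q / 2; have s1 : 1 <= s by rewrite /s; lra.
have sq u : 0 <= u -> u `^ q = (u ^+ 2) `^ s.
  by move=> u0; rewrite -powR_mulrn // -powRrM /s mulrC divfK.
have xy0 : 0 <= (x + y) / 2 by rewrite divr_ge0 // addr_ge0.
have d0 : 0 <= `|x - y| / 2 by rewrite divr_ge0.
rewrite !sq //; apply: (le_trans (powR_superadditive s1 (sqr_ge0 _) (sqr_ge0 _))).
have -> : ((x + y) / 2) ^+ 2 + (`|x - y| / 2) ^+ 2 = (1 - 2^-1) * x ^+ 2 + 2^-1 * y ^+ 2.
  by rewrite [(`|_| / _) ^+ 2]exprMn real_normK ?num_real //; field.
apply: (le_trans (powR_convex s1 (sqr_ge0 _) (sqr_ge0 _) _)); first lra.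
by rewrite le_eqVlt; apply/orP; left; apply/eqP; field.
Qed.

End power_inequalities.

Section ereal_powers.
Context {R : realType}.
Local Open Scope ereal_scope.
Implicit Types x y : \bar R.

Lemma le_poweR x y (r : R) : (0 <= r)%R -> 0 <= x -> x <= y -> x `^ r <= y `^ r.
Proof.
move=> r0 x0 xy; apply: gt0_ler_poweR => //; rewrite in_itv /= leey andbT //.
exact: le_trans xy.
Qed.

Lemma ge0_addye x : 0 <= x -> +oo + x = +oo. Proof. by case: x. Qed.
Lemma ge0_addey x : 0 <= x -> x + +oo = +oo. Proof. by case: x. Qed.

Lemma poweRy_gt0 (r : R) : (0 < r)%R -> +oo `^ r = +oo.
Proof. by move=> r0; rewrite poweRyr // gt_eqF. Qed.

Lemma poweR_poweR x (r s : R) : (0 < r)%R -> (0 < s)%R -> 0 <= x -> (x `^ r) `^ s = x `^ (r * s)%R.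
Proof.
move=> r0 s0; case: x => [u| |] // u0; last by rewrite !poweRy_gt0 // mulr_gt0.
by rewrite !poweR_EFin powRrM.
Qed.

Lemma expe_poweR x k : 0 <= x -> x ^+ k.+1 = x `^ k.+1%:R.
Proof.
case: x => [u| |] // u0; first by rewrite poweR_EFin powR_mulrn // EFin_expe.
rewrite poweRy_gt0 ?ltr0n //; elim: k => [|k IH]; first by [].
by rewrite expeS IH mulyy.
Qed.

Lemma poweR_add_le x z (p : R) : (1 < p <= 2)%R -> 0 <= x -> 0 <= z ->
  (x + z) `^ p <= x `^ p + p%:E * (x `^ (p - 1) * z) + p%:E * z `^ p.
Proof.
move=> p12; have /andP[p1 p2] := p12; have p0 : (0 < p)%R by lra.
have pp x' : 0 <= p%:E * x' `^ p by rewrite mule_ge0 ?poweR_ge0 // lee_fin ltW.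
case: x => [u| |] //; case: z => [v| |] // u0 v0.
- by rewrite -EFinD !poweR_EFin -!(EFinM, EFinD) lee_fin; exact: powR_add_le.
- rewrite [X in _ <= _ + X](_ : _ = +oo); last by rewrite poweRy_gt0 // gt0_muley ?lte_fin.
  by rewrite [leRHS]ge0_addey ?leey // adde_ge0 ?poweR_ge0 // !mule_ge0 ?poweR_ge0 // lee_fin ltW.
- rewrite [X in _ <= X + _ + _](_ : _ = +oo); last by rewrite poweRy_gt0.
  by rewrite [X in _ <= X + _]ge0_addye ?[leRHS]ge0_addye ?leey // !mule_ge0 ?poweR_ge0 // lee_fin ltW.
- rewrite [X in _ <= X + _ + _](_ : _ = +oo); last by rewrite poweRy_gt0.
  by rewrite [X in _ <= X + _]ge0_addye ?[leRHS]ge0_addye ?leey // !mule_ge0 ?poweR_ge0 // lee_fin ltW.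
Qed.

Lemma poweR_split x y (s q : R) : (1 <= q)%R -> 0 <= x -> 0 <= y -> (0 < s < 1)%R ->
  (x + y) `^ q <= ((1 - s) `^ (1 - q))%:E * x `^ q + (s `^ (1 - q))%:E * y `^ q.
Proof.
move=> q1 + + s01; have /andP[s0 s1] := s01; have q0 : (0 < q)%R by lra.
have p1 : 0 < ((1 - s) `^ (1 - q))%:E by rewrite lte_fin powR_gt0 // subr_gt0.
have p2 : 0 < (s `^ (1 - q))%:E by rewrite lte_fin powR_gt0.
case: x => [u| |] //; case: y => [v| |] // u0 v0.
- by rewrite -EFinD !poweR_EFin -!(EFinM, EFinD) lee_fin; exact: powR_split.
- rewrite [X in _ <= _ + X](_ : _ = +oo); last by rewrite poweRy_gt0 // gt0_muley.
  by rewrite [leRHS]ge0_addey ?leey // mule_ge0 ?poweR_ge0 // ltW.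
- rewrite [X in _ <= X + _](_ : _ = +oo); last by rewrite poweRy_gt0 // gt0_muley.
  by rewrite [leRHS]ge0_addye ?leey // mule_ge0 ?poweR_ge0 // ltW.
- rewrite [X in _ <= X + _](_ : _ = +oo); last by rewrite poweRy_gt0 // gt0_muley.
  by rewrite [leRHS]ge0_addye ?leey // mule_ge0 ?poweR_ge0 // ltW.
Qed.

Lemma clarkson_ereal x y (q : R) : (2 <= q)%R -> 0 <= x -> 0 <= y ->
  (2^-1%:E * (x + y)) `^ q + (2^-1%:E * `|x - y|) `^ q <= 2^-1%:E * (x `^ q + y `^ q).
Proof.
move=> q2; have q0 : (0 < q)%R by lra.
have h2 : 0 < (2^-1 : R)%:E by rewrite lte_fin invr_gt0.
case: x => [u| |] //; case: y => [v| |] // u0 v0.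
- rewrite [leLHS](_ : _ = ((2^-1 * (u + v)) `^ q + (2^-1 * `|u - v|) `^ q)%:E); last first.
    by rewrite EFinD -!poweR_EFin.
  rewrite !poweR_EFin -EFinD -EFinM lee_fin.
  by rewrite ![(2^-1 * _)%R]mulrC; exact: clarkson.
- rewrite [X in _ <= _ * (_ + X)](_ : _ = +oo); last by rewrite poweRy_gt0.
  by rewrite [X in _ <= _ * X]ge0_addey ?poweR_ge0 // [leRHS]gt0_muley ?leey.
- rewrite [X in _ <= _ * (X + _)](_ : _ = +oo); last by rewrite poweRy_gt0.
  by rewrite [X in _ <= _ * X]ge0_addye ?poweR_ge0 // [leRHS]gt0_muley ?leey.
- rewrite [X in _ <= _ * (X + _)](_ : _ = +oo); last by rewrite poweRy_gt0.
  by rewrite [X in _ <= _ * X]ge0_addye ?poweR_ge0 // [leRHS]gt0_muley ?leey.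
Qed.

Lemma young_ereal x y (p q : R) : (0 < p)%R -> (0 < q)%R -> (p^-1 + q^-1 = 1)%R ->
  0 <= x -> 0 <= y -> x * y <= p^-1%:E * x `^ p + q^-1%:E * y `^ q.
Proof.
move=> p0 q0 pq; have pi : 0 < (p^-1)%:E by rewrite lte_fin invr_gt0.
have qi : 0 < (q^-1)%:E by rewrite lte_fin invr_gt0.
case: x => [u| |] //; case: y => [v| |] // u0 v0.
- rewrite !poweR_EFin -!(EFinM, EFinD) lee_fin [(p^-1 * _)%R]mulrC [(q^-1 * _)%R]mulrC.
  exact: conjugate_powR.
- rewrite [X in _ <= _ + X](_ : _ = +oo); last by rewrite poweRy_gt0 // gt0_muley.
  by rewrite [leRHS]ge0_addey ?leey // mule_ge0 ?poweR_ge0 // ltW.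
- rewrite [X in _ <= X + _](_ : _ = +oo); last by rewrite poweRy_gt0 // gt0_muley.
  by rewrite [leRHS]ge0_addye ?leey // mule_ge0 ?poweR_ge0 // ltW.
- rewrite [X in _ <= X + _](_ : _ = +oo); last by rewrite poweRy_gt0 // gt0_muley.
  by rewrite [leRHS]ge0_addye ?leey // mule_ge0 ?poweR_ge0 // ltW.
Qed.

End ereal_powers.

(** * Borel functions *)

Section borel_functions.
Local Open Scope ereal_scope.
Context {R : realType} {n : nat}.
Notation V := 'rV[R]_n.

(** A copy of the space carrying the Borel sigma-algebra, which turns [borel_fun] into
    [measurable_fun]. *)
Definition borelType : Type := g_sigma_algebraType [set U : set V | open U].
HB.instance Definition _ := Measurable.on borelType.

Lemma borel_funP (f : V -> \bar R) :
  borel_fun f <-> measurable_fun [set: borelType] (f : borelType -> \bar R).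
Proof.
split=> [bf|mf t]; first by apply: emeasurable_gt => t; rewrite setTI; exact: bf.
by have := emeasurable_fun_o_infty measurableT mf t%:E; rewrite setTI.
Qed.

Lemma borel_fun_cst (c : \bar R) : borel_fun (fun _ : V => c).
Proof. by apply/borel_funP; exact: measurable_cst. Qed.

Lemma borel_funD (f g : V -> \bar R) : borel_fun f -> borel_fun g -> borel_fun (fun x => f x + g x).
Proof. by move=> /borel_funP mf /borel_funP mg; apply/borel_funP; exact: emeasurable_funD. Qed.

Lemma borel_funM (f g : V -> \bar R) : borel_fun f -> borel_fun g -> borel_fun (fun x => f x * g x).
Proof. by move=> /borel_funP mf /borel_funP mg; apply/borel_funP; exact: emeasurable_funM. Qed.

Lemma borel_fun_max (f g : V -> \bar R) : borel_fun f -> borel_fun g -> borel_fun (fun x => maxe (f x) (g x)).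
Proof. by move=> /borel_funP mf /borel_funP mg; apply/borel_funP; exact: measurable_maxe. Qed.

Lemma borel_fun_dist (f g : V -> \bar R) : borel_fun f -> borel_fun g -> borel_fun (fun x => `|f x - g x|).
Proof.
move=> /borel_funP mf /borel_funP mg; apply/borel_funP.
by apply: measurableT_comp; [exact: abse_measurable|exact: emeasurable_funB].
Qed.

Lemma borel_fun_poweR (f : V -> \bar R) (r : R) : borel_fun f -> borel_fun (fun x => f x `^ r).
Proof.
move=> /borel_funP mf; apply/borel_funP.
exact: (measurableT_comp (measurable_poweR r) mf).
Qed.

Lemma borel_fun_indic (A : set V) : borel_set A -> borel_fun (fun x => (\1_A x)%:E).
Proof.
by move=> bA; apply/borel_funP/measurable_EFinP; exact: (@measurable_indic _ borelType R setT A).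
Qed.

Lemma borel_fun_sup (f : nat -> V -> \bar R) : (forall k, borel_fun (f k)) ->
  borel_fun (fun x => ereal_sup (range (f ^~ x))).
Proof.
move=> bf t; rewrite [X in borel_set X](_ : _ = \bigcup_k [set x | t%:E < f k x]).
  by apply: borel_bigcup => k; exact: bf.
apply/seteqP; split=> x /=.
  by move=> /ereal_sup_gt[_ [k _ <-] tk]; exists k.
by move=> [k _ /= tk]; apply: (lt_le_trans tk); apply: ereal_sup_ubound; exists k.
Qed.

Lemma borel_cara_fun (mu : {outer_measure set V -> \bar R}) (f : V -> \bar R) :
  borel_outer mu -> borel_fun f -> cara_fun mu f.
Proof. by move=> bmu bf t; apply: borel_caratheodory => //; exact: bf. Qed.

Lemma borel_measurable_fun (mu : {outer_measure set V -> \bar R}) (f : V -> \bar R) (D : set V) :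
  borel_outer mu -> borel_fun f -> measurable_fun (D : set (caratheodory_type mu)) f.
Proof. by move=> bmu bf; apply: cara_fun_measurable; exact: borel_cara_fun. Qed.

Lemma borel_lcintE (mu : {outer_measure set V -> \bar R}) (A : set V) (f : V -> \bar R) :
  borel_outer mu -> borel_set A -> borel_fun f -> (forall x, 0 <= f x) ->
  lcint mu A f = \int[cmeas mu]_(x in A) f x.
Proof.
move=> bmu bA bf f0; apply: lcintE => //; first exact: borel_caratheodory.
exact: borel_cara_fun.
Qed.

Lemma borel_setT : borel_set [set: V].
Proof. by apply: open_borel; exact: openT. Qed.

Variable mu : {outer_measure set V -> \bar R}.
Hypothesis bmu : borel_outer mu.

Lemma lcintD (A : set V) (f g : V -> \bar R) : borel_set A -> borel_fun f -> borel_fun g ->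
  (forall x, 0 <= f x) -> (forall x, 0 <= g x) ->
  lcint mu A (fun x => f x + g x) = lcint mu A f + lcint mu A g.
Proof.
move=> bA bf bg f0 g0; rewrite !borel_lcintE //; last 2 first.
- exact: borel_funD.
- by move=> x; rewrite adde_ge0.
by rewrite ge0_integralD //; [exact: borel_caratheodory| |]; exact: borel_measurable_fun.
Qed.

Lemma lcintZl (A : set V) (c : \bar R) (f : V -> \bar R) : borel_set A -> borel_fun f ->
  (forall x, 0 <= f x) -> 0 <= c ->
  lcint mu A (fun x => c * f x) = c * lcint mu A f.
Proof.
move=> bA bf f0 c0; rewrite !borel_lcintE //; last 2 first.
- by apply: borel_funM => //; exact: borel_fun_cst.
- by move=> x; rewrite mule_ge0.
by rewrite ge0_integralZl //; [exact: borel_caratheodory|exact: borel_measurable_fun].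
Qed.

Lemma lcint_indic (A B : set V) : borel_set A -> borel_set B ->
  lcint mu A (fun x => (\1_B x)%:E) = mu (B `&` A).
Proof.
move=> bA bB; rewrite borel_lcintE //; last exact: borel_fun_indic.
by rewrite (integral_indic (cmeas mu)) //; exact: borel_caratheodory.
Qed.

Lemma lcint_sup (f : nat -> V -> \bar R) (X : \bar R) : (forall k, borel_fun (f k)) ->
  (forall k x, 0 <= f k x) -> (forall k x, f k x <= f k.+1 x) ->
  (forall k, lcint mu setT (f k) <= X) ->
  lcint mu setT (fun x => ereal_sup (range (f ^~ x))) <= X.
Proof.
move=> bf f0 fS fX.
have nd x : {homo (f ^~ x) : k l / (k <= l)%N >-> k <= l}.
  by apply/nondecreasing_seqP => k; exact: fS.
have lE x : ereal_sup (range (f ^~ x)) = limn (f ^~ x).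
  by apply/esym/cvg_lim => //; apply: ereal_nondecreasing_cvgn; exact: nd.
rewrite borel_lcintE //; [|exact: borel_setT|exact: borel_fun_sup|]; last first.
  by move=> x; apply: (le_trans (f0 0%N x)); apply: ereal_sup_ubound; exists 0%N.
rewrite (_ : (fun x => _) = fun x => limn (f ^~ x)); last by apply/funext.
have mf k : measurable_fun ([set: V] : set (caratheodory_type mu)) (f k).
  exact: borel_measurable_fun.
have := @cvg_monotone_convergence _ _ _ (cmeas mu) setT measurableT f mf
  (fun k x _ => f0 k x) (fun x _ => nd x).
move=> /cvg_lim <- //; apply: lime_le.
  apply: ereal_nondecreasing_is_cvgn => k l kl; apply: ge0_le_integral => // x _; exact: nd.
by apply: nearW => k; rewrite -borel_lcintE //; exact: borel_setT.
Qed.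

End borel_functions.

(** * Continuity of the modulus along increasing families *)

Section ziemer.
Local Open Scope ereal_scope.
Context {R : realType} {n : nat}.
Notation V := 'rV[R]_n.
Variable mu : {outer_measure set V -> \bar R}.
Hypothesis bmu : borel_outer mu.
Variables (q : R) (q2 : (2 <= q)%R).
Local Notation I u := (lcint mu setT (fun x => u x `^ q)).

Let q_gt1 : (1 < q)%R. Proof. by apply: lt_le_trans q2; rewrite ltr1n. Qed.
Let q_gt0 : (0 < q)%R. Proof. by apply: lt_trans q_gt1. Qed.

Lemma clarkson_lcint (u v : V -> \bar R) : borel_fun u -> borel_fun v ->
  (forall x, 0 <= u x) -> (forall x, 0 <= v x) ->
  I (fun x => 2^-1%:E * (u x + v x)) + (2^-1 `^ q)%:E * I (fun x => `|u x - v x|) <=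
  2^-1%:E * (I u + I v).
Proof.
move=> bu bv u0 v0; have q0 := q_gt0.
have bd := borel_fun_dist bu bv.
have pw w : borel_fun w -> borel_fun (fun x : V => w x `^ q) by exact: borel_fun_poweR.
have b2 : borel_fun (fun x => 2^-1%:E * (u x + v x)).
  by apply: borel_funM; [exact: borel_fun_cst|exact: borel_funD].
have p0 (w : V -> \bar R) x : 0 <= w x `^ q by exact: poweR_ge0.
have h0 : 0 <= (2^-1 `^ q : R)%:E by rewrite lee_fin powR_ge0.
have bT := @borel_setT R n.
have bdq : borel_fun (fun x : V => (2^-1 `^ q)%:E * `|u x - v x| `^ q).
  by apply: borel_funM; [exact: borel_fun_cst|exact: pw].
have buv : borel_fun (fun x : V => u x `^ q + v x `^ q) by apply: borel_funD; exact: pw.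
rewrite -[X in _ + X <= _](lcintZl bmu bT (pw _ bd) (p0 _) h0).
rewrite -[leLHS](lcintD bmu bT (pw _ b2) bdq (p0 _)); last by move=> x; rewrite mule_ge0 ?poweR_ge0.
rewrite -[X in _ <= _ * X](lcintD bmu bT (pw _ bu) (pw _ bv) (p0 _) (p0 _)).
rewrite -[leRHS](lcintZl bmu bT buv); [|by move=> x; rewrite adde_ge0 ?poweR_ge0|by rewrite lee_fin].
apply: le_lcint => // x _; apply: le_trans (clarkson_ereal q2 (u0 x) (v0 x)).
by rewrite leeD2l // poweRM // ?lee_fin // poweR_EFin.
Qed.

Lemma split_lcint (u v w : V -> \bar R) (s : R) : borel_fun u -> borel_fun v ->
  (forall x, 0 <= u x) -> (forall x, 0 <= v x) -> (forall x, 0 <= w x) -> (0 < s < 1)%R ->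
  (forall x, w x <= u x + v x) ->
  I w <= ((1 - s) `^ (1 - q))%:E * I u + (s `^ (1 - q))%:E * I v.
Proof.
move=> bu bv u0 v0 w0 s01 wuv; have q1 := ltW q_gt1; have q0 := q_gt0.
have pw z : borel_fun z -> borel_fun (fun x : V => z x `^ q) by exact: borel_fun_poweR.
have p0 (z : V -> \bar R) x : 0 <= z x `^ q by exact: poweR_ge0.
have h1 : 0 <= ((1 - s) `^ (1 - q))%:E by rewrite lee_fin powR_ge0.
have h2 : 0 <= (s `^ (1 - q))%:E by rewrite lee_fin powR_ge0.
have bT := @borel_setT R n.
have b1 : borel_fun (fun x : V => ((1 - s) `^ (1 - q))%:E * u x `^ q).
  by apply: borel_funM; [exact: borel_fun_cst|exact: pw].
have b2 : borel_fun (fun x : V => (s `^ (1 - q))%:E * v x `^ q).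
  by apply: borel_funM; [exact: borel_fun_cst|exact: pw].
rewrite -(lcintZl bmu bT (pw _ bu) (p0 _) h1) -(lcintZl bmu bT (pw _ bv) (p0 _) h2).
rewrite -(lcintD bmu bT b1 b2); [|by move=> x; rewrite mule_ge0 ?poweR_ge0|by move=> x; rewrite mule_ge0 ?poweR_ge0].
apply: le_lcint => // x _; apply: le_trans (poweR_split q1 (u0 x) (v0 x) s01).
by apply: le_poweR => //; exact: ltW.
Qed.

Let splitting (A b : R) : (0 < A)%R -> (0 < b)%R ->
  exists2 s : R, (0 < s < 1)%R & ((1 - s) `^ (1 - q) * A <= A + b)%R.
Proof.
move=> A0 b0; have q1 : (0 < q - 1)%R by rewrite subr_gt0 q_gt1.
have y1 : (1 < 1 + b / A)%R by rewrite ltrDl divr_gt0.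
have y0 : (0 < 1 + b / A)%R by lra.
(* [t] stands for 1 - s and solves t^(1-q) = 1 + b / A. *)
pose t := ((1 + b / A) `^ (- (q - 1)^-1))%R.
have t0 : (0 < t)%R by rewrite powR_gt0.
have t1 : (t < 1)%R.
  rewrite /t powRN invf_lt1 ?powR_gt0 // /powR gt_eqF // -[ltLHS]expR0 ltr_expR.
  by rewrite mulr_gt0 ?invr_gt0 // ln_gt0.
exists (1 - t)%R; first by lra.
rewrite subKr /t -powRrM.
have -> : (- (q - 1)^-1 * (1 - q) = 1)%R by field; rewrite gt_eqF.
by rewrite powRr1 ?(ltW y0) // mulrDl mul1r divfK // gt_eqF.
Qed.

(** In the application [Adm j] consists of the densities admissible for curves with a tube of width
    1/(j+1) and length at most j+1. Midpoints feed Clarkson's inequality; upward closure passes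
    admissibility on to a supremum. *)
Variable Adm : nat -> set (V -> \bar R).
Hypothesis Adm_borel : forall j u, Adm j u -> borel_fun u /\ forall x, 0 <= u x.
Hypothesis Adm_up : forall j u v, Adm j u -> borel_fun v -> (forall x, u x <= v x) -> Adm j v.
Hypothesis AdmS : forall j u, Adm j.+1 u -> Adm j u.
Hypothesis Adm_mid : forall j u v, Adm j u -> Adm j v -> Adm j (fun x => 2^-1%:E * (u x + v x)).
Variable m : R.
Hypothesis Adm_m : forall j, exists2 u, Adm j u & I u <= m%:E.

Let I0 u : 0 <= I u. Proof. exact: lcint_ge0. Qed.

Let m0 : (0 <= m)%R.
Proof. by have [u _ um] := Adm_m 0; rewrite -lee_fin (le_trans (I0 u)). Qed.

Let Adm_le j j' u : (j <= j')%N -> Adm j' u -> Adm j u.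
Proof.
move=> /subnK <-; elim: (j' - j)%N => // k IH; rewrite addSn => /AdmS; exact: IH.
Qed.

Let c j := ereal_inf [set I u | u in Adm j].

Let c0 j : 0 <= c j. Proof. by apply: le_ereal_inf_tmp => _ [u _ <-]; exact: I0. Qed.

Let cm j : c j <= m%:E.
Proof.
by have [u Au um] := Adm_m j; apply: le_trans um; apply: ereal_inf_lbound; exists u.
Qed.

Let cfin j : c j \is a fin_num.
Proof. by rewrite ge0_fin_numE // (le_lt_trans (cm j)) // ltry. Qed.

Let c_le j j' : (j <= j')%N -> c j <= c j'.
Proof.
move=> jj'; apply: le_ereal_inf_tmp => _ [u Au <-]; apply: ereal_inf_lbound; exists u => //.
exact: Adm_le Au.
Qed.

Let C : R := sup (range (fun j => fine (c j))).

Let hasC : has_sup (range (fun j => fine (c j))).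
Proof.
split; first by exists (fine (c 0%N)); exists 0%N.
by exists m => _ [j _ <-]; rewrite -lee_fin fineK.
Qed.

Let cC j : (fine (c j) <= C)%R.
Proof. by apply: ub_le_sup; [case: hasC|exists j]. Qed.

Let Cm : (C <= m)%R.
Proof. by apply: ge_sup => [|_ [j _ <-]]; [case: hasC|rewrite -lee_fin fineK]. Qed.

(* Near-minimizers are close to each other by uniform convexity, so the
   supremum of a fast subsequence costs little. *)
Lemma ziemer (e : R) : (0 < e)%R ->
  exists2 U, (forall j, Adm j U) & I U <= (m + e)%:E.
Proof.
move=> e0; pose A := (m + e)%R; have A0 : (0 < A)%R by rewrite ltr_wpDl.
(* Each step of the induction for [IU] costs 2 b_k = e / 2^(k+2), so the total stays below [e]. *)
pose b k := (e / 2 ^+ k.+3)%R.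
have b0 k : (0 < b k)%R by rewrite divr_gt0 // exprn_gt0.
have /choice[s sP] k : exists s : R, (0 < s < 1)%R /\ ((1 - s) `^ (1 - q) * A <= A + b k)%R.
  by have [s s1 s2] := splitting A0 (b0 k); exists s.
(* Clarkson's inequality gives I(w_k) <= 2 de_k / 2^(-q), and [split_lcint] multiplies this by
   s_k^(1-q); [K k] is the product of the constants. *)
pose K k := (s k `^ (1 - q) / (2^-1 `^ q) * 2)%R.
have s0 k : (0 < s k)%R by have [/andP[]] := sP k.
have K0 k : (0 < K k)%R by rewrite mulr_gt0 // divr_gt0 // powR_gt0 // invr_gt0.
pose ep k := (Num.min (b k) (b k / K k))%R.
have ep0 k : (0 < ep k)%R by rewrite lt_min b0 divr_gt0.
(* Nonincreasing tolerances, so that the near-minimizers number k and k+1 both have energy at most C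
   + de_k. *)
pose fix de k := if k is l.+1 then (Num.min (de l) (ep l.+1))%R else ep 0%N.
have de0 k : (0 < de k)%R by elim: k => [|k IH] //=; rewrite lt_min IH ep0.
have deS k : (de k.+1 <= de k)%R by rewrite /= ge_min lexx.
have de_ep k : (de k <= ep k)%R by case: k => [|k] //=; rewrite ge_min lexx orbT.
have /choice[J JP] k : exists j, (C - de k < fine (c j))%R.
  by have [_ [j _ <-] Cj] := sup_adherent (de0 k) hasC; exists j.
(* At least [J k], so that the infimum over [Adm (jj k)] is within [de k] of [C], and at least [k],
   so that every class contains some [u k]. *)
pose fix jj k := if k is l.+1 then (jj l + J l.+1).+1 else J 0%N.
have jjS k : (jj k <= jj k.+1)%N by rewrite /= ltnW // ltnS leq_addr.
have jjk k : (k <= jj k)%N by elim: k => // k IH; rewrite /= ltnS (leq_trans IH) // leq_addr.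
have Jjj k : (J k <= jj k)%N by case: k => //= k; rewrite ltnW // ltnS leq_addl.
have cjj k : (C - de k < fine (c (jj k)))%R.
  by apply: (lt_le_trans (JP k)); rewrite -lee_fin !fineK // c_le.
have /choice[u uP] k : exists u, Adm (jj k) u /\ I u <= (C + de k)%:E.
  have [_ [u Au <-] Iu] := lb_ereal_inf_adherent (de0 k) (cfin (jj k)).
  exists u; split=> //; apply: (le_trans (ltW Iu)).
  by rewrite -/(c (jj k)) -(fineK (cfin (jj k))) -EFinD lee_fin lerD2r.
have Au k : Adm (jj k) (u k) by case: (uP k).
have Iu k : I (u k) <= (C + de k)%:E by case: (uP k).
have bu k : borel_fun (u k) by case: (Adm_borel (Au k)).
have u0 k x : 0 <= u k x by case: (Adm_borel (Au k)).
have Iuf k : I (u k) \is a fin_num by rewrite ge0_fin_numE ?I0 // (le_lt_trans (Iu k)) // ltry.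
pose w k x := `|u k x - u k.+1 x|.
have bw k : borel_fun (w k) by exact: borel_fun_dist.
have Iw k : (s k `^ (1 - q))%:E * I (w k) <= (b k)%:E.
  have mid : (C - de k)%:E <= I (fun x => 2^-1%:E * (u k x + u k.+1 x)).
    apply: (@le_trans _ _ (c (jj k))); first by rewrite -(fineK (cfin (jj k))) lee_fin ltW.
    by apply: ereal_inf_lbound; eexists; [apply: Adm_mid|reflexivity];
      [exact: Au|exact: Adm_le (jjS k) (Au k.+1)].
  have cl := clarkson_lcint (bu k) (bu k.+1) (u0 k) (u0 k.+1).
  have h : (C - de k)%:E + (2^-1 `^ q)%:E * I (w k) <= (C + de k)%:E.
    apply: (@le_trans _ _ (2^-1%:E * ((C + de k)%:E + (C + de k)%:E))).
      apply: (@le_trans _ _ (2^-1%:E * (I (u k) + I (u k.+1)))).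
        by apply: le_trans cl; rewrite leeD2r.
      rewrite lee_wpmul2l ?lee_fin // leeD // (le_trans (Iu k.+1)) // lee_fin lerD2l; exact: deS.
    by rewrite -EFinD -EFinM lee_fin; lra.
  have t0 : (0 < 2^-1 `^ q :> R)%R by rewrite powR_gt0 // invr_gt0.
  have Iwf : I (w k) \is a fin_num.
    rewrite ge0_fin_numE ?I0 //; rewrite ltey; apply/eqP => Iwoo; move: h.
    by rewrite Iwoo gt0_muley ?lte_fin // leNgt ltry.
  move: h; rewrite -(fineK Iwf) -!EFinM -EFinD !lee_fin => h.
  set W := fine _ in h *.
  have h' : (W <= 2 * de k / (2^-1 `^ q))%R by rewrite ler_pdivlMr // mulrC; lra.
  apply: (@le_trans _ _ (s k `^ (1 - q) * (2 * ep k / (2^-1 `^ q)))%R).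
    rewrite ler_wpM2l ?powR_ge0 // (le_trans h') // ler_wpM2r ?invr_ge0 ?(ltW t0) //.
    by rewrite ler_pM2l.
  apply: (@le_trans _ _ (K k * ep k)%R).
    by rewrite le_eqVlt; apply/orP; left; apply/eqP; rewrite /K; field; rewrite gt_eqF.
  by rewrite mulrC -ler_pdivlMr // /ep ge_min lexx orbT.
pose fix U k := if k is l.+1 then (fun x => maxe (U l x) (u l.+1 x)) else u 0%N.
have bU k : borel_fun (U k) by elim: k => [|k IH] //=; exact: borel_fun_max.
have uU k x : u k x <= U k x by case: k => [|k] //=; rewrite le_max lexx orbT.
have U0 k x : 0 <= U k x by apply: le_trans (u0 k x) (uU k x).
have US k x : U k x <= U k.+1 x by rewrite /= le_max lexx.
have Uw k x : U k.+1 x <= U k x + w k x.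
  rewrite /= ge_max leeDl ?abse_ge0 //=.
  apply: (@le_trans _ _ (u k x + w k x)); last by rewrite leeD2r.
  have := u0 k x; have := u0 k.+1 x; rewrite /w.
  case: (u k x) => [a| |]; case: (u k.+1 x) => [d| |] // d0 a0; last exact: leey.
  rewrite -EFinB /abse -EFinD lee_fin.
  by have := ler_norm (d - a)%R; rewrite distrC; lra.
have IU k : I (U k) <= (m + e * (1 - 2^-1 ^+ k.+1))%:E.
  elim: k => [|k IH].
    apply: (le_trans (Iu 0%N)); rewrite lee_fin lerD // (le_trans (de_ep 0%N)) //.
    rewrite /ep ge_min; apply/orP; left; rewrite /b expr1.
    by rewrite ler_pdivrMr //; lra.
  have IUA : I (U k) <= A%:E.
    apply: (le_trans IH); rewrite lee_fin lerD2l -[leRHS]mulr1 ler_pM2l // gerBl exprn_ge0 //.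
  have IUf : I (U k) \is a fin_num by rewrite ge0_fin_numE ?I0 // (le_lt_trans IH) // ltry.
  have [s01 sA] := sP k.
  have := split_lcint (bU k) (bw k) (U0 k) (fun x => abse_ge0 _) (U0 k.+1) s01 (Uw k).
  move=> /le_trans; apply.
  apply: (@le_trans _ _ (((1 - s k) `^ (1 - q))%:E * I (U k) + (b k)%:E)); first by rewrite leeD2l.
  move: IH IUA; rewrite -(fineK IUf) -EFinM -EFinD !lee_fin => IH IUA.
  set X := fine _ in IH IUA *.
  have X0 : (0 <= X)%R by rewrite fine_ge0.
  have h1 : ((1 - s k) `^ (1 - q) * X <= X + b k)%R.
    have : ((1 - s k) `^ (1 - q) <= 1 + b k / A)%R.
      by rewrite -(ler_pM2r A0) (le_trans sA) // mulrDl mul1r divfK // gt_eqF.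
    move=> /(ler_wpM2r X0) /le_trans; apply; rewrite mulrDl mul1r lerD2l mulrAC ler_pdivrMr //.
    by rewrite ler_pM2l // b0.
  apply: (le_trans (lerD h1 (lexx _))).
  have bE : (b k = e * 2^-1 ^+ k.+1 / 4)%R.
    by rewrite /b !exprS exprVn; field; rewrite expf_neq0.
  have sE : (2^-1 ^+ k.+2 = 2^-1 ^+ k.+1 / 2 :> R)%R by rewrite exprS mulrC.
  by rewrite bE sE; lra.
pose Us x := ereal_sup (range (U ^~ x)).
have bUs : borel_fun Us by exact: borel_fun_sup.
exists Us.
  move=> j; apply: (Adm_up _ bUs) => [|x]; first exact: Adm_le (jjk j) (Au j).
  by apply: (le_trans (uU j x)); apply: ereal_sup_ubound; exists j.
have q0 := ltW q_gt0; have qp := q_gt0.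
apply: (@le_trans _ _ (lcint mu setT (fun x => ereal_sup (range (fun k => U k x `^ q))))).
  apply: le_lcint => // x _.
  have Us0 : 0 <= Us x by apply: (le_trans (U0 0%N x)); apply: ereal_sup_ubound; exists 0%N.
  have nd : {homo (U ^~ x) : k l / (k <= l)%N >-> k <= l} by apply/nondecreasing_seqP => k; exact: US.
  pose X := ereal_sup (range (fun k => U k x `^ q)); rewrite -/X.
  have UX k : U k x <= X `^ q^-1.
    have -> : U k x = (U k x `^ q) `^ q^-1.
      by rewrite poweR_poweR ?invr_gt0 ?divff ?poweRe1 ?U0 // ?gt_eqF.
    apply: le_poweR; [by rewrite invr_ge0|exact: poweR_ge0|].
    by apply: ereal_sup_ubound; exists k.
  have X0 : 0 <= X by apply: (@le_trans _ _ (U 0%N x `^ q)); [exact: poweR_ge0|apply: ereal_sup_ubound; exists 0%N].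
  rewrite -[leRHS]poweRe1 // -(_ : (q^-1 * q)%R = 1%R); last by rewrite mulVf // gt_eqF.
  rewrite -poweR_poweR ?invr_gt0 //.
  by apply: le_poweR => //; apply: ge_ereal_sup => _ [k _ <-].
apply: lcint_sup => //.
- by move=> k; exact: borel_fun_poweR.
- by move=> k x; exact: poweR_ge0.
- by move=> k x; apply: le_poweR.
move=> k; apply: (le_trans (IU k)); rewrite lee_fin lerD2l -[leRHS]mulr1 ler_pM2l // gerBl exprn_ge0 //.
Qed.

End ziemer.

(** * Tubes around curves *)

Section tube.
Context {R : realType} {n : nat}.
Notation V := 'rV[R]_n.+2.
Notation H := (@hausdorff R n.+2 n.+1).
Notation kap := (@kappa R n).

(** A closed ball of the maximum norm [|.|], whereas lengths of curves are Euclidean, through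
    [enorm]. *)
Definition cube (c : V) (d : R) : set V := [set y | `|y - c| <= d].

Lemma cubeE (c : V) (d : R) : 0 <= d -> cube c d = box (c - const_mx d) (c + const_mx d).
Proof.
move=> d0; apply/seteqP; split=> [x xd i|x xb].
  by have := le_trans (rV_coord_le_norm (x - c) i) xd; rewrite !mxE ler_norml; lra.
by apply: ler_rV_norm => // i; have := xb i; rewrite !mxE ler_norml; lra.
Qed.

Lemma cube_borel (c : V) (d : R) : 0 <= d -> borel_set (cube c d).
Proof.
move=> d0; rewrite cubeE //; apply: closed_borel; apply: compact_closed.
  exact: norm_hausdorff.
exact: box_compact.
Qed.

Lemma cube_ebounded (c : V) (d : R) : ebounded (cube c d).
Proof.
exists (n.+2%:R * (d + `|c|)) => x xd; apply: (le_trans (enorm_le_norm _)).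
rewrite ler_pM2l // -[x](subrK c); apply: (le_trans (ler_normD _ _)); by rewrite lerD2r.
Qed.

Lemma leb_cube_le (c : V) (d : R) : 0 <= d -> (leb_outer (cube c d) <= ((2 * d) ^+ n.+2)%:E)%E.
Proof.
move=> d0; rewrite cubeE //.
have ok : box_ok (c - const_mx d, c + const_mx d) by move=> i; rewrite /= !mxE; lra.
apply: (le_trans (leb_outer_box_le ok)); rewrite /boxvol /= lee_fin.
rewrite (eq_bigr (fun=> 2 * d)) => [|i _]; last by rewrite !mxE; ring.
by rewrite prodr_const card_ord.
Qed.

Lemma leb_ebounded_fin (E : set V) : ebounded E -> leb_outer E \is a fin_num.
Proof.
move=> [B WB]; rewrite ge0_fin_numE ?outer_measure_ge0 //.
apply: (@le_lt_trans _ _ (leb_outer (cube 0 `|B|%R))).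
  apply: le_outer_measure => y /WB yB; rewrite /cube /= subr0.
  exact: le_trans (norm_le_enorm _) (le_trans yB (ler_norm B)).
by apply: le_lt_trans (leb_cube_le 0 (normr_ge0 B)) _; rewrite ltry.
Qed.

Lemma leb_cube_ge (d : R) : 0 < d -> (((2 * d) ^+ n.+2)%:E <= leb_outer (cube 0 d))%E.
Proof.
move=> d0; have dd0 : 0 < 2 * d by rewrite mulr_gt0.
have di0 : 0 < (2 * d)^-1 by rewrite invr_gt0.
have := @leb_lipschitz R n.+1 (fun x => (2 * d)^-1 *: (x + const_mx d)) _ _ di0 (@cube_ebounded 0 d) _.
have -> : (fun x : V => (2 * d)^-1 *: (x + const_mx d)) @` cube 0 d = box 0 (const_mx 1).
  rewrite cubeE ?ltW //; apply/seteqP; split=> [_ [x xb <-] i|x xb].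
    have := xb i; rewrite !mxE => /andP[x0 x1].
    rewrite mulr_ge0 ?(ltW di0) //=; last by lra.
    by rewrite mulrC ler_pdivrMr // mul1r; lra.
  exists ((2 * d) *: x - const_mx d); last first.
    by rewrite subrK scalerA mulVf ?scale1r // gt_eqF.
  move=> i; have := xb i; rewrite !mxE => /andP[x0 x1].
  have h : 2 * d * x ord0 i <= 2 * d by rewrite -[leRHS]mulr1 ler_pM2l.
  have h' : 0 <= 2 * d * x ord0 i by rewrite mulr_ge0 // ltW.
  by lra.
rewrite leb_outer_unit_cube => h.
have {h} : (1 <= ((2 * d)^-1 ^+ n.+2)%:E * leb_outer (cube 0 d))%E.
  apply: h => x y _ _; rewrite -scalerBr enormZ gtr0_norm //.
  by rewrite (_ : x + const_mx d - (y + const_mx d) = x - y) // opprD addrACA subrr addr0.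
rewrite exprVn -lee_pdivrMl ?invr_gt0 ?exprn_gt0 // invrK mule1.
exact.
Qed.

(** The intermediate value theorem on the edge that leads to the first vertex with v >= r. *)
Lemma polygon_hits (W : set V) (v : V -> R) (P : nat -> V) (k : nat) (z : V) (r : R) :
  {within W, continuous v} ->
  (forall i t, (i < k)%N -> 0 <= t <= 1 -> W (P i + z + t *: (P i.+1 - P i))) ->
  v (P 0%N + z) < r -> r < v (P k + z) ->
  exists i t, [/\ (i < k)%N, 0 <= t <= 1 & v (P i + z + t *: (P i.+1 - P i)) = r].
Proof.
move=> cv PW v0 vk.
have ex : exists i, r <= v (P i + z) by exists k; exact: ltW.
case: (ex_minnP ex) => -[|i] ri mini; first by move: ri; rewrite leNgt v0.
have ik : (i < k)%N by have := mini k (ltW vk).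
have vi : v (P i + z) < r.
  by rewrite ltNge; apply/negP => /mini; rewrite ltnn.
pose phi t := v (P i + z + t *: (P i.+1 - P i)).
have phi0 : phi 0 = v (P i + z) by rewrite /phi scale0r addr0.
have phi1 : phi 1 = v (P i.+1 + z).
  by rewrite /phi scale1r; congr v; rewrite addrAC [P i + _]addrC subrK.
have cphi : {within `[0, 1], continuous phi}.
  apply/subspace_continuousP => t; rewrite /= in_itv /= => t01.
  move/subspace_continuousP : cv => /(_ _ (PW i t ik t01)) cvt A /cvt /nbhs_ballP[e /= e0 eA].
  have K0 : 0 < `|P i.+1 - P i| + 1 by rewrite ltr_wpDl.
  apply/nbhs_ballP; exists (e / (`|P i.+1 - P i| + 1)); first by rewrite /= divr_gt0.
  move=> s; rewrite -ball_normE /= in_itv /= => ts s01.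
  apply: eA; last exact: PW.
  rewrite -ball_normE /= opprD addrACA subrr add0r -scalerBl normrZ.
  apply: (@le_lt_trans _ _ (`|t - s| * (`|P i.+1 - P i| + 1))).
    by rewrite ler_wpM2l // lerDl.
  by rewrite -ltr_pdivlMr.
have := @IVT R phi 0 1 r ler01 cphi; rewrite phi0 phi1.
rewrite ge_min (ltW vi) /= le_max ri orbT => /(_ isT)[t].
by rewrite in_itv /= => t01 vt; exists i, t.
Qed.

(** Every translate of the polygon by [z] in the cube of radius [d] crosses the level, so [z] lies
    in the shadow of a piece of the level along some edge, shifted back by the vertex of that edge.
    Volumes are compared, and [shadow_le] bounds each shadow. *)
Lemma tube (W : set V) (v : V -> R) (P : nat -> V) (k : nat) (lam d r : R) :
  {within W, continuous v} -> 0 < lam -> 0 < d ->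
  (forall i, (i < k)%N -> enorm (P i.+1 - P i) <= lam) ->
  (forall i, (i < k)%N -> cube (P i) (d + lam) `<=` W) ->
  (forall y, cube (P 0%N) d y -> v y < r) -> (forall y, cube (P k) d y -> r < v y) ->
  (kap * ((2 * d) ^+ n.+2)%:E <=
   \sum_(i < k) lam%:E * H ([set y | W y /\ v y = r] `&` cube (P i) (d + lam)))%E.
Proof.
move=> cv lam0 d0 Pl PW Pr Pk; set S := [set y | _].
(* A degenerate edge gets an arbitrary unit direction. *)
have /choice[e eP] i : exists e : V, enorm e = 1 /\
    P i.+1 - P i = enorm (P i.+1 - P i) *: e.
  have [l0|l0] := eqVneq (enorm (P i.+1 - P i)) 0.
    exists (delta_mx ord0 ord0); split; last by rewrite (enorm_eq0 l0) enorm0 scale0r.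
    rewrite enormE /dotv (bigD1 ord0) //= big1 ?addr0 => [|j j0]; last by rewrite !mxE (negbTE j0) mulr0.
    by rewrite !mxE eqxx mulr1 sqrtr1.
  exists ((enorm (P i.+1 - P i))^-1 *: (P i.+1 - P i)); split.
    by rewrite enormZ ger0_norm ?invr_ge0 ?enorm_ge0 // mulVf.
  by rewrite scalerA divff // scale1r.
pose A i := S `&` cube (P i) (d + lam).
have bsh i : ebounded (shadow (A i) (e i) lam).
  have [M MP] := @cube_ebounded (P i) (d + lam); exists (M + lam) => _ [y [t [[_ yc] tl ->]]].
  apply: (le_trans (enormD _ _)); rewrite enormN enormZ (eP i).1 mulr1 lerD ?MP //.
  by rewrite ger0_norm; lra.
pose T i x := x - P i.
have Ti i x y : enorm (T i x - T i y) = enorm (x - y).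
  by rewrite /T opprB addrA subrK.
have sub : cube 0 d `<=` \bigcup_(i < k) (T i @` shadow (A i) (e i) lam).
  move=> z; rewrite /cube /= subr0 => zd.
  have Wst i t : (i < k)%N -> 0 <= t <= 1 -> cube (P i) (d + lam) (P i + z + t *: (P i.+1 - P i)).
    move=> ik t01; rewrite /cube /=.
    rewrite (_ : _ - P i = z + t *: (P i.+1 - P i)); last by apply/rowP => j; rewrite !mxE; ring.
    apply: (le_trans (ler_normD _ _)); rewrite lerD //.
    rewrite normrZ ger0_norm; last by lra.
    have := le_trans (norm_le_enorm _) (Pl i ik); have := normr_ge0 (P i.+1 - P i).
    by nra.
  have z0 i : cube (P i) d (P i + z) by rewrite /cube /= addrAC subrr add0r.
  have [i t ik t01|i [t [ik t01 vt]]] := polygon_hits (z := z) cv _ (Pr _ (z0 _)) (Pk _ (z0 _)).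
    exact/(PW i ik)/Wst.
  exists i => //; exists (P i + z); last by rewrite /T addrAC subrr add0r.
  exists (P i + z + t *: (P i.+1 - P i)), (t * enorm (P i.+1 - P i)); split.
  - split; last exact: Wst.
    by split=> //; exact/(PW i ik)/Wst.
  - have := Pl i ik; have := enorm_ge0 (P i.+1 - P i); nra.
  - by rewrite -scalerA -(eP i).2 addrK.
apply: (@le_trans _ _ (kap * leb_outer (cube 0 d)))%E.
  by rewrite lee_wpmul2l ?kappa_ge0 // leb_cube_ge.
apply: (@le_trans _ _ (kap * \sum_(i < k) leb_outer (T i @` shadow (A i) (e i) lam)))%E.
  rewrite lee_wpmul2l ?kappa_ge0 //; apply: (le_trans (le_outer_measure leb_outer _ _ sub)).
  rewrite bigcup_mkord.
  exact: (outer_measure_subadditive leb_outer (fun i => T i @` shadow (A i) (e i) lam) k).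
rewrite ge0_sume_distrr => [|i _]; last exact: outer_measure_ge0.
apply: lee_sum => i _; apply: le_trans (shadow_le (A i) (eP i).1 lam0).
by rewrite lee_wpmul2l ?kappa_ge0 //; apply: leb_isometry_le.
Qed.

End tube.

Section lcint_restriction.
Local Open Scope ereal_scope.
Context {R : realType} {n : nat}.
Notation V := 'rV[R]_n.
Variable mu : {outer_measure set V -> \bar R}.

Lemma lcint_restrict (A : set V) (g : V -> \bar R) :
  lcint mu A g = lcint mu setT (fun x => g x * (\1_A x)%:E).
Proof.
apply: eq_integral => t; rewrite inE /= in_itv /= andbT => t0; congr (mu _).
apply/seteqP; split=> x /=.
  by move=> [Ax tg]; rewrite indicE mem_set // mule1.
move=> [_]; rewrite indicE; case: (boolP (x \in A)) => [/set_mem Ax|_]; first by rewrite mule1.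
by rewrite mule0 lte_fin ltNge ltW.
Qed.

Hypothesis bmu : borel_outer mu.

Lemma lcint_cst (A : set V) (c : \bar R) : borel_set A -> 0 <= c -> lcint mu A (fun=> c) = c * mu A.
Proof.
move=> bA c0; rewrite borel_lcintE //; last exact: borel_fun_cst.
by rewrite (integral_cst (cmeas mu)) //; exact: borel_caratheodory.
Qed.

Lemma lcint_sum (A : set V) (f : nat -> V -> \bar R) (k : nat) : borel_set A ->
  (forall i, borel_fun (f i)) -> (forall i x, 0 <= f i x) ->
  lcint mu A (fun x => \sum_(i < k) f i x) = \sum_(i < k) lcint mu A (f i).
Proof.
move=> bA bf f0; elim: k => [|k IH].
  rewrite big_ord0 (@eq_lcint _ _ mu A _ (fun=> 0)) => [|x _]; last by rewrite big_ord0.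
  by rewrite lcint_cst // mul0e.
rewrite big_ord_recr /= -IH -lcintD //; last first.
  by move=> x; apply: sume_ge0.
  elim: k {IH} => [|k IH] t.
    by under eq_set do rewrite big_ord0; exact: borel_fun_cst.
  have := borel_funD IH (bf k) t; congr borel_set; apply/seteqP; split=> x /=; by rewrite big_ord_recr.
by apply: eq_lcint => x _; rewrite big_ord_recr.
Qed.

End lcint_restriction.

(** * Integrals over small balls and their L^alpha norm *)

Section averaging.
Local Open Scope ereal_scope.
Context {R : realType} {n : nat}.
Notation V := 'rV[R]_n.+2.
Notation leb := (@leb_outer R n.+2).

Let bL : borel_outer leb := @leb_outer_halfspace R n.+1.

Lemma ball_borel (y : V) (D : R) : borel_set (ball y D).
Proof. apply: open_borel; rewrite openE => x; rewrite -ball_normE /= => yx.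
apply/nbhs_ballP; exists (D - `|y - x|)%R; first by rewrite /= subr_gt0.
move=> z; rewrite -!ball_normE /= => xz; rewrite -[(y - z)%R](subrKA x).
by apply: (le_lt_trans (ler_normD _ _)); rewrite addrC -ltrBrDr. Qed.

(** Not divided by the volume: the [ball] is that of the maximum norm, of measure at most
    (2D)^(n+2), and [duality] normalizes with its constant [K]. *)
Definition ballint (g : V -> \bar R) (D : R) (y : V) : \bar R := lcint leb (ball y D) g.

Lemma ballint_ge0 g D y : 0 <= ballint g D y. Proof. exact: lcint_ge0. Qed.

(** Lower semicontinuity: by monotone convergence a smaller concentric ball already has integral
    above [t], and it is contained in every ball of radius [D] with nearby centre. *)
Lemma ballint_borel (g : V -> \bar R) (D : R) : (0 < D)%R -> borel_fun g -> (forall x, 0 <= g x) ->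
  borel_fun (ballint g D).
Proof.
move=> D0 bg g0 t; apply: open_borel; rewrite openE => y /= ty.
pose f (j : nat) x := g x * (\1_(ball y (D - j.+1%:R^-1)) x)%:E.
have [j tj] : exists j, t%:E < lcint leb setT (f j).
  apply: contrapT => /forallNP ne; move: ty; apply/negP; rewrite -leNgt /ballint lcint_restrict.
  apply: (@le_trans _ _ (lcint leb setT (fun x => ereal_sup (range (f ^~ x))))).
    apply: le_lcint => // x _; rewrite indicE; case: (boolP (x \in _)) => [/set_mem|_]; last first.
      rewrite mule0; apply: (@le_trans _ _ (f 0%N x)); last by apply: ereal_sup_ubound; exists 0%N.
      by rewrite mule_ge0 // lee_fin.
    rewrite -ball_normE /= => xy; rewrite mule1; apply: ereal_sup_ubound.
    pose j := Num.truncn (D - `|y - x|)^-1%R; exists j => //; rewrite /f indicE mem_set ?mule1 //.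
    rewrite -ball_normE /= ltrBrDr -ltrBrDl -[ltRHS]invrK ltf_pV2 ?posrE ?invr_gt0 ?subr_gt0 //.
    exact: truncnS_gt.
  apply: lcint_sup => //.
  - by move=> k; apply: borel_funM => //; apply: borel_fun_indic; exact: ball_borel.
  - by move=> k x; rewrite mule_ge0 // lee_fin.
  - move=> k x; rewrite lee_wpmul2l // lee_fin !indicE ler_nat; case: (boolP (x \in (ball y (D - k.+1%:R^-1)%R : set V))) => //.
    move=> /set_mem xk; rewrite mem_set //; apply: le_ball xk.
    by rewrite lerD2l lerN2 lef_pV2 ?posrE // ler_nat.
  - by move=> k; have := ne k; rewrite leNgt => /negP.
apply/nbhs_ballP; exists (j.+1%:R^-1)%R; first by rewrite /= invr_gt0.
have fE : lcint leb (ball y (D - j.+1%:R^-1)%R) g = lcint leb setT (f j) := lcint_restrict leb _ g.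
rewrite -fE in tj; move=> y' yy'; apply: (lt_le_trans tj); rewrite /ballint; apply: le_lcint => // x.
move: yy'; rewrite -!ball_normE /= => yy' yx.
rewrite -[(y' - x)%R](subrKA y); apply: (le_lt_trans (ler_normD _ _)).
by rewrite distrC -(subrKC (j.+1%:R^-1) D) ltrD.
Qed.

Variables (al P : R) (al1 : (1 < al)%R) (P1 : (1 < P)%R) (alP : (al^-1 + P^-1 = 1)%R).

(** Hoelder's inequality on the ball, obtained from Young's with a free parameter [t]. *)
Lemma ballint_jensen (g : V -> \bar R) (D : R) y : (0 < D)%R -> borel_fun g -> (forall x, 0 <= g x) ->
  ballint g D y `^ al <= (((2 * D) ^+ n.+2) `^ (al - 1))%:E * ballint (fun x => g x `^ al) D y.
Proof.
move=> D0 bg g0; set B := ((2 * D) ^+ n.+2)%R.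
have al0 : (0 < al)%R := lt_trans ltr01 al1; have P0 : (0 < P)%R := lt_trans ltr01 P1.
have B0 : (0 < B)%R by rewrite exprn_gt0 // mulr_gt0.
have Bp : (0 < B `^ (al - 1))%R by rewrite powR_gt0.
have lB : leb (ball y D) <= B%:E.
  apply: (@le_trans _ _ (leb (cube y D))); last by apply: leb_cube_le; exact: ltW.
  by apply: le_outer_measure => x; rewrite -ball_normE /cube /= distrC => /ltW.
pose G := ballint (fun x => g x `^ al) D y; rewrite -/G.
have [Goo|Gne] := eqVneq G +oo; first by rewrite Goo gt0_muley ?lte_fin // leey.
have Gf : G \is a fin_num by rewrite ge0_fin_numE ?ballint_ge0 // ltey.
have G0 : (0 <= fine G)%R by rewrite fine_ge0 // ballint_ge0.
have bga : borel_fun (fun x => g x `^ al) by exact: borel_fun_poweR.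
have bb := ball_borel y D.
have young (t : R) : (0 < t)%R ->
    t%:E * ballint g D y <= (al^-1 * fine G + P^-1 * (t `^ P * B))%:E.
  move=> t0; rewrite /ballint -lcintZl ?lee_fin ?(ltW t0) //.
  apply: (@le_trans _ _ (lcint leb (ball y D) (fun x => (al^-1)%:E * g x `^ al + (P^-1 * t `^ P)%:E))).
    apply: le_lcint => // x _; rewrite muleC EFinM -poweR_EFin.
    by apply: young_ereal => //; rewrite lee_fin ltW.
  have ai : 0 <= (al^-1)%:E by rewrite lee_fin invr_ge0 ltW.
  have pi : 0 <= (P^-1 * t `^ P)%:E by rewrite lee_fin mulr_ge0 ?invr_ge0 ?powR_ge0 // ltW.
  rewrite lcintD //; last 3 first.
  - by apply: borel_funM => //; exact: borel_fun_cst.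
  - exact: borel_fun_cst.
  - by move=> x; rewrite mule_ge0 // poweR_ge0.
  rewrite lcintZl //; last by move=> x; exact: poweR_ge0.
  rewrite lcint_cst // EFinD; apply: leeD; first by rewrite EFinM fineK.
  by rewrite mulrA [leRHS]EFinM lee_wpmul2l.
have key (e : R) : (0 < e)%R -> ballint g D y `^ al <= (B `^ (al - 1) * (fine G + e))%:E.
  move=> e0; set E := (fine G + e)%R; have E0 : (0 < E)%R by rewrite ltr_wpDl.
  (* Chosen so that t^P B = E, which bounds both terms of Young's inequality by [E] in all; the
     summand [e] keeps [E] positive when the integral vanishes. *)
  pose t := ((E / B) `^ P^-1)%R; have t0 : (0 < t)%R by rewrite powR_gt0 // divr_gt0.
  have tP : (t `^ P = E / B)%R by rewrite /t -powRrM mulVf ?gt_eqF // powRr1 // divr_ge0 // ltW.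
  have := young t t0; rewrite tP divfK ?gt_eqF // => h.
  have {}h : ballint g D y <= (E / t)%:E.
    rewrite -(lee_pmul2l (x := t%:E)) // ?lte_fin // (le_trans h) // -EFinM lee_fin.
    rewrite mulrCA divff ?gt_eqF // mulr1.
    rewrite -[leRHS]mul1r -alP mulrDl lerD2r ler_wpM2l ?invr_ge0 ?(ltW al0) //.
    by rewrite /E lerDl ltW.
  apply: (le_trans (le_poweR (ltW al0) (ballint_ge0 _ _ _) h)).
  rewrite poweR_EFin lee_fin /t powRM ?invr_ge0 ?(ltW E0) ?powR_ge0 //.
  have PE : (P^-1 = 1 - al^-1)%R by rewrite -alP [RHS]addrAC subrr add0r.
  have PE' : (P^-1 * al = al - 1)%R by rewrite PE mulrBl mul1r mulVf ?gt_eqF.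
  rewrite -powRN -powRrM mulNr PE' opprB powRM ?invr_ge0 ?(ltW B0) ?(ltW E0) //.
  rewrite mulrA -powRD; last by rewrite (gt_eqF E0) implybT.
  rewrite addrC subrK powRr1 ?(ltW E0) // mulrC -powR_inv1 ?(ltW B0) // -powRrM.
  by rewrite mulN1r opprB.
apply/lee_addgt0Pr => e e0.
have := key (e / B `^ (al - 1))%R (divr_gt0 e0 Bp); rewrite mulrDr [X in (_ + X)%R]mulrC divfK ?gt_eqF //.
by rewrite EFinD EFinM fineK.
Qed.

(** A name for the measure of [leb_outer] to which the sigma-finite structure demanded by Tonelli's
    theorem is attached. *)
Definition lebm : set (caratheodory_type leb) -> \bar R := cmeas leb.

HB.instance Definition _ := Measure.on lebm.

Lemma lebm_sigma_finite : sigma_finite setT lebm.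
Proof.
exists (fun i : nat => cube 0 i%:R : set (caratheodory_type leb)).
  apply/seteqP; split=> // x _; exists (Num.truncn `|x|).+1 => //.
  by rewrite /cube /= subr0 ltW // truncnS_gt.
move=> i; split.
  by apply: (borel_caratheodory bL); exact: cube_borel.
by apply: le_lt_trans (leb_cube_le 0 (ler0n R i)) _; rewrite ltry.
Qed.

HB.instance Definition _ := @Measure_isSigmaFinite.Build _ _ _ lebm lebm_sigma_finite.

Lemma ballint_tonelli (G : V -> \bar R) (D : R) : (0 < D)%R -> borel_fun G -> (forall x, 0 <= G x) ->
  lcint leb setT (ballint G D) <= ((2 * D) ^+ n.+2)%:E * lcint leb setT G.
Proof.
move=> D0 bG G0; pose W := caratheodory_type leb.
pose f (z : W * W) : \bar R := G z.1 * (\1_[set z : W * W | (`|(z.2 : V) - z.1| < D)%R] z)%:E.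
have mcoord i : measurable_fun [set: W] (fun x : W => (x : V) ord0 i).
  apply/measurable_EFinP; apply: (@borel_measurable_fun _ _ _ (fun x : V => (x ord0 i)%:E)) => // t.
  rewrite [X in borel_set X](_ : _ = ~` [set x : V | (x ord0 i <= t)%R]).
    by apply: borelC; exact: borel_coord_le.
  by apply/seteqP; split=> x /=; rewrite lte_fin ltNge => /negP.
have mset : measurable [set z : W * W | (`|(z.2 : V) - z.1| < D)%R].
  rewrite (_ : mkset _ = \bigcap_(i in [set: 'I_n.+2])
      [set z : W * W | (`|(z.2 : V) ord0 i - (z.1 : V) ord0 i| < D)%R]).
    apply: fin_bigcap_measurable => // i _.
    have mi : measurable_fun [set: W * W] (fun z : W * W => `|(z.2 : V) ord0 i - (z.1 : V) ord0 i|%R).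
      apply: measurableT_comp => //; apply: measurable_funB.
        exact: (measurableT_comp (mcoord i) measurable_snd).
      exact: (measurableT_comp (mcoord i) measurable_fst).
    rewrite (_ : mkset _ = setT `&` (fun z : W * W => `|(z.2 : V) ord0 i - (z.1 : V) ord0 i|%R) @^-1` `]-oo, D[%classic).
      by apply: mi => //; exact: measurable_itv.
    by rewrite setTI; apply/seteqP; split=> z /=; rewrite in_itv.
  apply/seteqP; split=> z /=.
    move=> zD i _; apply: le_lt_trans zD; have := rV_coord_le_norm ((z.2 : V) - z.1)%R i.
    by rewrite !mxE.
  move=> zD; pose m := (\big[Num.max/0]_(i < n.+2) `|(z.2 : V) ord0 i - (z.1 : V) ord0 i|)%R.
  have mD : (m < D)%R by apply/bigmax_ltP; split=> // i _; exact: zD.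
  apply: le_lt_trans mD; apply: ler_rV_norm => [|j]; first exact: bigmax_ge_id.
  by rewrite !mxE; exact: (le_bigmax _ (fun i => `|(z.2 : V) ord0 i - (z.1 : V) ord0 i|%R)).
have inb (x y : W) : ((x, y) \in [set z : W * W | (`|(z.2 : V) - z.1| < D)%R]) = (y \in (ball (x : V) D : set V)).
  apply/idP/idP => [/set_mem /= h|/set_mem h]; apply/mem_set; first by rewrite -ball_normE /= distrC.
  by move: h; rewrite -ball_normE /= distrC.
have mG : measurable_fun [set: W] (G : W -> \bar R) by exact: borel_measurable_fun.
have mf : measurable_fun [set: W * W] f.
  apply: emeasurable_funM; first exact: (measurableT_comp mG measurable_fst).
  by apply/measurable_EFinP; exact: measurable_indic.
have f0 z : 0 <= f z by rewrite mule_ge0 // lee_fin.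
have bT := @borel_setT R n.+2.
rewrite borel_lcintE //; [|exact: ballint_borel|by move=> x; exact: ballint_ge0].
have -> : \int[cmeas leb]_x ballint G D x = \int[lebm]_y \int[lebm]_x f (x, y).
  apply: eq_integral => y _; rewrite /ballint lcint_restrict borel_lcintE //; last 2 first.
  - by apply: borel_funM => //; apply: borel_fun_indic; exact: ball_borel.
  - by move=> x; rewrite mule_ge0 // lee_fin.
  apply: eq_integral => x _; rewrite /f /= !indicE; congr (_ * (nat_of_bool _)%:R%:E).
  by apply/idP/idP => /set_mem; rewrite -?ball_normE => h; apply/mem_set; rewrite -?ball_normE.
rewrite -(@fubini_tonelli _ _ W W R lebm lebm f mf f0).
have -> : lcint leb setT G = \int[lebm]_x G x by exact: borel_lcintE.
have B0 : 0 <= ((2 * D) ^+ n.+2)%:E by rewrite lee_fin exprn_ge0 // mulr_ge0 // ltW.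
rewrite -(@ge0_integralZl _ W R lebm setT measurableT G mG) //.
apply: (@ge0_le_integral _ W R lebm setT measurableT).
- by move=> x _; apply: integral_ge0 => y _; exact: f0.
- exact: (@measurable_fun_fubini_tonelli_F _ _ W W R lebm f mf f0).
- exact: measurable_funeM.
move=> x _; rewrite /f /= (@ge0_integralZl _ W R lebm setT measurableT) //; last first.
  apply/measurable_EFinP; rewrite (_ : (fun y => _) = \1_(ball (x : V) D : set W)); last first.
    apply/funext => y; rewrite !indicE; congr (nat_of_bool _)%:R.
    exact: inb.
  by apply: measurable_indic; apply: (borel_caratheodory bL); exact: ball_borel.
rewrite muleC lee_wpmul2r //.
rewrite (_ : \int[lebm]_y _ = leb (ball (x : V) D)); last first.
  transitivity (leb (ball (x : V) D `&` setT)); last by rewrite setIT.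
  rewrite -(lcint_indic bL bT (ball_borel (x : V) D)) borel_lcintE //; last first.
    by apply: borel_fun_indic; exact: ball_borel.
  apply: eq_integral => y _; rewrite !indicE; congr (nat_of_bool _)%:R%:E.
  exact: inb.
apply: (@le_trans _ _ (leb (cube (x : V) D))); last by apply: leb_cube_le; exact: ltW.
by apply: le_outer_measure => y; rewrite -ball_normE /cube /= distrC => /ltW.
Qed.

Lemma ballint_power (g : V -> \bar R) (D : R) : (0 < D)%R -> borel_fun g -> (forall x, 0 <= g x) ->
  lcint leb setT (fun y => ballint g D y `^ al) <=
  (((2 * D) ^+ n.+2) `^ al)%:E * lcint leb setT (fun x => g x `^ al).
Proof.
move=> D0 bg g0; set B := ((2 * D) ^+ n.+2)%R.
have B0 : (0 < B)%R by rewrite exprn_gt0 // mulr_gt0.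
have al0 : (0 < al)%R := lt_trans ltr01 al1.
have bga : borel_fun (fun x => g x `^ al) by exact: borel_fun_poweR.
have ga0 x : 0 <= g x `^ al by exact: poweR_ge0.
have Bp : 0 <= (B `^ (al - 1))%:E by rewrite lee_fin powR_ge0.
apply: (@le_trans _ _ (lcint leb setT (fun y => (B `^ (al - 1))%:E * ballint (fun x => g x `^ al) D y))).
  by apply: le_lcint => // y _; exact: ballint_jensen.
rewrite lcintZl //; [|exact: borel_setT|exact: ballint_borel|by move=> y; exact: ballint_ge0].
apply: (@le_trans _ _ ((B `^ (al - 1))%:E * (B%:E * lcint leb setT (fun x => g x `^ al)))).
  by rewrite lee_wpmul2l //; exact: ballint_tonelli.
rewrite muleA -EFinM mulrC mulr_powRB1 // ltW //.
Qed.

End averaging.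

(** * Duality between curves and level surfaces *)

Section lipschitz_composition.
Context {R : realType} {n : nat}.
Notation V := 'rV[R]_n.+1.

Lemma lipschitz_comp_measurable (u : V -> \bar R) (N : R -> V) (l : R) : 0 <= l -> borel_fun u ->
  (forall s s', 0 <= s -> s <= s' -> s' <= l -> enorm (N s' - N s) <= s' - s) ->
  measurable_fun `[0, l]%classic (fun s : R => u (N s)).
Proof.
(* Clamping the parameter extends [N] to a continuous map on the whole line. *)
move=> l0 bu Nl; pose cl (s : R) : R := Num.min (Num.max s 0) l.
have cl0 s : 0 <= cl s by rewrite le_min l0 le_max lexx orbT.
have cll s : cl s <= l by rewrite ge_min lexx orbT.
have clm s s' : s <= s' -> cl s <= cl s' /\ cl s' - cl s <= s' - s.
  rewrite /cl /Num.min /Num.max => ss'; do ![case: ifPn]; rewrite -?leNgt; split; lra.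
pose N' s := N (cl s).
have N'l s s' : `|N' s - N' s'| <= `|s - s'|.
  wlog ss' : s s' / s <= s' => [H|].
    by have [/H//|/ltW/H] := leP s s'; rewrite distrC [X in _ <= X]distrC.
  have [c1 c2] := clm _ _ ss'; apply: (le_trans (norm_le_enorm _)); rewrite enormB.
  apply: (le_trans (Nl _ _ (cl0 s) c1 (cll s'))); apply: (le_trans c2).
  by rewrite distrC; exact: ler_norm.
have cN' : continuous N'.
  move=> s A /nbhs_ballP[e /= e0 eA]; apply/nbhs_ballP; exists e => // s'.
  rewrite -ball_normE /= => ss'; apply: eA; rewrite -ball_normE /=.
  exact: le_lt_trans (N'l s s') ss'.
have mN' : measurable_fun [set: R] (N' : R -> @borelType R n.+1).
  apply: (@measurability _ _ R (g_sigma_algebraType [set U : set V | open U]) setT N' [set U : set V | open U]) => //.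
  move=> _ [U oU <-]; rewrite setTI.
  apply: open_measurable; move/continuousP : cN'; exact.
have mu' : measurable_fun [set: R] (fun s => u (N' s)).
  by move/borel_funP : bu => mu; exact: (measurableT_comp mu mN').
apply: (eq_measurable_fun (fun s => u (N' s))); last exact: measurable_funTS.
move=> s; rewrite inE /= in_itv /= => /andP[s0 sl]; rewrite /N' /cl.
by rewrite (max_idPl s0) (min_idPl sl).
Qed.

End lipschitz_composition.

Section duality.
Local Open Scope ereal_scope.
Context {R : realType} {n : nat}.
Notation V := 'rV[R]_n.+2.
Notation leb := (@leb_outer R n.+2).
Notation H := (@hausdorff R n.+2 n.+1).
Notation kap := (@kappa R n).

Let bL : borel_outer leb := @leb_outer_halfspace R n.+1.
Let bH : borel_outer H := @hausdorff_borel_outer R n.+2 n.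

Variables (Wd : set V) (v : V -> R) (a b P : R).
Hypotheses (oW : open Wd) (bW : ebounded Wd) (cv : {within Wd, continuous v}) (P12 : (1 < P <= 2)%R).

Definition vlevel (r : R) : set V := [set y | Wd y /\ v y = r].

Lemma open_within (O : set R) : open O -> open [set y | Wd y /\ O (v y)].
Proof.
move=> oO; rewrite openE => y [Wy Oy].
have h1 : nbhs y Wd by exact: open_nbhs_nbhs.
move/subspace_continuousP : cv => /(_ y Wy O (open_nbhs_nbhs (conj oO Oy))) h2.
by apply: filterS2 h1 h2 => z Wz Oz; split=> //; exact: Oz.
Qed.

Lemma vlevel_borel r : borel_set (vlevel r).
Proof.
rewrite (_ : vlevel r = Wd `\` [set y | Wd y /\ [set t | t != r] (v y)]).
  apply: borelD; first exact: open_borel.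
  by apply: open_borel; apply: open_within; exact: open_neq.
apply/seteqP; split=> y /=; first by move=> [Wy vr]; split=> // -[_]; rewrite vr eqxx.
by move=> [Wy ne]; split=> //; apply/eqP; apply: contrapT => /negP vr; exact: ne.
Qed.

(** Admissibility for the levels in terms of h = rho^k: the constraint becomes linear in [h], which
    the variation needs, and the energy becomes the integral of h^P. *)
Definition hadm (h : V -> \bar R) := [/\ borel_fun h, (forall x, 0 <= h x) &
  forall r, (a < r < b)%R -> 1 <= lcint H (vlevel r) h].

Variables (M : R) (M0 : (0 < M)%R).
Hypothesis Mmin : forall h, hadm h -> M%:E <= lcint leb setT (fun x => h x `^ P).
Hypothesis Mnear : forall d, (0 < d)%R ->
  exists2 h, hadm h & lcint leb setT (fun x => h x `^ P) <= (M + d)%:E.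

Let P0 : (0 < P)%R. Proof. by have /andP[P1 _] := P12; apply: lt_trans P1. Qed.
Let P1 : (0 < P - 1)%R. Proof. by have /andP[P1 _] := P12; rewrite subr_gt0. Qed.

(** (h + t g) / (1 + t) is again admissible, so (1 + t)^P M is at most the integral of (h + t g)^P.
    The former is at least (1 + P t) M, the latter is expanded by [poweR_add_le], and division by P
    t leaves the error terms. *)
Lemma variation (h g : V -> \bar R) (t d C : R) : hadm h -> hadm g -> (0 < t)%R ->
  lcint leb setT (fun x => h x `^ P) <= (M + d)%:E ->
  lcint leb setT (fun x => g x `^ P) <= C%:E ->
  (M - d / (P * t) - t `^ (P - 1) * C)%:E <= lcint leb setT (fun x => h x `^ (P - 1) * g x).
Proof.
move=> [bh h0 hS] [bg g0 gS] t0 hM gC; set X := lcint _ _ _.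
have [->|Xne] := eqVneq X +oo; first exact: leey.
have X0 : 0 <= X by exact: lcint_ge0.
have Xf : X \is a fin_num by rewrite ge0_fin_numE // ltey.
have t1 : (0 < 1 + t)%R by apply: ltr_wpDl.
have t1i : (0 < (1 + t)^-1)%R by rewrite invr_gt0.
pose w x := h x + t%:E * g x.
have te0 : 0 <= t%:E by rewrite lee_fin ltW.
have btg : borel_fun (fun x => t%:E * g x) by apply: borel_funM => //; exact: borel_fun_cst.
have tg0 x : 0 <= t%:E * g x by rewrite mule_ge0.
have bw : borel_fun w by exact: borel_funD.
have w0 x : 0 <= w x by rewrite adde_ge0.
have iw0 : 0 <= ((1 + t)^-1)%:E by rewrite lee_fin ltW.
have wadm : hadm (fun x => ((1 + t)^-1)%:E * w x).
  split=> [|x|r rab]; first by apply: borel_funM => //; exact: borel_fun_cst.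
    by rewrite mule_ge0.
  have bl := vlevel_borel r.
  rewrite lcintZl // lcintD // lcintZl //.
  apply: (@le_trans _ _ (((1 + t)^-1)%:E * (1 + t%:E * 1))).
    by rewrite mule1 -EFinD -EFinM mulVf // gt_eqF.
  by rewrite lee_wpmul2l // leeD ?hS // lee_wpmul2l // gS.
have bT := @borel_setT R n.+2.
have pw z : borel_fun z -> borel_fun (fun x : V => z x `^ P) by exact: borel_fun_poweR.
have h1 : ((1 + t) `^ P * M)%:E <= lcint leb setT (fun x => w x `^ P).
  have := Mmin wadm; rewrite (@eq_lcint _ _ leb setT _ (fun x => (((1 + t)^-1) `^ P)%:E * w x `^ P)); last first.
    by move=> x _; rewrite poweRM // poweR_EFin.
  rewrite lcintZl //; [|exact: pw|by move=> x; exact: poweR_ge0|by rewrite lee_fin powR_ge0].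
  rewrite -lee_pdivrMl ?powR_gt0 // => h1; apply: le_trans h1.
  have -> : (((1 + t)^-1 `^ P)^-1 = (1 + t) `^ P)%R.
    by rewrite -[((1 + t)^-1)%R]powR_inv1 ?(ltW t1) // -powRrM mulN1r powRN invrK.
  by rewrite -EFinM.
have h2 : lcint leb setT (fun x => w x `^ P) <=
    (M + d)%:E + (P * t)%:E * X + (P * t `^ P * C)%:E.
  apply: (@le_trans _ _ (lcint leb setT (fun x => (h x `^ P + (P * t)%:E * (h x `^ (P - 1) * g x)) + (P * t `^ P)%:E * g x `^ P))).
    apply: le_lcint => // x _; apply: (le_trans (poweR_add_le P12 (h0 x) (tg0 x))).
    rewrite poweRM // poweR_EFin; apply: leeD; last by rewrite EFinM muleA.
    by rewrite leeD2l // EFinM [X in _ * X <= _]muleCA muleA.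
  have Pt0 : 0 <= (P * t)%:E by rewrite lee_fin mulr_ge0 // ltW.
  have Pt1 : 0 <= (P * t `^ P)%:E by rewrite lee_fin mulr_ge0 ?powR_ge0 // ltW.
  have bhg : borel_fun (fun x => h x `^ (P - 1) * g x).
    by apply: borel_funM => //; exact: borel_fun_poweR.
  have hg0 x : 0 <= h x `^ (P - 1) * g x by rewrite mule_ge0 // poweR_ge0.
  have b1 : borel_fun (fun x => (P * t)%:E * (h x `^ (P - 1) * g x)).
    by apply: borel_funM => //; exact: borel_fun_cst.
  have b2 : borel_fun (fun x => (P * t `^ P)%:E * g x `^ P).
    by apply: borel_funM; [exact: borel_fun_cst|exact: pw].
  have p0 (z : V -> \bar R) x : 0 <= z x `^ P by exact: poweR_ge0.
  have c1 x : 0 <= (P * t)%:E * (h x `^ (P - 1) * g x) by rewrite mule_ge0.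
  rewrite lcintD //; [|by apply: borel_funD => //; exact: pw|by move=> x; rewrite adde_ge0 ?p0|by move=> x; rewrite mule_ge0 ?p0].
  rewrite lcintD //; do ?[exact: pw|by move=> x; exact: p0].
  rewrite lcintZl // lcintZl //; do ?[exact: pw|by move=> x; exact: p0].
  apply: leeD; last by rewrite [leRHS]EFinM lee_wpmul2l.
  by rewrite leeD.
have := le_trans h1 h2; rewrite -(fineK Xf) -!(EFinM, EFinD) !lee_fin.
have := powR_tangent (ltW (proj1 (andP P12))) (ltW t1) ler01; rewrite !powR1 mulr1 addrAC subrr add0r.
have -> : (t `^ P = t * t `^ (P - 1))%R by rewrite mulr_powRB1 // ltW.
set Y := ((1 + t) `^ P)%R; set s := (t `^ (P - 1))%R; set x := fine X => h3 h4.
have h5 : ((1 + P * t) * M <= Y * M)%R by rewrite ler_wpM2r // ltW.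
have Pt : (0 < P * t)%R by rewrite mulr_gt0.
have h6 : (P * t * (M - s * C) <= P * t * x + d)%R by nra.
rewrite -(ler_pM2l Pt); apply: (@le_trans _ _ (P * t * (M - s * C) - d)%R); last lra.
rewrite le_eqVlt; apply/orP; left; apply/eqP; field.
by rewrite !gt_eqF // mulr_gt0.
Qed.

(** [N] models a parametrization by arc length on [0, l]. The bound [Lm] makes the energy of the
    test functions uniform over the class. *)
Definition tubepath (rho Lm : R) (N : R -> V) (l : R) := [/\ (0 < l <= Lm)%R,
  (forall s s', 0 <= s -> s <= s' -> s' <= l -> enorm (N s' - N s) <= s' - s)%R,
  (forall s, (0 <= s <= l)%R -> cube (N s) rho `<=` Wd),
  (forall y, cube (N 0%R) rho y -> v y <= a)%R & (forall y, cube (N l) rho y -> b <= v y)%R].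

Section test_function.
Variables (rho Lm : R) (N : R -> V) (l : R) (tN : tubepath rho Lm N l).
Variables (k : nat) (d : R) (d0 : (0 < d)%R) (k0 : (0 < k)%N).
Let lam := (l / k%:R)%R.
Hypothesis dl : (d + lam <= rho)%R.
Let Z := (fine kap * (2 * d) ^+ n.+2)%R.
Let l0 : (0 < l)%R. Proof. by case: tN => /andP[]. Qed.
Let lam0 : (0 < lam)%R. Proof. by rewrite divr_gt0 // ltr0n. Qed.
Let kk0 : (0 < fine kap)%R. Proof. by rewrite fine_gt0 // kappa_gt0 /= ltey_eq kappa_fin. Qed.
Let Z0 : (0 < Z)%R. Proof. by rewrite mulr_gt0 // exprn_gt0 // mulr_gt0. Qed.
Let Q i := cube (N (i%:R * lam)) (d + lam).

Let sl i : (i <= k)%N -> (0 <= i%:R * lam <= l)%R.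
Proof.
move=> ik; rewrite mulr_ge0 ?(ltW lam0) //= /lam mulrA ler_pdivrMr ?ltr0n // mulrC.
by rewrite ler_pM2l // ler_nat.
Qed.

Let QW i : (i <= k)%N -> Q i `<=` Wd.
Proof.
move=> ik y yQ; have [_ _ h _ _] := tN; apply: (h _ (sl ik)); exact: le_trans yQ dl.
Qed.

(** The number of cubes [Q i] containing the point, scaled so that [tube] makes the integral over
    each level at least 1. *)
Definition testfun (y : V) : \bar R := (lam / Z)%:E * \sum_(i < k) (\1_(Q i) y)%:E.

Let bQ i : borel_set (Q i).
Proof. by apply: cube_borel; rewrite addr_ge0 // ltW. Qed.

Let bind i : borel_fun (fun y : V => (\1_(Q i) y)%:E). Proof. exact: borel_fun_indic. Qed.

Let ind0 i y : 0 <= (\1_(Q i) y : R)%:E. Proof. by rewrite lee_fin. Qed.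

Let bsum : borel_fun (fun y : V => \sum_(i < k) (\1_(Q i) y)%:E).
Proof.
elim: (k) => [|j IH] t; first by under eq_set do rewrite big_ord0; exact: borel_fun_cst.
have := borel_funD IH (bind j) t; congr borel_set; apply/seteqP; split=> x /=; by rewrite big_ord_recr.
Qed.

Let lZ0 : 0 <= (lam / Z)%:E. Proof. by rewrite lee_fin divr_ge0 // ltW. Qed.

Lemma testfun_borel : borel_fun testfun.
Proof. by apply: borel_funM => //; exact: borel_fun_cst. Qed.

Lemma testfun_ge0 y : 0 <= testfun y.
Proof. by rewrite mule_ge0 // sume_ge0. Qed.

Lemma testfun_hadm : hadm testfun.
Proof.
split; [exact: testfun_borel|exact: testfun_ge0|move=> r /andP[ar rb]].
have bl := vlevel_borel r.
rewrite lcintZl //; last by move=> y; exact: sume_ge0.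
rewrite (lcint_sum bH (f := fun i y => (\1_(Q i) y)%:E)) //.
have [_ NL _ Na Nb] := tN.
have := @tube R n Wd v (fun i => N (i%:R * lam)%R) k lam d r cv lam0 d0.
have -> : N (k%:R * lam)%R = N l by rewrite /lam mulrC divfK // pnatr_eq0 -lt0n.
rewrite mul0r => tb.
have {tb} : kap * ((2 * d) ^+ n.+2)%:E <= \sum_(i < k) lam%:E * H (vlevel r `&` Q i).
  have dr : (d <= rho)%R by apply: le_trans dl; rewrite lerDl ltW.
  apply: tb => [i ik|i ik|y yd|y yd].
  - apply: (le_trans (NL _ _ _ _ _)); first by case/andP: (sl (ltnW ik)).
    + by rewrite ler_pM2r // ler_nat.
    + by case/andP: (sl ik).
    + by rewrite -mulrBl -natrB // subSnn mul1r.
  - by apply: QW; exact: ltnW.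
  - by apply: le_lt_trans ar; apply: Na; exact: le_trans yd dr.
  - by apply: lt_le_trans rb _; apply: Nb; exact: le_trans yd dr.
rewrite -ge0_sume_distrr => [|i _]; last exact: outer_measure_ge0.
rewrite -(fineK (@kappa_fin R n)) -EFinM -/Z => tb.
rewrite (eq_bigr (fun i : 'I_k => H (vlevel r `&` Q i))) => [|i _]; last by rewrite lcint_indic // setIC.
rewrite [(lam / Z)%R]mulrC EFinM -muleA; apply: (@le_trans _ _ ((Z^-1)%:E * Z%:E)).
  by rewrite -EFinM mulVf // gt_eqF.
by rewrite lee_wpmul2l // lee_fin invr_ge0 ltW.
Qed.

(** At most [k] cubes overlap and k lam = l <= Lm, so the bound does not depend on [k]. *)
Lemma testfun_energy : lcint leb setT (fun x => testfun x `^ P) <=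
  ((Lm / Z) `^ P)%:E * leb Wd.
Proof.
have LZ0 : (0 <= Lm / Z)%R.
  by case: tN => /andP[_ lL] _ _ _ _; rewrite divr_ge0 ?(ltW Z0) // (le_trans (ltW l0)).
rewrite -lcint_cst //; [|exact: open_borel|by rewrite lee_fin powR_ge0].
rewrite lcint_restrict; apply: le_lcint => // x _; rewrite indicE.
case: (boolP (x \in Wd)) => [_|/negP xW].
  rewrite mule1 -poweR_EFin; apply: le_poweR; [exact: ltW|exact: testfun_ge0|].
  rewrite /testfun (@le_trans _ _ ((lam / Z)%:E * k%:R%:E)) //.
    rewrite lee_wpmul2l //; apply: (@le_trans _ _ (\sum_(i < k) 1)).
      by apply: lee_sum => i _; rewrite lee_fin indicE lern1 leq_b1.
    by rewrite sumEFin lee_fin sumr_const card_ord.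
  rewrite -EFinM lee_fin mulrAC /lam divfK ?pnatr_eq0 -?lt0n // ler_pM2r ?invr_gt0 //.
  by case: tN => /andP[].
rewrite mule0 /testfun big1 ?mule0 ?poweR0r ?gt_eqF // => i _; rewrite indicE.
case: (boolP (x \in _)) => // /set_mem xQ; case: xW; apply/mem_set.
exact: (QW (ltnW (ltn_ord i))) xQ.
Qed.

Lemma testfun_pairing (g : V -> \bar R) : borel_fun g -> (forall x, 0 <= g x) ->
  lcint leb setT (fun x => g x * testfun x) = (lam / Z)%:E * \sum_(i < k) lcint leb (Q i) g.
Proof.
move=> bg g0; have bT := @borel_setT R n.+2.
rewrite (@eq_lcint _ _ leb setT _ (fun x => (lam / Z)%:E * \sum_(i < k) g x * (\1_(Q i) x)%:E)); last first.
  by move=> x _; rewrite /testfun muleCA ge0_sume_distrr.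
have bgi i : borel_fun (fun x => g x * (\1_(Q i) x)%:E) by exact: borel_funM.
have gi0 i x : 0 <= g x * (\1_(Q i) x)%:E by rewrite mule_ge0.
rewrite lcintZl //; last first.
- by move=> x; rewrite sume_ge0.
- elim: (k) => [|j IH] t; first by under eq_set do rewrite big_ord0; exact: borel_fun_cst.
  have := borel_funD IH (bgi j) t; congr borel_set; apply/seteqP; split=> x /=; by rewrite big_ord_recr.
congr (_ * _); rewrite (lcint_sum bL (f := fun i x => g x * (\1_(Q i) x)%:E)) //.
by apply: eq_bigr => i _; rewrite -lcint_restrict.
Qed.

(** A lower Riemann sum: during the [i]-th interval the curve stays within [lam] of N(i lam). *)
Lemma path_integral_ge (u : V -> \bar R) (c : nat -> \bar R) : borel_fun u -> (forall x, 0 <= u x) ->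
  (forall i y, (i < k)%N -> cube (N (i%:R * lam)) lam y -> c i <= u y) -> (forall i, 0 <= c i) ->
  lam%:E * \sum_(i < k) c i <= \int[lebesgue_measure]_(s in `[0%R, l]) u (N s).
Proof.
move=> bu u0 cu c0; have [_ NL _ _ _] := tN.
have mu : measurable_fun `[0%R, l]%classic (fun s : R => u (N s)).
  by apply: lipschitz_comp_measurable => //; exact: ltW.
suff key j : (j <= k)%N ->
    lam%:E * \sum_(i < j) c i <= \int[lebesgue_measure]_(s in `[0%R, (j%:R * lam)%R[) u (N s).
  apply: (le_trans (key k (leqnn k))); apply: ge0_subset_integral => //.
  by have /andP[_ kl] := sl (leqnn k); move=> s /=; rewrite !in_itv /= => /andP[-> /ltW /le_trans]; exact.
elim: j => [|j IH] jk; first by rewrite big_ord0 mule0 integral_ge0.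
have [/andP[sj0 sjl] /andP[sj1 sj1l]] := (sl (ltnW jk), sl jk).
have jS : (j.+1%:R * lam = j%:R * lam + lam)%R by rewrite -natr1 mulrDl mul1r.
have -> : (`[0%R, (j.+1%:R * lam)%R[%classic : set R) =
    `[0%R, (j%:R * lam)%R[%classic `|` `[(j%:R * lam)%R, (j.+1%:R * lam)%R[%classic.
  apply/seteqP; split=> s /=; rewrite !in_itv /=; rewrite jS in sj1 *.
    move=> /andP[s0 s1]; have [sj|sj] := ltP s (j%:R * lam)%R; first by left; rewrite s0.
    by right.
  by move: lam0 => ? [/andP[s0 s1]|/andP[s0 s1]]; apply/andP; split; lra.
have mu' : measurable_fun (`[0%R, (j%:R * lam)%R[%classic `|` `[(j%:R * lam)%R, (j.+1%:R * lam)%R[%classic : set R) (fun s : R => u (N s)).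
  apply: measurable_funS mu => //.
  move=> s /=; rewrite !in_itv /=; rewrite jS in sj1 sj1l *.
  by move: lam0 => ? [/andP[s0 s1]|/andP[s0 s1]]; apply/andP; split; lra.
rewrite ge0_integral_setU //; last first.
  apply/disj_setPS => s [] /=; rewrite !in_itv /= => /andP[_ s1] /andP[s2 _].
  by move: s1; rewrite ltNge s2.
rewrite big_ord_recr /= ge0_muleDr ?c0 ?sume_ge0 //; apply: leeD; first exact: IH (ltnW jk).
apply: (@le_trans _ _ (\int[lebesgue_measure]_(s in `[(j%:R * lam)%R, (j.+1%:R * lam)%R[) cst (c j) s)).
  have mI : measurable (`[(j%:R * lam)%R, (j.+1%:R * lam)%R[%classic : set R) by exact: measurable_itv.
  rewrite le_eqVlt; apply/orP; left; apply/eqP/esym.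
  etransitivity; first exact: (integral_cst (@lebesgue_measure R) mI).
  rewrite muleC; congr (_ * _).
  rewrite [LHS](_ : _ = lebesgue_measure (`[(j%:R * lam)%R, (j.+1%:R * lam)%R[%classic : set R)) //.
  by rewrite lebesgue_measure_itv /= lte_fin jS ltrDl lam0 -EFinB addrAC subrr add0r.
apply: ge0_le_integral => //.
- by move=> s _; exact: c0.
- apply: measurable_funS mu'; last by move=> s; right.
  by apply: measurableU; exact: measurable_itv.
move=> s /=; rewrite in_itv /= => /andP[s1 s2]; apply: cu => //.
apply: (le_trans (norm_le_enorm _)); apply: (le_trans (NL _ _ _ _ _)) => //.
  by apply: (le_trans (ltW s2)).
by move: s2; rewrite jS; lra.
Qed.

End test_function.

(* The first variation at a near-minimizer [h] of the surface modulus, tested on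
   a tube around the curve, bounds from below the line integral of the averages
   of [h `^ (P - 1)]. *)
Lemma duality (al rho Lm c : R) : (al^-1 + P^-1 = 1)%R -> (0 < rho)%R -> (0 < Lm)%R -> (1 < c)%R ->
  exists u : V -> \bar R, [/\ borel_fun u, (forall x, 0 <= u x),
    (forall N l, tubepath rho Lm N l -> 1 <= \int[lebesgue_measure]_(s in `[0%R, l]) u (N s)) &
    lcint leb setT (fun x => u x `^ al) <= (c * (fine kap `^ (- al) * M `^ (1 - al)))%:E].
Proof.
move=> alP rho0 Lm0 c1.
have /andP[P_gt1 P_le2] := P12.
have Pi1 : (P^-1 < 1)%R by rewrite invf_lt1.
have ali : (0 < al^-1 < 1)%R.
  have Pi0 : (0 < P^-1)%R by rewrite invr_gt0.
  by move: alP Pi1 Pi0; move: (al^-1)%R (P^-1)%R => x y; lra.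
have al0 : (0 < al)%R by rewrite -invr_gt0; case/andP: ali.
have al1 : (1 < al)%R by rewrite -[al]invrK -invf_lt1 ?invrK // ?invr_gt0 // ; case/andP: ali.
have Pal : ((P - 1) * al = P)%R.
  have PE : (P^-1 = 1 - al^-1)%R by rewrite -alP [RHS]addrAC subrr add0r.
  have alE : (al^-1 = 1 - P^-1)%R by rewrite PE opprB addrC subrK.
  rewrite -[al]invrK alE (_ : (1 - P^-1 = (P - 1) / P)%R); last by field; rewrite gt_eqF.
  by rewrite invf_div mulrCA divff ?mulr1 // gt_eqF.
set kk := fine kap; have kk0 : (0 < kk)%R by rewrite fine_gt0 // kappa_gt0 /= ltey_eq kappa_fin.
(* The total loss will be q^((n+2) al + 1): the comparison of cube volumes, raised to the power
   [al], and one more factor for near-minimality of [h]. *)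
pose E0 := (n.+2%:R * al + 1)%R; have E00 : (0 < E0)%R by rewrite addr_gt0 // mulr_gt0.
pose q := (c `^ E0^-1)%R; have c0 : (0 < c)%R by apply: lt_trans c1.
have q1 : (1 < q)%R.
  by rewrite /q /powR gt_eqF // -[ltLHS]expR0 ltr_expR mulr_gt0 ?invr_gt0 // ln_gt0.
have q0 : (0 < q)%R by apply: lt_trans q1.
have qE : (q `^ E0 = c)%R by rewrite /q -powRrM mulVf ?gt_eqF // powRr1 // ltW.
(* Solves (1 + th) / (1 - th) = q, the form in which the losses appear. *)
pose th := ((q - 1) / (q + 1))%R.
have qp1 : (0 < q + 1)%R by rewrite addr_gt0.
have th0 : (0 < th)%R by rewrite divr_gt0 // subr_gt0.
have th1 : (th < 1)%R by rewrite ltr_pdivrMr // mul1r; lra.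
have th1' : (0 < 1 - th)%R by rewrite subr_gt0.
have qth : ((1 + th) / (1 - th) = q)%R.
  rewrite /th; field; rewrite (_ : q + 1 - (q - 1) = 2)%R; last by ring.
  by rewrite gt_eqF //= pnatr_eq0.
pose d := (rho / 2)%R; have d0 : (0 < d)%R by rewrite divr_gt0.
pose Z := (kk * (2 * d) ^+ n.+2)%R.
have Z0 : (0 < Z)%R by rewrite mulr_gt0 // exprn_gt0 // mulr_gt0.
have Wfin := leb_ebounded_fin bW.
pose CP := ((Lm / Z) `^ P * fine (leb Wd))%R.
have CP0 : (0 <= CP)%R by rewrite mulr_ge0 ?powR_ge0 // fine_ge0 // outer_measure_ge0.
have CP1 : (0 < 2 * (CP + 1))%R by rewrite mulr_gt0 // ltr_wpDl.
have thM : (0 < th * M)%R by rewrite mulr_gt0.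
(* First [t] makes the term t^(P-1) CP of [variation] at most th M / 2, then [de] makes de / (P t)
   at most th M / 2; the pairing is thus at least (1 - th) M. *)
pose t := ((th * M / (2 * (CP + 1))) `^ (P - 1)^-1)%R.
have t0 : (0 < t)%R by rewrite powR_gt0 // divr_gt0.
have tC : (t `^ (P - 1) * CP <= th * M / 2)%R.
  rewrite /t -powRrM mulVf ?gt_eqF // powRr1; last by rewrite divr_ge0 // ltW.
  rewrite mulrAC ler_pdivrMr // -subr_ge0.
  rewrite (_ : (_ - _)%R = (th * M)%R); last by field.
  exact: ltW.
pose de := Num.min (th * M)%R (P * t * (th * M / 2))%R.
have Pt0 : (0 < P * t)%R by rewrite mulr_gt0.
have de0 : (0 < de)%R by rewrite lt_min thM mulr_gt0 // divr_gt0.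
have [h [bh h0 hS] hM] := Mnear de0.
pose g x := h x `^ (P - 1).
have bg : borel_fun g by exact: borel_fun_poweR.
have g0 x : 0 <= g x by exact: poweR_ge0.
(* As soon as 2 lam < th d, the ball of radius [Dl] around a point within [lam] of N(i lam) contains
   the cube of radius d + lam around N(i lam). *)
pose Dl := (d * (1 + th))%R; have Dl0 : (0 < Dl)%R by rewrite mulr_gt0 // addr_gt0.
(* [Z] stems from the scaling of the test function and M (1 - th) from the pairing; their inverse
   makes line integrals at least 1. *)
pose K := ((Z * (M * (1 - th)))^-1)%R.
have ZM0 : (0 < Z * (M * (1 - th)))%R by apply: mulr_gt0 => //; exact: mulr_gt0.
have K0 : (0 < K)%R by rewrite invr_gt0.
have Ke0 : 0 <= K%:E by rewrite lee_fin ltW.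
have bb := ballint_borel Dl0 bg g0.
pose u y := K%:E * ballint g Dl y.
have bu : borel_fun u by apply: borel_funM => //; exact: borel_fun_cst.
have u0 x : 0 <= u x by rewrite mule_ge0 // ballint_ge0.
exists u; split=> //.
- move=> N l tN; have [/andP[l0 lL] _ _ _ _] := tN.
  have thd : (0 < th * d)%R by rewrite mulr_gt0.
  pose k := (Num.truncn (2 * l / (th * d))).+1; have k1 : (0 < k)%N by [].
  have k0 : (0 < k%:R :> R)%R by rewrite ltr0n.
  pose lam := (l / k%:R)%R; have lam0 : (0 < lam)%R by rewrite divr_gt0.
  have lth : (2 * lam < th * d)%R.
    rewrite /lam mulrA ltr_pdivrMr // [ltRHS]mulrC -ltr_pdivrMr //; exact: truncnS_gt.
  have dl : (d + lam <= rho)%R.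
    have thd1 : (th * d < d)%R by rewrite -[ltRHS]mul1r ltr_pM2r.
    rewrite [leRHS](splitr rho) -/d lerD2l -(ler_pM2l (ltr0Sn R 1)); apply: ltW.
    by apply: (lt_trans lth); apply: (lt_trans thd1); rewrite ltr_pMl // ltr1n.
  have tadm := testfun_hadm tN d0 k1 dl.
  have ten : lcint leb setT (fun x => testfun N l k d x `^ P) <= CP%:E.
    apply: (le_trans (testfun_energy tN d0 k1 dl)).
    by rewrite /CP EFinM fineK.
  have := variation (And3 bh h0 hS) tadm t0 hM ten; rewrite (testfun_pairing tN d0 k1 bg g0).
  rewrite -/kk -/Z -/lam => var.
  have {}var : (M * (1 - th))%:E <= (lam / Z)%:E *
      \sum_(i < k) lcint leb (cube (N (i%:R * lam)%R) (d + lam)) g.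
    apply: le_trans var; rewrite lee_fin.
    have h1 : (de / (P * t) <= th * M / 2)%R.
      by rewrite ler_pdivrMr // mulrC ge_min lexx orbT.
    rewrite mulrBr mulr1 [(M * th)%R]mulrC [X in (_ - X)%R](splitr (th * M)%R) opprD addrA.
    exact: lerB (lerB (lexx _) h1) tC.
  apply: le_trans (path_integral_ge tN k1 bu u0
      (c := fun i => K%:E * lcint leb (cube (N (i%:R * lam)%R) (d + lam)) g) _ _); last first.
  + by move=> i; rewrite mule_ge0 // lcint_ge0.
  + move=> i y ik yi; rewrite lee_wpmul2l //; apply: le_lcint => // x.
    rewrite /cube /= -ball_normE /= => xd.
    rewrite -[(y - x)%R](subrKA (N (i%:R * lam)%R)); apply: (le_lt_trans (ler_normD _ _)).
    rewrite [X in (_ + X)%R]distrC /Dl; apply: (le_lt_trans (lerD yi xd)).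
    rewrite -/lam (_ : (lam + (d + lam) = d + 2 * lam)%R); last by ring.
    by rewrite mulrDr mulr1 ltrD2l [(d * th)%R]mulrC.
  rewrite -/lam -ge0_sume_distrr => [|i _]; last exact: lcint_ge0.
  rewrite muleCA; apply: (@le_trans _ _ (K%:E * (Z%:E * (M * (1 - th))%:E))).
    by rewrite -!EFinM mulVf // gt_eqF.
  rewrite lee_wpmul2l // (@le_trans _ _ (Z%:E * ((lam / Z)%:E *
      \sum_(i < k) lcint leb (cube (N (i%:R * lam)%R) (d + lam)) g))) //.
    by rewrite lee_wpmul2l // lee_fin ltW.
  by rewrite muleA -EFinM mulrCA (divff (lt0r_neq0 Z0)) mulr1.
have bT := @borel_setT R n.+2.
rewrite (@eq_lcint _ _ leb setT _ (fun x => (K `^ al)%:E * ballint g Dl x `^ al)); last first.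
  by move=> x _; rewrite poweRM // ?ballint_ge0 // poweR_EFin.
rewrite lcintZl //; [|exact: borel_fun_poweR|by move=> x; exact: poweR_ge0|by rewrite lee_fin powR_ge0].
apply: (@le_trans _ _ ((K `^ al)%:E * ((((2 * Dl) ^+ n.+2) `^ al)%:E * lcint leb setT (fun x => g x `^ al)))).
  by rewrite lee_wpmul2l ?lee_fin ?powR_ge0 //; apply: (@ballint_power R n al P).
have gE : lcint leb setT (fun x => g x `^ al) <= (M * (1 + th))%:E.
  rewrite (@eq_lcint _ _ leb setT _ (fun x => h x `^ P)); last first.
    by move=> x _; rewrite /g poweR_poweR ?Pal.
  apply: (le_trans hM); rewrite lee_fin mulrDr mulr1 lerD2l mulrC ge_min lexx //.
apply: (@le_trans _ _ ((K `^ al)%:E * ((((2 * Dl) ^+ n.+2) `^ al)%:E * (M * (1 + th))%:E))).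
  by rewrite lee_wpmul2l ?lee_fin ?powR_ge0 // lee_wpmul2l ?lee_fin ?powR_ge0.
have DlE : (0 <= (2 * Dl) ^+ n.+2)%R by rewrite exprn_ge0 // mulr_ge0 // ltW.
rewrite -!EFinM lee_fin mulrA -powRM ?(ltW K0) ?DlE //.
have KD : (K * (2 * Dl) ^+ n.+2 <= q ^+ n.+2 / (kk * M))%R.
  have -> : (K * (2 * Dl) ^+ n.+2 = ((1 + th) ^+ n.+2 / (1 - th)) / (kk * M))%R.
    rewrite /K /Z (_ : (2 * Dl) ^+ n.+2 = (2 * d) ^+ n.+2 * (1 + th) ^+ n.+2)%R; last by rewrite /Dl mulrA exprMn.
    move: ((2 * d) ^+ n.+2)%R (exprn_gt0 n.+2 (mulr_gt0 (ltr0Sn R 1) d0)) ((1 + th) ^+ n.+2)%R => x x0 y.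
    by field; rewrite !gt_eqF.
  rewrite ler_pM2r ?invr_gt0 ?mulr_gt0 // -qth expr_div_n ler_wpM2l ?exprn_ge0 ?addr_ge0 ?(ltW th0) //.
  rewrite lef_pV2 ?posrE ?exprn_gt0 // exprS -[leRHS]mulr1 ler_pM2l //.
  by rewrite exprn_ile1 ?(ltW th1') // gerBl ltW.
have KD0 : (0 <= K * (2 * Dl) ^+ n.+2)%R.
  by rewrite mulr_ge0 ?(ltW K0) // exprn_ge0 // mulr_ge0 // ltW.
have kM0 : (0 < kk * M)%R by rewrite mulr_gt0.
have qn0 : (0 < q ^+ n.+2)%R by rewrite exprn_gt0.
apply: (@le_trans _ _ ((q ^+ n.+2 / (kk * M)) `^ al * (M * q))%R).
  apply: ler_pM.
  - exact: powR_ge0.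
  - by apply: mulr_ge0; [exact: ltW|apply: addr_ge0 => //; exact: ltW].
  - apply: ge0_ler_powR => //; rewrite ?nnegrE ?(ltW al0) //.
    exact: ltW (divr_gt0 qn0 kM0).
  rewrite ler_pM2l // -qth ler_pdivlMr // -[leRHS]mulr1 ler_pM2l ?addr_gt0 //.
  by rewrite gerBl; exact: ltW.
rewrite le_eqVlt; apply/orP; left; apply/eqP.
rewrite powRM ?(ltW qn0) ?invr_ge0 ?(ltW kM0) //.
rewrite -[((kk * M)^-1)%R]powR_inv1 ?(ltW kM0) // -[X in (_ * X * _)%R]powRrM mulN1r.
rewrite powRM ?(ltW kk0) ?(ltW M0) // -powR_mulrn ?(ltW q0) // -powRrM.
have -> : (M `^ (1 - al) = M `^ (- al) * M)%R.
  rewrite -{3}[M]powRr1 ?(ltW M0) // -powRD; last by rewrite (gt_eqF M0) implybT.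
  by rewrite addrC.
have -> : c = (q `^ (n.+2%:R * al) * q)%R.
  rewrite -qE /E0 powRD; last by rewrite (gt_eqF q0) implybT.
  by rewrite powRr1 // ltW.
by ring.
Qed.

End duality.

(** * Modulus of all curves that have a tube *)

Section tube_modulus.
Local Open Scope ereal_scope.
Context {R : realType} {n : nat}.
Notation V := 'rV[R]_n.+2.
Notation leb := (@leb_outer R n.+2).
Notation kap := (@kappa R n).
Let bL : borel_outer leb := @leb_outer_halfspace R n.+1.
Variables (Wd : set V) (v : V -> R) (a b P : R).
Hypothesis oW : open Wd.
Hypothesis bW : ebounded Wd.
Hypothesis cv : {within Wd, continuous v}.
Hypothesis P12 : (1 < P <= 2)%R.
Local Notation I q u := (lcint leb setT (fun x => u x `^ q)).

(** The test function of a single tube has finite energy; hence an infinite minimal energy of the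
    levels means that no curve has a tube. *)
Lemma tubepath_hadm (rho Lm : R) (N : R -> V) (l : R) : (0 < rho)%R ->
  tubepath Wd v a b rho Lm N l -> exists2 h, hadm Wd v a b h & I P h < +oo.
Proof.
move=> r0 tN; have [/andP[l0 _] _ _ _ _] := tN.
have d0 : (0 < rho / 2)%R by rewrite divr_gt0.
pose k := (Num.truncn (l / (rho / 2))).+1; have k1 : (0 < k)%N by [].
have dl : (rho / 2 + l / k%:R <= rho)%R.
  rewrite [leRHS](splitr rho) lerD2l ler_pdivrMr ?ltr0n // mulrC -ler_pdivrMr //.
  exact/ltW/truncnS_gt.
exists (testfun N l k (rho / 2)%R); first exact: (testfun_hadm oW cv tN d0 k1 dl).
apply: le_lt_trans (testfun_energy oW P12 tN d0 k1 dl) _.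
by rewrite -[leb Wd]fineK ?(leb_ebounded_fin bW) // ltry.
Qed.

Let tadm (rho Lm : R) (u : V -> \bar R) := [/\ borel_fun u, (forall x, 0 <= u x) &
  forall N l, tubepath Wd v a b rho Lm N l ->
    1 <= \int[lebesgue_measure]_(s in `[0%R, l]) u (N s)].

Lemma tubepath_le (rho rho' Lm Lm' : R) N l : (rho' <= rho)%R -> (Lm <= Lm')%R ->
  tubepath Wd v a b rho Lm N l -> tubepath Wd v a b rho' Lm' N l.
Proof.
move=> rr LL [/andP[l0 lL] lip tW t0 t1].
have sub y : cube y rho' `<=` cube y rho by move=> z; rewrite /cube /= => /le_trans; apply.
split=> //; first by rewrite l0 (le_trans lL).
- by move=> s s01; apply: subset_trans (tW s s01); exact: sub.
- by move=> y /sub; exact: t0.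
- by move=> y /sub; exact: t1.
Qed.

Let tadm_up rho Lm u w : tadm rho Lm u -> borel_fun w -> (forall x, u x <= w x) -> tadm rho Lm w.
Proof.
move=> [bu u0 uN] bw uw; have w0 x : 0 <= w x by apply: le_trans (uw x).
split=> // N l tN; apply: (le_trans (uN N l tN)).
have [/andP[l0 _] lip _ _ _] := tN.
have mN z : borel_fun z -> measurable_fun `[0%R, l]%classic (fun s : R => z (N s)).
  by move=> bz; apply: lipschitz_comp_measurable => //; exact: ltW.
by apply: ge0_le_integral => //; exact: mN.
Qed.

Let tadm_mid rho Lm u w : tadm rho Lm u -> tadm rho Lm w ->
  tadm rho Lm (fun x => 2^-1%:E * (u x + w x)).
Proof.
move=> [bu u0 uN] [bw w0 wN].
split=> [|x|N l tN].
- by apply: borel_funM; [exact: borel_fun_cst|exact: borel_funD].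
- by rewrite mule_ge0 ?adde_ge0 // lee_fin invr_ge0.
have [/andP[l0 _] lip _ _ _] := tN.
have mN z : borel_fun z -> measurable_fun `[0%R, l]%classic (fun s : R => z (N s)).
  by move=> bz; apply: lipschitz_comp_measurable => //; exact: ltW.
have m0 : measurable (`[0%R, l]%classic : set R) by [].
have -> : \int[lebesgue_measure]_(s in `[0%R, l]) (2^-1%:E * (u (N s) + w (N s))) =
  2^-1%:E * (\int[lebesgue_measure]_(s in `[0%R, l]) u (N s) +
             \int[lebesgue_measure]_(s in `[0%R, l]) w (N s)).
  etransitivity.
    apply: ge0_integralZl_EFin => //.
    - by move=> s _; rewrite adde_ge0.
    - by have := mN _ (borel_funD bu bw).
  by rewrite ge0_integralD //; [exact: mN|exact: mN].
apply: (@le_trans _ _ (2^-1%:E * (1 + 1))).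
  by rewrite -EFinD -EFinM lee_fin -[(1 + 1)%R]/(2%R) mulVf // pnatr_eq0.
rewrite lee_wpmul2l ?lee_fin ?invr_ge0 //; apply: leeD; [exact: uN|exact: wN].
Qed.

(** [duality] gives a density for each class of curves with tube width 1/(j+1) and length at most
    j+1; these classes exhaust the curves with a tube, and [ziemer] provides one density for all of
    them. *)
Lemma tube_modulus (al M e : R) : (2 <= al)%R -> (al^-1 + P^-1 = 1)%R -> (0 < M)%R ->
  (forall h, hadm Wd v a b h -> M%:E <= I P h) -> (0 < e)%R ->
  exists U : V -> \bar R, [/\ borel_fun U, (forall x, 0 <= U x),
    (forall rho Lm N l, (0 < rho)%R -> tubepath Wd v a b rho Lm N l ->
      1 <= \int[lebesgue_measure]_(s in `[0%R, l]) U (N s)) &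
    I al U <= (fine kap `^ (- al) * M `^ (1 - al) + e)%:E].
Proof.
move=> al2 alP M0 Mle e0; have al0 : (0 < al)%R by apply: lt_le_trans al2.
pose Mi := ereal_inf [set I P h | h in hadm Wd v a b].
have MMi : M%:E <= Mi by apply: le_ereal_inf_tmp => _ [h hh <-]; exact: Mle.
have kk0 : (0 < fine kap)%R by rewrite fine_gt0 // kappa_gt0 /= ltey_eq kappa_fin.
have [Mioo|/negP Mifin] := boolP (Mi == +oo).
  (* By [tubepath_hadm] there is no curve with a tube, so the zero density will do. *)
  exists (fun=> 0); split=> //; first exact: borel_fun_cst.
    move=> rho Lm N l r0 /(tubepath_hadm r0)[h hh].
    by rewrite ltNge => /negP[]; rewrite -(eqP Mioo); apply: ereal_inf_lbound; exists h.
  rewrite (@eq_lcint _ _ leb setT _ (fun=> 0)); last by move=> x _; rewrite poweR_EFin powR0 ?gt_eqF.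
  by rewrite (lcint_cst bL) // ?mul0e ?lee_fin ?addr_ge0 ?mulr_ge0 ?powR_ge0 ?ltW //; exact: borel_setT.
have Mf : Mi \is a fin_num.
  by rewrite fin_numE; apply/andP; split; [rewrite gt_eqF // (lt_le_trans _ MMi) // ltNyr|exact/negP].
(* [duality] is stated for the exact infimum. Since al > 1, passing from [m] back to the smaller [M]
   only increases the bound. *)
pose m := fine Mi; have mE : m%:E = Mi by rewrite fineK.
have Mm : (M <= m)%R by rewrite -lee_fin mE.
have m0 : (0 < m)%R by apply: lt_le_trans Mm.
pose B := (fine kap `^ (- al) * m `^ (1 - al))%R.
have B0 : (0 <= B)%R by rewrite mulr_ge0 ?powR_ge0.
have B1 : (0 < 2 * (B + 1))%R by rewrite mulr_gt0 // ltr_wpDl.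
pose c := (1 + e / (2 * (B + 1)))%R.
have c1 : (1 < c)%R by rewrite ltrDl divr_gt0.
have cB : (c * B <= B + e / 2)%R.
  rewrite /c mulrDl mul1r lerD2l mulrAC ler_pdivrMr // -subr_ge0.
  by rewrite (_ : (_ - _ = e)%R); [exact: ltW|field].
have mmin h : hadm Wd v a b h -> m%:E <= I P h.
  by move=> hh; rewrite mE; apply: ereal_inf_lbound; exists h.
have mnear d : (0 < d)%R -> exists2 h, hadm Wd v a b h & I P h <= (m + d)%:E.
  move=> d0; have /(ereal_inf_lt (x:=_)) : Mi < (m + d)%:E by rewrite -mE lte_fin ltrDl.
  by case=> _ [h hh <-] /ltW; exists h.
have jE j : exists2 u, tadm j.+1%:R^-1 j.+1%:R u & I al u <= (c * B)%:E.
  have [u [bu u0 uN uI]] := duality oW bW cv P12 m0 mmin mnear alP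
    (rho := j.+1%:R^-1) (Lm := j.+1%:R) ltac:(by rewrite invr_gt0) ltac:(by []) c1.
  by exists u.
have [||||U UA UI] := ziemer bL al2 (Adm := fun j => tadm j.+1%:R^-1 j.+1%:R) _ _ _ _ jE
    (divr_gt0 e0 (ltr0Sn R 1)).
- by move=> j u [].
- by move=> j u w Au bw uw; exact: tadm_up Au bw uw.
- move=> j u [bu u0 uN]; split=> // N l /(@tubepath_le _ j.+2%:R^-1 _ j.+2%:R) tN.
  by apply: uN; apply: tN; rewrite ?ler_nat // lef_pV2 ?posrE // ler_nat.
- by move=> j u w; exact: tadm_mid.
have [bU U0 _] := UA 0%N.
exists U; split=> //.
- move=> rho Lm N l r0 tN.
  pose j := maxn (Num.truncn rho^-1) (Num.truncn Lm).
  have [_ _] := UA j; apply; apply: tubepath_le tN.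
    rewrite -[leRHS]invrK lef_pV2 ?posrE ?invr_gt0 //; apply: ltW.
    by apply: lt_le_trans (truncnS_gt _) _; rewrite ler_nat ltnS leq_maxl.
  by apply: ltW; apply: lt_le_trans (truncnS_gt _) _; rewrite ler_nat ltnS leq_maxr.
apply: (le_trans UI); rewrite lee_fin.
apply: (@le_trans _ _ (B + e)%R).
  by rewrite [X in (_ <= _ + X)%R](splitr e) addrA lerD2r.
rewrite lerD2r ler_wpM2l ?powR_ge0 // -[(1 - al)%R]opprB !powRN lef_pV2 ?posrE ?powR_gt0 //.
by apply: ge0_ler_powR; rewrite ?nnegrE ?subr_ge0 ?(ltW m0) ?(ltW M0) // (le_trans _ al2) // ler1n.
Qed.

End tube_modulus.

(** * Tubes around image curves *)

Section image_of_paths.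
Context {R : realType} {n : nat}.
Notation V := 'rV[R]_n.+2.

Lemma open_cube (O : set V) y : open O -> O y -> exists2 r, 0 < r & cube y r `<=` O.
Proof.
rewrite openE => oO /oO /nbhs_ballP[r /= r0 rO]; exists (r / 2); first by rewrite divr_gt0.
move=> z; rewrite /cube /= => zy; apply: rO; rewrite -ball_normE /= distrC.
by apply: (le_lt_trans zy); rewrite ltr_pdivrMr // ltr_pMr // ltr1n.
Qed.

Lemma curve_tube (O : set V) (N : R -> V) (l : R) : open O ->
  (forall s, 0 <= s <= l -> O (N s)) ->
  (forall s s', 0 <= s -> s <= s' -> s' <= l -> enorm (N s' - N s) <= s' - s) ->
  exists2 r, 0 < r & forall s, 0 <= s <= l -> cube (N s) r `<=` O.
Proof.
move=> oO NO lip; have /compact_near_coveringP cZ := @segment_compact R 0 l.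
have lipN s s' : 0 <= s <= l -> 0 <= s' <= l -> `|N s' - N s| <= `|s' - s|.
  move=> /andP[s0 sl] /andP[s'0 s'l]; apply: (le_trans (norm_le_enorm _)).
  have [ss'|s's] := leP s s'; first by rewrite ger0_norm ?subr_ge0 // lip.
  have ss := ltW s's; by rewrite enormB distrC ger0_norm ?subr_ge0 //; exact: lip.
have := cZ nat \oo (fun i s => 0 <= s <= l -> cube (N s) i.+1%:R^-1 `<=` O) _.
case=> [s|k _ kP]; last first.
  exists k.+1%:R^-1; first by rewrite invr_gt0.
  by move=> s s01; apply: (kP k (leqnn k) s) => //=; rewrite in_itv.
rewrite /= in_itv /= => s01; have [d d0 dO] := open_cube oO (NO _ s01).
pose N0 := Num.truncn (2 / d); exists (ball s (d / 2), [set i | (N0 <= i)%N]) => /=.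
  by split; [apply: nbhsx_ballx; rewrite divr_gt0|exists N0].
move=> [s' i] [/=]; rewrite -ball_normE /= => ss' Ni s'01 z; rewrite /cube /= => zs'; apply: dO.
have iN : i.+1%:R^-1 < d / 2.
  rewrite -[ltRHS]invrK ltf_pV2 ?posrE ?invr_gt0 ?divr_gt0 // invf_div.
  by rewrite (lt_le_trans (truncnS_gt _)) // ler_nat.
rewrite /cube /= -[z - N s](subrKA (N s')); apply: (le_trans (ler_normD _ _)).
rewrite (splitr d); apply: lerD; first exact: le_trans zs' (ltW iN).
by apply: (le_trans (lipN _ _ s01 s'01)); rewrite distrC ltW.
Qed.

Variables (x0 : V) (D : set V) (f g : V -> V).
Hypothesis oD : open D.
Hypothesis cf : {within D, continuous f}.
Hypothesis gf : forall x, D x -> g (f x) = x.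
Hypothesis cg : {within f @` D, continuous g}.
Let v y := enorm (g y - x0).

Lemma image_dist_continuous : {within f @` D, continuous v}.
Proof.
move=> y; apply: (@continuous_comp _ _ _ _ (fun z : V => enorm (z - x0))); first exact: cg.
apply: (@continuous_comp _ _ _ (fun z : V => z - x0)); first exact: subr_continuous_rV.
exact: enorm_continuous.
Qed.

(** The strict inequalities e < a and b < e0 place the ends of the image curve in the open sets {v <
    a} and {v > b}, together with a cube around each; compactness gives a cube of uniform size along
    the curve. *)
Lemma image_tubepath (C1 C2 : set V) (e e0 a b : R) (gm : cpath) :
  e < a -> a < b -> b < e0 -> C1 `<=` ecball x0 e `&` D -> C2 `<=` D `\` eball x0 e0 ->
  image_paths f (joining_paths C1 C2 D) gm -> rectifiable gm ->
  exists2 rho, 0 < rho & tubepath (f @` D) v a b rho (arclen gm (pb gm))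
    (normal_rep gm) (arclen gm (pb gm)).
Proof.
move=> ea ab be C1D C2D [g0 [[t01 cg0] st en mid] <-{gm}].
set gm := CPath _ _ _ => rgm.
have gD t : pa g0 <= t <= pb g0 -> D (Defs.pmap g0 t).
  move=> /andP[]; rewrite le_eqVlt => /orP[/eqP<- _|t0]; first by case: (C1D _ st).
  rewrite le_eqVlt => /orP[/eqP->|t1]; first by case: (C2D _ en).
  by apply: mid; rewrite t0.
have oW := invariance_of_domain oD cf gf cg.
have cgm : is_cpath gm.
  split=> //=; apply/subspace_continuousP => t /=; rewrite in_itv /= => t1.
  move/subspace_continuousP : (cg0) => /(_ t); rewrite /= in_itv /= => /(_ t1) ct.
  apply: cvg_comp ct _.
  move: cf; rewrite (continuous_open_subspace _ oD) => /(_ (Defs.pmap g0 t)); apply.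
  by rewrite inE; exact: gD.
set l := arclen gm (pb gm).
have l0 : 0 <= l by apply: arclen_ge0 => //=; rewrite lexx ltW.
have lip := normal_rep_lipschitz cgm rgm.
have N0 : normal_rep gm 0 = f (Defs.pmap g0 (pa g0)) by rewrite normal_rep0.
have N1 : normal_rep gm l = f (Defs.pmap g0 (pb g0)) by rewrite normal_rep_end.
have D0 : D (Defs.pmap g0 (pa g0)) by apply: gD; rewrite lexx ltW.
have D1 : D (Defs.pmap g0 (pb g0)) by apply: gD; rewrite lexx ltW.
have v0 : v (normal_rep gm 0) < a.
  by rewrite /v N0 gf //; have [h _] := C1D _ st; exact: le_lt_trans h ea.
have v1 : b < v (normal_rep gm l).
  rewrite /v N1 gf //; have [_ /negP] := C2D _ en; rewrite -leNgt.
  exact: lt_le_trans.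
have NW s : 0 <= s <= l -> (f @` D) (normal_rep gm s).
  move=> /andP[s0 sl]; have [t t1 ->] := normal_rep_image cgm sl.
  by exists (Defs.pmap g0 t) => //; exact: gD.
have [r1 r10 r1P] := curve_tube oW NW lip.
have cv := image_dist_continuous.
have [|r2 r20 r2P] := open_cube (open_within oW cv (@open_lt R a)) (y := normal_rep gm 0).
  by split=> //; apply: NW; rewrite lexx.
have [|r3 r30 r3P] := open_cube (open_within oW cv (@open_gt R b)) (y := normal_rep gm l).
  by split=> //; apply: NW; rewrite lexx l0.
pose r := Num.min r1 (Num.min r2 r3).
have sub r' (y : V) : r <= r' -> cube y r `<=` cube y r'.
  by move=> rr z; rewrite /cube /= => /le_trans; apply.
have lr1 : r <= r1 by rewrite ge_min lexx.
have lr2 : r <= r2 by rewrite !ge_min lexx orbT.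
have lr3 : r <= r3 by rewrite !ge_min lexx !orbT.
exists r; first by rewrite !lt_min r10 r20.
split=> //.
- rewrite lexx andbT lt_neqAle l0 andbT; apply/eqP => l0'; move: v1; rewrite -l0'.
  by rewrite ltNge (ltW (lt_trans v0 ab)).
- by move=> s s01; apply: subset_trans (r1P s s01); exact: sub.
- by move=> y /(sub _ _ lr2) /r2P[_ /ltW].
- by move=> y /(sub _ _ lr3) /r3P[_ /ltW].
Qed.

End image_of_paths.

(** * Modulus of the spheres *)

Section sphere_integral_bound.
Local Open Scope ereal_scope.
Context {R : realType} {n : nat}.
Notation V := 'rV[R]_n.+2.
Notation leb := (@leb_outer R n.+2).
Notation H := (@hausdorff R n.+2 n.+1).
Notation kap := (@kappa R n).

Lemma cayley_le_expR (th : R) : (0 < th <= 2^-1)%R -> ((1 + th) / (1 - th) <= expR (3 * th))%R.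
Proof.
move=> /andP[t0 t1]; have t2 : (0 < 1 - th)%R by lra.
have -> : (3 * th = th + 2 * th)%R by ring.
rewrite expRD; apply: ler_pM; [lra|by rewrite invr_ge0 ltW|exact: expR_ge1Dx|].
apply: le_trans (expR_ge1Dx _); rewrite -[leLHS]mul1r ler_pdivrMr //; nra.
Qed.

(** The limit of [sphere_integrals] as [th] and [d] tend to 0: for th <= 1/2 the factors ((1 + th) /
    (1 - th))^(n+2) and e^th are together at most e^(c th), with c = 3 (n+2) + 1. *)
Lemma sphere_integral_le (x0 : V) (a b : R) (h : V -> \bar R) (w : R -> \bar R) : (0 < a)%R ->
  measurable_fun `]a, b[%classic w -> (forall r, 0 <= w r) ->
  (forall r, (a < r < b)%R -> w r <= lcint H (esphere x0 r) h) ->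
  \int[lebesgue_measure]_(r in `]a, b[) w r <= kap * lcint leb (annulus x0 a b) h.
Proof.
move=> a0 mw w0 wh; set X := lcint leb _ _; have X0 : 0 <= X by exact: lcint_ge0.
have k0 : 0 <= kap := kappa_ge0.
apply: le_expR_lim; first by rewrite mule_ge0.
move=> th' th'0; pose c := (n.+2%:R * 3 + 1 : R)%R; have c0 : (0 < c)%R by rewrite addr_gt0 ?mulr_gt0.
pose th := Num.min 2^-1%R (th' / c)%R.
have th0 : (0 < th)%R by rewrite lt_min invr_gt0 ltr0n divr_gt0.
have th1 : (th <= 2^-1)%R by rewrite ge_min lexx.
have thc : (th * c <= th')%R by rewrite -ler_pdivlMr // ge_min lexx orbT.
have th11 : (0 < th < 1)%R by rewrite th0 (le_lt_trans th1) // invf_lt1 ?ltr1n.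
apply/lee_addgt0Pr => d d0.
have [psi [mpsi psi0 psih psiI]] := sphere_integrals x0 b h a0 th11 d0.
apply: (@le_trans _ _ (\int[lebesgue_measure]_(r in `]a, b[) psi r)).
  apply: ge0_le_integral => //; first exact: measurable_funS mpsi.
  by move=> r /=; rewrite in_itv /= => rab; exact: le_trans (wh r rab) (psih r rab).
apply: (@le_trans _ _ (\int[lebesgue_measure]_r psi r)); first exact: ge0_subset_integral.
apply: (le_trans psiI); rewrite leeD2r // -/X [kap * (_ * _)]muleCA [leLHS]muleA -EFinM.
rewrite lee_wpmul2r ?mule_ge0 // lee_fin.
apply: (@le_trans _ _ (expR (3 * th) ^+ n.+2 * expR th)%R).
  rewrite ler_wpM2r ?expR_ge0 // lerXn2r ?nnegrE ?expR_ge0 ?cayley_le_expR ?th0 //.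
  by rewrite divr_ge0 // ?subr_ge0 ?addr_ge0 ?ltW //; case/andP: th11.
rewrite -expRM_natl -expRD ler_expR; apply: le_trans thc.
by rewrite /c mulrDr mulr1 [(th * (_ * _))%R]mulrC mulrA.
Qed.

End sphere_integral_bound.

Section weighted_young.
Local Open Scope ereal_scope.
Context {R : realType}.

(** Young's inequality for t q^(-1/P) x and t^(-1) q^(1/P) y. Since al / P = al - 1, the weight 1/q
    on x^P turns into q^(al-1) on y^al, which is the weight of the theorem. *)
Lemma weighted_young (P al t q : R) (x y : \bar R) : (0 < P)%R -> (0 < al)%R ->
  (al^-1 + P^-1 = 1)%R -> (0 < t)%R -> (0 < q)%R -> 0 <= x -> 0 <= y ->
  x * y <= (P^-1 * t `^ P)%:E * (x `^ P * q^-1%:E) +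
           (al^-1 * t `^ (- al))%:E * ((q `^ (al - 1))%:E * y `^ al).
Proof.
move=> P0 al0 alP t0 q0 x0 y0; have t1 := ltW t0; have q1 := ltW q0.
pose c := (t * q `^ (- P^-1))%R; pose d := (t^-1 * q `^ P^-1)%R.
have c0 : (0 <= c)%R by rewrite mulr_ge0 ?powR_ge0.
have d0 : (0 <= d)%R by rewrite mulr_ge0 ?powR_ge0 ?invr_ge0.
have -> : x * y = (c%:E * x) * (d%:E * y).
  rewrite muleACA -EFinM /c /d mulrACA divff ?gt_eqF // mul1r -powRD; last by rewrite (gt_eqF q0) implybT.
  by rewrite addNr powRr0 mul1e.
have PA : (P^-1 + al^-1 = 1)%R by rewrite addrC.
have ce : 0 <= c%:E * x by rewrite mule_ge0.
have dy : 0 <= d%:E * y by rewrite mule_ge0.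
apply: (le_trans (young_ereal P0 al0 PA ce dy)).
have alE : (P^-1 * al = al - 1)%R.
  by rewrite (_ : P^-1 = 1 - al^-1)%R ?mulrBl ?mul1r ?mulVf ?gt_eqF // -alP addrC addKr.
rewrite !poweRM // !poweR_EFin /c /d !powRM ?powR_ge0 ?invr_ge0 // -!powRrM alE mulNr mulVf ?gt_eqF //.
rewrite powR_inv1 // -[(t^-1)%R]powR_inv1 // -powRrM mulN1r.
by rewrite !EFinM !muleA [X in X + _ <= _]muleAC.
Qed.

End weighted_young.

Section borel_spheres.
Local Open Scope ereal_scope.
Context {R : realType} {n : nat}.
Notation V := 'rV[R]_n.+2.
Notation leb := (@leb_outer R n.+2).
Notation H := (@hausdorff R n.+2 n.+1).
Notation kap := (@kappa R n).
Let bL : borel_outer leb := @leb_outer_halfspace R n.+1.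
Let bH : borel_outer H := @hausdorff_borel_outer R n.+2 n.

Lemma dist_open (x0 : V) (O : set R) : open O -> open [set x | O (enorm (x - x0))].
Proof.
move=> oO; apply: (@open_comp _ _ (fun x : V => enorm (x - x0)%R)) => // x _.
apply: (@continuous_comp _ _ _ (fun z : V => (z - x0)%R)); first exact: subr_continuous_rV.
exact: enorm_continuous.
Qed.

Lemma borel_fun_dist_comp (x0 : V) (w : R -> \bar R) : measurable_fun [set: R] w ->
  borel_fun (fun x : V => w (enorm (x - x0))).
Proof.
move=> mw; apply/borel_funP; apply: (measurableT_comp mw).
apply/measurable_EFinP/borel_funP => t; apply: open_borel.
by have := @dist_open x0 _ (@open_gt R t); congr open; apply/seteqP; split=> x /=; rewrite lte_fin.
Qed.

Lemma annulus_borel (x0 : V) (a b : R) : borel_set (annulus x0 a b).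
Proof.
apply: open_borel; have := @dist_open x0 _ (@interval_open R (BRight a) (BLeft b) isT isT).
by congr open; apply/seteqP; split=> x /=; rewrite in_itv.
Qed.

Lemma esphere_borel (x0 : V) (r : R) : borel_set (esphere x0 r).
Proof.
have -> : esphere x0 r = ~` ([set x | enorm (x - x0) < r]%R `|` [set x | r < enorm (x - x0)]%R).
  apply/seteqP; split=> x /=.
    by move=> xr; case; rewrite xr ltxx.
  by move=> /not_orP[/negP] + /negP; rewrite -!leNgt => h1 h2; apply/eqP; rewrite eq_le h1 h2.
apply: sigma_algebraC; apply: open_borel; apply: openU.
  exact: dist_open (@open_lt R r).
exact: dist_open (@open_gt R r).
Qed.

Lemma annulus_leb_fin (x0 : V) (a b : R) : leb (annulus x0 a b) < +oo.
Proof.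
rewrite -ge0_fin_numE ?outer_measure_ge0 //; apply: leb_ebounded_fin.
exists (b + enorm x0)%R => x /andP[_ xb].
by rewrite -[x](subrK x0); apply: (le_trans (enormD _ _)); rewrite lerD2r ltW.
Qed.

Variable mu : {outer_measure set V -> \bar R}.
Notation W := (caratheodory_type mu).

(** [Q] is only Lebesgue measurable, so integrals containing it are treated for Caratheodory
    measurable functions rather than for Borel ones. *)
Lemma lcint_caraE (A : set V) (f : V -> \bar R) : mu.-caratheodory A ->
  measurable_fun [set: W] (f : W -> \bar R) -> (forall x, 0 <= f x) ->
  lcint mu A f = \int[cmeas mu]_(x in A) f x.
Proof.
move=> cA mf f0; apply: lcintE => // t.
have := mf measurableT _ (emeasurable_itv `]t%:E, +oo[); rewrite setTI.
by congr (_.-caratheodory); apply/seteqP; split=> x /=; rewrite in_itv /= andbT.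
Qed.

Lemma lcint_cara_lin (A : set V) (c d : R) (f g : V -> \bar R) : mu.-caratheodory A ->
  measurable_fun [set: W] (f : W -> \bar R) -> measurable_fun [set: W] (g : W -> \bar R) ->
  (forall x, 0 <= f x) -> (forall x, 0 <= g x) -> (0 <= c)%R -> (0 <= d)%R ->
  lcint mu A (fun x => c%:E * f x + d%:E * g x) = c%:E * lcint mu A f + d%:E * lcint mu A g.
Proof.
move=> cA mf mg f0 g0 c0 d0.
have mZ e (z : V -> \bar R) : measurable_fun [set: W] (z : W -> \bar R) ->
    measurable_fun [set: W] ((fun x => e%:E * z x) : W -> \bar R).
  by move=> mz; apply: emeasurable_funM.
have Z0 e (z : V -> \bar R) x : (0 <= e)%R -> (forall x, 0 <= z x) -> 0 <= e%:E * z x.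
  by move=> e0 z0; rewrite mule_ge0.
have mA : measurable (A : set W) by [].
rewrite !lcint_caraE //; last 2 first.
- by apply: emeasurable_funD; exact: mZ.
- by move=> x; rewrite adde_ge0 ?Z0.
rewrite ge0_integralD //; last 4 first.
- by move=> x _; exact: Z0.
- by apply: measurable_funTS; exact: mZ.
- by move=> x _; exact: Z0.
- by apply: measurable_funTS; exact: mZ.
by rewrite !ge0_integralZl_EFin //; exact: measurable_funTS.
Qed.

End borel_spheres.

Section sphere_hoelder.
Local Open Scope ereal_scope.
Context {R : realType} {n : nat}.
Notation V := 'rV[R]_n.+2.
Notation leb := (@leb_outer R n.+2).
Notation H := (@hausdorff R n.+2 n.+1).
Notation kap := (@kappa R n).
Let bL : borel_outer leb := @leb_outer_halfspace R n.+1.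
Let bH : borel_outer H := @hausdorff_borel_outer R n.+2 n.
Variables (P al : R) (P0 : (0 < P)%R) (al0 : (0 < al)%R) (alP : (al^-1 + P^-1 = 1)%R).

(** On a set of finite measure, small in L^P implies small in L^1: in Young's inequality [t] is
    taken so large that the constant term contributes at most eps / 2, and [d] then makes the other
    term at most eps / 2. *)
Lemma small_energy_lcint (A : set V) (C eps : R) : borel_set A -> leb A < +oo ->
  (0 < C)%R -> (0 < eps)%R ->
  exists2 d : R, (0 < d)%R & forall h : V -> \bar R, borel_fun h -> (forall x, 0 <= h x) ->
    lcint leb setT (fun x => h x `^ P) <= d%:E -> lcint leb A (fun x => C%:E * h x) <= eps%:E.
Proof.
move=> bA fA C0 e0; have fA' : leb A \is a fin_num by rewrite ge0_fin_numE ?outer_measure_ge0.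
pose v := fine (leb A); have v0 : (0 <= v)%R by rewrite fine_ge0 ?outer_measure_ge0.
have Ca : (0 < C `^ al)%R by rewrite powR_gt0.
have v1 : (0 < v + 1)%R by rewrite ltr_wpDl.
pose T := (2 * (C `^ al * (v + 1)) / eps)%R.
have T0 : (0 < T)%R by rewrite divr_gt0 // mulr_gt0 // mulr_gt0.
pose t := (T `^ al^-1)%R; have t0 : (0 < t)%R by rewrite powR_gt0.
have tal : (t `^ (- al) = T^-1)%R.
  by rewrite /t -powRrM mulrN mulVf ?gt_eqF // powR_inv1 // ltW.
pose c := (P^-1 * t `^ P)%R.
have c0 : (0 < c)%R by rewrite mulr_gt0 ?invr_gt0 ?powR_gt0.
have al1 : (al^-1 <= 1)%R by rewrite -alP lerDl invr_ge0 ltW.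
exists (eps / 2 / c)%R; first by rewrite !divr_gt0.
move=> h bh h0 hd.
have bP : borel_fun (fun x : V => h x `^ P) by exact: borel_fun_poweR.
have d0 : (0 <= al^-1 * T^-1)%R by rewrite mulr_ge0 // invr_ge0 ltW.
apply: (@le_trans _ _ (lcint leb A (fun x => c%:E * h x `^ P + (al^-1 * T^-1)%:E * (C `^ al)%:E))).
  apply: le_lcint => // x _.
  have := weighted_young P0 al0 alP t0 ltr01 (h0 x) (y := C%:E); rewrite lee_fin => /(_ (ltW C0)).
  by rewrite powR1 mul1e invr1 mule1 tal muleC poweR_EFin.
have Ca' x : 0 <= (fun _ : V => (C `^ al)%:E) x by rewrite lee_fin ltW.
have hP0 x : 0 <= h x `^ P by exact: poweR_ge0.
have mC := borel_measurable_fun (D := setT) bL (@borel_fun_cst R n.+2 (C `^ al)%:E).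
have mP := borel_measurable_fun (D := setT) bL bP.
have -> := lcint_cara_lin (borel_caratheodory bL bA) mP mC hP0 Ca' (ltW c0) d0.
have cstE : lcint leb A (fun=> (C `^ al)%:E) = (C `^ al * v)%:E.
  by rewrite (lcint_cst bL bA) ?lee_fin ?(ltW Ca) // EFinM /v fineK.
apply: (@le_trans _ _ (c%:E * lcint leb A (fun x => h x `^ P) + (al^-1 * T^-1)%:E * (C `^ al * v)%:E)).
  by rewrite -cstE.
rewrite -EFinM (splitr eps) EFinD.
apply: leeD.
  apply: (@le_trans _ _ (c%:E * (eps / 2 / c)%:E)).
    rewrite lee_wpmul2l ?lee_fin ?(ltW c0) //; apply: le_trans hd; exact: le_lcint.
  by rewrite -EFinM lee_fin mulrC divfK // gt_eqF.
rewrite lee_fin /T invf_div.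
have -> : (al^-1 * (eps / (2 * (C `^ al * (v + 1)))) * (C `^ al * v) = al^-1 * (v / (v + 1)) * (eps / 2))%R.
  by field; rewrite !gt_eqF.
rewrite -[leRHS]mul1r ler_wpM2r ?divr_ge0 ?(ltW e0) // -[leRHS]mulr1 ler_pM ?invr_ge0 ?divr_ge0 ?(ltW al0) ?(ltW v1) //.
by rewrite ler_pdivrMr // mul1r lerDl.
Qed.

Variables (p : R) (pP : (p = n.+1%:R * P)%R).
Variables (x0 : V) (D : set V) (a b : R) (Q : V -> R) (w : R -> \bar R) (C : R) (rho : V -> \bar R).
Hypothesis a0 : (0 < a)%R.
Hypothesis oD : open D.
Hypothesis mQ : leb_measurable_fun Q.
Hypothesis Q0 : forall x, (0 < Q x)%R.
Hypothesis mw : measurable_fun [set: R] w.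
Hypothesis w0 : forall r, 0 <= w r.
Hypothesis C0 : (0 < C)%R.
Hypothesis wC : forall r, w r <= C%:E.
Hypothesis erho : ext_adm p (sphere_family D x0 a b) rho.

Let A := annulus x0 a b.

(** The exceptional spheres have modulus zero, so some [r] of arbitrarily small energy is admissible
    for them. Adding r^k to rho^k restores the condition on every sphere, and since [w] is at most
    [C], the added term is negligible by [small_energy_lcint]. *)
Lemma ext_adm_lcint : \int[lebesgue_measure]_(r in `]a, b[) w r <=
  kap * lcint leb (A `&` D) (fun x => rho x ^+ n.+1 * w (enorm (x - x0)%R)).
Proof.
have [brho rho0 [Sg [SgS Sg0] Srho]] := erho.
have bA : borel_set A := annulus_borel x0 a b.
have bD : borel_set D := open_borel oD.
have k0 : 0 <= kap := kappa_ge0.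
have bpow (z : V -> \bar R) : borel_fun z -> (forall x, 0 <= z x) -> borel_fun (fun x => z x ^+ n.+1).
  move=> bz z0; have := @borel_fun_poweR R n.+2 z n.+1%:R bz; congr borel_fun.
  by apply/funext => x; rewrite expe_poweR.
have bww : borel_fun (fun x : V => w (enorm (x - x0)%R)) by exact: borel_fun_dist_comp.
have pow0 (z : V -> \bar R) x : (forall x, 0 <= z x) -> 0 <= z x ^+ n.+1 by move=> z0; rewrite expe_ge0.
apply/lee_addgt0Pr => e e0.
have kf : kap = (fine kap)%:E by rewrite fineK // kappa_fin.
have kk0 : (0 < fine kap)%R by rewrite fine_gt0 // kappa_gt0 /= ltey_eq kappa_fin.
have [d d0 dP] := small_energy_lcint bA (annulus_leb_fin x0 a b) C0 (divr_gt0 e0 kk0).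
have [r [br r0 rS] rI] : exists2 r, surf_adm Sg r & lcint leb setT (fun x => r x `^ p) <= d%:E.
  have /(ereal_inf_lt (x:=_)) : surf_modulus p Sg < d%:E by rewrite Sg0 lte_fin.
  by case=> _ [r ar <-] /ltW; exists r.
pose G x := (\1_D x)%:E * rho x ^+ n.+1 + r x ^+ n.+1.
have ind0 x : 0 <= (\1_D x : R)%:E by rewrite lee_fin.
have G0 x : 0 <= G x by rewrite adde_ge0 ?mule_ge0 ?pow0.
have b1 : borel_fun (fun x => (\1_D x)%:E * rho x ^+ n.+1).
  by apply: borel_funM; [exact: borel_fun_indic|exact: bpow].
have b2 := bpow _ br r0.
have bG : borel_fun G by exact: borel_funD.
pose h x := w (enorm (x - x0)%R) * G x.
have wh s : (a < s < b)%R -> w s <= lcint H (esphere x0 s) h.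
  move=> sab; have bS := esphere_borel x0 s.
  rewrite (@eq_lcint _ _ H _ _ (fun x => w s * G x)); last by move=> x xs; rewrite /h xs.
  rewrite (lcintZl bH bS bG G0 (w0 s)) -[leLHS]mule1 lee_wpmul2l //.
  have SF : sphere_family D x0 a b (esphere x0 s `&` D) by exists s.
  have [SS|nS] := pselect (Sg (esphere x0 s `&` D)).
    apply: (le_trans (rS _ SS)); apply: le_lcint; first by move=> x [].
    by move=> x _; rewrite /G leeDr // mule_ge0 ?pow0.
  apply: (le_trans (Srho _ SF nS)); apply: le_lcint; first by move=> x [].
  by move=> x [_ Dx]; rewrite /G indicE mem_set // mul1e leeDl ?pow0.
have mw' : measurable_fun `]a, b[%classic w by exact: measurable_funS mw.
apply: (le_trans (sphere_integral_le a0 mw' w0 wh)).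
have hle : lcint leb A h <= lcint leb (A `&` D) (fun x => rho x ^+ n.+1 * w (enorm (x - x0)%R)) +
    (e / fine kap)%:E.
  apply: (@le_trans _ _ (lcint leb A (fun x => (\1_D x)%:E * rho x ^+ n.+1 * w (enorm (x - x0)%R)) +
     lcint leb A (fun x => C%:E * r x ^+ n.+1))).
    rewrite -(lcintD bL bA); last 4 first.
    - exact: borel_funM.
    - by apply: borel_funM => //; exact: borel_fun_cst.
    - by move=> x; rewrite !mule_ge0 ?pow0.
    - by move=> x; rewrite mule_ge0 ?pow0 // lee_fin ltW.
    apply: le_lcint => // x _; rewrite /h /G muleC ge0_muleDl ?mule_ge0 ?pow0 //.
    by rewrite leeD2l // muleC lee_wpmul2r ?pow0.
  apply: leeD.
    rewrite lcint_restrict [leRHS]lcint_restrict; apply: le_lcint => // x _.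
    rewrite !indicE in_setI; case: (x \in A); case: (x \in D);
    by rewrite ?andbT ?andbF ?mule1 ?mule0 ?mul1e ?mul0e.
  apply: dP => //; first by move=> x; exact: pow0.
  rewrite (@eq_lcint _ _ leb _ _ (fun x => r x `^ p)) // => x _.
  by rewrite expe_poweR // poweR_poweR // -pP.
apply: (@le_trans _ _ (kap * (lcint leb (A `&` D) (fun x => rho x ^+ n.+1 * w (enorm (x - x0)%R)) +
    (e / fine kap)%:E))); first by rewrite lee_wpmul2l.
rewrite [leLHS]ge0_muleDr; [|exact: lcint_ge0|by rewrite lee_fin divr_ge0 // ltW].
apply: leeD => //; rewrite {1}kf -EFinM lee_fin.
by rewrite mulrC divfK // gt_eqF.
Qed.

Lemma ext_adm_energy (m J : R) : (0 < m)%R -> (0 < J)%R ->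
  kap * m%:E <= \int[lebesgue_measure]_(r in `]a, b[) w r ->
  lcint leb A (fun x => (Q x `^ (al - 1))%:E * w (enorm (x - x0)%R) `^ al) <= J%:E ->
  (m `^ P * J `^ (1 - P))%:E <= lcint leb (D `&` A) (fun x => rho x `^ p * (Q x)^-1%:E).
Proof.
move=> m0 J0 mle Jle; have [brho rho0 _] := erho; rewrite setIC.
set I := lcint leb (A `&` D) (fun x => rho x `^ p * _).
have cAD : leb.-caratheodory (A `&` D).
  apply: caratheodory_measurable_setI; apply: (borel_caratheodory bL); first exact: annulus_borel.
  exact: open_borel.
have kk0 : (0 < fine kap)%R by rewrite fine_gt0 // kappa_gt0 /= ltey_eq kappa_fin.
(* The optimal parameter in [weighted_young]: with t^al = J / m the term in [w] contributes at most
   m / al, which leaves m / P <= (t^P / P) I for the energy [I]. *)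
pose t := ((J / m) `^ al^-1)%R.
have Jm : (0 < J / m)%R by rewrite divr_gt0.
have t0 : (0 < t)%R by rewrite powR_gt0.
have tal : (t `^ (- al) = m / J)%R.
  by rewrite /t -powRrM mulrN mulVf ?gt_eqF // powR_inv1 ?invf_div // ltW.
have mEQ : measurable_fun [set: caratheodory_type leb] (fun x => (Q x)%:E).
  apply/measurable_EFinP; apply: (measurability _ (RGenInftyO.measurableE R)).
  move=> _ [_ [r ->] <-]; rewrite setTI; have := mQ r.
  rewrite (_ : [set x | Q x < r]%R = Q @^-1` `]-oo, r[%classic); last first.
    by apply/seteqP; split=> x /=; rewrite in_itv.
  exact.
have mpw s : measurable_fun [set: caratheodory_type leb] (fun x => (Q x `^ s)%:E).
  by have := measurableT_comp (measurable_poweR s) mEQ.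
have mF : measurable_fun [set: caratheodory_type leb] (fun x => rho x `^ p * (Q x)^-1%:E).
  apply: emeasurable_funM; first exact: (borel_measurable_fun bL (borel_fun_poweR p brho)).
  have := mpw (-1)%R; congr measurable_fun; apply/funext => x.
  by rewrite powR_inv1 // ltW.
have mG : measurable_fun [set: caratheodory_type leb]
    (fun x => (Q x `^ (al - 1))%:E * w (enorm (x - x0)%R) `^ al).
  apply: emeasurable_funM; first exact: mpw.
  exact: (borel_measurable_fun bL (borel_fun_poweR al (borel_fun_dist_comp x0 mw))).
have F0 x : 0 <= rho x `^ p * (Q x)^-1%:E by rewrite mule_ge0 ?poweR_ge0 // lee_fin invr_ge0 ltW.
have G0 x : 0 <= (Q x `^ (al - 1))%:E * w (enorm (x - x0)%R) `^ al.
  by rewrite mule_ge0 ?poweR_ge0 // lee_fin powR_ge0.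
have tP0 : (0 < P^-1 * t `^ P)%R by rewrite mulr_gt0 ?invr_gt0 ?powR_gt0.
have c20 : (0 <= al^-1 * (m / J))%R by rewrite mulr_ge0 ?invr_ge0 ?divr_ge0 ?ltW.
have key : m%:E <= (P^-1 * t `^ P)%:E * I + (al^-1 * m)%:E.
  apply: (@le_trans _ _ (lcint leb (A `&` D) (fun x => rho x ^+ n.+1 * w (enorm (x - x0)%R)))).
    have := le_trans mle ext_adm_lcint.
    by rewrite -[kap]fineK ?kappa_fin // lee_pmul2l.
  apply: (@le_trans _ _ (lcint leb (A `&` D) (fun x => (P^-1 * t `^ P)%:E * (rho x `^ p * (Q x)^-1%:E) +
     (al^-1 * (m / J))%:E * ((Q x `^ (al - 1))%:E * w (enorm (x - x0)%R) `^ al)))).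
    apply: le_lcint => // x _.
    have := weighted_young P0 al0 alP t0 (Q0 x) (expe_ge0 n.+1 (rho0 x)) (w0 (enorm (x - x0)%R)).
    by rewrite tal [X in X `^ P]expe_poweR // poweR_poweR // -pP.
  have -> := lcint_cara_lin cAD mF mG F0 G0 (ltW tP0) c20.
  rewrite leeD2l //; apply: (@le_trans _ _ ((al^-1 * (m / J))%:E * J%:E)).
    rewrite lee_wpmul2l // (le_trans _ Jle) //; apply: le_lcint => //; exact: subIsetl.
  by rewrite -EFinM lee_fin -mulrA divfK // gt_eqF.
have [->|Ify] := eqVneq I +oo; first exact: leey.
have If : I \is a fin_num by rewrite ge0_fin_numE ?lcint_ge0 // ltey.
move: key; rewrite -[I]fineK // -EFinM -EFinD !lee_fin; move: (fine I) => i key.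
have {}key : (m <= t `^ P * i)%R.
  rewrite -(ler_pM2l (_ : 0 < P^-1)%R) ?invr_gt0 // mulrA.
  by rewrite (_ : P^-1 * m = m - al^-1 * m)%R ?lerBlDr // -[X in (X - _)%R]mul1r -alP; ring.
apply: (@le_trans _ _ (m / t `^ P)%R); last by rewrite ler_pdivrMr ?powR_gt0 // mulrC.
rewrite le_eqVlt; apply/orP; left; apply/eqP; rewrite /t -powRrM.
have -> : (al^-1 * P = P - 1)%R.
  by rewrite (_ : al^-1 = 1 - P^-1)%R ?mulrBl ?mul1r ?mulVf ?gt_eqF // -alP addrK.
rewrite -powRN opprB powRM ?invr_ge0 ?(ltW m0) ?(ltW J0) // mulrCA mulrC; congr (_ * _)%R.
rewrite -[(m^-1)%R]powR_inv1 ?(ltW m0) // -powRrM mulN1r opprB -[X in (_ = X * _)%R]powRr1 ?(ltW m0) //.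
by rewrite -powRD ?(gt_eqF m0) ?implybT // addrC subrK.
Qed.

End sphere_hoelder.

(** * Proof of the theorem *)

Section borel_minorant.
Import HBNNSimple finmap.
Local Open Scope ereal_scope.
Context {R : realType}.
Notation cmu := (@completed_lebesgue_measure R).
Notation mu := (@lebesgue_measure R).

(** A Lebesgue measurable set is a Borel set together with a subset of a Borel null set. *)
Lemma lebR_measurable_inner (E : set R) : lebR_measurable E ->
  exists B : set R, [/\ measurable B, B `<=` E & mu B = cmu E].
Proof.
rewrite /lebR_measurable => mE.
have : completed_algebra_gen mu E.
  by rewrite -g_sigma_completed_algebra_genE completed_caratheodory_measurable.
move=> [B mB [N [M [mM M0 NM]] BE]]; exists B; split=> //; first by rewrite -BE => x; left.
pose om := [the {outer_measure set (ocitv_type R) -> \bar R} of (@wlength R idfun)^*%mu].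
have -> : mu B = om B by [].
have -> : cmu E = om E by [].
apply/eqP; rewrite eq_le; apply/andP; split; first by apply: le_outer_measure; rewrite -BE => x; left.
apply: (@le_trans _ _ (om B + om M)); last by rewrite [om M]M0 adde0.
rewrite -BE; apply: le_trans (outer_measureU2 om _ _); apply: le_outer_measure.
exact: setUS.
Qed.

(** A simple function that nearly attains the integral has Lebesgue measurable level sets; shrinking
    each to a Borel set of equal measure lowers the function and keeps its integral. *)
Lemma simple_minorant (D : set R) (f : R -> \bar R) (m : \bar R) : (forall r, D r -> 0 <= f r) ->
  m < lebR_integral D f ->
  exists (w : R -> \bar R) (C : R), [/\ measurable_fun [set: R] w, (forall r, 0 <= w r),
    (forall r, w r <= C%:E), (forall r, w r <= (f \_ D) r) & m < \int[mu]_r w r].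
Proof.
move=> f0; rewrite /lebR_integral ge0_integralE // => /(ereal_sup_gt (x:=_)) [_ [h hf <-]] mh.
pose k : R -> R := h.
have fr : finite_set (range k) by exact: (@fimfunP _ _ h).
have k0 r : (0 <= k r)%R by exact: fun_ge0.
pose s : seq R := finmap.enum_fset (fset_set (range k)).
have s0 x : x \in s -> (0 <= x)%R.
  move=> xs; have : x \in fset_set (range k) by exact: xs.
  by rewrite in_fset_set // => /set_mem[r _ <-].
have /choice[B BP] x : exists B : set R,
    [/\ measurable B, B `<=` k @^-1` [set x] & mu B = cmu (k @^-1` [set x])].
  exact/lebR_measurable_inner/measurable_sfunP.
pose c (x : R) : R := if x \in s then x else 0%R.
have c0 x : (0 <= c x)%R by rewrite /c; case: ifP => // /s0.
pose w r : \bar R := \sum_(x <- s) (c x)%:E * (\1_(B x) r)%:E.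
have mB x : measurable (B x) by case: (BP x).
have i0 x r : 0 <= (\1_(B x) r : R)%:E by rewrite lee_fin.
have mi x : measurable_fun [set: R] (fun r => (\1_(B x) r : R)%:E).
  by apply/measurable_EFinP; exact: measurable_indic.
have mt x : measurable_fun [set: R] (fun r => (c x)%:E * (\1_(B x) r)%:E).
  by apply: emeasurable_funM.
have t0 x r : 0 <= (c x)%:E * (\1_(B x) r)%:E by rewrite mule_ge0 ?lee_fin.
exists w, (\sum_(x <- s) c x)%R; split.
- exact: emeasurable_sum.
- by move=> r; rewrite /w sume_ge0.
- move=> r; rewrite /w -sumEFin; apply: lee_sum => x _.
  rewrite -[leRHS]mule1; apply: lee_wpmul2l; first by rewrite lee_fin.
  by rewrite indicE lee_fin; case: (_ \in _).
- move=> r; apply: le_trans (hf r); rewrite -[h r]/(k r).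
  have -> : k r = (\sum_(x <- s) x * \1_(k @^-1` [set x]) r)%R.
    by rewrite /k (fimfunE h) fsbig_finite.
  rewrite -sumEFin /w big_seq [leRHS]big_seq; apply: lee_sum => x xs.
  rewrite EFinM /c xs lee_wpmul2l ?lee_fin ?s0 // !indicE.
  case: (boolP (r \in B x)) => [|_]; last by case: (_ \in _).
  by move=> /set_mem Br; rewrite mem_set //; case: (BP x) => _ + _; apply.
apply: (lt_le_trans mh); rewrite sintegralE fsbig_finite //= -/s /w.
have -> : \int[mu]_r (\sum_(x <- s) (c x)%:E * (\1_(B x) r)%:E) = \sum_(x <- s) (c x)%:E * mu (B x).
  etransitivity; first exact: (ge0_integral_sum mu).
  apply: eq_bigr => x _; etransitivity; first exact: (ge0_integralZl_EFin mu measurableT (fun r _ => i0 x r) (mi x) (c0 x)).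
  by congr (_ * _); etransitivity; [exact: (integral_indic mu measurableT (mB x))|rewrite setIT].
rewrite big_seq [leRHS]big_seq; apply: lee_sum => x xs.
by rewrite /c xs; case: (BP x) => _ _ ->.
Qed.

Lemma interval_minorant (f : R -> \bar R) (e e0 m : R) : (e < e0)%R ->
  (forall r, (e < r < e0)%R -> 0 <= f r) -> m%:E < lebR_integral `]e, e0[%classic f ->
  exists (w : R -> \bar R) (C a b : R), [/\ (e < a)%R, (a < b)%R, (b < e0)%R & (0 < C)%R] /\
    [/\ measurable_fun [set: R] w, (forall r, 0 <= w r), (forall r, w r <= C%:E),
      (forall r, (e < r < e0)%R -> w r <= f r) & m%:E <= \int[mu]_(r in `]a, b[) w r].
Proof.
move=> ee f0 /simple_minorant[r|w [C' [mw w0 wC wf mI]]]; first by rewrite /= in_itv; exact: f0.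
pose C := Num.max C' 1%R; have C0 : (0 < C)%R by rewrite lt_max ltr01 orbT.
have {}wC r : w r <= C%:E by apply: (le_trans (wC r)); rewrite lee_fin le_max lexx.
have wout r : ~ (e < r < e0)%R -> w r = 0.
  move=> nr; apply/eqP; rewrite eq_le w0 andbT; apply: (le_trans (wf r)).
  by rewrite patchE memNset //= in_itv.
have {}wf r : (e < r < e0)%R -> w r <= f r.
  by move=> rr; apply: (le_trans (wf r)); rewrite patchE mem_set //= in_itv.
have [d d0 dP] : exists2 d : R, (0 < d)%R & m%:E + d%:E <= \int[mu]_r w r.
  move: mI; case: (\int[mu]_r w r) => [s| |] //.
    by rewrite lte_fin => ms; exists (s - m)%R; rewrite ?subr_gt0 // -EFinD addrCA subrr addr0.
  by exists 1%R => //; rewrite leey.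
(* Cutting [t] off at each end loses at most 2 C t <= d of the integral, and t <= (e0 - e) / 3 keeps
   a < b. *)
pose t := Num.min (d / (2 * C))%R ((e0 - e) / 3)%R.
have C2 : (0 < 2 * C)%R by rewrite mulr_gt0.
have t0 : (0 < t)%R by rewrite lt_min !divr_gt0 // subr_gt0.
have tC : (2 * C * t <= d)%R by rewrite mulrC -ler_pdivlMr // ge_min lexx.
have t3 : (t <= (e0 - e) / 3)%R by rewrite ge_min lexx orbT.
exists w, C, (e + t)%R, (e0 - t)%R; split; first by split=> //; lra.
split=> //; set a := (e + t)%R; set b := (e0 - t)%R.
have mab : measurable_fun [set: R] (fun r => (\1_(`]a, b[%classic : set R) r : R)%:E).
  by apply/measurable_EFinP; exact: measurable_indic.
have mea : measurable_fun [set: R] (fun r => (\1_(`]e, a]%classic : set R) r : R)%:E).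
  by apply/measurable_EFinP; exact: measurable_indic.
have mbe : measurable_fun [set: R] (fun r => (\1_(`[b, e0[%classic : set R) r : R)%:E).
  by apply/measurable_EFinP; exact: measurable_indic.
pose u r := w r * (\1_(`]a, b[%classic : set R) r)%:E.
pose v r := C%:E * (\1_(`]e, a]%classic : set R) r)%:E.
pose z r := C%:E * (\1_(`[b, e0[%classic : set R) r)%:E.
have mu' : measurable_fun [set: R] u by apply: emeasurable_funM.
have mv : measurable_fun [set: R] v by apply: emeasurable_funM.
have mz : measurable_fun [set: R] z by apply: emeasurable_funM.
have Ce : 0 <= C%:E by rewrite lee_fin ltW.
have u0 r : 0 <= u r by rewrite mule_ge0 // lee_fin.
have v0 r : 0 <= v r by rewrite mule_ge0 // lee_fin.
have z0 r : 0 <= z r by rewrite mule_ge0 // lee_fin.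
have : \int[mu]_r w r <= \int[mu]_r (u r + (v r + z r)).
  apply: ge0_le_integral => //; first by apply: emeasurable_funD => //; exact: emeasurable_funD.
  move=> r _; have [/andP[er re]|/wout ->] := pselect (e < r < e0)%R; last by rewrite !adde_ge0.
  have [ra|ar] := leP r a.
    apply: (le_trans (wC r)); rewrite addeCA (_ : v r = C%:E) ?leeDl ?adde_ge0 //.
    by rewrite /v indicE mem_set ?mule1 //= in_itv /= er.
  have [br|rb] := leP b r.
    apply: (le_trans (wC r)); rewrite addeA (_ : z r = C%:E) ?leeDr ?adde_ge0 //.
    by rewrite /z indicE mem_set ?mule1 //= in_itv /= br.
  rewrite (_ : u r = w r) ?leeDl ?adde_ge0 //.
  by rewrite /u indicE mem_set ?mule1 //= in_itv /= ar.
have -> : \int[mu]_r (u r + (v r + z r)) = \int[mu]_(r in `]a, b[) w r + ((C * t)%:E + (C * t)%:E).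
  etransitivity; first by apply: (ge0_integralD mu) => //; [by move=> r _; rewrite adde_ge0|exact: emeasurable_funD].
  congr (_ + _).
    by rewrite [RHS]integral_mkcond; apply: eq_integral => r _; rewrite /u epatch_indic.
  etransitivity; first exact: (ge0_integralD mu).
  congr (_ + _).
    etransitivity; first exact: (ge0_integralZl_EFin mu _ _ mea (ltW C0)).
    rewrite EFinM; congr (_ * _); etransitivity; first exact: (integral_indic mu).
    rewrite setIT [LHS](_ : _ = lebesgue_measure (`]e, a]%classic : set R)) // lebesgue_measure_itv /=.
    by rewrite lte_fin ltrDl t0 -EFinD addrAC subrr add0r.
  etransitivity; first exact: (ge0_integralZl_EFin mu _ _ mbe (ltW C0)).
  rewrite EFinM; congr (_ * _); etransitivity; first exact: (integral_indic mu).
  rewrite setIT [LHS](_ : _ = lebesgue_measure (`[b, e0[%classic : set R)) // lebesgue_measure_itv /=.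
  by rewrite lte_fin gtrBl t0 -EFinD opprB addrC subrK.
move=> /(le_trans dP); set I := \int[mu]_(r in _) _ => mdI.
have : m%:E + d%:E <= I + d%:E.
  apply: (le_trans mdI); rewrite leeD2l // -EFinD lee_fin (le_trans _ tC) //.
  by rewrite -mulrA mulr_natl mulr2n.
by rewrite leeD2rE.
Qed.

End borel_minorant.

(** Here [k] stands for kappa: since P (1 - al) = - al, the power on the right contains k^al, which
    cancels k^(-al). *)
Lemma modulus_exponents (R : realType) (P al m k J : R) : 0 < m -> 0 < k -> 0 < J ->
  P * (1 - al) = - al -> (1 - P) * (1 - al) = 1 ->
  k `^ (- al) * ((m / k) `^ P * J `^ (1 - P)) `^ (1 - al) = m `^ (- al) * J.
Proof.
move=> m0 k0 J0 e1 e2; rewrite powRM ?powR_ge0 // -!powRrM e1 e2 powRr1 ?(ltW J0) //.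
rewrite mulrA; congr (_ * _); rewrite powRM ?(ltW m0) ?invr_ge0 ?(ltW k0) // mulrCA.
rewrite -[k^-1]powR_inv1 ?(ltW k0) // -powRrM -powRD ?(gt_eqF k0) ?implybT //.
by rewrite mulN1r opprK addNr powRr0 mulr1.
Qed.

Lemma conjugate_exponents (R : realType) (p k : R) (P := p / k) (al := p / (p - k)) : 1 <= k -> k < p -> p <= k + 1 ->
  [/\ 0 < P, 0 < al, 1 < P <= 2 & 2 <= al] /\
  [/\ al^-1 + P^-1 = 1, k / (p - k) = al - 1, P * (1 - al) = - al & (1 - P) * (1 - al) = 1].
Proof.
move=> k1 kp pk; have k0 : 0 < k by apply: lt_le_trans k1.
have p0 : 0 < p by apply: lt_trans kp.
have pk0 : 0 < p - k by rewrite subr_gt0.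
rewrite /P /al; split; split; rewrite ?divr_gt0 //.
- by rewrite ltr_pdivlMr // mul1r kp ler_pdivrMr //; lra.
- by rewrite ler_pdivlMr //; lra.
- by field; rewrite !gt_eqF.
- by field; rewrite !gt_eqF.
- by field; rewrite !gt_eqF.
- by field; rewrite !gt_eqF.
Qed.

Section surface_modulus.
Local Open Scope ereal_scope.
Context {R : realType} {n : nat}.
Notation V := 'rV[R]_n.+2.

(** The density for the image surfaces is h^(1/k), and the level {v = r} in f(D) is precisely the
    image of the sphere of radius r. *)
Lemma image_surf_modulus_le (p P : R) (x0 : V) (D : set V) (f g : V -> V) (a b : R) (h : V -> \bar R) :
  (p = n.+1%:R * P)%R -> (0 < P)%R -> (forall x, D x -> g (f x) = x) ->
  hadm (f @` D) (fun y => enorm (g y - x0)) a b h ->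
  surf_modulus p ((fun S => f @` S) @` sphere_family D x0 a b) <= lcint leb_outer setT (fun x => h x `^ P).
Proof.
move=> pP P0 gf [bh h0 hS]; have k0 : (0 < n.+1%:R :> R)%R by [].
have kV : (0 < n.+1%:R^-1 :> R)%R by rewrite invr_gt0.
apply: ereal_inf_lbound; exists (fun x => h x `^ n.+1%:R^-1); last first.
  apply: eq_lcint => x _; rewrite poweR_poweR // ?pP ?mulr_gt0 //.
  by rewrite mulrA mulVf ?mul1r // pnatr_eq0.
split=> [|x|_ [_ [r rab ->] <-]]; [exact: borel_fun_poweR|exact: poweR_ge0|].
rewrite /surf_int (@eq_lcint _ _ (@hausdorff R n.+2 n.+1) _ _ h) => [|y _]; last first.
  by rewrite expe_poweR ?poweR_ge0 // poweR_poweR // mulVf ?poweRe1 // pnatr_eq0.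
have vE : vlevel (f @` D) (fun y => enorm (g y - x0)) r = f @` (esphere x0 r `&` D).
  apply/seteqP; split=> [y [[x Dx <-]]|_ [x [xr Dx] <-]].
    by rewrite gf // => xr; exists x.
  by split; [exists x|rewrite gf].
by rewrite -vE; exact: hS.
Qed.

End surface_modulus.

Theorem theorem4p1 (R : realType) (n : nat) (x0 : 'rV[R]_n) (D : set 'rV[R]_n)
    (p : R) (Q : 'rV[R]_n -> R) (f : 'rV[R]_n -> 'rV[R]_n) :
  (2 <= n)%N ->
  domain D ->
  n.-1%:R < p <= n%:R ->
  leb_measurable_fun Q ->
  (forall x, 0 < Q x) ->
  Lloc ((n.-1)%:R / (p - n.-1%:R)) Q ->
  homeo_onto_image D f ->
  (exists M : R, forall y, (f @` D) y -> enorm y <= M) ->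
  lower_Q_mapping p Q D f x0 ->
  forall (e e0 : R) (C1 C2 : set 'rV[R]_n),
    0 < e -> e < e0 ->
    compact C2 -> C2 `<=` D `\` eball x0 e0 ->
    compact C1 -> C1 `<=` ecball x0 e `&` D ->
  forall eta : R -> \bar R,
    (forall r, e < r < e0 -> (0 <= eta r)%E) ->
    lebR_measurable_fun `]e, e0[%classic eta ->
    lebR_integral `]e, e0[%classic eta = 1%E ->
    (path_modulus (p / (p - n.-1%:R)) (image_paths f (joining_paths C1 C2 D))
     <= vint (annulus x0 e e0)
          (fun x => (Q x `^ ((n.-1)%:R / (p - n.-1%:R)))%:E
                    * poweR (eta (enorm (x - x0))) (p / (p - n.-1%:R))))%E.
Proof.
case: n x0 D Q f => [|[|n]] // x0 D Q f _ [oD _].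
set k : R := n.+2.-1%:R => /andP[kp pk] mQ Q0 _ [cf _ [g [gf cg]]] bW lowQ e e0 C1 C2 epos ee _ C2D _ C1D.
move=> eta eta0 _ etaI; set J := vint _ _.
have k1 : 1 <= k by rewrite /k ler1n.
have k0 : 0 < k by apply: lt_le_trans k1.
have pk2 : p <= k + 1 by apply: (le_trans pk); rewrite /k natr1.
have [[P0 al0 P12 al2] [alP alk e1 e2]] := conjugate_exponents k1 kp pk2.
set P := p / k in P0 P12 alP e1 e2; set al := p / (p - k) in al0 al2 alP alk e1 e2 J *.
have pP : p = n.+1%:R * P by rewrite /P mulrCA divff ?mulr1 // gt_eqF.
have J0 : (0 <= J)%E by exact: lcint_ge0.
have bL : borel_outer (@leb_outer R n.+2) := @leb_outer_halfspace R n.+1.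
(* With [C2] empty there is no curve at all. Otherwise [x2], at distance at least e0 > b from x0,
   shows that [b] is below the supremum d0, as [lower_Q_mapping] requires. *)
have [[x2 C2x2]|C20] := pselect (exists x, C2 x); last first.
  apply: le_trans J0; apply: ereal_inf_lbound; exists (fun=> 0%E).
    split=> //; first exact: borel_fun_cst.
    by move=> gm [h [_ _ C2h _] _]; case: C20; exists (Defs.pmap h (pb h)).
  rewrite /vint (@eq_lcint _ _ (@leb_outer R n.+2) setT _ (fun=> 0%E)); last first.
    by move=> x _; rewrite poweR_EFin powR0 ?gt_eqF.
  by rewrite (lcint_cst bL) ?mul0e //; exact: borel_setT.
have [->|Jy] := eqVneq J +oo%E; first exact: leey.
have Jf : J \is a fin_num by rewrite ge0_fin_numE // ltey.
apply/lee_addgt0Pr => d d0; pose d3 := d / 3; have d30 : 0 < d3 by rewrite divr_gt0.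
pose j := fine J; have jE : J = j%:E by rewrite fineK.
have j0 : 0 <= j by rewrite fine_ge0.
(* Positive even when the right-hand side vanishes, as [ext_adm_energy] requires. *)
pose J1 := j + d3; have J10 : 0 < J1 by rewrite ltr_wpDl.
have J20 : 0 < J1 + d3 by rewrite addr_gt0.
have JJ0 : 0 < J1 / (J1 + d3) by rewrite divr_gt0.
(* Solves m^(-al) J1 = J1 + d / 3. The allowance [d] is spent in three equal parts: on J1, on m < 1,
   and on the error of [tube_modulus]. *)
pose m := (J1 / (J1 + d3)) `^ al^-1; have m0 : 0 < m by rewrite powR_gt0.
have mJ : m `^ (- al) * J1 = J1 + d3.
  rewrite /m -powRrM mulrN mulVf ?gt_eqF // powR_inv1 ?(ltW JJ0) // invf_div mulrC.
  by rewrite mulrCA divff ?mulr1 // gt_eqF.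
have m1 : m < 1.
  have <- : 1 `^ al^-1 = 1 :> R by rewrite powR1.
  rewrite /m; apply: gt0_ltr_powR; rewrite ?invr_gt0 ?nnegrE ?(ltW JJ0) //.
  by rewrite ltr_pdivrMr // mul1r ltrDl.
have kk0 : 0 < fine (@kappa R n) by rewrite fine_gt0 // kappa_gt0 /= ltey_eq kappa_fin.
have [|w [C [a [b [[ea ab be CC0] [mw w0 wC weta wI]]]]]] := interval_minorant (m := m) ee eta0.
  by rewrite etaI lte_fin.
have a0 : 0 < a by apply: lt_trans ea.
pose M := (m / fine (@kappa R n)) `^ P * J1 `^ (1 - P).
have mk0 : 0 < m / fine (@kappa R n) by rewrite divr_gt0.
have M0 : 0 < M by rewrite mulr_gt0 ?powR_gt0.
pose v y := enorm (g y - x0).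
have Mle h : hadm (f @` D) v a b h -> (M%:E <= lcint leb_outer setT (fun x => h x `^ P))%E.
  move=> hh; apply: le_trans (image_surf_modulus_le pP P0 gf hh).
  apply: le_trans (lowQ b a _ _ _); rewrite ?a0 ?(lt_trans a0) //; last first.
    have [Dx2 /negP] := C2D _ C2x2; rewrite -leNgt => x2e.
    apply: (@lt_le_trans _ _ (enorm (x2 - x0))%:E); first by rewrite lte_fin (lt_le_trans be).
    by apply: ereal_sup_ubound; exists x2.
  apply: le_ereal_inf_tmp => _ [rho erho <-].
  apply: (ext_adm_energy P0 al0 alP pP a0 oD mQ Q0 mw w0 CC0 wC erho mk0 J10).
    rewrite -[X in (X * _)%E]fineK ?kappa_fin // -EFinM mulrCA divff ?mulr1 // gt_eqF //.
  apply: (@le_trans _ _ J); last by rewrite jE lee_fin lerDl ltW.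
  apply: le_lcint.
    by move=> x /andP[h1 h2]; rewrite /annulus /= (lt_trans ea) // (lt_trans h2).
  move=> x /andP[h1 h2]; rewrite -/k alk lee_wpmul2l ?lee_fin ?powR_ge0 //.
  by apply: le_poweR; rewrite ?(ltW al0) // weta // (lt_trans ea) // (lt_trans h2).
have oW := invariance_of_domain oD cf gf cg.
have cv : {within f @` D, continuous v} by exact: image_dist_continuous cg.
have [U [bU U0 UN UI]] := tube_modulus oW bW cv P12 al2 alP M0 Mle d30.
apply: (@le_trans _ _ (lcint leb_outer setT (fun x => U x `^ al))%E).
  apply: ereal_inf_lbound; exists U => //; split=> // h hh rh.
  have [r r0 tr] := image_tubepath oD cf gf cg ea ab be C1D C2D hh rh.
  exact: UN r0 tr.
apply: (le_trans UI); rewrite (modulus_exponents m0 kk0 J10 e1 e2) mJ jE -EFinD lee_fin.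
by rewrite /J1 -!addrA lerD2l /d3; lra.
Qed.
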